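(* Let $\Delta\subseteq\mathbb{R}^2$ be a two-dimensional lattice polygon. On the quadratic strand one has $$ c_1=N_{\Delta^{(1)}},\qquad c_2=\begin{cases}(N_\Delta-3)(N_{\Delta^{(1)}}-1)&\text{if }\Delta^{(1)}\neq\emptyset,\\0&\text{if }\Delta^{(1)}=\emptyset,\end{cases}$$ $$ c_{N_\Delta-3}=\begin{cases}0&\text{if }|\partial\Delta\cap\mathbb{Z}^2|>3,\\1&\text{if }|\partial\Delta\cap\mathbb{Z}^2|=3\text{ and }\dim\Delta^{(1)}=2,\\N_\Delta-3&\text{if }|\partial\Delta\cap\mathbb{Z}^2|=3\text{ and }\dim\Delta^{(1)}\le1.\end{cases}$$ On the linear strand one has $$ b_1=\binom{N_\Delta-1}{2}-2\,\mathrm{vol}(\Delta),\qquad b_{N_\Delta-3}=\begin{cases}0&\text{if }\Delta^{(1)}\neq\emptyset,\\N_\Delta-3&\text{if }\Delta^{(1)}=\emptyset,\end{cases}$$ $$ b_2=2\binom{N_\Delta-1}{3}-2(N_\Delta-3)\,\mathrm{vol}(\Delta)+c_{N_\Delta-3}.$$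
   Context: Let $k$ be a field of characteristic $0$. A lattice polygon is the convex hull in $\mathbb{R}^2$ of finitely many points of $\mathbb{Z}^2$; $\partial\Delta$ is its boundary, $\mathrm{vol}(\Delta)$ its Euclidean area, $\Delta^{(1)}$ the convex hull of the lattice points in the interior of $\Delta$, and $N_\Delta=|\Delta\cap\mathbb{Z}^2|$, $N_{\Delta^{(1)}}=|\Delta^{(1)}\cap\mathbb{Z}^2|$. Let $S_\Delta=k[X_{i,j}\mid (i,j)\in\Delta\cap\mathbb{Z}^2]$, so that $\mathbb{P}^{N_\Delta-1}=\mathrm{Proj}\, S_\Delta$. The toric surface $X_\Delta\subseteq\mathbb{P}^{N_\Delta-1}$ is the Zariski closure of the image of $(k^* )^2\to\mathbb{P}^{N_\Delta-1}:(a,b)\mapsto(a^ib^j)_{(i,j)\in\Delta\cap\mathbb{Z}^2}$, and $I_\Delta\subseteq S_\Delta$ is its homogeneous ideal. The graded Betti numbers $\beta_{p,q}$ are the exponents in a minimal graded free resolution $\cdots\to\bigoplus_{q}S_\Delta(-q)^{\beta_{1,q}}\to\bigoplus_q S_\Delta(-q)^{\beta_{0,q}}\to S_\Delta/I_\Delta\to0$ of $S_\Delta/I_\Delta$ as a graded $S_\Delta$-module. For $1\le\ell\le N_\Delta-3$ one writes $b_\ell=\beta_{\ell,\ell+1}$ (the linear strand) and $c_\ell=\beta_{N_\Delta-2-\ell,\,N_\Delta-\ell}$ (the quadratic strand); $b_\ell$ and $c_\ell$ are understood to be $0$ for $\ell$ outside this range. The empty set is regarded as having dimension $\le1$. *)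

(* Defs.v *)
From HB Require Import structures.
From mathcomp Require Import all_boot all_order all_algebra finmap.
From mathcomp Require Import all_classical all_reals all_analysis.
(* The notations of mpoly clash with those of MathComp-Analysis: below,
   [mpoly n k] is {mpoly k[n]}, [ishomog1 d (@mdeg n)] is d.-homog,
   [meval v f] is f.@[v] and [mcoeff m f] is f@_m. *)
From mathcomp Require Import -(notations) mpoly.

Set Implicit Arguments.
Unset Strict Implicit.
Unset Printing Implicit Defensive.

Import Order.TTheory GRing.Theory Num.Theory.
Import numFieldNormedType.Exports.

Local Open Scope classical_set_scope.
Local Open Scope ring_scope.

Section Polygons.
Variable R : realType.
Implicit Types A D : set (R * R).

Definition conv_hull A : set (R * R) :=
  smallest (@convex_set R (R * R)%type) A.

Definition affine_set A : Prop :=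
  forall (x y : R * R) (t : R), A x -> A y -> A ((1 - t) *: x + t *: y).

Definition aff_hull A : set (R * R) := smallest affine_set A.

(* The empty set has no dimension in the sense of [has_dim]. *)
Definition has_dim A (d : nat) : Prop :=
  exists (x : R * R) (U : {vspace R * R}),
    aff_hull A = [set x + u | u in [set` U]] /\ \dim U = d.

Definition dim_le1 A : Prop :=
  A = set0 \/ exists2 d, (d <= 1)%N & has_dim A d.

Definition lattice_embed (z : int * int) : R * R := (z.1%:~R, z.2%:~R).

Definition lattice_polygon D : Prop :=
  exists s : seq (int * int), D = conv_hull (lattice_embed @` [set` s]).

(* [fset_set] of an infinite set is empty; this is only meant for bounded A. *)
Definition lattice_points A : {fset int * int} :=
  fset_set (lattice_embed @^-1` A).

Definition num_points A : nat := #|` lattice_points A|.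

Definition boundary D : set (R * R) := closure D `\` D°.

Definition interior_polygon D : set (R * R) :=
  conv_hull (D° `&` range lattice_embed).

Definition vol D : R :=
  fine ((@lebesgue_measure R \x @lebesgue_measure R)%E D).

End Polygons.

(* Points of P^(n-1) are given by homogeneous coordinates v : 'I_n -> k, not all
   zero, and a subset of P^(n-1) by coordinate vectors of its points. *)
Section Projective.
Variables (k : fieldType) (n : nat).

Definition proj_closure (A : set ('I_n -> k)) : set ('I_n -> k) :=
  [set v | (exists i, v i != 0) /\
    forall (d : nat) (F : mpoly n k), F \is ishomog1 d (@mdeg n) ->
      (forall w, A w -> meval w F = 0) -> meval v F = 0].

(* The ideal generated by the homogeneous polynomials vanishing on A: those f
   all of whose homogeneous components vanish on A. *)
Definition homogeneous_ideal (A : set ('I_n -> k)) : set (mpoly n k) :=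
  [set f | forall (d : nat) v, A v -> meval v (pihomog (@mdeg n) d f) = 0].

End Projective.

Section Toric.
Variables (R : realType) (k : fieldType) (D : set (R * R)).

(* The i-th variable of mpoly (num_points D) k is the one indexed by
   [lattice_point i]. *)
Definition lattice_point (i : 'I_(num_points D)) : int * int :=
  nth (0, 0) (enum_fset (lattice_points D)) i.

Definition torus_map (a b : k) : 'I_(num_points D) -> k :=
  fun i => a ^ (lattice_point i).1 * b ^ (lattice_point i).2.

Definition toric_surface : set ('I_(num_points D) -> k) :=
  proj_closure
    [set v | exists a b : k, [/\ a != 0, b != 0 & v = torus_map a b]].

Definition toric_ideal : set (mpoly (num_points D) k) :=
  homogeneous_ideal toric_surface.

End Toric.

Arguments torus_map {R k} D a b.
Arguments toric_surface {R} k D _.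
Arguments toric_ideal {R} k D _.

(* Data of a sequence ... -> F_1 -> F_0 -> S of maps of graded free modules over
   S = mpoly n k: F_p is the direct sum over i : 'I_(rank p) of the S(-twist p i),
   its elements are row vectors, and maps act by multiplication on the right.
   The last map is a lift of an augmentation F_0 -> S/I. *)
Record free_complex (k : fieldType) (n : nat) := FreeComplex {
  rank : nat -> nat;
  twist : forall p, 'I_(rank p) -> int;
  augmentation : 'cV[mpoly n k]_(rank 0);
  differential : forall p, 'M[mpoly n k]_(rank p.+1, rank p)
}.

Section Resolutions.
Variables (k : fieldType) (n : nat).
Implicit Types (I : set (mpoly n k)) (C : free_complex k n).

(* All maps are homogeneous of degree 0; the basis vector of S(-q) has degree q.
   A nonzero entry i j of a differential thus has degree
   twist p.+1 i - twist p j. *)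
Definition graded C : Prop :=
  (forall i m, m \in msupp (augmentation C i 0) -> twist i = (mdeg m)%:Z) /\
  (forall p (i : 'I_(rank C p.+1)) (j : 'I_(rank C p)) m,
     m \in msupp (differential C p i j) ->
     twist i = twist j + (mdeg m)%:Z).

(* Exactness at S/I (surjectivity), at F_0, and at F_(p+1). *)
Definition resolves C I : Prop :=
  [/\ forall f : mpoly n k, exists v : 'rV_(rank C 0),
        I (f - (v *m augmentation C) 0 0),
      forall v : 'rV_(rank C 0),
        I ((v *m augmentation C) 0 0) <->
        exists w, v = w *m differential C 0
    & forall p (v : 'rV_(rank C p.+1)),
        v *m differential C p = 0 <->
        exists w, v = w *m differential C p.+1].

(* The image of F_(p+1) lies in (X_1, ..., X_n) F_p. *)
Definition minimal C : Prop :=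
  forall p i j, mcoeff (@mnm0 n) (differential C p i j) = 0.

Definition minimal_graded_free_resolution I C : Prop :=
  [/\ graded C, resolves C I & minimal C].

Definition betti C (p q : nat) : nat :=
  #|[set i : 'I_(rank C p) | twist i == q%:Z]%SET|.

Definition linear_strand C (l : nat) : nat :=
  if (1 <= l <= n - 3)%N then betti C l l.+1 else 0%N.

Definition quadratic_strand C (l : nat) : nat :=
  if (1 <= l <= n - 3)%N then betti C (n - 2 - l) (n - l) else 0%N.

End Resolutions.

(* Main.v *)
(* Write P for the lattice points of Delta, N1 for the number of interior ones.
   The toric ideal is spanned by the binomials of the relations among the (P, 1),
   and S/I is the semigroup ring of the cone C over Delta, since lattice polygons
   are normal. A Betti number vanishes with the Koszul homology of S/I, which
   splits by multidegree: in degree M it is that of the simplicial complex of the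
   sets T of points with M - sum_T (P, 1) in C. Resolving the indicator of C by the
   half-spaces of the normal fan (Ishida's complex) identifies this homology, up to
   a shift by 3, with that of the opposite of the interior of C; there it vanishes
   outside the linear and quadratic strands, and at the end of the linear strand
   when N1 > 0.
   The Hilbert function is the Ehrhart function, a quadratic polynomial with values
   1, N, N1 at 0, 1, -1; its N-th differences are the alternating sums of the Betti
   numbers, and counting squares of side 1/d gives Pick's formula
   2 vol = N + N1 - 2. This settles everything but c_(N-3) = beta_(1,3), the number
   of cubic generators. By duality a cubic generator gives a cocycle on 4-subsets,
   whose weights are interior points up to a translation; a discrete Green formula
   produces at least N - 3 of them, so N1 < N - 3 leaves no cubics (Koelman). With
   three boundary points, removing a vertex gives a polygon to which this applies,
   unless the interior is collinear; the product of the three vertices is then the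
   only cubic, and in the collinear case there is one for each interior point. *)
From HB Require Import structures.
Require Import Defs.
From mathcomp Require Import all_boot all_order all_algebra boolp.
From mathcomp Require Import -(notations) mpoly.
From mathcomp Require Import zify ring lra.

Set Implicit Arguments.
Unset Strict Implicit.
Unset Printing Implicit Defensive.

Import Order.TTheory GRing.Theory Num.Theory.

Local Open Scope ring_scope.

(** * Koszul contraction and exterior multiplication on functions of index sets *)

Module KoszulContraction.
Section Koszul.
Variables (N : nat) (M : zmodType).
Implicit Types (T : {set 'I_N}) (i j : 'I_N) (f g : {set 'I_N} -> M).

(** Only vanishing of Koszul homology is ever proved, in the form that every cycle bounds; no
    homology group is formed. Nonzero Betti numbers come from Euler characteristics, which determine
    a number that is alone in its internal degree. This is so for b_1 in degree 2 and for c_1 in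
    degree N - 1. In degree N - 2 the end of the linear strand shares a relation with c_2, but one
    of the two vanishes, according to whether interior points exist. In degree 3 the numbers b_2 and
    beta_(1,3) share one, which is why cubics need separate combinatorics. The shift by 3 is the
    number of middle terms of Ishida's complex: each summand of these is stable under translation by
    a vertex, so its cycles bound their cones with that apex. A chain of homological degree p and
    total degree q ends up on sets of p + 3 points lying over interior points of height p + 3 - q;
    heights 1 and 2 are the quadratic and the linear strand. The directions used are the normals to
    all differences of points, closed under negation: a refinement of the normal fan that does not
    require knowing the vertices. *)

Definition kpos (i : 'I_N) (T : {set 'I_N}) : nat := #|[set j in T | (j < i)%N]|.

Definition ksgn (i : 'I_N) (T : {set 'I_N}) : int := (-1) ^+ kpos i T.

Lemma kposU i j T : j \notin T -> kpos i (j |: T) = ((j < i) + kpos i T)%N.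
Proof.
move=> jT; rewrite /kpos; case: (ltnP j i) => ji.
  have -> : [set x in j |: T | (x < i)%N] = j |: [set x in T | (x < i)%N].
    by apply/setP=> x; rewrite !inE; case: eqP => [->|_] //=; rewrite ji.
  by rewrite cardsU1 inE (negbTE jT).
congr #|pred_of_set _|; apply/setP=> x; rewrite !inE.
by case: eqP => [->|_] //=; rewrite ltnNge ji andbF.
Qed.

Lemma ksgnU i j T : j \notin T -> ksgn i (j |: T) = (-1) ^+ (j < i)%N * ksgn i T.
Proof. by move=> jT; rewrite /ksgn kposU // exprD. Qed.

Lemma ksgnD1 i T : ksgn i (T :\ i) = ksgn i T.
Proof.
rewrite /ksgn /kpos; congr (_ ^+ _); congr #|pred_of_set _|; apply/setP=> x.
by rewrite !inE; case: eqP => [->|_] //=; rewrite ltnn andbF.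
Qed.

Lemma ksgnU1 i T : ksgn i (i |: T) = ksgn i T.
Proof.
case: (boolP (i \in T)) => iT; first by rewrite (setUidPr _) // sub1set.
by rewrite ksgnU // ltnn mul1r.
Qed.

Lemma ksgn_sqr i T : ksgn i T * ksgn i T = 1.
Proof. by rewrite -expr2 sqrr_sign. Qed.

Lemma ltn_ord_neqC i j : i != j -> (i < j)%N = ~~ (j < i)%N.
Proof. by move=> ij; rewrite ltn_neqAle ij -leqNgt. Qed.

Lemma ksgn_swap i j T : i != j -> i \notin T -> j \notin T ->
  ksgn i (j |: T) * ksgn j T = - (ksgn j (i |: T) * ksgn i T).
Proof.
move=> ij iT jT; rewrite !ksgnU // (ltn_ord_neqC ij).
by case: (j < i)%N; rewrite /= ?expr0 ?expr1 ?mulN1r ?mul1r ?mulNr ?opprK mulrC.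
Qed.

Variables (x a : 'I_N -> {additive M -> M}).

(* Contraction [kos] and exterior multiplication [wdg] on chains written as
   functions on index sets, with coefficients acting through the operators. *)
Definition kos f T : M := \sum_(i | i \notin T) x i (f (i |: T)) *~ ksgn i T.

Definition wdg f T : M := \sum_(i | i \in T) a i (f (T :\ i)) *~ ksgn i T.

Lemma kosD f g T : kos (fun T => f T + g T) T = kos f T + kos g T.
Proof.
by rewrite /kos -big_split /=; apply: eq_bigr => i _; rewrite raddfD mulrzDl.
Qed.

Lemma kosB f g T : kos (fun T => f T - g T) T = kos f T - kos g T.
Proof.
by rewrite /kos -sumrB; apply: eq_bigr => i _; rewrite raddfB mulrzBl.
Qed.

Lemma kos_sum (I : Type) (r : seq I) (F : I -> {set 'I_N} -> M) T :
  kos (fun T => \sum_(l <- r) F l T) T = \sum_(l <- r) kos (F l) T.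
Proof.
rewrite /kos exchange_big; apply: eq_bigr => i _ /=.
by rewrite raddf_sum mulrz_suml.
Qed.

Lemma eq_kos f g T : (forall i, i \notin T -> f (i |: T) = g (i |: T)) ->
  kos f T = kos g T.
Proof. by move=> fg; apply: eq_bigr => i iT; rewrite fg. Qed.

Hypothesis xx : forall i j u, x i (x j u) = x j (x i u).

Lemma kosK f T : kos (kos f) T = 0.
Proof.
have -> : kos (kos f) T =
    \sum_(i | i \notin T) \sum_(j | (j \notin T) && (j != i))
       x i (x j (f (j |: (i |: T)))) *~ (ksgn j (i |: T) * ksgn i T).
  apply: eq_bigr => i iT; rewrite raddf_sum mulrz_suml.
  apply: eq_big => [j|j _]; first by rewrite !inE negb_or andbC.
  by rewrite raddfMz mulrzA.
rewrite pair_big_dep /=.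
pose A := [pred p : 'I_N * 'I_N | [&& p.1 \notin T, p.2 \notin T & p.2 != p.1]].
pose F (p : 'I_N * 'I_N) : M :=
  x p.1 (x p.2 (f (p.2 |: (p.1 |: T)))) *~ (ksgn p.2 (p.1 |: T) * ksgn p.1 T).
rewrite -[LHS]/(\sum_(p | A p) F p) (bigID (fun p : 'I_N * 'I_N => (p.1 < p.2)%N)) /=.
(* Exchanging the two contracted indices pairs each term with one of opposite sign. *)
have inv : involutive (fun p : 'I_N * 'I_N => (p.2, p.1)) by case.
rewrite [X in _ + X](reindex_inj (inv_inj inv)) /=.
rewrite [X in _ + X](eq_bigl (fun p => A p && (p.1 < p.2)%N)); last first.
  move=> p /=; case: (boolP (p.1 == p.2)) => [/eqP ->|ne].
    by rewrite eqxx !andbF.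
  by rewrite eq_sym (negbTE ne) /= andbCA (ltn_ord_neqC ne).
rewrite -big_split big1 //= => p /andP[/and3P[p1 p2 ne] _].
rewrite /F /= xx setUCA ksgn_swap // 1?eq_sym //.
by rewrite mulrNz ?addNr ?subrr.
Qed.

Hypothesis xa : forall i j u, i != j -> x i (a j u) = a j (x i u).

(** A Cartan homotopy formula: terms with two distinct indices cancel because x_i and a_j commute,
    and only the diagonal survives. It serves twice, with a_i the partial derivatives of polynomials
    and with a_i the identity at a single index over scalars. *)
Lemma kos_wdg f T :
  kos (wdg f) T + wdg (kos f) T =
  \sum_(i | i \notin T) x i (a i (f T)) + \sum_(i | i \in T) a i (x i (f T)).
Proof.
have -> : kos (wdg f) T = \sum_(i | i \notin T) x i (a i (f T)) +
    \sum_(i | i \notin T) \sum_(j | j \in T)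
       x i (a j (f ((i |: T) :\ j))) *~ (ksgn j (i |: T) * ksgn i T).
  rewrite -big_split; apply: eq_bigr => i iT /=.
  rewrite /wdg (bigD1 i) ?setU11 //= raddfD mulrzDl; congr (_ + _).
    by rewrite setU1K // raddfMz -mulrzA ksgnU1 ksgn_sqr.
  rewrite raddf_sum mulrz_suml; apply: eq_big => [j|j _]; last first.
    by rewrite raddfMz mulrzA.
  rewrite !inE; case: (boolP (j == i)) => [/eqP ->|] //=.
    by rewrite (negbTE iT).
  by rewrite andbT.
have -> : wdg (kos f) T = \sum_(i | i \in T) a i (x i (f T)) +
    \sum_(j | j \in T) \sum_(i | i \notin T)
       a j (x i (f (i |: (T :\ j)))) *~ (ksgn i (T :\ j) * ksgn j T).
  rewrite -big_split; apply: eq_bigr => j jT /=.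
  rewrite /kos (bigD1 j) ?setD11 //= raddfD mulrzDl; congr (_ + _).
    by rewrite setD1K // raddfMz -mulrzA ksgnD1 ksgn_sqr.
  rewrite raddf_sum mulrz_suml; apply: eq_big => [i|i _]; last first.
    by rewrite raddfMz mulrzA.
  rewrite !inE; case: (boolP (i == j)) => [/eqP ->|] //=.
    by rewrite jT.
  by rewrite andbT.
rewrite addrACA -[RHS]addr0; congr (_ + _).
rewrite [X in _ + X]exchange_big -big_split big1 //= => i iT.
rewrite -big_split big1 //= => j jT.
have ij : i != j by apply: contraNneq iT => ->.
have -> : (i |: T) :\ j = i |: (T :\ j).
  apply/setP=> l; rewrite !inE; case: (boolP (l == i)) => [/eqP ->|] //=.
  by rewrite ij.
have iTj : i \notin T :\ j by rewrite !inE negb_and iT orbT.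
have jTj : j \notin T :\ j by rewrite setD11.
have sg : ksgn j (i |: T) * ksgn i T + ksgn i (T :\ j) * ksgn j T = 0.
  rewrite -(setD1K jT) setUCA setU1K // !ksgnU1 !ksgnU // (ltn_ord_neqC ij).
  case: (j < i)%N; rewrite /= ?expr0 ?expr1 ?mulN1r ?mul1r ?mulNr ?mulrN;
    by rewrite [X in _ + X]mulrC ?addNr ?subrr.
by rewrite xa // -mulrzDr sg mulr0z.
Qed.

End Koszul.

End KoszulContraction.

(** * Homogeneous components and Euler's identity *)

Module HomogeneousParts.
Import KoszulContraction.

Section Homogeneous.
Variables (k : fieldType) (N : nat).
Local Notation S := (mpoly N k).
Local Notation X i := (@mpolyX N k (mnm1 i)).

(** Degrees are integers so that differences of a degree and a twist make sense; in negative degree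
    only 0 is homogeneous. *)
Definition homz (z : int) (f : S) : Prop :=
  forall m, m \in msupp f -> (mdeg m)%:Z = z.

Definition hpart (z : int) (f : S) : S :=
  if z is Posz d then pihomog (@mdeg N) d f else 0.

Lemma mcoeff_hpart z f m :
  mcoeff m (hpart z f) = if (mdeg m)%:Z == z then mcoeff m f else 0.
Proof.
case: z => d /=; last by rewrite mcoeff0.
rewrite eqz_nat /pihomog raddf_sum /= big_mkcond.
rewrite (eq_bigr (fun m' => (if m' == m then (if mdeg m == d then mcoeff m f else 0) else 0))); last first.
  move=> m' _; case: (eqVneq m' m) => [->|ne].
    by case: ifP => // _; rewrite mcoeffZ mcoeffX eqxx mulr1.
  by case: ifP => // _; rewrite mcoeffZ mcoeffX (negbTE ne) mulr0.
case: (boolP (m \in msupp f)) => mf.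
  rewrite (bigD1_seq m) ?msupp_uniq //= eqxx big1 ?addr0 //.
  by move=> i /negbTE ->.
rewrite big1_seq ?(memN_msupp_eq0 mf) ?if_same // => m' /andP[_ m'f].
by case: eqP => // e; rewrite -e m'f in mf.
Qed.

Lemma homzP z f : homz z f <-> (forall m, (mdeg m)%:Z != z -> mcoeff m f = 0).
Proof.
split=> h m.
  by move=> ne; apply: memN_msupp_eq0; apply/negP => /h e; rewrite e eqxx in ne.
rewrite mcoeff_msupp => nz; apply/eqP; apply: contraT => /h e; move: nz; rewrite e eqxx //.
Qed.

Lemma homz_hpart z f : homz z (hpart z f).
Proof. by apply/homzP => m /negbTE ne; rewrite mcoeff_hpart ne. Qed.

Lemma hpart_id z f : homz z f -> hpart z f = f.
Proof.
move/homzP=> h; apply/mpolyP => m; rewrite mcoeff_hpart.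
by case: (boolP (_ == z)) => // /h ->.
Qed.

Lemma homz0 z : homz z 0.
Proof. by apply/homzP => m _; rewrite mcoeff0. Qed.

Lemma homzD z f g : homz z f -> homz z g -> homz z (f + g).
Proof. by move=> /homzP hf /homzP hg; apply/homzP => m ne; rewrite mcoeffD hf ?hg ?addr0. Qed.

Lemma homzN z f : homz z f -> homz z (- f).
Proof. by move=> /homzP hf; apply/homzP => m ne; rewrite mcoeffN hf ?oppr0. Qed.

Lemma homzB z f g : homz z f -> homz z g -> homz z (f - g).
Proof. by move=> hf hg; apply/homzD/homzN. Qed.

Lemma homzZ z c f : homz z f -> homz z (c *: f).
Proof. by move=> /homzP hf; apply/homzP => m ne; rewrite mcoeffZ hf ?mulr0. Qed.

Lemma homz_sum z (I : Type) (r : seq I) (P : pred I) (F : I -> S) :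
  (forall i, P i -> homz z (F i)) -> homz z (\sum_(i <- r | P i) F i).
Proof. by move=> h; elim/big_rec: _ => [|i f Pi hf]; [exact: homz0|apply: homzD; auto]. Qed.

Lemma homzMz z (c : int) f : homz z f -> homz z (f *~ c).
Proof. by move=> hf; rewrite -scaler_int; apply: homzZ. Qed.

Lemma homzM z1 z2 f g : homz z1 f -> homz z2 g -> homz (z1 + z2) (f * g).
Proof.
move=> hf hg m /msuppM_le /allpairsP [[m1 m2]] /= [/hf <- /hg <- ->].
by rewrite mdegD.
Qed.

Lemma homz_X m : homz (mdeg m)%:Z (mpolyX k m).
Proof. by move=> m'; rewrite msuppX inE => /eqP ->. Qed.

Lemma homz_C c : homz 0 (mpolyC N c).
Proof. by move=> m; rewrite msuppC; case: eqP => // _; rewrite inE => /eqP ->; rewrite mdeg0. Qed.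

Lemma homz_mderiv z i f : homz z f -> homz (z - 1) (mderiv i f).
Proof.
move=> /homzP hf; apply/homzP => m ne; rewrite mcoeff_deriv hf ?mul0rn //.
by apply: contra ne => /eqP <-; rewrite mdegD mdeg1 PoszD addrK.
Qed.

Lemma homz_neg (z : int) f : (z < 0)%R -> homz z f -> f = 0.
Proof.
move=> z0 /homzP hf; apply/mpolyP => m; rewrite mcoeff0 hf //.
by apply: contraTneq z0 => <-; rewrite -leNgt.
Qed.

Lemma homz_const f : homz 0 f -> f = mpolyC N (mcoeff mnm0 f).
Proof.
move=> /homzP hf; apply/mpolyP => m; rewrite mcoeffC.
case: (eqVneq m mnm0) => [->|ne]; first by rewrite mulr1.
by rewrite mulr0 hf // eqz_nat mdeg_eq0.
Qed.

(* Coefficientwise: a homogeneous factor shifts the degree of each monomial. *)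
Lemma hpartM z e f g : homz e g -> hpart (z + e) (f * g) = hpart z f * g.
Proof.
move=> /homzP hg; apply/mpolyP => m; rewrite mcoeff_hpart !mcoeffM.
case: ifP => zm; last first.
  rewrite big1 // => -[m1 m2] /= /eqP em; rewrite mcoeff_hpart.
  case: ifP => m1z; last by rewrite mul0r.
  rewrite hg ?mulr0 //; apply: contraFneq zm => e2.
  by rewrite em mdegD PoszD (eqP m1z) e2.
apply: eq_bigr => -[m1 m2] /= /eqP em; rewrite mcoeff_hpart.
case: ifP => m1z //; rewrite mul0r hg ?mulr0 //.
apply: contraFneq m1z => e2; rewrite em mdegD PoszD e2 in zm.
by rewrite -(inj_eq (addIr e)).
Qed.

Lemma hpart_is_additive z : additive (hpart z).
Proof.
by move=> f g; apply/mpolyP => m; rewrite mcoeffB !mcoeff_hpart mcoeffB; case: ifP; rewrite ?subr0.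
Qed.
HB.instance Definition _ z := GRing.isAdditive.Build S S (hpart z) (hpart_is_additive z).

Lemma euler z f : homz z f -> \sum_i X i * mderiv i f = f *~ z.
Proof.
move=> hf; rewrite [in RHS](mpolyE f) mulrz_suml [in LHS](mpolyE f).
under eq_bigr do rewrite raddf_sum mulr_sumr.
rewrite exchange_big big_seq [RHS]big_seq; apply: eq_bigr => m mf /=.
rewrite -(hf _ mf) mdegE -pmulrn.
under eq_bigr => i _.
  rewrite mderivZ mderivX -!scalerAr.
  have -> : (m i)%:R *: (X i * mpolyX k (mnm_sub m (mnm1 i))) = (mpolyX k m) *+ (m i).
    rewrite -scaler_nat; case: (eqVneq (m i) 0%N) => [->|nz]; first by rewrite !scale0r.
    by rewrite -mpolyXD addmC submK // lep1mP.
  over.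
by rewrite -scaler_sumr /= sumrMnr scalerMnr.
Qed.

End Homogeneous.

End HomogeneousParts.

(** * Acyclicity of the polynomial Koszul complex in characteristic 0 *)

Module PolynomialKoszul.
Import KoszulContraction HomogeneousParts.

Section PolyKoszul.
Variables (k : fieldType) (N : nat).
Local Notation S := (mpoly N k).
Local Notation X i := (@mpolyX N k (mnm1 i)).

Definition mulX (i : 'I_N) (f : S) : S := X i * f.
Lemma mulX_is_additive i : additive (mulX i).
Proof. by move=> f g; rewrite /mulX mulrBr. Qed.
HB.instance Definition _ i := GRing.isAdditive.Build S S (mulX i) (mulX_is_additive i).

Definition scaleX r (i : 'I_N) (v : 'rV[S]_r) : 'rV[S]_r := X i *: v.
Lemma scaleX_is_additive r i : additive (@scaleX r i).
Proof. by move=> f g; rewrite /scaleX scalerBr. Qed.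
HB.instance Definition _ r i :=
  GRing.isAdditive.Build 'rV[S]_r 'rV[S]_r (@scaleX r i) (@scaleX_is_additive r i).

Definition kosS : ({set 'I_N} -> S) -> {set 'I_N} -> S :=
  kos (fun i => (mulX i : {additive S -> S})).

Definition kosR r : ({set 'I_N} -> 'rV[S]_r) -> {set 'I_N} -> 'rV[S]_r :=
  kos (fun i => (@scaleX r i : {additive 'rV[S]_r -> 'rV[S]_r})).

Lemma mxMzE m n (A : 'M[S]_(m, n)) (c : int) i j : (A *~ c) i j = A i j *~ c.
Proof.
by case: c => d; rewrite ?NegzE ?mulrNz -?pmulrn ?mxE mulmxnE.
Qed.

Lemma kosR_entry r (f : {set 'I_N} -> 'rV[S]_r) T j :
  kosR f T 0 j = kosS (fun T => f T 0 j) T.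
Proof.
rewrite /kosR /kosS /kos summxE; apply: eq_bigr => i _.
by rewrite mxMzE /= /scaleX mxE.
Qed.

Lemma kosR_mul r r' (d : 'M[S]_(r', r)) (f : {set 'I_N} -> 'rV[S]_r') T :
  kosR (fun T => f T *m d) T = kosR f T *m d.
Proof.
rewrite /kosR /kos mulmx_suml; apply: eq_bigr => i _.
by rewrite -!scaler_int -scalemxAl /= /scaleX -scalemxAl.
Qed.

Lemma kosRK r (f : {set 'I_N} -> 'rV[S]_r) T : kosR (kosR f) T = 0.
Proof. by apply: kosK => i j u; rewrite /= /scaleX !scalerA mulrC. Qed.

Lemma kosRB r (f g : {set 'I_N} -> 'rV[S]_r) T :
  kosR (fun T => f T - g T) T = kosR f T - kosR g T.
Proof. exact: kosB. Qed.

Definition supported (M : zmodType) (p : nat) (f : {set 'I_N} -> M) : Prop :=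
  forall T : {set 'I_N}, #|T| != p -> f T = 0.

Lemma kosS_homz z f T : (forall T, homz z (f T)) -> homz (z + 1) (kosS f T).
Proof.
move=> hf; apply: homz_sum => i _; apply: homzMz; rewrite addrC.
by apply: homzM (hf _); have := @homz_X k _ (mnm1 i); rewrite mdeg1.
Qed.

Hypothesis chark : [pchar k] =i pred0.

Lemma intk_neq0 (z : int) : z != 0 -> (z%:~R : k) != 0.
Proof.
have h n : n != 0%N -> (n%:R : k) != 0 by move/pcharf0P: chark => ->.
case: z => n z0; first by rewrite -pmulrn h.
by rewrite NegzE mulrNz -pmulrn oppr_eq0 h.
Qed.

(** The exterior differential is a homotopy: by Euler's identity its composites with the contraction
    add up to multiplication by z + p, the polynomial degree plus the exterior degree, which is
    invertible in characteristic 0 unless it is 0. *)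
Lemma kosS_euler (p : nat) (z : int) (f : {set 'I_N} -> S) :
  supported p f -> (forall T, homz z (f T)) -> (forall T, kosS f T = 0) ->
  (forall T, f T != 0 -> z + p%:Z != 0) ->
  let g T := ((z + p%:Z)%:~R)^-1 *:
    wdg (fun i => (mderiv i : {additive S -> S})) f T in
  [/\ supported p.+1 g, forall T, homz (z - 1) (g T) & forall T, kosS g T = f T].
Proof.
move=> sf hf kf nz g; split.
- move=> T Tp; rewrite /g /wdg big1 ?scaler0 // => i iT.
  rewrite sf ?raddf0 ?mul0rz //; apply: contra Tp => /eqP <-.
  by rewrite (cardsD1 i T) iT.
- move=> T; apply: homzZ; apply: homz_sum => i _; apply: homzMz.
  exact: homz_mderiv.
move=> T.
have -> : kosS g T = ((z + p%:Z)%:~R)^-1 *: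
    kosS (wdg (fun i => (mderiv i : {additive S -> S})) f) T.
  rewrite /kosS /kos scaler_sumr; apply: eq_bigr => i _ /=.
  by rewrite /mulX /g -!scaler_int -scalerAr !scalerA mulrC.
have e : kosS (wdg (fun i => (mderiv i : {additive S -> S})) f) T
    = f T *~ (z + p%:Z).
  rewrite -[LHS]addr0.
  have -> : 0 = wdg (fun i => (mderiv i : {additive S -> S})) (kosS f) T.
    by rewrite /wdg big1 // => i _; rewrite kf raddf0 mul0rz.
  rewrite kos_wdg /=; last first.
    move=> i j u ij; rewrite /= /mulX mderivM mderivX mnm1E (negbTE ij).
    by rewrite scale0r mul0r add0r.
  transitivity (\sum_i X i * mderiv i (f T) + \sum_(i | i \in T) f T).
    (* For i in T the derivative meets X_i, and Leibniz adds [f T] once more; this yields the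
       summand p. *)
    have -> : \sum_(i | i \in T) mderiv i (mulX i (f T)) =
        \sum_(i | i \in T) f T + \sum_(i | i \in T) X i * mderiv i (f T).
      rewrite -big_split; apply: eq_bigr => i iT /=.
      rewrite /mulX mderivM mderivX mnm1E eqxx scale1r.
      have -> : mnm_sub (mnm1 i) (mnm1 i) = mnm0.
        by apply/mnmP => j; rewrite mnmBE mnm0E subnn.
      by rewrite mpolyX0 mul1r.
    rewrite [in RHS](bigID (fun i => i \in T)) /=.
    by rewrite [RHS]addrC [LHS]addrC -addrA.
  rewrite (euler (hf T)) sumr_const mulrzDr -pmulrn; congr (_ + _).
  case: (eqVneq #|T| p) => [-> //|/sf ->]; by rewrite !mul0rn.
rewrite e -scaler_int scalerA; case: (eqVneq (f T) 0) => [->|fT].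
  by rewrite scaler0.
by rewrite mulVf ?scale1r // intk_neq0 // (nz T).
Qed.
End PolyKoszul.

End PolynomialKoszul.

(** * Dimension shifting for Koszul homology of graded modules *)

Module KoszulVanishing.
Import KoszulContraction HomogeneousParts PolynomialKoszul.

Section Rows.
Variables (k : fieldType) (N : nat).
Local Notation S := (mpoly N k).

Definition hdeg r (tw : 'I_r -> int) (q : int) (v : 'rV[S]_r) : Prop :=
  forall i, homz (q - tw i) (v 0 i).

Definition hrow r (tw : 'I_r -> int) (q : int) (v : 'rV[S]_r) : 'rV[S]_r :=
  \row_i hpart (q - tw i) (v 0 i).

Lemma hdeg_hrow r (tw : 'I_r -> int) q v : hdeg tw q (hrow tw q v).
Proof. by move=> i; rewrite mxE; exact: homz_hpart. Qed.

Lemma hrow_id r (tw : 'I_r -> int) q v : hdeg tw q v -> hrow tw q v = v.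
Proof. by move=> h; apply/rowP => i; rewrite mxE hpart_id. Qed.

Lemma hdegB r (tw : 'I_r -> int) q u v : hdeg tw q u -> hdeg tw q v -> hdeg tw q (u - v).
Proof. by move=> hu hv i; rewrite !mxE; apply: homzB. Qed.

Section Mul.
Variables (r r' : nat) (tw : 'I_r -> int) (tw' : 'I_r' -> int) (d : 'M[S]_(r', r)).
Hypothesis dg : forall i j, homz (tw' i - tw j) (d i j).

Lemma hrow_mul q w : hrow tw q (w *m d) = hrow tw' q w *m d.
Proof.
apply/rowP => j; rewrite mxE !mxE raddf_sum; apply: eq_bigr => i _ /=.
rewrite !mxE -(@hpartM _ _ _ (tw' i - tw j)); last exact: dg.
by congr (hpart _ _); rewrite addrA subrK.
Qed.

Lemma hdeg_mul q w : hdeg tw' q w -> hdeg tw q (w *m d).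
Proof. by move=> /hrow_id hw; rewrite -hw -hrow_mul; exact: hdeg_hrow. Qed.
End Mul.

Lemma hdeg_kosR r (tw : 'I_r -> int) q (f : {set 'I_N} -> 'rV[S]_r) T :
  (forall T, hdeg tw q (f T)) -> hdeg tw (q + 1) (kosR f T).
Proof.
move=> hf i; rewrite kosR_entry addrAC; apply: kosS_homz => T'; exact: hf.
Qed.

Lemma supported_kosR r p (f : {set 'I_N} -> 'rV[S]_r) :
  supported p.+1 f -> supported p (kosR f).
Proof.
move=> sf T Tp; rewrite /kosR /kos big1 // => i iT.
by rewrite sf ?raddf0 ?mul0rz // cardsU1 iT add1n eqSS.
Qed.

Lemma mcoeff0_kosR0 r (f : {set 'I_N} -> 'rV[S]_r) T j : mcoeff mnm0 (kosR f T 0 j) = 0.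
Proof.
rewrite kosR_entry /kosS /kos raddf_sum big1 //= => i _.
rewrite raddfMz /= /mulX (rmorphM (mcoeff mnm0)) /= mcoeffX mnm1_eq0.
by rewrite mul0r mul0rz.
Qed.

Hypothesis chark : [pchar k] =i pred0.

(** At the j-th basis vector the number z + p of [kosS_euler] is q - tw j, so the only obstruction
    is a nonzero entry with q = tw j. *)
Lemma kosR_exact r (tw : 'I_r -> int) p q (f : {set 'I_N} -> 'rV[S]_r) :
  supported p f -> (forall T, hdeg tw (q - p%:Z) (f T)) -> (forall T, kosR f T = 0) ->
  (forall T j, f T 0 j != 0 -> q != tw j) ->
  exists g, [/\ supported p.+1 g, forall T, hdeg tw (q - p.+1%:Z) (g T)
    & forall T, kosR g T = f T].
Proof.
move=> sf hf kf nz.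
pose G j T := ((q - p%:Z - tw j + p%:Z)%:~R)^-1 *:
    wdg (fun i => (mderiv i : {additive S -> S})) (fun T => f T 0 j) T.
have main j : [/\ supported p.+1 (G j), forall T, homz (q - p%:Z - tw j - 1) (G j T)
    & forall T, kosS (G j) T = f T 0 j].
  apply: (kosS_euler chark).
  - by move=> T /sf ->; rewrite mxE.
  - by move=> T; exact: hf.
  - by move=> T; rewrite -kosR_entry kf mxE.
  - by move=> T /nz; rewrite -subr_eq0 addrAC subrK.
exists (fun T => \row_j G j T); split.
- by move=> T Tp; apply/rowP => j; rewrite !mxE; have [h _ _] := main j; exact: h.
- move=> T j; rewrite mxE; have [_ h _] := main j.
  have -> : q - p.+1%:Z - tw j = q - p%:Z - tw j - 1 by rewrite -addn1 PoszD; ring.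
  exact: h.
- move=> T; apply/rowP => j; have [_ _ h] := main j.
  rewrite kosR_entry -(h T).
  by congr (kosS _ _); apply/funext => T'; rewrite mxE.
Qed.

(* Vanishing of the Koszul homology, in homological degree [p] and total degree
   [q], of the quotient of a shifted free module by the submodule [Z]. *)
Definition Hvan r (tw : 'I_r -> int) (Z : 'rV[S]_r -> Prop) (p : nat) (q : int) : Prop :=
  forall f, supported p f -> (forall T, hdeg tw (q - p%:Z) (f T)) ->
    (forall T, Z (kosR f T)) ->
  exists g, [/\ supported p.+1 g, forall T, hdeg tw (q - p.+1%:Z) (g T)
    & forall T, Z (f T - kosR g T)].

Section Shift.
Variables (r r' : nat) (tw : 'I_r -> int) (tw' : 'I_r' -> int) (d : 'M[S]_(r', r)).
Hypothesis dg : forall i j, homz (tw' i - tw j) (d i j).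

(** The connecting homomorphism of 0 -> F'/ker d -> F -> F/im d -> 0: the image of the cycle f
    bounds in the free module F, and the vanishing for F/im d lets the bounding chain be chosen in
    the image of d, where it lifts to F'. *)
Lemma Hvan_lift p q f :
  Hvan tw (fun v => exists w, v = w *m d) p.+1 q ->
  supported p f -> (forall T, hdeg tw' (q - p%:Z) (f T)) ->
  (forall T, kosR f T *m d = 0) ->
  (forall T j, (f T *m d) 0 j != 0 -> q != tw j) ->
  exists g, [/\ supported p.+1 g, forall T, hdeg tw' (q - p.+1%:Z) (g T)
    & forall T, (f T - kosR g T) *m d = 0].
Proof.
move=> hZ sf hf kf nz.
have [||||g [sg hg kg]] := @kosR_exact r tw p q (fun T => f T *m d).
- by move=> T /sf ->; rewrite mul0mx.
- by move=> T; exact: hdeg_mul dg _ _ (hf T).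
- by move=> T; rewrite kosR_mul.
- exact: nz.
have [|h [sh hh Zh]] := hZ g sg hg.
  by move=> T; exists (f T); rewrite kg.
have /choice[w0 w0P] : forall T, exists w, g T - kosR h T = w *m d by [].
(* The lifts are chosen set by set, so they are cut down to the right exterior and internal
   degrees. *)
pose w (T : {set 'I_N}) := if #|T| == p.+1 then hrow tw' (q - p.+1%:Z) (w0 T) else 0.
have wP T : g T - kosR h T = w T *m d.
  rewrite /w; case: ifP => Tp.
    rewrite -(hrow_mul dg) -w0P hrow_id //; apply: hdegB (hg T) _.
    have -> : q - p.+1%:Z = q - p.+2%:Z + 1 by rewrite -[in RHS]addn1 PoszD; ring.
    exact: hdeg_kosR.
  by rewrite sg ?Tp // (supported_kosR sh) ?Tp // subr0 mul0mx.
exists w; split.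
- by move=> T /negbTE Tp; rewrite /w Tp.
- move=> T; rewrite /w; case: ifP => _; first exact: hdeg_hrow.
  by move=> i; rewrite mxE; exact: homz0.
- move=> T; rewrite mulmxBl -kosR_mul -kg.
  have -> : (fun T => w T *m d) = (fun T => g T - kosR h T).
    by apply/funext => T'; rewrite wP.
  by rewrite kosRB kosRK subr0 subrr.
Qed.

(** For p > 0 an entry over a basis vector of twist q would have degree -p < 0, so the obstruction q
    = tw j does not occur. *)
Lemma Hvan_shift p q : (0 < p)%N ->
  Hvan tw (fun v => exists w, v = w *m d) p.+1 q ->
  Hvan tw' (fun v => v *m d = 0) p q.
Proof.
move=> p0 hZ f sf hf kf; apply: Hvan_lift => // T j.
have hj : homz (q - p%:Z - tw j) ((f T *m d) 0 j) by exact: hdeg_mul dg _ _ (hf T) j.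
by apply: contraNneq => e; apply/eqP; apply: homz_neg hj; rewrite e; lia.
Qed.

(** A basis vector of twist q is a Koszul 0-chain. If it bounded modulo the kernel of d, its
    constant entry 1 would vanish, because neither Koszul boundaries nor, by minimality, kernel
    elements have constant terms. *)
Lemma Hvan_base q i :
  (forall i j, mcoeff (@mnm0 N) (d i j) = 0) ->
  (forall v : 'rV[S]_r', v *m d = 0 -> mcoeff (@mnm0 N) (v 0 i) = 0) ->
  Hvan tw (fun v => exists w, v = w *m d) 1 q -> tw' i != q.
Proof.
move=> dmin kmin hZ; apply/negP => /eqP tq.
pose f (T : {set 'I_N}) : 'rV[S]_r' := if T == finset.set0 then delta_mx 0 i else 0.
have [||||g [sg hg kg]] := @Hvan_lift 0 q f hZ.
- by move=> T; rewrite cards_eq0 /f => /negbTE ->.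
- move=> T j; rewrite /f subr0; case: ifP => _; last by rewrite mxE; exact: homz0.
  rewrite mxE eqxx /=; case: eqP => [->|_]; last exact: homz0.
  by rewrite tq subrr -mpolyC1; exact: homz_C.
- move=> T; rewrite /kosR /kos big1 ?mul0mx // => j jT.
  rewrite /f ifF ?raddf0 ?mul0rz //; apply/negbTE/finset.set0Pn.
  by exists j; rewrite setU11.
(* An entry of d between basis vectors of equal twist is constant, hence 0 by minimality. *)
- move=> T j; rewrite /f; case: ifP => _; last by rewrite mul0mx mxE eqxx.
  rewrite -rowE mxE; apply: contraNneq => e; apply/eqP.
  by have := @dg i j; rewrite tq e subrr => /homz_const ->; rewrite dmin mpolyC0.
have := kmin _ (kg finset.set0).
rewrite /f eqxx !mxE !eqxx mcoeffB mcoeff0_kosR0 mcoeff1 eqxx subr0 => /eqP.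
by rewrite oner_eq0.
Qed.

End Shift.
End Rows.

End KoszulVanishing.

(** * Betti numbers of a minimal resolution from Koszul cycles *)

Module BettiVanishing.
Import KoszulContraction HomogeneousParts PolynomialKoszul KoszulVanishing.

Section Resolution.
Variables (k : fieldType) (N : nat) (I : mpoly N k -> Prop) (C : free_complex k N).
Local Notation S := (mpoly N k).
Local Notation X i := (@mpolyX N k (mnm1 i)).

Hypothesis chark : [pchar k] =i pred0.
Hypothesis I0 : I 0.
Hypothesis ID : forall f g, I f -> I g -> I (f + g).
Hypothesis IM : forall f g, I g -> I (f * g).
Hypothesis Ihom : forall z f, I f -> I (hpart z f).
Hypothesis Idegree : forall (z : int) f, z <= 1 -> homz z f -> I f -> f = 0.
Hypothesis resC : minimal_graded_free_resolution I C.

Local Notation tws p := (@twist k N C p).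
Local Notation d p := (@differential k N C p).
Local Notation aug := (augmentation C).

Lemma res_homz p i j : homz (tws p.+1 i - tws p j) (d p i j).
Proof.
have [[_ h] _ _] := resC; move=> m /h ->; rewrite addrAC subrr add0r //.
Qed.

Lemma res_const0 p (w : 'rV_(rank C p.+1)) j :
  mcoeff (@mnm0 N) ((w *m d p) 0 j) = 0.
Proof.
have [_ _ h] := resC; rewrite mxE raddf_sum big1 //= => i _.
by rewrite (rmorphM (mcoeff mnm0)) /= h mulr0.
Qed.

Lemma res_ker_const0 p (v : 'rV_(rank C p.+1)) i :
  v *m d p = 0 -> mcoeff (@mnm0 N) (v 0 i) = 0.
Proof.
by have [_ [_ _ ex] _] := resC => /ex[w ->]; exact: res_const0.
Qed.

Lemma Iconst f : I f -> mcoeff (@mnm0 N) f = 0.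
Proof.
move=> /(Ihom 0) h; have := Idegree (z := 0) ler01 (@homz_hpart _ _ 0 f) h.
by move/(congr1 (mcoeff mnm0)); rewrite mcoeff0 mcoeff_hpart mdeg0 eqxx.
Qed.

(** By surjectivity some generator maps to an element with nonzero constant term, so it has twist 0.
    A second generator minus a multiple of it would be a relation with an entry 1, against
    minimality. *)
Lemma res_rank0 : exists i0 c,
  [/\ c != 0, aug i0 0 = mpolyC N c, tws 0%N i0 = 0 & forall i, i = i0].
Proof.
have [[ga _] [surj ex0 _] _] := resC.
have [v vP] := surj 1.
have [i0 i0P] : exists i0, mcoeff (@mnm0 N) (aug i0 0) != 0.
  apply/not_existsP => h; have := Iconst vP.
  rewrite mcoeffB mcoeff1 eqxx mxE raddf_sum big1 /=.
    by rewrite subr0 => /eqP; rewrite oner_eq0.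
  move=> i _; rewrite (rmorphM (mcoeff mnm0)) /=; have /negP := h i.
  by rewrite negbK => /eqP ->; rewrite mulr0.
have t0 : tws 0%N i0 = 0 by rewrite (ga _ mnm0) ?mdeg0 // mcoeff_msupp.
have a0 : aug i0 0 = mpolyC N (mcoeff mnm0 (aug i0 0)).
  by apply: homz_const => m /ga <-.
exists i0, (mcoeff mnm0 (aug i0 0)); split=> // i.
apply/eqP; apply: contraT => ne.
set c := mcoeff mnm0 _ in i0P a0.
pose u : 'rV[S]_(rank C 0) := delta_mx 0 i - (c^-1 *: aug i 0) *: delta_mx 0 i0.
have : I ((u *m aug) 0 0).
  rewrite mulmxBl -scalemxAl -!rowE !mxE a0 -mul_mpolyC.
  rewrite [_ * _ * _]mulrAC -mpolyCM mulVf // mpolyC1 mul1r subrr; exact: I0.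
move=> /ex0[w /(congr1 (fun v : 'rV_(rank C 0) => mcoeff (@mnm0 N) (v 0 i)))].
rewrite res_const0 !mxE !eqxx (negbTE ne) mulr0 subr0 mcoeff1 eqxx => /eqP.
by rewrite oner_eq0.
Qed.

(* The generator of F_0 identifies F_0 with S. *)
Lemma res_im0 i0 (v : 'rV[S]_(rank C 0)) : (forall i, i = i0) ->
  (exists w, v = w *m d 0%N) <-> I (v 0 i0).
Proof.
move=> h; have [_ [_ ex0 _] _] := resC; rewrite -ex0.
have [i1 [c [c0 ac _ _]]] := res_rank0.
rewrite (h i1) in ac; rewrite mxE (bigD1 i0) //= big1 ?addr0; last first.
  by move=> i; rewrite (h i) eqxx.
rewrite ac mulrC; split=> [/(IM (mpolyC N c^-1))|]; last exact: IM.
by rewrite mulrA -mpolyCM mulVf // mpolyC1 mul1r.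
Qed.

(** Twists grow strictly along a minimal resolution, and those of F_1 start at 2 because I has no
    nonzero element of degree at most 1. *)
Lemma res_twist_gt p (i : 'I_(rank C p.+1)) : (p.+2%:Z <= tws p.+1 i).
Proof.
elim: p i => [|p IH] i.
  have [i0 [c [_ _ t0 u]]] := res_rank0.
  rewrite leNgt; apply/negP => lt2.
  have z1 : tws 1%N i - tws 0%N i0 <= 1 by rewrite t0; lia.
  have : I (d 0%N i i0).
    have := (res_im0 (row i (d 0%N)) u).1; rewrite mxE; apply.
    by exists (delta_mx 0 i); rewrite rowE.
  move=> /(Idegree z1 (@res_homz _ _ _)) e.
  have /(@res_ker_const0 _ _ i) : (delta_mx 0 i : 'rV_(rank C 1)) *m d 0%N = 0.
    by apply/rowP => j; rewrite -rowE !mxE (u j).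
  by rewrite mxE !eqxx mcoeff1 eqxx => /eqP; rewrite oner_eq0.
(* A zero row would make a basis vector a syzygy with constant entry 1. *)
have [j] : exists j, d p.+1 i j != 0.
  apply/not_existsP => h.
  have /(@res_ker_const0 _ _ i) : (delta_mx 0 i : 'rV_(rank C p.+2)) *m d p.+1 = 0.
    apply/rowP => j; rewrite -rowE !mxE; apply/eqP/negPn/negP; exact: h.
  by rewrite mxE !eqxx mcoeff1 eqxx => /eqP; rewrite oner_eq0.
rewrite -mleadc_eq0 -mcoeff_msupp => mS.
have [[_ g] _ mi] := resC.
have := g _ _ _ _ mS => ->.
have : mdeg (mlead (d p.+1 i j)) != 0%N.
  rewrite mdeg_eq0; apply: contraTneq mS => ->.
  by rewrite mcoeff_msupp mi eqxx.
by have := IH j; lia.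
Qed.

Lemma betti_lt p (q : nat) : (q <= p.+1)%N -> betti C p.+1 q = 0%N.
Proof.
move=> qp; apply/eqP; rewrite cards_eq0; apply/eqP/finset.setP => i.
by rewrite !inE; apply/negbTE; have := res_twist_gt i; lia.
Qed.

Lemma betti0 q : betti C 0 q = (q == 0%N).
Proof.
have [i0 [c [_ _ t0 u]]] := res_rank0.
rewrite /betti; case: (eqVneq q 0%N) => [->|q0].
  rewrite /= -[RHS](cards1 i0); congr #|pred_of_set _|; apply/finset.setP => i.
  by rewrite !inE (u i) t0 !eqxx.
apply/eqP; rewrite cards_eq0; apply/eqP/finset.setP => i.
by rewrite !inE (u i) t0; lia.
Qed.

(** Vanishing of the Koszul homology of S/I in homological degree p and total degree q, stated on
    representatives in S. *)
Definition Ivan (p : nat) (q : int) : Prop :=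
  forall f : {set 'I_N} -> S, supported p f ->
    (forall T, homz (q - p%:Z) (f T)) -> (forall T, I (kosS f T)) ->
  exists g, [/\ supported p.+1 g, forall T, homz (q - p.+1%:Z) (g T)
    & forall T, I (f T - kosS g T)].

Lemma Ivan_Hvan p q : Ivan p q ->
  Hvan (tws 0%N) (fun v => exists w, v = w *m d 0%N) p q.
Proof.
have [i0 [c [_ _ t0 u]]] := res_rank0.
move=> hI f sf hf kf.
have [|||g [sg hg kg]] := hI (fun T => f T 0 i0).
- by move=> T /sf ->; rewrite mxE.
- by move=> T; have := hf T i0; rewrite t0 subr0.
- by move=> T; rewrite -kosR_entry -res_im0.
exists (fun T => \row_i g T); split.
- by move=> T Tp; apply/rowP => i; rewrite !mxE sg.
- by move=> T i; rewrite mxE (u i) t0 subr0.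
move=> T; rewrite (res_im0 _ u) !mxE kosR_entry.
have -> : (fun T0 => (\row_(i < rank C 0) g T0) 0 i0) = g.
  by apply/funext => T'; rewrite mxE.
exact: kg.
Qed.

Lemma Hvan_ext r (t : 'I_r -> int) (Z Z' : 'rV[S]_r -> Prop) p q :
  (forall v, Z v <-> Z' v) -> Hvan t Z p q -> Hvan t Z' p q.
Proof.
move=> ZZ' h f sf hf kf; have [|g [sg hg kg]] := h f sf hf.
  by move=> T; rewrite ZZ'.
by exists g; split=> // T; rewrite -ZZ'.
Qed.

(** The vanishing for S/I at p + 1 is shifted along the resolution to the cokernel of d_p at 1,
    where [Hvan_base] excludes basis vectors of twist q. *)
Lemma betti_eq0 p (q : nat) : Ivan p.+1 q%:Z -> betti C p.+1 q = 0%N.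
Proof.
move=> hI.
have h j : (j <= p)%N ->
    Hvan (tws j) (fun v => exists w, v = w *m d j) (p - j).+1 q%:Z.
  elim: j => [_|j IH jp]; first by rewrite subn0; exact: Ivan_Hvan.
  apply: (Hvan_ext (Z := fun v => v *m differential C j = 0)).
    by have [_ [_ _ ex] _] := resC.
  apply: (@Hvan_shift _ _ chark _ _ (tws j)); [exact: res_homz|lia|].
  have -> : (p - j.+1).+2 = (p - j).+1 by lia.
  by apply: IH; lia.
apply/eqP; rewrite cards_eq0; apply/eqP/finset.setP => i; rewrite !inE.
apply/negbTE; have := h p (leqnn p); rewrite subnn.
apply: (Hvan_base chark); first exact: res_homz.
  by have [_ _ mi] := resC; exact: mi.
by move=> v; exact: res_ker_const0.
Qed.

(* [lin_syz] is the degree 3 part of S_1 I_2. *)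
Definition lin_syz (f : S) : Prop :=
  exists2 g : 'I_N -> S, forall i, I (g i) /\ homz 2 (g i) & f = \sum_i X i * g i.

Lemma lin_syzD f1 f2 : lin_syz f1 -> lin_syz f2 -> lin_syz (f1 + f2).
Proof.
move=> [g1 h1 ->] [g2 h2 ->]; exists (fun i => g1 i + g2 i).
  move=> i; have [a b] := h1 i; have [a' b'] := h2 i.
  by split; [exact: ID|exact: homzD].
by rewrite -big_split; apply: eq_bigr => i _; rewrite mulrDr.
Qed.

Lemma lin_syzZ c f1 : lin_syz f1 -> lin_syz (c *: f1).
Proof.
move=> [g1 h1 ->]; exists (fun i => c *: g1 i).
  move=> i; have [a b] := h1 i.
  by split; [rewrite -mul_mpolyC; exact: IM|exact: homzZ].
by rewrite scaler_sumr; apply: eq_bigr => i _; rewrite scalerAr.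
Qed.

Lemma lin_syz0 : lin_syz 0.
Proof.
exists (fun _ => 0); first by move=> i; split; [exact: I0|exact: homz0].
by rewrite big1 // => i _; rewrite mulr0.
Qed.

Lemma lin_syz_sum (J : Type) (s : seq J) (P : pred J) (F : J -> S) :
  (forall j, P j -> lin_syz (F j)) -> lin_syz (\sum_(j <- s | P j) F j).
Proof.
by move=> h; elim/big_rec: _ => [|j f Pj hf]; [exact: lin_syz0|apply: lin_syzD; auto].
Qed.

(** Steinitz exchange modulo the subspace J, by the rank of the matrix of coefficients. *)
Lemma indep_mod_le (J : S -> Prop) a b (f : 'I_a -> S) (g : 'I_b -> S) :
  (forall u v, J u -> J v -> J (u + v)) -> (forall c u, J u -> J (c *: u)) -> J 0 ->
  (forall c : 'I_a -> k, J (\sum_i c i *: f i) -> forall i, c i = 0) ->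
  (forall i, exists c : 'I_b -> k, J (f i - \sum_j c j *: g j)) -> (a <= b)%N.
Proof.
move=> JD JZ J0 ind /choice[c cP].
pose A := \matrix_(i < a, j < b) c i j.
suff -> : a = \rank A by exact: rank_leq_col.
apply/eqP; rewrite eq_sym -[_ == _]/(row_free A) -kermx_eq0; apply/eqP/row_matrixP => i.
rewrite row0; set u := row i _.
have uA : u *m A = 0 by apply/sub_kermxP; exact: row_sub.
clearbody u.
have u0 : forall i, u 0 i = 0.
  apply: ind.
  have -> : \sum_i u 0 i *: f i = \sum_i u 0 i *: (f i - \sum_j c i j *: g j).
    under [RHS]eq_bigr do rewrite scalerBr.
    rewrite sumrB [Y in _ - Y](_ : _ = 0) ?subr0 //.
    under eq_bigr do rewrite scaler_sumr.
    rewrite exchange_big big1 //= => j _.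
    under eq_bigr do rewrite scalerA.
    rewrite -scaler_suml; have /rowP/(_ j) := uA.
    by rewrite !mxE; under eq_bigr do rewrite mxE; move=> e; rewrite e scale0r.
  by elim/big_rec: _ => // l x _ Jx; apply: JD => //; exact: JZ.
by apply/rowP => j; rewrite u0 mxE.
Qed.

Section Cubics.
Variables (r : nat) (g : 'I_r -> S).
Hypothesis gI : forall i, I (g i) /\ homz 3 (g i).
Hypothesis gind : forall c : 'I_r -> k, lin_syz (\sum_i c i *: g i) -> forall i, c i = 0.
Hypothesis ggen : forall f, I f -> homz 3 f ->
  exists c : 'I_r -> k, lin_syz (f - \sum_i c i *: g i).

(** The basis vectors of F_1 of twist 3 and the g_i both map to bases of I_3 modulo S_1 I_2. *)
Lemma betti13 : betti C 1 3 = r.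
Proof.
have [i0 [c0 [c0n _ t0 u]]] := res_rank0.
pose E := [set i : 'I_(rank C 1) | tws 1%N i == 3%:Z]%SET.
pose f (i : 'I_(rank C 1)) := d 0%N i i0.
have fE i : f i = ((delta_mx 0 i : 'rV_(rank C 1)) *m d 0%N) 0 i0.
  by rewrite -rowE mxE.
have If i : I (f i) by rewrite fE; apply/(res_im0 _ u); eexists.
have hf i : homz (tws 1%N i) (f i) by have := @res_homz 0 i i0; rewrite t0 subr0.
have hE (i : 'I_#|E|) : tws 1%N (enum_val i) = 3 by have := enum_valP i; rewrite inE => /eqP.
rewrite /betti -/E; apply/eqP; rewrite eqn_leq; apply/andP; split.
  apply: (@indep_mod_le lin_syz _ _ (fun i => f (enum_val i)) g).
  - exact: lin_syzD.
  - exact: lin_syzZ.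
  - exact: lin_syz0.
  - move=> c [h hP e] i.
    have /choice[w wP] l : exists w : 'rV[S]_(rank C 1), h l = (w *m d 0%N) 0 i0.
      have [|w ew] := (res_im0 (\row_(i < rank C 0) h l) u).2.
        by rewrite mxE; exact: (hP l).1.
      by exists w; rewrite -ew mxE.
    (* A relation modulo S_1 I_2 lifts to a syzygy whose constant terms are the [c i]; minimality
       kills them. *)
    pose v : 'rV[S]_(rank C 1) := \sum_i (mpolyC N (c i)) *: delta_mx 0 (enum_val i)
       - \sum_l X l *: w l.
    have vd : v *m d 0%N = 0.
      apply/rowP => j; rewrite (u j) mulmxBl !mulmx_suml !mxE !summxE.
      apply/eqP; rewrite subr_eq0; apply/eqP.
      transitivity (\sum_i c i *: f (enum_val i)).
        by apply: eq_bigr => l _; rewrite -scalemxAl mxE -fE mul_mpolyC.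
      by rewrite e; apply: eq_bigr => l _; rewrite -scalemxAl mxE -wP.
    have := @res_ker_const0 _ _ (enum_val i) vd.
    rewrite !mxE !summxE mcoeffB raddf_sum (bigD1 i) //= !mxE !eqxx mulr1.
    rewrite mcoeffC eqxx mulr1 big1 ?addr0; last first.
      move=> l li; rewrite !mxE eqxx (inj_eq enum_val_inj) eq_sym (negbTE li).
      by rewrite mulr0 mcoeff0.
    rewrite raddf_sum big1 ?subr0 // => l _.
    by rewrite mxE /= (rmorphM (mcoeff mnm0)) /= mcoeffX mnm1_eq0 mul0r.
  - by move=> i; apply: ggen; [exact: If|rewrite -(hE i); exact: hf].
apply: (@indep_mod_le lin_syz _ _ g (fun i => f (enum_val i))).
- exact: lin_syzD.
- exact: lin_syzZ.
- exact: lin_syz0.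
- exact: gind.
move=> l; have [Ig hg] := gI l.
have [w0 w0P] : exists w : 'rV[S]_(rank C 1), g l = (w *m d 0%N) 0 i0.
  have [|w ew] := (res_im0 (\row_(i < rank C 0) g l) u).2; first by rewrite mxE.
  by exists w; rewrite -ew mxE.
pose w := hrow (tws 1%N) 3 w0.
have wP : g l = (w *m d 0%N) 0 i0.
  rewrite -(hrow_mul (@res_homz 0)) mxE t0 subr0 -w0P hpart_id //.
have wE i : i \in E -> w 0 i = mpolyC N (mcoeff mnm0 (w 0 i)).
  rewrite inE => /eqP ti; apply: homz_const.
  by have := @hdeg_hrow k N _ (tws 1%N) 3 w0 i; rewrite ti subrr.
exists (fun i => mcoeff mnm0 (w 0 (enum_val i))).
have -> : g l - \sum_(i < #|E|) mcoeff mnm0 (w 0 (enum_val i)) *: f (enum_val i)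
    = \sum_(i | i \notin E) w 0 i * f i.
  rewrite wP mxE (bigID (fun i => i \in E)) /= addrC.
  suff -> : \sum_(i < #|E|) mcoeff mnm0 (w 0 (enum_val i)) *: f (enum_val i)
      = \sum_(i in E) w 0 i * d 0%N i i0 by rewrite addrK.
  rewrite [RHS]big_enum_val /=; apply: eq_bigr => j _.
  by rewrite [in RHS]wE ?enum_valP // mul_mpolyC.
apply: lin_syz_sum => i; rewrite inE => ti.
have hw : homz (3 - tws 1%N i) (w 0 i) by exact: hdeg_hrow.
case: (eqVneq (tws 1%N i) 2) => [t2|n2]; last first.
  rewrite (homz_neg _ hw) ?mul0r; first exact: lin_syz0.
  by have := res_twist_gt i; lia.
rewrite t2 in hw.
(* Over a generator of degree 2 the coefficient is a linear form, which Euler's identity writes as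
   the sum of the X_l times its derivatives. *)
exists (fun l => mderiv l (w 0 i) * f i).
  move=> l'; split; first exact: IM (If i).
  by have := homzM (@homz_mderiv _ _ _ l' _ hw) (@hf i); rewrite t2.
rewrite -[w 0 i in LHS](mulr1z) -(euler hw) mulr_suml.
by apply: eq_bigr => l' _; rewrite mulrA.
Qed.

End Cubics.
End Resolution.

End BettiVanishing.

(** * The Hilbert function as an alternating sum of Betti numbers *)

Module HilbertBetti.
Import KoszulContraction HomogeneousParts PolynomialKoszul KoszulVanishing BettiVanishing.

Section Hilbert.
Variables (k : fieldType) (N : nat) (I : mpoly N k -> Prop) (C : free_complex k N).
Local Notation S := (mpoly N k).
Local Notation tws p := (@twist k N C p).
Local Notation d p := (@differential k N C p).

Hypothesis chark : [pchar k] =i pred0.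
Hypothesis I0 : I 0.
Hypothesis ID : forall f g, I f -> I g -> I (f + g).
Hypothesis IM : forall f g, I g -> I (f * g).
Hypothesis Ihom : forall z f, I f -> I (hpart z f).
Hypothesis Idegree : forall (z : int) f, z <= 1 -> homz z f -> I f -> f = 0.
Hypothesis resC : minimal_graded_free_resolution I C.

Variable q : nat.

(** The monomial basis of the degree q part of F_p. Bounding the degree of the monomial by q makes
    the index type finite and loses nothing, since twists are nonnegative. *)
Definition hbasis p : {set 'I_(rank C p) * bmultinom N q.+1} :=
  [set x : 'I_(rank C p) * bmultinom N q.+1 | (mdeg x.2)%:Z + tws p x.1 == q%:Z]%SET.

Definition of_coord p (u : 'rV[k]_#|hbasis p|) : 'rV[S]_(rank C p) :=
  \row_i \sum_(j < #|hbasis p| | (enum_val j).1 == i) u 0 j *: mpolyX k (enum_val j).2.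

Definition to_coord p (v : 'rV[S]_(rank C p)) : 'rV[k]_#|hbasis p| :=
  \row_(j < #|hbasis p|) mcoeff (enum_val j).2 (v 0 (enum_val j).1).

Lemma of_coordK p : cancel (@of_coord p) (@to_coord p).
Proof.
move=> u; apply/rowP => j; rewrite !mxE raddf_sum (bigD1 j) //= mcoeffZ mcoeffX.
rewrite eqxx mulr1 big1 ?addr0 // => l /andP[/eqP e1 lj].
rewrite mcoeffZ mcoeffX; case: eqP => [/val_inj e2|]; last by rewrite mulr0.
case/eqP: lj; apply: enum_val_inj.
by rewrite [LHS]surjective_pairing e1 e2 -surjective_pairing.
Qed.

Lemma to_coordK p v : (forall i, 0 <= tws p i) -> hdeg (tws p) q%:Z v ->
  of_coord (to_coord v) = v.
Proof.
move=> tw0 hv; apply/rowP => i; rewrite mxE; apply/mpolyP => m.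
rewrite raddf_sum; under eq_bigr => j _ do rewrite /= mxE mcoeffZ mcoeffX.
have /homzP hvi : homz (q%:Z - tws p i) (v 0 i) by exact: hv.
case: (boolP ((mdeg m)%:Z == q%:Z - tws p i)) => [/eqP dm|ne]; last first.
  rewrite hvi // big1 // => j /eqP ji; case: eqP => [e|]; last by rewrite mulr0.
  by rewrite ji e hvi ?mul0r.
have mq : (mdeg m < q.+1)%N by have := tw0 i; lia.
have xB : (i, BMultinom mq) \in hbasis p by rewrite inE /= dm subrK.
rewrite (bigD1 (enum_rank_in xB (i, BMultinom mq))) /= enum_rankK_in //=.
rewrite eqxx mulr1 big1 ?addr0 // => j /andP[/eqP ji ne].
case: eqP => [e|]; last by rewrite mulr0.
case/eqP: ne; apply: enum_val_inj; rewrite enum_rankK_in //.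
by rewrite [LHS]surjective_pairing ji; congr pair; exact: val_inj.
Qed.

Lemma hdeg_of_coord p u : hdeg (tws p) q%:Z (@of_coord p u).
Proof.
move=> i; rewrite mxE; apply: homz_sum => j /eqP ji; apply: homzZ.
have := enum_valP j; rewrite inE ji => /eqP <-.
by rewrite addrK; exact: homz_X.
Qed.

Lemma of_coord_is_linear p (c : k) u v :
  @of_coord p (c *: u + v) = mpolyC N c *: of_coord u + of_coord v.
Proof.
apply/rowP => i; rewrite !mxE mul_mpolyC scaler_sumr -big_split /=.
by apply: eq_bigr => j _; rewrite !mxE scalerDl scalerA.
Qed.

Definition dcoord p (u : 'rV[k]_#|hbasis p.+1|) : 'rV[k]_#|hbasis p| :=
  to_coord (of_coord u *m d p).

Lemma dcoord_is_linear p : linear (@dcoord p).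
Proof.
move=> c u v; rewrite /dcoord of_coord_is_linear mulmxDl -scalemxAl.
apply/rowP => j; rewrite !mxE mcoeffD.
by rewrite -mcoeffZ -mul_mpolyC.
Qed.
HB.instance Definition _ p :=
  GRing.isLinear.Build k _ _ _ (@dcoord p) (@dcoord_is_linear p).

Lemma twist_ge0 p (i : 'I_(rank C p)) : 0 <= tws p i.
Proof.
case: p i => [|p] i; last by have := @res_twist_gt _ _ _ _ I0 IM Ihom Idegree resC _ i; lia.
by have [i0 [c [_ _ t0 u]]] := res_rank0 I0 Ihom Idegree resC; rewrite (u i) t0.
Qed.

Lemma of_dcoord p u : of_coord (@dcoord p u) = of_coord u *m d p.
Proof.
rewrite to_coordK //; first exact: twist_ge0.
by apply: hdeg_mul; [exact: (res_homz resC)|exact: hdeg_of_coord].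
Qed.

Lemma dcoord_exact p u : @dcoord p u = 0 -> exists w, u = @dcoord p.+1 w.
Proof.
move=> e; have := of_dcoord u; rewrite e.
have -> : of_coord (0 : 'rV_#|hbasis p|) = 0.
  by apply/rowP => i; rewrite !mxE big1 // => j _; rewrite mxE scale0r.
have [_ [_ _ ex] _] := resC => /esym/ex[w ew].
exists (to_coord (hrow (tws p.+2) q%:Z w)).
rewrite /dcoord to_coordK; [|exact: twist_ge0|exact: hdeg_hrow].
rewrite -(hrow_mul (@res_homz _ _ _ _ resC _)) -ew hrow_id ?of_coordK //.
exact: hdeg_of_coord.
Qed.

Lemma dcoordK p u : @dcoord p (@dcoord p.+1 u) = 0.
Proof.
have [_ [_ _ ex] _] := resC.
rewrite /dcoord of_dcoord (ex _ _).2; last by eexists.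
by apply/rowP => j; rewrite !mxE mcoeff0.
Qed.

Definition dmx p : 'M[k]_(#|hbasis p.+1|, #|hbasis p|) := lin1_mx (@dcoord p).

Variables (a : nat) (phi : {linear S -> 'rV[k]_a}).
Hypothesis phi_ker : forall f, homz q%:Z f -> (phi f = 0 <-> I f).
Hypothesis phi_surj : forall u, exists2 f, homz q%:Z f & phi f = u.

Lemma rank_exact (F : fieldType) l m n (A : 'M[F]_(l, m)) (B : 'M[F]_(m, n)) :
  (forall u : 'rV_m, u *m B = 0 <-> exists w, u = w *m A) ->
  (\rank A + \rank B)%N = m.
Proof.
move=> h; have -> : \rank A = \rank (kermx B).
  apply/eqP; rewrite eqn_leq !mxrankS //.
    apply/row_subP => i; apply/submxP; apply/h.
    by apply/sub_kermxP; exact: row_sub.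
  apply/sub_kermxP/row_matrixP => i; rewrite row0 row_mul.
  by apply/h; exists (delta_mx 0 i); rewrite rowE.
by rewrite mxrank_ker subnK // rank_leq_row.
Qed.

Lemma rank_dmxS p : (\rank (dmx p.+1) + \rank (dmx p))%N = #|hbasis p.+1|.
Proof.
apply: rank_exact => u; rewrite mul_rV_lin1; split=> [/dcoord_exact[w ->]|[w ->]].
  by exists w; rewrite mul_rV_lin1.
by rewrite mul_rV_lin1 /= dcoordK.
Qed.

Lemma rank_dmx0 : (\rank (dmx 0) + a)%N = #|hbasis 0|.
Proof.
have [i0 [c [_ _ t0 u0]]] := res_rank0 I0 Ihom Idegree resC.
pose ac u := phi (@of_coord 0 u 0 i0).
have acl : linear ac.
  by move=> e u v; rewrite /ac of_coord_is_linear !mxE mul_mpolyC linearP.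
pose acL : {linear 'rV[k]_#|hbasis 0| -> 'rV[k]_a} :=
  HB.pack ac (GRing.isLinear.Build k _ _ _ ac acl).
have hh u : homz q%:Z (@of_coord 0 u 0 i0).
  by have := @hdeg_of_coord 0 u i0; rewrite t0 subr0.
have fullA : \rank (lin1_mx acL) = a.
  apply/eqP; rewrite -[_ == _]/(row_full _); apply/row_fullP.
  have /choice[g gP] : forall j : 'I_a, exists u, ac u = delta_mx 0 j.
    move=> j; have [f hf fj] := phi_surj (delta_mx 0 j).
    exists (to_coord (\row_(i < rank C 0) f)).
    rewrite /ac to_coordK ?mxE //; first exact: twist_ge0.
    by move=> i; rewrite mxE (u0 i) t0 subr0.
  exists (\matrix_(j < a) g j); apply/row_matrixP => j.
  by rewrite row_mul rowK mul_rV_lin1 /= gP rowE mulmx1.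
rewrite -[in LHS]fullA; apply: rank_exact => u.
rewrite mul_rV_lin1 /= /ac phi_ker // -(res_im0 I0 IM Ihom Idegree resC _ u0).
split=> [[w ew]|[w ->]].
  exists (to_coord (hrow (tws 1%N) q%:Z w)); rewrite mul_rV_lin1 /= /dcoord.
  rewrite to_coordK; [|exact: twist_ge0|exact: hdeg_hrow].
  rewrite -(hrow_mul (@res_homz _ _ _ _ resC _)) -ew hrow_id ?of_coordK //.
  exact: hdeg_of_coord.
by rewrite mul_rV_lin1 /= of_dcoord; eexists.
Qed.

(** [phi] makes a the dimension of the degree q part of S/I. The resolution is exact in degree q, so
    ranks telescope, and they stop because all twists of F_(q+1) exceed q. *)
Lemma hbasis_alternating :
  a%:Z = \sum_(p < q.+1) (-1) ^+ p * #|hbasis p|%:Z.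
Proof.
have h P : \sum_(p < P.+1) (-1) ^+ p * #|hbasis p|%:Z =
    a%:Z + (-1) ^+ P * (\rank (dmx P))%:Z.
  elim: P => [|P IH].
    have e : #|hbasis 0|%:Z = (\rank (dmx 0))%:Z + a%:Z.
      by rewrite -PoszD; congr Posz; rewrite rank_dmx0.
    by rewrite big_ord_recl big_ord0 e; ring.
  have e : #|hbasis P.+1|%:Z = (\rank (dmx P.+1))%:Z + (\rank (dmx P))%:Z.
    by rewrite -PoszD; congr Posz; rewrite rank_dmxS.
  by rewrite big_ord_recr IH /= e exprS; ring.
rewrite h; have : (\rank (dmx q) <= 0)%N.
  apply: leq_trans (rank_leq_row _) _; rewrite leqn0 cards_eq0.
  apply/eqP/finset.setP => -[i m]; rewrite !inE /=; apply/negbTE/eqP => e.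
  have := @res_twist_gt _ _ _ _ I0 IM Ihom Idegree resC _ i.
  by move: e; move: (tws _ _) => t; lia.
by rewrite leqn0 => /eqP ->; rewrite mulr0 addr0.
Qed.

Lemma card_mdeg n e b : (e < b)%N -> N = n.+1 ->
  #|[set m : bmultinom N b | mdeg m == e]%SET| = 'C(e + n, e).
Proof.
move=> eb Nn; move: (Nn) => eN; subst N.
rewrite -size_basis cardE -(size_map val); apply/perm_size/uniq_perm.
- by rewrite map_inj_uniq ?enum_uniq //; exact: val_inj.
- exact: uniq_basis.
move=> m; rewrite -basis_cover; apply/mapP/idP => [[x]|me].
  by rewrite mem_enum inE => xe ->.
have mb : (mdeg m < b)%N by rewrite (eqP me).
by exists (BMultinom mb) => //; rewrite mem_enum inE.
Qed.

Lemma card_hbasis n p : N = n.+1 ->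
  #|hbasis p| = (\sum_(e < q.+1) betti C p e * 'C(q - e + n, q - e))%N.
Proof.
move=> Nn.
pose s (t : int) := #|[set m : bmultinom N q.+1 | (mdeg m)%:Z + t == q%:Z]%SET|.
transitivity (\sum_(i < rank C p) s (tws p i))%N.
  have -> : #|hbasis p| = (\sum_(x : 'I_(rank C p) * bmultinom N q.+1 |
      ((mdeg x.2)%:Z + tws p x.1 == q%:Z)%R) 1)%N.
    by rewrite -sum1_card; apply: eq_bigl => x; rewrite inE.
  rewrite -(pair_big_dep xpredT (fun i (m : bmultinom N q.+1) =>
    (mdeg m)%:Z + tws p i == q%:Z) (fun _ _ => 1%N)) /=.
  by apply: eq_bigr => i _; rewrite sum1dep_card.
transitivity (\sum_(i < rank C p) \sum_(e < q.+1 | tws p i == e%:Z) s e%:Z)%N.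
  apply: eq_bigr => i _; have := @twist_ge0 p i.
  case tE: (tws p i) => [t|//] _.
  case: (ltnP t q.+1) => tq.
    by rewrite (big_pred1 (Ordinal tq)) // => e; rewrite eqz_nat eq_sym.
  rewrite big_pred0; last by move=> e; rewrite eqz_nat; have := ltn_ord e; lia.
  apply/eqP; rewrite cards_eq0; apply/eqP/finset.setP => m; rewrite !inE; lia.
rewrite (exchange_big_dep xpredT) //=; apply: eq_bigr => e _.
rewrite big_const iter_addn_0 mulnC; congr muln.
  by rewrite /betti cardsE.
have eq' : (q - e < q.+1)%N by lia.
rewrite -(card_mdeg eq' Nn); congr #|pred_of_set _|; apply/finset.setP => m.
by rewrite !inE; have := ltn_ord e; lia.
Qed.

Theorem hilbert_betti n : N = n.+1 ->
  a%:Z = \sum_(e < q.+1)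
    (\sum_(p < q.+1) (-1) ^+ p * (betti C p e)%:Z) * ('C(q - e + n, q - e))%:Z.
Proof.
move=> Nn; rewrite hbasis_alternating.
under eq_bigr => p _ do rewrite (card_hbasis p Nn) -natz natr_sum mulr_sumr.
rewrite exchange_big; apply: eq_bigr => e _; rewrite mulr_suml.
by apply: eq_bigr => p _; rewrite natrM !natz mulrA.
Qed.

End Hilbert.

End HilbertBetti.

(** * Gordan's alternative in the plane *)

Module PlaneGordan.
Section Plane.
Variable R : realFieldType.
Implicit Types (u v w l : R * R).

Definition dot u v : R := u.1 * v.1 + u.2 * v.2.
Definition det2 u v : R := u.1 * v.2 - u.2 * v.1.

Lemma normsq_gt0 w : w != 0 -> 0 < w.1 ^+ 2 + w.2 ^+ 2.
Proof.
move=> w0; rewrite lt_neqAle addr_ge0 ?sqr_ge0 // andbT eq_sym.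
rewrite paddr_eq0 ?sqr_ge0 // !sqrf_eq0; apply: contra w0.
by case: w => x y /= /andP[/eqP -> /eqP ->].
Qed.

Lemma big_enough (T : eqType) (W : seq T) (f g : T -> R) :
  (forall q, q \in W -> 0 < f q) ->
  exists K, forall K', K <= K' -> forall q, q \in W -> 0 < K' * f q + g q.
Proof.
elim: W => [|q W IH] fW; first by exists 0.
have [K KP] := IH (fun q' q'W => fW q' ltac:(by rewrite inE q'W orbT)).
have fq : 0 < f q by apply: fW; rewrite mem_head.
exists (Num.max K (`|g q| / f q + 1)) => K'.
rewrite ge_max => /andP[h1 h2] q'; rewrite inE => /orP[/eqP ->|]; last exact: KP.
have : (`|g q| / f q + 1) * f q <= K' * f q by rewrite ler_pM2r.
by rewrite mulrDl divfK ?gt_eqF //; have := ler_norm (- g q); rewrite normrN; lra.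
Qed.

(** Induction on W. If l fails at the new w, either the other vectors lie strictly on one side of
    the line of w and a tilted functional works, or two of them on opposite sides satisfy with w
    Cramer's relation, whose coefficients are nonnegative thanks to l. *)
Lemma gordan (W : seq (R * R)) :
  (exists l, forall w, w \in W -> 0 < dot l w) \/
  exists w1 w2 w3 a b c, [/\ [/\ w1 \in W, w2 \in W & w3 \in W],
    [/\ 0 <= a, 0 <= b, 0 <= c & 0 < a + b + c],
    a * w1.1 + b * w2.1 + c * w3.1 = 0 &
    a * w1.2 + b * w2.2 + c * w3.2 = 0].
Proof.
elim: W => [|w W [[l lW]|[w1 [w2 [w3 [a [b [c [[h1 h2 h3] h4 h5 h6]]]]]]]]].
- by left; exists 0.
- case: (ltP 0 (dot l w)) => lw.
    by left; exists l => q; rewrite inE => /orP[/eqP -> //|]; exact: lW.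
  have sep (s : R) : s ^+ 2 = 1 -> (forall q, q \in W -> 0 < s * det2 w q) ->
      w != 0 -> exists l0, forall q, q \in w :: W -> 0 < dot l0 q.
    (* The functional is a large multiple of the normal to w plus w itself, so it is positive both
       on W and on w. *)
    move=> s1 sW w0; have [K KP] := big_enough (fun q => dot w q) sW.
    exists (- (K * s) * w.2 + w.1, (K * s) * w.1 + w.2) => q.
    rewrite inE => /orP[/eqP ->|qW].
      have -> : dot (- (K * s) * w.2 + w.1, K * s * w.1 + w.2) w = w.1 ^+ 2 + w.2 ^+ 2.
        by rewrite /dot /=; ring.
      exact: normsq_gt0.
    have := KP K (lexx _) q qW.
    by congr (0 < _); rewrite /dot /det2 /=; ring.
  case: (eqVneq w 0) => [->|w0].
    right; exists 0, 0, 0, 1, 0, 0; rewrite mem_head /= !mulr0 !addr0.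
    by split=> //; split; rewrite ?ler01 ?ltr01 ?lexx.
  case: (boolP (all (fun q => 0 < det2 w q) W)) => [/allP pos|/allPn[q2 q2W]].
    left; apply: (sep 1); rewrite ?expr1n // => q /pos; by rewrite mul1r.
  rewrite -leNgt => n2.
  case: (boolP (all (fun q => det2 w q < 0) W)) => [/allP neg|/allPn[q1 q1W]].
    left; apply: (sep (-1)); rewrite ?sqrrN ?expr1n // => q /neg.
    by rewrite mulN1r oppr_gt0.
  rewrite -leNgt => n1; right.
  have e1 : det2 q1 q2 * w.1 + det2 q2 w * q1.1 + det2 w q1 * q2.1 = 0.
    by rewrite /det2; ring.
  have e2 : det2 q1 q2 * w.2 + det2 q2 w * q1.2 + det2 w q1 * q2.2 = 0.
    by rewrite /det2; ring.
  have anti : det2 q2 w = - det2 w q2 by rewrite /det2; ring.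
  have l1 := lW _ q1W; have l2 := lW _ q2W.
  have key : det2 q1 q2 * dot l w = - (det2 q2 w * dot l q1 + det2 w q1 * dot l q2).
    by rewrite /dot /det2; ring.
  (* A vanishing determinant means that w is opposite to the other vector. *)
  have par q : q \in W -> det2 w q = 0 -> exists w1 w2 w3 a b c,
     [/\ [/\ w1 \in w :: W, w2 \in w :: W & w3 \in w :: W],
    [/\ 0 <= a, 0 <= b, 0 <= c & 0 < a + b + c],
    a * w1.1 + b * w2.1 + c * w3.1 = 0 &
    a * w1.2 + b * w2.2 + c * w3.2 = 0].
    move=> qW dq; have lq := lW _ qW.
    exists w, q, q, (dot l q), (- dot l w), 0; split.
    - by rewrite mem_head inE qW orbT.
    - by split=> //; lra.
    - by have : dot l q * w.1 - dot l w * q.1 = l.2 * det2 w q;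
        [rewrite /dot /det2; ring|rewrite dq mulr0; lra].
    - by have : dot l q * w.2 - dot l w * q.2 = - l.1 * det2 w q;
        [rewrite /dot /det2; ring|rewrite dq mulr0; lra].
  case: (eqVneq (det2 w q2) 0) => [|n2']; first exact: par.
  case: (eqVneq (det2 w q1) 0) => [|n1']; first exact: par.
  have p1 : 0 < det2 w q1 by rewrite lt_neqAle eq_sym n1'.
  have p2 : 0 < det2 q2 w by rewrite anti oppr_gt0 lt_neqAle n2'.
  exists w, q1, q2, (det2 q1 q2), (det2 q2 w), (det2 w q1); split=> //.
    by rewrite mem_head !inE q1W q2W !orbT.
  have p3 : 0 <= det2 q1 q2.
    rewrite leNgt; apply/negP => n3.
    have : 0 <= - det2 q1 q2 * - dot l w by apply: mulr_ge0; rewrite oppr_ge0 ?(ltW n3).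
    rewrite mulrNN key; have : 0 < det2 q2 w * dot l q1 by rewrite mulr_gt0.
    have : 0 < det2 w q1 * dot l q2 by rewrite mulr_gt0.
    lra.
  by split; lra.
right; exists w1, w2, w3, a, b, c; split=> //.
by rewrite !inE h1 h2 h3 !orbT.
Qed.
End Plane.

End PlaneGordan.

(** * The cone over a polygon and its normality *)

Module PolygonCone.
Import PlaneGordan.

Section Config.
Variables (R : realFieldType) (N : nat) (P : 'I_N -> int * int) (i0 : 'I_N).
Implicit Types (l u v : R * R) (z : int * int) (x y : int * int * int).

Definition emb z : R * R := (z.1%:~R, z.2%:~R).

Lemma dotDl l1 l2 u : dot (l1 + l2) u = dot l1 u + dot l2 u.
Proof. by rewrite /dot /=; ring. Qed.
Lemma dotZl (a : R) l u : dot (a * l.1, a * l.2) u = a * dot l u.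
Proof. by rewrite /dot /=; ring. Qed.
Lemma dotNl l u : dot (- l) u = - dot l u.
Proof. by rewrite /dot /=; ring. Qed.
Lemma dot0l u : dot 0 u = 0.
Proof. by rewrite /dot /= !mul0r addr0. Qed.
Lemma dotDr l u v : dot l (u + v) = dot l u + dot l v.
Proof. by rewrite /dot /=; ring. Qed.
Lemma dotNr l u : dot l (- u) = - dot l u.
Proof. by rewrite /dot /=; ring. Qed.
Lemma embD z z' : emb (z + z') = emb z + emb z'.
Proof. by rewrite /emb /= !intrD. Qed.
Lemma embN z : emb (- z) = - emb z.
Proof. by rewrite /emb /= !mulrNz. Qed.

(** The support function of the polygon; [i0] makes the minimum range over a nonempty set. *)
Definition hmin l : R := dot l (emb (P [arg min_(i < i0) dot l (emb (P i))]%O)).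

Lemma hmin_le l i : hmin l <= dot l (emb (P i)).
Proof. by rewrite /hmin; case: arg_minP => // j _; exact. Qed.

Lemma hminP l : exists i, hmin l = dot l (emb (P i)).
Proof. by eexists. Qed.

Lemma hmin0 : hmin 0 = 0.
Proof. by rewrite /hmin dot0l. Qed.

Lemma hminZ (a : R) l : 0 <= a -> hmin (a * l.1, a * l.2) = a * hmin l.
Proof.
move=> a0; apply/eqP; rewrite eq_le; apply/andP; split.
  by have [i ->] := hminP l; rewrite -dotZl hmin_le.
have [i ->] := hminP (a * l.1, a * l.2).
by rewrite dotZl ler_wpM2l // hmin_le.
Qed.

Lemma hminD l1 l2 : hmin l1 + hmin l2 <= hmin (l1 + l2).
Proof. by have [i ->] := hminP (l1 + l2); rewrite dotDl lerD // hmin_le. Qed.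

(* A point x = (z, d) of the cone over the polygon is tested by the functionals
   [ev l], nonnegative on the cone. *)
Definition ev l x : R := dot l (emb x.1) - x.2%:~R * hmin l.
Definition inC x : Prop := forall l, 0 <= ev l x.
Definition intC x : Prop := forall l, l != 0 -> 0 < ev l x.
Definition PP i : int * int * int := (P i, 1).

Lemma evD l x y : ev l (x + y) = ev l x + ev l y.
Proof. by rewrite /ev /= embD dotDr intrD; ring. Qed.
Lemma evN l x : ev l (- x) = - ev l x.
Proof. by rewrite /ev /= embN dotNr mulrNz; ring. Qed.
Lemma evB l x y : ev l (x - y) = ev l x - ev l y.
Proof. by rewrite evD evN. Qed.
Lemma ev0 l : ev l 0 = 0.
Proof. by have := evB l 0 0; rewrite subr0 subrr. Qed.
Lemma ev_l0 x : ev 0 x = 0.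
Proof. by rewrite /ev dot0l hmin0 mulr0 subr0. Qed.
Lemma ev_PP l i : 0 <= ev l (PP i).
Proof. by rewrite /ev /= mul1r subr_ge0 hmin_le. Qed.
Lemma evZ (a : R) l x : 0 <= a -> ev (a * l.1, a * l.2) x = a * ev l x.
Proof. by move=> a0; rewrite /ev hminZ // dotZl; ring. Qed.
Lemma ev_sub l1 l2 x : 0 <= x.2 -> ev (l1 + l2) x <= ev l1 x + ev l2 x.
Proof.
rewrite -(ler0z R) => x0; rewrite /ev dotDl.
have := ler_wpM2l x0 (hminD l1 l2); lra.
Qed.
Lemma ev_super l1 l2 x : x.2 <= 0 -> ev l1 x + ev l2 x <= ev (l1 + l2) x.
Proof.
rewrite -(lerz0 R) => x0; rewrite /ev dotDl.
have := ler_wnM2l x0 (hminD l1 l2); lra.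
Qed.
Lemma ev_Mn l x n : ev l (x *+ n) = n%:R * ev l x.
Proof.
elim: n => [|n IH]; first by rewrite mulr0n ev0 mul0r.
by rewrite mulrS evD IH -(@natr1 R) mulrDl mul1r addrC.
Qed.

Lemma inC_PP i : inC (PP i). Proof. by move=> l; exact: ev_PP. Qed.
Lemma inC0 : inC 0. Proof. by move=> l; rewrite ev0. Qed.
Lemma intC_inC x : intC x -> inC x.
Proof. by move=> hx l; case: (eqVneq l 0) => [->|/hx/ltW //]; rewrite ev_l0. Qed.

Lemma ev_comb3 x (a b c : R) i j m l : a + b + c = x.2%:~R ->
  (emb x.1).1 = a * (emb (P i)).1 + b * (emb (P j)).1 + c * (emb (P m)).1 ->
  (emb x.1).2 = a * (emb (P i)).2 + b * (emb (P j)).2 + c * (emb (P m)).2 ->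
  ev l x = a * ev l (PP i) + b * ev l (PP j) + c * ev l (PP m).
Proof.
move=> s e1 e2; rewrite /ev /= !mul1r -s /dot e1 e2; ring.
Qed.

Hypothesis closedP : forall z, inC (z, 1) -> exists i, P i = z.

(** Caratheodory's theorem in the cone: Gordan's alternative for the vectors d P_i - z, where x =
    (z, d). A functional positive on all of them would violate [inC]. *)
Lemma cone3 x : 0 < x.2 -> inC x -> exists i j m (a b c : R),
  [/\ [/\ 0 <= a, 0 <= b & 0 <= c], a + b + c = x.2%:~R,
    (emb x.1).1 = a * (emb (P i)).1 + b * (emb (P j)).1 + c * (emb (P m)).1 &
    (emb x.1).2 = a * (emb (P i)).2 + b * (emb (P j)).2 + c * (emb (P m)).2].
Proof.
rewrite -(ltr0z R) => d0 hx.
pose w i : R * R := (x.2%:~R * (emb (P i)).1 - (emb x.1).1,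
                     x.2%:~R * (emb (P i)).2 - (emb x.1).2).
case: (gordan [seq w i | i <- enum 'I_N]) => [[l lP]|].
  have [i hi] := hminP l.
  have : 0 < dot l (w i) by apply: lP; apply: map_f; rewrite mem_enum.
  have := hx l; rewrite /ev hi /dot /w /=; lra.
move=> [_ [_ [_ [a [b [c [[/mapP[i _ ->] /mapP[j _ ->] /mapP[m _ ->]] [a0 b0 c0 s0] e1 e2]]]]]]].
set s := a + b + c in s0; pose t := x.2%:~R / s.
have t0 : 0 < t by rewrite divr_gt0.
have ts : t * s = x.2%:~R by rewrite divfK ?gt_eqF.
have key (g p1 p2 p3 : R) : a * (x.2%:~R * p1 - g) + b * (x.2%:~R * p2 - g) + c * (x.2%:~R * p3 - g) = 0 ->
    g = (t * a) * p1 + (t * b) * p2 + (t * c) * p3.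
  move=> e; have : s * g = x.2%:~R * (a * p1 + b * p2 + c * p3) by rewrite /s; lra.
  rewrite -ts => e'; apply: (mulfI (lt0r_neq0 s0)); rewrite e'; ring.
exists i, j, m, (t * a), (t * b), (t * c); split.
- by split; rewrite mulr_ge0 // ltW.
- by rewrite -ts /s; ring.
- exact: key.
- exact: key.
Qed.

Lemma ev_comb3_inC x (a b c : R) i j m : 0 <= a -> 0 <= b -> 0 <= c ->
  a + b + c = x.2%:~R ->
  (emb x.1).1 = a * (emb (P i)).1 + b * (emb (P j)).1 + c * (emb (P m)).1 ->
  (emb x.1).2 = a * (emb (P i)).2 + b * (emb (P j)).2 + c * (emb (P m)).2 -> inC x.
Proof.
move=> a0 b0 c0 s e1 e2 l; rewrite (ev_comb3 l s e1 e2).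
by rewrite !addr_ge0 // mulr_ge0 // ev_PP.
Qed.

Lemma comb3_peel x (a b c : R) i j m : 1 <= a -> 0 <= b -> 0 <= c ->
  a + b + c = x.2%:~R ->
  (emb x.1).1 = a * (emb (P i)).1 + b * (emb (P j)).1 + c * (emb (P m)).1 ->
  (emb x.1).2 = a * (emb (P i)).2 + b * (emb (P j)).2 + c * (emb (P m)).2 ->
  inC (x - PP i).
Proof.
move=> a1 b0 c0 s e1 e2; apply: (@ev_comb3_inC _ (a - 1) b c i j m) => //.
- by rewrite subr_ge0.
- by rewrite /= intrB; lra.
- by move: e1; rewrite /= intrB; lra.
- by move: e2; rewrite /= intrB; lra.
Qed.

Definition area3 i j m : int :=
  ((P j).1 - (P i).1) * ((P m).2 - (P i).2) - ((P j).2 - (P i).2) * ((P m).1 - (P i).1).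

Lemma area3_perm1 i j m : area3 j m i = area3 i j m. Proof. by rewrite /area3; ring. Qed.

(* Replacing a vertex of a triangle by an interior lattice point shrinks it. *)
Lemma normal2 (n : nat) x (a b c : R) i j m : (`|area3 i j m| < n)%N -> x.2 = 2 ->
  0 <= a -> 0 <= b -> 0 <= c ->
  a + b + c = x.2%:~R ->
  (emb x.1).1 = a * (emb (P i)).1 + b * (emb (P j)).1 + c * (emb (P m)).1 ->
  (emb x.1).2 = a * (emb (P i)).2 + b * (emb (P j)).2 + c * (emb (P m)).2 ->
  exists i', inC (x - PP i').
Proof.
elim: n x a b c i j m => [//|n IH] x a b c i j m an x2 a0 b0 c0 s e1 e2.
case: (leP 1 a) => a1; first by exists i; exact: comb3_peel s e1 e2.
case: (leP 1 b) => b1.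
  by exists j; apply: (comb3_peel (i := j) (j := m) (m := i) b1 c0 a0); lra.
case: (leP 1 c) => c1.
  by exists m; apply: (comb3_peel (i := m) (j := i) (m := j) c1 a0 b0); lra.
have s2 : a + b + c = 2 by rewrite s x2.
(* In a degenerate triangle one of three collinear points lies between the others and is eliminated;
   with two weights of sum 2, one is at least 1. *)
case: (eqVneq (area3 i j m) 0) => [ar0|arN0].
  have two p1 p2 (s1 s2' : R) : 0 <= s1 -> 0 <= s2' -> s1 + s2' = 2 ->
      (emb x.1).1 = s1 * (emb (P p1)).1 + s2' * (emb (P p2)).1 ->
      (emb x.1).2 = s1 * (emb (P p1)).2 + s2' * (emb (P p2)).2 ->
      exists i', inC (x - PP i').
    move=> h1 h2 h3 h4 h5; clear e1 e2 s s2 a1 b1 c1 a0 b0 c0 an IH.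
    case: (leP 1 s1) => hs.
      exists p1; apply: (comb3_peel (i := p1) (j := p2) (m := p2) hs h2 (lexx 0)); rewrite ?x2; lra.
    have hs' : 1 <= s2' by lra.
    exists p2; apply: (comb3_peel (i := p2) (j := p1) (m := p1) hs' h1 (lexx 0)); rewrite ?x2; lra.
  pose f1 i' := (emb (P i')).1; pose f2 i' := (emb (P i')).2.
  have arR : (f1 j - f1 i) * (f2 m - f2 i) - (f2 j - f2 i) * (f1 m - f1 i) = 0.
    have /(congr1 (fun z : int => z%:~R : R)) := ar0.
    by rewrite /area3 /f1 /f2 /= intrB !intrM !intrB.
  case: (eqVneq (P m) (P i)) => [emi|nmi].
    by apply: (two i j (a + c) b); rewrite ?e1 ?e2 ?emi; lra.
  pose q := (f1 m - f1 i) ^+ 2 + (f2 m - f2 i) ^+ 2.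
  have q0 : 0 < q.
    apply: (@normsq_gt0 R (f1 m - f1 i, f2 m - f2 i)); apply: contra nmi.
    rewrite xpair_eqE /f1 /f2 /= !subr_eq0 !eqr_int.
    by case: (P m) (P i) => p1 p2 [p3 p4].
  pose t := ((f1 j - f1 i) * (f1 m - f1 i) + (f2 j - f2 i) * (f2 m - f2 i)) / q.
  have tq : t * q = (f1 j - f1 i) * (f1 m - f1 i) + (f2 j - f2 i) * (f2 m - f2 i).
    by rewrite divfK ?gt_eqF.
  have t1 : f1 j - f1 i = t * (f1 m - f1 i).
    apply: (mulIf (lt0r_neq0 q0)); rewrite mulrAC tq /q.
    have := congr1 ( *%R (f2 m - f2 i)) arR; rewrite mulr0; lra.
  have t2 : f2 j - f2 i = t * (f2 m - f2 i).
    apply: (mulIf (lt0r_neq0 q0)); rewrite mulrAC tq /q.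
    have := congr1 ( *%R (f1 m - f1 i)) arR; rewrite mulr0; lra.
  have ej1 : f1 j = (1 - t) * f1 i + t * f1 m by lra.
  have ej2 : f2 j = (1 - t) * f2 i + t * f2 m by lra.
  rewrite -/(f1 i) -/(f1 j) -/(f1 m) in e1; rewrite -/(f2 i) -/(f2 j) -/(f2 m) in e2.
  case: (ltP t 0) => tn.
    have u0 : 0 < 1 - t by lra.
    pose u := (1 - t)^-1.
    have uu : u * (1 - t) = 1 by rewrite mulVf ?gt_eqF.
    have up : 0 < u by rewrite invr_gt0.
    have ei1 : f1 i = u * f1 j - u * t * f1 m.
      by transitivity (u * (1 - t) * f1 i); [rewrite uu mul1r|rewrite ej1; ring].
    have ei2 : f2 i = u * f2 j - u * t * f2 m.
      by transitivity (u * (1 - t) * f2 i); [rewrite uu mul1r|rewrite ej2; ring].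
    have ut : u * t <= 0 by rewrite pmulr_rle0 // ltW.
    apply: (two j m (b + a * u) (c - a * (u * t))).
    - by rewrite addr_ge0 // mulr_ge0 // ltW.
    - by rewrite addr_ge0 // -mulrN mulr_ge0 // oppr_ge0.
    - have : a * (u * (1 - t)) = a by rewrite uu mulr1.
      lra.
    - by rewrite e1 {1}ei1 -/(f1 j) -/(f1 m); ring.
    - by rewrite e2 {1}ei2 -/(f2 j) -/(f2 m); ring.
  case: (leP t 1) => t1'.
    apply: (two i m (a + b * (1 - t)) (c + b * t)).
    - by rewrite addr_ge0 // mulr_ge0 // subr_ge0.
    - by rewrite addr_ge0 // mulr_ge0.
    - lra.
    - by rewrite e1 ej1 -/(f1 i) -/(f1 m); ring.
    - by rewrite e2 ej2 -/(f2 i) -/(f2 m); ring.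
  have tp : 0 < t by lra.
  pose u := t^-1.
  have uu : u * t = 1 by rewrite mulVf ?gt_eqF.
  have up : 0 < u by rewrite invr_gt0.
  have u1 : u <= 1 by rewrite invf_le1 // ltW.
  have em1 : f1 m = (1 - u) * f1 i + u * f1 j.
    rewrite ej1; transitivity (f1 i - (u * t) * f1 i + (u * t) * f1 m); last by ring.
    by rewrite uu; ring.
  have em2 : f2 m = (1 - u) * f2 i + u * f2 j.
    rewrite ej2; transitivity (f2 i - (u * t) * f2 i + (u * t) * f2 m); last by ring.
    by rewrite uu; ring.
  apply: (two i j (a + c * (1 - u)) (b + c * u)).
  - by rewrite addr_ge0 // mulr_ge0 // subr_ge0.
  - by rewrite addr_ge0 // mulr_ge0 // ltW.
  - lra.
  - by rewrite e1 em1 -/(f1 i) -/(f1 j); ring.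
  - by rewrite e2 em2 -/(f2 i) -/(f2 j); ring.
(* All weights are below 1 and add up to 2, so the complementary weights 1 - a, 1 - b, 1 - c are
   those of a point of the triangle, which is a lattice point. *)
pose Z := P i + P j + P m - x.1.
have ZC : inC (Z, 1).
  apply: (@ev_comb3_inC _ (1 - a) (1 - b) (1 - c) i j m); rewrite ?subr_ge0 ?(ltW a1) ?(ltW b1) ?(ltW c1) //.
  - by rewrite /=; lra.
  - by move: e1; rewrite /= !intrB !intrD; lra.
  - by move: e2; rewrite /= !intrB !intrD; lra.
have [z zZ] := closedP ZC.
have zE1 : (emb (P z)).1 = (1 - a) * (emb (P i)).1 + (1 - b) * (emb (P j)).1 + (1 - c) * (emb (P m)).1.
  by move: e1; rewrite zZ /= !intrB !intrD; lra.
have zE2 : (emb (P z)).2 = (1 - a) * (emb (P i)).2 + (1 - b) * (emb (P j)).2 + (1 - c) * (emb (P m)).2.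
  by move: e2; rewrite zZ /= !intrB !intrD; lra.
(* Peeling through the vertex with the smallest weight. *)
have step p1 p2 p3 (q1 q2 q3 : R) : area3 p1 p2 p3 = area3 i j m ->
    0 < q1 -> q1 <= q2 -> q1 <= q3 -> q1 < 1 -> q1 + q2 + q3 = 2 ->
    (emb (P z)).1 = (1 - q1) * (emb (P p1)).1 + (1 - q2) * (emb (P p2)).1 + (1 - q3) * (emb (P p3)).1 ->
    (emb (P z)).2 = (1 - q1) * (emb (P p1)).2 + (1 - q2) * (emb (P p2)).2 + (1 - q3) * (emb (P p3)).2 ->
    (emb x.1).1 = q1 * (emb (P p1)).1 + q2 * (emb (P p2)).1 + q3 * (emb (P p3)).1 ->
    (emb x.1).2 = q1 * (emb (P p1)).2 + q2 * (emb (P p2)).2 + q3 * (emb (P p3)).2 ->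
    exists i', inC (x - PP i').
  move=> ear q10 q12 q13 q11 qs z1 z2 x1' x2'.
  pose u := (1 - q1)^-1.
  have u0 : 0 < 1 - q1 by lra.
  have uu : u * (1 - q1) = 1 by rewrite mulVf ?gt_eqF.
  have up : 0 < u by rewrite invr_gt0.
  have uq : u * (q1 * (1 - q1)) = q1 by rewrite mulrCA uu mulr1.
  have g (s0 s1 s2' s3 xx : R) : s0 = (1 - q1) * s1 + (1 - q2) * s2' + (1 - q3) * s3 ->
      xx = q1 * s1 + q2 * s2' + q3 * s3 ->
      xx = (u * q1) * s0 + (u * (q2 - q1)) * s2' + (u * (q3 - q1)) * s3.
    move=> -> ->; apply: (mulfI (lt0r_neq0 u0)).
    transitivity ((u * (1 - q1)) * (q1 * ((1 - q1) * s1 + (1 - q2) * s2' + (1 - q3) * s3) + (q2 - q1) * s2' + (q3 - q1) * s3)).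
      by rewrite uu; ring.
    by ring.
  apply: (IH x (u * q1) (u * (q2 - q1)) (u * (q3 - q1)) z p2 p3) => //.
  (* Replacing p1 by z multiplies the area by 1 - q1 < 1. *)
  - have lt1 : (`|area3 z p2 p3| < `|area3 p1 p2 p3|).
      rewrite -(ltr_int R) !intr_norm.
      have -> : (area3 z p2 p3)%:~R = (1 - q1) * (area3 p1 p2 p3)%:~R :> R.
        rewrite /area3 !intrB !intrM !intrB.
        move: z1 z2; rewrite /= => -> ->.
        have -> : q3 = 2 - q1 - q2 by lra.
        by ring.
      rewrite normrM gtr0_norm // gtr_pMl ?normr_gt0 ?intr_eq0 ?ear //; lra.
    have lt1N : (`|area3 z p2 p3| < `|area3 p1 p2 p3|)%N by rewrite -ltz_nat !abszE.
    by rewrite -ltnS; apply: leq_trans an; rewrite ltnS -ear.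
  - by rewrite mulr_ge0 // ltW.
  - by rewrite mulr_ge0 ?subr_ge0 // ltW.
  - by rewrite mulr_ge0 ?subr_ge0 // ltW.
  - rewrite x2; have : u * (1 - q1) * 2 = 2 by rewrite uu mul1r.
    have -> : q3 = 2 - q1 - q2 by lra.
    lra.
  - exact: g z1 x1'.
  - exact: g z2 x2'.
have [a0' b0' c0'] : [/\ 0 < a, 0 < b & 0 < c].
  by clear -a1 b1 c1 s2; split; lra.
have stepj : b <= a -> b <= c -> exists i', inC (x - PP i').
  move=> ba bc; apply: (step j m i b c a) => //.
  - exact: area3_perm1.
  - by rewrite -s2; ring.
  - by rewrite zE1; ring.
  - by rewrite zE2; ring.
  - by rewrite e1; ring.
  - by rewrite e2; ring.
have stepm : c <= a -> c <= b -> exists i', inC (x - PP i').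
  move=> ca cb; apply: (step m i j c a b) => //.
  - exact: esym (area3_perm1 m i j).
  - by rewrite -s2; ring.
  - by rewrite zE1; ring.
  - by rewrite zE2; ring.
  - by rewrite e1; ring.
  - by rewrite e2; ring.
case/orP: (le_total a b) => ab; case/orP: (le_total a c) => ac.
- exact: (step i j m a b c).
- by apply: stepm => //; exact: le_trans ab.
- by apply: stepj => //; exact: le_trans ac.
- by case/orP: (le_total b c) => bc; [exact: stepj|exact: stepm].
Qed.

Lemma int_ge3 (d : int) : 0 < d -> d != 1 -> d != 2 -> 3 <= d.
Proof. lia. Qed.

(** Height 1 is [closedP], and from height 3 on one of three weights is at least 1 and can be peeled
    off. Only height 2 needs the descent of [normal2]. *)
Lemma normal x : 0 < x.2 -> inC x -> exists i, inC (x - PP i).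
Proof.
move=> x0 hx; have [i [j [m [a [b [c [[a0 b0 c0] s e1 e2]]]]]]] := cone3 x0 hx.
case: (eqVneq x.2 1) => [x1|n1].
  have [i' hi'] : exists i', P i' = x.1.
    by apply: closedP; rewrite -x1 -surjective_pairing.
  exists i'; have -> : x - PP i' = 0 by rewrite [x]surjective_pairing /PP x1 -hi' subrr.
  exact: inC0.
case: (eqVneq x.2 2) => [x2|n2].
  exact: (normal2 (ltnSn _) x2 a0 b0 c0 s e1 e2).
case: (leP 1 a) => a1; first by exists i; exact: comb3_peel s e1 e2.
case: (leP 1 b) => b1.
  by exists j; apply: (comb3_peel (i := j) (j := m) (m := i) b1 c0 a0); lra.
have c1 : 1 <= c.
  have : 3%:~R <= x.2%:~R :> R by rewrite ler_int int_ge3.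
  by move=> h3; move: s a1 b1 h3; clear; lra.
by exists m; apply: (comb3_peel (i := m) (j := i) (m := j) c1 a0 b0); clear -s e1 e2; lra.
Qed.

End Config.

End PolygonCone.

(** * Directions in cyclic order and the cones between them *)

Module NormalFan.
Import PlaneGordan PolygonCone.

Section Fan.
Variable R : realFieldType.
Implicit Types (l u v w : R * R).

(** A half-open half-plane, containing one of u and -u for every nonzero u; on it the sign of [det2]
    orders directions by angle. *)
Definition upper u : bool := (0 < u.2) || (u.2 == 0) && (0 < u.1).

Lemma upperP u : u != 0 -> upper u || upper (- u).
Proof.
case: u => x y; rewrite /upper /= oppr_gt0 oppr_eq0.
case: (ltrgtP y 0) => //= [->]; rewrite oppr_gt0 xpair_eqE eqxx andbT.
by case: (ltrgtP x 0).
Qed.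

(** In the relation w.2 det(u,v) + u.2 det(v,w) = v.2 det(u,w) the weights are nonnegative on the
    upper half-plane. *)
Lemma upper_trans u v w : upper u -> upper v -> upper w ->
  0 < det2 u v -> 0 < det2 v w -> 0 < det2 u w.
Proof.
move=> hu hv hw uv vw.
have e : w.2 * det2 u v + u.2 * det2 v w = v.2 * det2 u w by rewrite /det2; ring.
have ge2 (x : R * R) : upper x -> 0 <= x.2.
  by rewrite /upper => /orP[/ltW //|/andP[/eqP ->]].
have hu2 := ge2 _ hu; have hw2 := ge2 _ hw.
have v2 : 0 < v.2.
  case/orP: hv => // /andP[/eqP v20 v1].
  move: uv; rewrite /det2 v20 mulr0 sub0r oppr_gt0 => h.
  by have := mulr_ge0 hu2 (ltW v1); rewrite leNgt h.
have {hw2} w2 : 0 < w.2.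
  rewrite lt_neqAle hw2 andbT eq_sym; apply: contraTneq vw => w20.
  rewrite /det2 w20 mulr0 sub0r oppr_gt0 -leNgt mulr_ge0 // ?(ltW v2) //.
  by move: hw; rewrite /upper w20 ltxx eqxx => /ltW.
rewrite -(pmulr_rgt0 _ v2) -e ltr_wpDr // ?mulr_gt0 // mulr_ge0 //.
exact: ltW.
Qed.

Definition before u v : bool := 0 < det2 u v.

(** Insertion sort by angle of the lines spanned by E, each represented by one upper vector. *)
Lemma fan_exists (E : seq (R * R)) : exists b : seq (R * R),
  [/\ all upper b, pairwise before b &
      forall e, e \in E -> e != 0 -> exists2 u, u \in b & det2 e u = 0].
Proof.
elim: E => [|e E [b [ub pb cb]]]; first by exists [::].
have ext e' : upper e' -> det2 e e' = 0 ->
    exists b : seq (R * R), [/\ all upper b, pairwise before b &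
      forall e0, e0 \in e :: E -> e0 != 0 -> exists2 u, u \in b & det2 e0 u = 0].
  move=> ue' ee'.
  case: (boolP (has (fun u => det2 e' u == 0) b)) => [/hasP[u uB /eqP du]|/hasPn nb].
    exists b; split=> // e0; rewrite inE => /orP[/eqP -> e_n0|]; last exact: cb.
    exists u => //.
    have e'0 : e' != 0 by apply: contraTneq ue' => ->; rewrite /upper /= !ltxx andbF.
    have k1 : e'.1 * det2 e u = u.1 * det2 e e' - e.1 * det2 u e' .
      by rewrite /det2; ring.
    have k2 : e'.2 * det2 e u = u.2 * det2 e e' - e.2 * det2 u e'.
      by rewrite /det2; ring.
    have du' : det2 u e' = 0.
      have -> : det2 u e' = - det2 e' u by rewrite /det2; ring.
      by rewrite du oppr0.
    rewrite ee' du' !mulr0 subrr in k1 k2.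
    move/eqP: k1; move/eqP: k2; rewrite !mulf_eq0.
    case: (eqVneq (det2 e u) 0) => // _; rewrite !orbF => /eqP h2 /eqP h1.
    by case/eqP: e'0; rewrite [e']surjective_pairing h1 h2.
  exists ([seq u <- b | before u e'] ++ e' :: [seq u <- b | before e' u]); split.
  - rewrite all_cat /= ue' !all_filter; apply/andP; split.
      by apply/allP => u /(allP ub) uu; apply/implyP.
    by apply/allP => u /(allP ub) uu; apply/implyP.
  - rewrite pairwise_cat /= !(subseq_pairwise (filter_subseq _ _)) // andbT.
    apply/andP; split.
      apply/allrelP => u v; rewrite mem_filter => /andP[ue uB].
      rewrite inE => /orP[/eqP -> //|]; rewrite mem_filter => /andP[ev vB].
      by apply: (upper_trans _ ue' _ ue ev); apply: (allP ub).
    by apply/allP => u; rewrite mem_filter => /andP[].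
  move=> e0; rewrite inE => /orP[/eqP -> _|e0E en0].
    by exists e'; rewrite // mem_cat mem_head orbT.
  have [u uB du] := cb _ e0E en0; exists u => //.
  rewrite mem_cat inE !mem_filter uB !andbT /before.
  have := nb _ uB; rewrite neq_lt => /orP[h|->]; last by rewrite !orbT.
  have -> : det2 u e' = - det2 e' u by rewrite /det2; ring.
  by rewrite oppr_gt0 h.
case: (eqVneq e 0) => [->|e0].
  exists b; split=> // e' ; rewrite inE => /orP[/eqP -> |]; last exact: cb.
  by rewrite eqxx.
case/orP: (upperP e0) => he; first by apply: (ext e) => //; rewrite /det2; ring.
by apply: (ext (- e)) => //; rewrite /det2 /=; ring.
Qed.

Section Dirs.
Variable b : nat -> R * R.
Variable m : nat.
Hypothesis m2 : (2 <= m)%N.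
Hypothesis bdet : forall i j, (i < j < m)%N -> 0 < det2 (b i) (b j).

(* The directions b_0, ..., b_(m-1) followed by their opposites, in cyclic order. *)
Definition dirs (i : nat) : R * R := if (i < m)%N then b i else - b (i - m)%N.

Lemma det2NN u v : det2 (- u) (- v) = det2 u v.
Proof. by rewrite /det2 /=; ring. Qed.
Lemma det2Nr u v : det2 u (- v) = - det2 u v.
Proof. by rewrite /det2 /=; ring. Qed.
Lemma det2Nl u v : det2 (- u) v = - det2 u v.
Proof. by rewrite /det2 /=; ring. Qed.
Lemma det2C u v : det2 u v = - det2 v u.
Proof. by rewrite /det2 /=; ring. Qed.

Lemma dirs_det i j : (i < j < m + m)%N ->
  [/\ (j - i < m)%N -> 0 < det2 (dirs i) (dirs j),
      (m < j - i)%N -> det2 (dirs i) (dirs j) < 0 &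
      j = (i + m)%N -> dirs j = - dirs i].
Proof.
move=> ij; rewrite /dirs; split=> h.
- case: (ltnP i m) => im; case: (ltnP j m) => jm; try lia.
  + by apply: bdet; lia.
  + by rewrite det2Nr -det2C; apply: bdet; lia.
  + by rewrite det2NN; apply: bdet; lia.
- have -> : (i < m)%N by lia.
  have -> : (j < m)%N = false by lia.
  by rewrite det2Nr oppr_lt0; apply: bdet; lia.
have -> : (i < m)%N by lia.
have -> : (j < m)%N = false by lia.
by rewrite h addnK.
Qed.

Lemma cone2 u v w : 0 < det2 u v ->
  w = (det2 w v / det2 u v * u.1 + det2 u w / det2 u v * v.1,
       det2 w v / det2 u v * u.2 + det2 u w / det2 u v * v.2).
Proof.
move=> uv; have n0 : det2 u v != 0 by rewrite gt_eqF.
by rewrite [LHS]surjective_pairing; congr pair; move: n0; rewrite /det2 => n0; field.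
Qed.

Definition cone_mem u v w : Prop :=
  exists a c, [/\ 0 <= a, 0 <= c & w = (a * u.1 + c * v.1, a * u.2 + c * v.2)].

Lemma cone_memP u v w : 0 < det2 u v -> 0 <= det2 u w -> 0 <= det2 w v -> cone_mem u v w.
Proof.
move=> uv uw wv; exists (det2 w v / det2 u v), (det2 u w / det2 u v).
by split; [rewrite divr_ge0 // ltW|rewrite divr_ge0 // ltW|exact: cone2].
Qed.

Definition nxt (i : nat) : nat := if i.+1 == (m + m)%N then 0%N else i.+1.

Lemma nxt_lt i : (i < m + m)%N -> (nxt i < m + m)%N.
Proof. by rewrite /nxt; case: eqP; lia. Qed.

Lemma dirs_nxt i : (i < m + m)%N -> 0 < det2 (dirs i) (dirs (nxt i)).
Proof.
move=> im; rewrite /nxt; case: eqP => e.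
  have ij : (0 < i < m + m)%N by lia.
  by have [_ h _] := dirs_det ij; rewrite det2C oppr_gt0; apply: h; lia.
have ij : (i < i.+1 < m + m)%N by lia.
by have [h _ _] := dirs_det ij; apply: h; lia.
Qed.

(** The cone is the one that ends at the first b_i having l strictly on its right, or the last one,
    which ends at -b_0. *)
Lemma dirs_coverP l : 0 <= det2 (b 0) l ->
  exists2 i, (i < m)%N & cone_mem (dirs i) (dirs (nxt i)) l.
Proof.
move=> h0; case: (boolP [exists i : 'I_m, det2 (b i) l < 0]) => [|/existsPn all_ge].
  move=> /existsP[i0 hi0].
  have ex : exists i, (i < m)%N && (det2 (b i) l < 0) by exists i0; rewrite ltn_ord.
  case: (ex_minnP ex) => -[|i] /andP[im hi] mini; first by move: hi; rewrite ltNge h0.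
  have hi' : 0 <= det2 (b i) l.
    rewrite leNgt; apply/negP => h; have := mini i; rewrite h andbT (ltnW im).
    by rewrite ltnn => /(_ isT).
  exists i; first exact: ltnW.
  have e1 : dirs i = b i by rewrite /dirs ifT //; lia.
  have e2 : dirs (nxt i) = b i.+1 by rewrite /nxt ifF /dirs ?ifT //; lia.
  rewrite e1 e2; apply: cone_memP => //; first by apply: bdet; lia.
  by rewrite det2C oppr_ge0 ltW.
exists m.-1; first lia.
have e1 : dirs m.-1 = b m.-1 by rewrite /dirs ifT //; lia.
have e2 : dirs (nxt m.-1) = - b 0%N.
  by rewrite /nxt ifF /dirs ?ifF ?prednK ?subnn //; lia.
rewrite e1 e2; apply: cone_memP.
- by rewrite det2Nr -det2C; apply: bdet; lia.
- have lt : (m.-1 < m)%N by lia.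
  by have := all_ge (Ordinal lt); rewrite -leNgt.
- by rewrite det2Nr -det2C.
Qed.

Lemma dirsN i : (i < m)%N ->
  dirs (i + m) = - dirs i /\ dirs (nxt (i + m)) = - dirs (nxt i).
Proof.
move=> im; split; first by rewrite /dirs im ifF ?addnK //; lia.
rewrite /nxt; have -> : (i.+1 == (m + m)%N) = false by lia.
case: (eqVneq i.+1 m) => e.
  have -> : (i + m).+1 == (m + m)%N by rewrite -e; lia.
  by rewrite /dirs e ltnn subnn opprK ifT //; lia.
have -> : ((i + m).+1 == (m + m)%N) = false by lia.
have -> : (i + m).+1 = (i.+1 + m)%N by lia.
by rewrite /dirs ifF ?addnK ?ifT //; lia.
Qed.

Lemma dirs_cover l : exists2 i, (i < m + m)%N & cone_mem (dirs i) (dirs (nxt i)) l.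
Proof.
case: (leP 0 (det2 (b 0) l)) => h0.
  by have [i im hi] := dirs_coverP h0; exists i => //; lia.
have h0' : 0 <= det2 (b 0) (- l) by rewrite det2Nr oppr_ge0 ltW.
have [i im [a [c [a0 c0 e]]]] := dirs_coverP h0'.
exists (i + m)%N; first lia.
have [-> ->] := dirsN im; exists a, c; split=> //.
have /= e1 := congr1 fst e; have /= e2 := congr1 snd e.
by rewrite [LHS]surjective_pairing /=; congr pair; clear -e1 e2; lra.
Qed.

(* The lines orthogonal to the b_j do not separate consecutive directions. *)
Lemma dirs_same_side i j : (i < m + m)%N -> (j < m)%N ->
  0 <= det2 (dirs i) (b j) * det2 (dirs (nxt i)) (b j).
Proof.
have lo i' : (i' < m)%N -> (j < m)%N -> 0 <= det2 (dirs i') (b j) * det2 (dirs (nxt i')) (b j).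
  move=> im jm.
  have bd x y : (x <= y < m)%N -> 0 <= det2 (b x) (b y).
    move=> xy; case: (eqVneq x y) => [->|ne]; first by rewrite /det2 [_ * _]mulrC subrr.
    by apply/ltW/bdet; lia.
  have bd' x y : (y <= x < m)%N -> det2 (b x) (b y) <= 0.
    by move=> xy; rewrite det2C oppr_le0 bd.
  have -> : dirs i' = b i' by rewrite /dirs im.
  case: (eqVneq i'.+1 m) => e.
    have -> : dirs (nxt i') = - b 0%N by rewrite /nxt ifF ?e /dirs ?ltnn ?subnn //; lia.
    by rewrite det2Nl mulrN -mulNr mulr_ge0 // ?oppr_ge0 ?bd' ?bd //; lia.
  have -> : dirs (nxt i') = b i'.+1 by rewrite /nxt ifF /dirs ?ifT //; lia.
  case: (ltnP i' j) => ij; first by rewrite mulr_ge0 // bd //; lia.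
  by rewrite -mulrNN mulr_ge0 // oppr_ge0 bd' //; lia.
move=> im jm; case: (ltnP i m) => h; first exact: lo.
have im' : (i - m < m)%N by lia.
have := dirsN im'; rewrite subnK // => -[-> ->].
by rewrite !det2Nl mulrNN lo.
Qed.

End Dirs.
End Fan.

End NormalFan.

(** * Linearity of the support function on fan cones, and arcs of signs *)

Module SupportArcs.
Import KoszulContraction PlaneGordan PolygonCone NormalFan.

Section Cone.
Variables (R : realFieldType) (N : nat) (P : 'I_N -> int * int) (i0 : 'I_N).
Implicit Types (l u v : R * R) (x y : int * int * int).
Local Notation emb := (@emb R).
Local Notation ev := (@ev R N P i0).
Local Notation inC := (@inC R N P i0).
Local Notation intC := (@intC R N P i0).
Local Notation PP := (@PP N P).
Local Notation hmin := (@hmin R N P i0).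

Hypothesis noncoll : forall l, l != 0 -> exists i j, dot l (emb (P i)) < dot l (emb (P j)).

(** One line orthogonal to each difference of points of P. The two coordinate directions are added
    so that there are at least two lines. *)
Lemma fan_data : exists (b : nat -> R * R) (m : nat),
  [/\ (2 <= m)%N, forall i j, (i < j < m)%N -> 0 < det2 (b i) (b j) &
      forall i j, exists2 l, (l < m)%N & dot (b l) (emb (P i) - emb (P j)) = 0].
Proof.
pose pr (e : R * R) : R * R := (- e.2, e.1).
pose E := [:: (1, 0); (0, 1)] ++ [seq pr (emb (P p.1) - emb (P p.2)) | p : 'I_N * 'I_N].
have [b [ub pb cb]] := fan_exists E.
exists (nth 0 b), (size b); split.
- have [u uB du] : exists2 u, u \in b & det2 (1, 0) u = 0.
    apply: cb; rewrite ?inE ?eqxx // xpair_eqE oner_eq0 //.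
  have [u' u'B du'] : exists2 u, u \in b & det2 (0, 1) u = 0.
    apply: cb; rewrite ?inE ?eqxx ?orbT // xpair_eqE oner_eq0 andbF //.
  rewrite ltnNge; apply/negP => s1.
  have uu : u = u'.
    by case: (b) uB u'B s1 => [|x [|]] //; rewrite !inE => /eqP -> /eqP ->.
  have := allP ub _ uB; rewrite /upper.
  move: du du'; rewrite -uu /det2 /= !mul1r !mul0r subr0 sub0r => -> /eqP.
  by rewrite oppr_eq0 => /eqP ->; rewrite ltxx eqxx.
- move=> i j /andP[ij jb]; apply: (pairwiseP 0 pb) => //; rewrite inE //.
  exact: ltn_trans jb.
move=> i j; case: (eqVneq (pr (emb (P i) - emb (P j))) 0) => [e0|ne].
  exists 0%N.
    rewrite lt0n size_eq0; apply/negP => /eqP b0.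
    have n10 : (1, 0) != 0 :> R * R by rewrite xpair_eqE oner_eq0.
    by have [u] := cb (1, 0) (mem_head _ _) n10; rewrite b0.
  have [h1 h2] := (congr1 fst e0, congr1 snd e0).
  move: h1 h2; rewrite /pr /dot /= => /eqP; rewrite oppr_eq0 => /eqP -> ->.
  by rewrite !mulr0 addr0.
have eE : pr (emb (P i) - emb (P j)) \in E.
  rewrite mem_cat; apply/orP; right; apply/mapP; exists (i, j) => //.
  by rewrite mem_enum.
have [u uB du] := cb _ eE ne.
exists (index u b); first by rewrite index_mem.
rewrite nth_index //; move: du; rewrite /pr /det2 /dot /= => e.
by rewrite -[RHS]oppr0 -e; ring.
Qed.

Lemma width l : l != 0 -> hmin l + hmin (- l) < 0.
Proof.
move=> l0; have [i [j ij]] := noncoll l0.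
have h1 := hmin_le P i0 l i; have h2 := hmin_le P i0 (- l) j.
by rewrite dotNl in h2; lra.
Qed.

Lemma intC_pos x : intC x -> 0 < x.2.
Proof.
move=> hx; pose l : R * R := (1, 0).
have l0 : l != 0 by rewrite xpair_eqE oner_eq0.
have h1 := hx l l0; have h2 : 0 < ev (- l) x by apply: hx; rewrite oppr_eq0.
have := width l0; rewrite -(ltr0z R); move: h1 h2; rewrite /PolygonCone.ev dotNl => h1 h2 w.
have h : 0 < x.2%:~R * - (hmin l + hmin (- l)) by lra.
by move: h; rewrite pmulr_lgt0 // oppr_gt0.
Qed.

Section Fixed.
Variables (b : nat -> R * R) (m : nat).
Hypothesis m2 : (2 <= m)%N.
Hypothesis bdet : forall i j, (i < j < m)%N -> 0 < det2 (b i) (b j).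
Hypothesis borth : forall i j, exists2 l, (l < m)%N & dot (b l) (emb (P i) - emb (P j)) = 0.
Local Notation w := (dirs b m).
Local Notation nxt := (nxt m).
Local Notation r := (m + m)%N.

Lemma dirs_neq0 i : (i < r)%N -> w i != 0.
Proof.
move=> ir; apply/eqP => e; have := dirs_nxt m2 bdet ir.
by rewrite e /det2 /= !mul0r subr0 ltxx.
Qed.

(** A point v minimizing the sum of two consecutive directions minimizes both: no difference P q - P
    v is positive on one and negative on the other, because its normal line is one of the b_l and
    these do not separate consecutive directions. *)
Lemma dirs_vertex i : (i < r)%N ->
  exists v : 'I_N, ev (w i) (PP v) = 0 /\ ev (w (nxt i)) (PP v) = 0.
Proof.
move=> ir; have [v hv] := hminP P i0 (w i + w (nxt i)); exists v.
have sides q : 0 <= dot (w i) (emb (P q) - emb (P v)) * dot (w (nxt i)) (emb (P q) - emb (P v)).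
  have [l lm] := borth q v; set e := _ - _ => be.
  (* Lagrange's identity; for e orthogonal to b_l it turns signs of scalar products into signs of
     determinants with b_l. *)
  have lag u : dot u e * dot (b l) (b l) = det2 (b l) u * det2 (b l) e.
    transitivity (dot u (b l) * dot (b l) e + det2 (b l) u * det2 (b l) e).
      by rewrite /dot /det2; ring.
    by rewrite be mulr0 add0r.
  have bl0 : 0 < dot (b l) (b l).
    have lr : (l < r)%N by lia.
    have : b l != 0 by have := dirs_neq0 lr; rewrite /dirs lm.
    by move/normsq_gt0; rewrite /dot !expr2.
  rewrite -(pmulr_rge0 _ (mulr_gt0 bl0 bl0)).
  have -> : dot (b l) (b l) * dot (b l) (b l) * (dot (w i) e * dot (w (nxt i)) e) =
      (det2 (w i) (b l) * det2 (w (nxt i)) (b l)) * (det2 (b l) e) ^+ 2.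
    transitivity ((dot (w i) e * dot (b l) (b l)) * (dot (w (nxt i)) e * dot (b l) (b l))).
      by ring.
    by rewrite !lag /det2; ring.
  by rewrite mulr_ge0 ?sqr_ge0 // dirs_same_side.
have sum q : 0 <= dot (w i) (emb (P q) - emb (P v)) + dot (w (nxt i)) (emb (P q) - emb (P v)).
  by have := hmin_le P i0 (w i + w (nxt i)) q; rewrite hv !dotDl !dotDr !dotNr; lra.
have fin u : (forall q, 0 <= dot u (emb (P q) - emb (P v))) -> ev u (PP v) = 0.
  move=> h; have [q hq] := hminP P i0 u; rewrite /PolygonCone.ev /= mul1r.
  have := hmin_le P i0 u v; have := h q; rewrite hq dotDr dotNr; lra.
have key (s t : R) : 0 <= s * t -> 0 <= s + t -> 0 <= s /\ 0 <= t.
  move=> st s_t; case: (ltP s 0) => s0; case: (ltP t 0) => t0 //; try lra.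
    have : 0 < t by lra.
    by move=> tp; have := nmulr_rlt0 t s0; rewrite tp ltNge st.
  have : 0 < s by lra.
  by move=> sp; have := pmulr_rlt0 t sp; rewrite t0 ltNge st.
by split; apply: fin => q; have [] := key _ _ (sides q) (sum q).
Qed.

(** On a cone of the fan the support function is the value at the common minimizing vertex, hence
    linear. *)
Lemma ev_cone i (a c : R) x : (i < r)%N -> 0 <= a -> 0 <= c ->
  ev (a * (w i).1 + c * (w (nxt i)).1, a * (w i).2 + c * (w (nxt i)).2) x =
  a * ev (w i) x + c * ev (w (nxt i)) x.
Proof.
move=> ir a0 c0; have [v [v1 v2]] := dirs_vertex ir.
set l := (_, _).
have dl z : dot l z = a * dot (w i) z + c * dot (w (nxt i)) z by rewrite /dot /l /=; ring.
have hl : hmin l = a * hmin (w i) + c * hmin (w (nxt i)).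
  apply/eqP; rewrite eq_le; apply/andP; split.
    have := hmin_le P i0 l v; rewrite dl.
    by move: v1 v2; rewrite /PolygonCone.ev /= !mul1r => /eqP + /eqP; rewrite !subr_eq0 => /eqP -> /eqP ->.
  have [q ->] := hminP P i0 l; rewrite dl.
  by rewrite lerD // ler_wpM2l // hmin_le.
by rewrite /PolygonCone.ev hl dl; ring.
Qed.

Lemma inC_dirs x : (forall i, (i < r)%N -> 0 <= ev (w i) x) -> inC x.
Proof.
move=> h l; have [i ir [a [c [a0 c0 ->]]]] := dirs_cover m2 bdet l.
by rewrite ev_cone // addr_ge0 // mulr_ge0 // h // nxt_lt.
Qed.

Lemma intC_dirs x : (forall i, (i < r)%N -> 0 < ev (w i) x) -> intC x.
Proof.
move=> h l; have [i ir [a [c [a0 c0 e]]]] := dirs_cover m2 bdet l.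
rewrite e => l0; rewrite ev_cone //.
have h1 := h _ ir; have h2 := h _ (nxt_lt m2 ir).
have [ap|an] := ltP 0 a; first by rewrite ltr_pwDl ?mulr_gt0 // mulr_ge0 // ltW.
have [cp|cn] := ltP 0 c; first by rewrite ltr_wpDl ?mulr_gt0 // mulr_ge0 // ltW.
have a00 : a = 0 by apply/eqP; rewrite eq_le an a0.
have c00 : c = 0 by apply/eqP; rewrite eq_le cn c0.
by case/eqP: l0; rewrite a00 c00 !mul0r addr0.
Qed.

Lemma cone_in u v (y : R * R) : 0 < det2 u v -> 0 < det2 u y -> 0 < det2 y v ->
  exists a c, [/\ 0 < a, 0 < c & y = (a * u.1, a * u.2) + (c * v.1, c * v.2)].
Proof.
move=> uv uy yv; exists (det2 y v / det2 u v), (det2 u y / det2 u v).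
by split; rewrite ?divr_gt0 //; exact: cone2.
Qed.

(* The functional l |-> ev l x is convex for x.2 >= 0 and concave for x.2 < 0,
   so its negative set is an arc of the circle of directions. *)
Lemma neg_arc x g i : (g < i < r)%N -> ev (w g) x < 0 -> ev (w i) x < 0 ->
  (forall j, (g < j < i)%N -> ev (w j) x < 0) \/
  (forall j, (j < r)%N -> (j < g)%N || (i < j)%N -> ev (w j) x < 0).
Proof.
move=> gi hg hi.
have dd p q : (p < q < r)%N -> [/\ (q - p < m)%N -> 0 < det2 (w p) (w q),
      (m < q - p)%N -> 0 < det2 (w q) (w p) & q = (p + m)%N -> w q = - w p].
  move=> pq; have [h1 h2 h3] := dirs_det m2 bdet pq; split=> // h.
  by rewrite det2C oppr_gt0 h2.
case: (leP 0 x.2) => x2.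
  have cvx p q j : 0 < det2 (w p) (w q) -> 0 < det2 (w p) (w j) -> 0 < det2 (w j) (w q) ->
      ev (w p) x < 0 -> ev (w q) x < 0 -> ev (w j) x < 0.
    move=> pq pj jq hp hq; have [a [c [a0 c0 ->]]] := cone_in pq pj jq.
    apply: le_lt_trans (ev_sub _ _ _ _ x2) _.
    rewrite !evZ ?ltW //.
    have := nmulr_llt0 a hp; have := nmulr_llt0 c hq; rewrite a0 c0 => h1 h2.
    by rewrite -oppr_gt0 opprD addr_gt0 // oppr_gt0.
  have [d1 d2 d3] := dd _ _ gi.
  case: (ltngtP (i - g) m) => c.
  - left=> j gj; apply: (cvx g i j) => //; first exact: d1.
      by have [h _ _] := dd g j ltac:(lia); apply: h; lia.
    by have [h _ _] := dd j i ltac:(lia); apply: h; lia.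
  - right=> j jr /orP[jg|ij]; apply: (cvx i g j) => //; try exact: d2.
    + by have [_ h _] := dd j i ltac:(lia); apply: h; lia.
    + by have [h _ _] := dd j g ltac:(lia); apply: h; lia.
    + by have [h _ _] := dd i j ltac:(lia); apply: h; lia.
    + by have [_ h _] := dd g j ltac:(lia); apply: h; lia.
  (* Opposite directions cannot both be negative, by subadditivity. *)
  have e : w i = - w g by apply: d3; lia.
  have := ev_sub P i0 (w g) (w i) x2; rewrite e subrr ev_l0 -e; lra.
(* For negative height the nonnegative indices form the convex arc: a nonnegative j between g and i
   together with a nonnegative l outside would force g or i to be nonnegative. *)
case: (boolP (has (fun j => (g < j < i)%N && (0 <= ev (w j) x)) (iota 0 r))); last first.
  move/hasPn => nh; left=> j gj; rewrite ltNge; apply/negP => hj.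
  have /nh : j \in iota 0 r by rewrite mem_iota; lia.
  by rewrite gj hj.
case/hasP => j _ /andP[gj hj].
right=> l lr lo; rewrite ltNge; apply/negP => hl.
have ccv p q s : 0 < det2 (w p) (w q) -> 0 < det2 (w p) (w s) -> 0 < det2 (w s) (w q) ->
    0 <= ev (w p) x -> 0 <= ev (w q) x -> 0 <= ev (w s) x.
  move=> pq ps sq hp hq; have [a [c [a0 c0 ->]]] := cone_in pq ps sq.
  apply: le_trans (ev_super _ _ _ _ (ltW x2)).
  by rewrite !evZ ?(ltW a0) ?(ltW c0) // addr_ge0 // mulr_ge0 // ltW.
have opp p q : w p = - w q -> 0 <= ev (w p) x -> 0 <= ev (w q) x -> (q < r)%N -> False.
  move=> -> hp hq qr; have wd := width (dirs_neq0 qr).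
  have e : ev (- w q) x + ev (w q) x = - x.2%:~R * (hmin (w q) + hmin (- w q)).
    by rewrite /PolygonCone.ev dotNl; ring.
  have x2' : 0 < - x.2%:~R :> R by rewrite oppr_gt0 ltrz0.
  have := addr_ge0 hp hq; rewrite e pmulr_rge0 // leNgt; by rewrite wd.
case/orP: lo => lo.
  have lj : (l < j < r)%N by lia.
  have [d1 d2 d3] := dd _ _ lj.
  case: (ltngtP (j - l) m) => c.
  - have : 0 <= ev (w g) x.
      apply: (ccv l j g) => //; first exact: d1.
        by have [h _ _] := dd l g ltac:(lia); apply: h; lia.
      by have [h _ _] := dd g j ltac:(lia); apply: h; lia.
    by rewrite leNgt hg.
  - have : 0 <= ev (w i) x.
      apply: (ccv j l i) => //; first exact: d2.
        by have [h _ _] := dd j i ltac:(lia); apply: h; lia.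
      by have [_ h _] := dd l i ltac:(lia); apply: h; lia.
    by rewrite leNgt hi.
  by apply: (opp j l) => //; apply: d3; lia.
have jl : (j < l < r)%N by lia.
have [d1 d2 d3] := dd _ _ jl.
case: (ltngtP (l - j) m) => c.
- have : 0 <= ev (w i) x.
    apply: (ccv j l i) => //; first exact: d1.
      by have [h _ _] := dd j i ltac:(lia); apply: h; lia.
    by have [h _ _] := dd i l ltac:(lia); apply: h; lia.
  by rewrite leNgt hi.
- have : 0 <= ev (w g) x.
    apply: (ccv l j g) => //; first exact: d2.
      by have [_ h _] := dd g l ltac:(lia); apply: h; lia.
    by have [h _ _] := dd g j ltac:(lia); apply: h; lia.
  by rewrite leNgt hg.
by apply: (opp l j) => //; [apply: d3; lia|case/andP: jl; lia].
Qed.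

End Fixed.
End Cone.

End SupportArcs.

(** * Multigraded Koszul chains and the Ishida complex *)

Module IshidaComplex.
Import KoszulContraction PolynomialKoszul PlaneGordan PolygonCone NormalFan SupportArcs.

Section ScalarKoszul.
Variables (k : fieldType) (N : nat).
Implicit Types (c b : {set 'I_N} -> k) (T : {set 'I_N}).

(** In a fixed multidegree all variables act as the identity on coefficients, so the Koszul complex
    is the augmented simplicial chain complex, restricted to the sets T with [loc M T] in the region
    considered. *)
Definition kosk : ({set 'I_N} -> k) -> {set 'I_N} -> k :=
  kos (fun _ : 'I_N => (idfun : {additive k -> k})).

Definition wedge_op (v i : 'I_N) : {additive k -> k} :=
  if i == v then (idfun : {additive k -> k}) else (\0 : {additive k -> k}).

(** The simplicial cone with apex v. *)
Definition wedge v : ({set 'I_N} -> k) -> {set 'I_N} -> k := wdg (wedge_op v).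

Lemma wedge_opE v i u : wedge_op v i u = if i == v then u else 0.
Proof. by rewrite /wedge_op; case: eqP. Qed.

Lemma wedgeE v c T : wedge v c T = if v \in T then c (T :\ v) *~ ksgn v T else 0.
Proof.
rewrite /wedge /wdg; case: ifP => vT.
  rewrite (bigD1 v) //= wedge_opE eqxx big1 ?addr0 // => i /andP[_ /negbTE iv].
  by rewrite wedge_opE iv mul0rz.
rewrite big1 // => i iT; rewrite wedge_opE; case: eqP => [e|_]; last by rewrite mul0rz.
by rewrite -e iT in vT.
Qed.

Lemma kosk_wedge v c T : kosk (wedge v c) T + wedge v (kosk c) T = c T.
Proof.
rewrite /kosk /wedge kos_wdg //=.
rewrite -[RHS](_ : \sum_i wedge_op v i (c T) = c T).
  by rewrite [RHS](bigID (fun i => i \in T)) /= addrC.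
rewrite (bigD1 v) //= wedge_opE eqxx big1 ?addr0 // => i /negbTE iv.
by rewrite wedge_opE iv.
Qed.

Lemma kosk_wedge_cycle v c : (forall T, kosk c T = 0) ->
  forall T, kosk (wedge v c) T = c T.
Proof.
move=> h T; have := kosk_wedge v c T.
by rewrite [wedge v (kosk c) T]wedgeE h mul0rz if_same addr0.
Qed.

Lemma koskK c T : kosk (kosk c) T = 0. Proof. exact: kosK. Qed.
Lemma koskB c b T : kosk (fun T => c T - b T) T = kosk c T - kosk b T.
Proof. exact: kosB. Qed.
Lemma koskD c b T : kosk (fun T => c T + b T) T = kosk c T + kosk b T.
Proof. exact: kosD. Qed.
Lemma eq_kosk c b T : c =1 b -> kosk c T = kosk b T.
Proof. by move=> cb; apply: eq_kos. Qed.
Lemma kosk_sum (I : Type) (r : seq I) (F : I -> {set 'I_N} -> k) T :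
  kosk (fun T => \sum_(l <- r) F l T) T = \sum_(l <- r) kosk (F l) T.
Proof. exact: kos_sum. Qed.

Lemma supported_wedge p v c : supported p c -> supported p.+1 (wedge v c).
Proof.
move=> sc T Tp; rewrite wedgeE; case: ifP => // vT.
rewrite sc ?mul0rz //; apply: contra Tp => /eqP <-.
by rewrite (cardsD1 v T) vT.
Qed.

Lemma supported_kosk p c : supported p.+1 c -> supported p (kosk c).
Proof.
move=> sc T Tp; rewrite /kosk /kos big1 // => i iT.
by rewrite sc ?mul0rz // cardsU1 iT add1n eqSS.
Qed.

Variable P : 'I_N -> int * int.
Local Notation PP := (@PP N P).

(* The basis element indexed by T of a multihomogeneous Koszul chain of degree M
   carries the coefficient in degree [loc M T]. *)
Definition loc (M : int * int * int) T : int * int * int := M - \sum_(i in T) PP i.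

Lemma locU M i T : i \notin T -> loc M T = loc M (i |: T) + PP i.
Proof. by move=> iT; rewrite /loc big_setU1 //= opprD addrA addrAC addrNK. Qed.

Lemma locD M i T : i \in T -> loc M (T :\ i) = loc M T + PP i.
Proof. by move=> iT; rewrite (@locU M i) ?setD1K // setD11. Qed.

Lemma loc2 M T : (loc M T).2 = M.2 - #|T|%:Z.
Proof.
rewrite /loc /=; congr (_ - _).
rewrite (raddf_sum (snd : {additive (int * int * int) -> int})) /=.
by rewrite sumr_const natz.
Qed.

Definition located M (A : int * int * int -> Prop) c := forall T, c T != 0 -> A (loc M T).

Lemma located_kosk M (A : int * int * int -> Prop) c :
  (forall x i, A x -> A (x + PP i)) -> located M A c -> located M A (kosk c).
Proof.
move=> up hc T; apply: contraPP => nA; apply/negP; rewrite negbK; apply/eqP.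
rewrite /kosk /kos big1 // => i iT /=.
suff -> : c (i |: T) = 0 by rewrite mul0rz.
apply/eqP; apply: contra_notT nA => /hc; rewrite (locU M iT); exact: up.
Qed.

(** Coning from v stays in a region stable under subtraction of [PP v], such as the half-space of a
    functional vanishing at [PP v]. *)
Lemma located_wedge M (A : int * int * int -> Prop) v c :
  (forall x, A (x + PP v) -> A x) -> located M A c -> located M A (wedge v c).
Proof.
move=> dn hc T; rewrite wedgeE; case: ifP => [vT|]; last by rewrite eqxx.
move=> h; apply: dn; rewrite -locD //; apply: hc.
by apply: contraNneq h => ->; rewrite mul0rz.
Qed.

Lemma locatedB M (A : int * int * int -> Prop) c b :
  located M A c -> located M A b -> located M A (fun T => c T - b T).
Proof.
move=> hc hb T h; case: (eqVneq (c T) 0) => [c0|]; last exact: hc.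
by apply: hb; apply: contra h => /eqP ->; rewrite c0 subrr.
Qed.

End ScalarKoszul.

Section Ishida.
Variables (R : realFieldType) (N : nat) (P : 'I_N -> int * int) (i0 : 'I_N).
Variable (k : fieldType).
Local Notation emb := (@emb R).
Local Notation ev := (@ev R N P i0).
Local Notation inC := (@inC R N P i0).
Local Notation intC := (@intC R N P i0).
Local Notation PP := (@PP N P).
Local Notation loc := (@loc N P).
Local Notation kosk := (@kosk k N).

Hypothesis noncoll : forall l, l != 0 -> exists i j, dot l (emb (P i)) < dot l (emb (P j)).

(** Vanishing, in multidegree M, of the Koszul homology of the semigroup ring of the cone. *)
Definition Avan (p : nat) (M : int * int * int) : Prop :=
  forall c, supported p c -> located P M inC c -> (forall T, kosk c T = 0) ->
  exists b, [/\ supported p.+1 b, located P M inC b & forall T, kosk b T = c T].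

(* The same for the module spanned by the opposites of the interior points. *)
Definition Lvan (p : nat) (M : int * int * int) : Prop :=
  forall h, supported p h -> (forall T, intC (- loc M T) -> kosk h T = 0) ->
  exists2 h', supported p.+1 h' & forall T, intC (- loc M T) -> kosk h' T = h T.

(** A chase in the exact complex k[C] -> sum of k[U_i and U_(i+1)] -> sum of k[U_i] -> k[Z^3] -> L,
    with U_i the half-space of the i-th direction. The three middle terms are acyclic by coning from
    vertices on the bounding planes; so c is lifted three times, corrected in L and carried back. *)
Lemma ishida p M : Lvan p.+3 M -> Avan p M.
Proof.
have [b [m [m2 bdet borth]]] := fan_data R P.
pose w := dirs b m; pose r := (m + m)%N.
have r0 : (0 < r)%N by rewrite /r; lia.
have /choice[vert0 vertP] (i : 'I_r) : exists v : 'I_N,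
    ev (w i) (PP v) = 0 /\ ev (w (nxt m i)) (PP v) = 0.
  by apply: (dirs_vertex _ m2 bdet borth); exact: ltn_ord.
pose U (i : nat) (x : int * int * int) : Prop := 0 <= ev (w i) x.
have Uup i x j : U i x -> U i (x + PP j) by rewrite /U evD => h; rewrite addr_ge0 // ev_PP.
pose prv (i : nat) : nat := if i == 0%N then r.-1 else i.-1.
move=> hL c sc lc cc.
pose vert (i : nat) : 'I_N := vert0 (insubd (Ordinal r0) i).
have vP i : (i < r)%N -> ev (w i) (PP (vert i)) = 0 /\ ev (w (nxt m i)) (PP (vert i)) = 0.
  by move=> ir; have := vertP (insubd (Ordinal r0) i); rewrite val_insubd ir.
have prvr i : (i < r)%N -> (prv i < r)%N by rewrite /prv; case: eqP; lia.
have nxtprv i : (i < r)%N -> nxt m (prv i) = i.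
  move=> ir; rewrite /nxt /prv -/r; case: (posnP i) => [->|i1].
    by rewrite prednK // eqxx.
  rewrite prednK // ifF //; exact/ltn_eqF.
(* First lift, at the corner of U_i and U_(i+1): its apex lies on both bounding planes. *)
pose B (i : nat) := wedge (vert i) c.
have Bc i T : kosk (B i) T = c T by exact: kosk_wedge_cycle.
have lB i : (i < r)%N -> located P M (fun x => U i x /\ U (nxt m i) x) (B i).
  move=> ir; apply: located_wedge => [x|T /lc hT]; last by split; exact: hT.
  by rewrite /U !evD; have [-> ->] := vP i ir; rewrite !addr0.
(* Consecutive lifts have the half-space U_i in common. *)
pose D (i : nat) T := B i T - B (prv i) T.
have cD i T : kosk (D i) T = 0 by rewrite koskB !Bc subrr.
have lD i : (i < r)%N -> located P M (U i) (D i).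
  move=> ir; apply: locatedB => T.
    by move=> /(lB i ir)[].
  by move=> /(lB _ (prvr i ir))[_]; rewrite nxtprv.
pose A (i : nat) := wedge (vert i) (D i).
have Ac i T : kosk (A i) T = D i T by exact: kosk_wedge_cycle.
have lA i : (i < r)%N -> located P M (U i) (A i).
  move=> ir; apply: located_wedge (lD i ir) => x.
  by rewrite /U evD; have [-> _] := vP i ir; rewrite addr0.
have sumprv (F : nat -> k) : \sum_(i < r) F (prv i) = \sum_(i < r) F i.
  have e : r = r.-1.+1 by rewrite prednK.
  rewrite -(big_mkord xpredT (fun i => F (prv i))) -(big_mkord xpredT F) e.
  by rewrite big_nat_recl // big_nat_recr //= addrC.
pose a T := \sum_(i < r) A i T.
have ca T : kosk a T = 0.
  rewrite /a kosk_sum; under eq_bigr => i _ do rewrite Ac.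
  by rewrite sumrB (sumprv (fun i => B i T)) subrr.
(* Third lift, in k[Z^3], where any apex will do. *)
pose h := wedge (vert 0) a.
have ha T : kosk h T = a T by exact: kosk_wedge_cycle.
have sa : supported p.+2 a.
  move=> T Tp; rewrite /a big1 // => i _; apply: (supported_wedge _ _ Tp) => T' T'p.
  by rewrite /D /B !(supported_wedge _ sc T'p) subrr.
have negL T i : intC (- loc M T) -> (i < r)%N -> ~ U i (loc M T).
  move=> hT ir; rewrite /U => hu; have := hT (w i) (dirs_neq0 m2 bdet ir).
  by rewrite evN oppr_gt0 ltNge hu.
have [|T hT|h' sh' hh'] := hL h; first exact: supported_wedge.
  rewrite ha /a big1 // => i _; apply/eqP/negPn/negP => /(lA i (ltn_ord i)).
  exact: negL.
pose s T := h T - kosk h' T.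
have sL T : intC (- loc M T) -> s T = 0 by move=> /hh' e; rewrite /s e subrr.
have cs T : kosk s T = a T by rewrite koskB koskK subr0 ha.
(* A degree outside the opposite of the interior lies in some half-space; s is split by assigning
   each of its terms to the first one. *)
pose fst_i T : nat := find (fun i : nat => 0 <= ev (w i) (loc M T)) (iota 0 r).
pose S (i : nat) T := if fst_i T == i then s T else 0.
have Ss T : \sum_(i < r) S i T = s T.
  rewrite /S; case: (ltnP (fst_i T) r) => fr.
    rewrite (bigD1 (Ordinal fr)) //= eqxx big1 ?addr0 // => i ne.
    by rewrite ifF //; apply: contraNF ne => /eqP e; apply/eqP/val_inj.
  rewrite big1 => [|i _]; last by rewrite ifF //; have := ltn_ord i; lia.
  apply/esym/sL; apply: (intC_dirs m2 bdet borth) => i ir.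
  rewrite evN oppr_gt0 ltNge; apply/negP => hi.
  have : ~~ has (fun i : nat => 0 <= ev (w i) (loc M T)) (iota 0 r).
    by rewrite has_find size_iota -leqNgt.
  by move/hasPn/(_ i); rewrite mem_iota add0n ir hi => /(_ isT).
have lS i : (i < r)%N -> located P M (U i) (S i).
  move=> ir T; rewrite /S; case: ifP => [/eqP e _|_]; last by rewrite eqxx.
  have hs : has (fun i : nat => 0 <= ev (w i) (loc M T)) (iota 0 r).
    by rewrite has_find size_iota -/(fst_i T) e.
  by have := nth_find 0%N hs; rewrite -/(fst_i T) e nth_iota.
pose A' (i : nat) T := A i T - kosk (S i) T.
have A's T : \sum_(i < r) A' i T = 0.
  rewrite sumrB -kosk_sum (@eq_kosk k N _ s) //.
  by rewrite cs subrr.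
have lA' i : (i < r)%N -> located P M (U i) (A' i).
  move=> ir; apply: locatedB; first exact: lA.
  by apply: located_kosk (lS i ir) => x j; exact: Uup.
have cA' i T : kosk (A' i) T = B i T - B (prv i) T by rewrite koskB koskK subr0 Ac.
(* A family summing to zero and supported on an arc is a family of differences. *)
have sA' i : supported p.+2 (A' i).
  move=> T Tp; rewrite /A' (supported_kosk _ Tp); last first.
    move=> T' T'p; rewrite /S; case: eqP => // _.
    by rewrite /s /h (supported_wedge _ sa T'p) (supported_kosk sh' T'p) subrr.
  rewrite subr0; apply: (supported_wedge _ _ Tp) => T' T'p.
  by rewrite /D /B !(supported_wedge _ sc T'p) subrr.
have /choice[t tP] (T : {set 'I_N}) : exists t : nat -> k, (#|T| != p.+2 -> t =1 fun=> 0) /\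
    forall i, (i < r)%N -> A' i T = t i - t (prv i) /\
      (t i != 0 -> U i (loc M T) /\ U (nxt m i) (loc M T)).
  case: (boolP (#|T| == p.+2)) => Tp; last first.
    by exists (fun=> 0); split=> // i ir; rewrite sA' // subrr eqxx.
  pose pos i := 0 <= ev (w i) (loc M T).
  have A'0 i : (i < r)%N -> ~~ pos i -> A' i T = 0.
    by move=> ir; apply: contraNeq => /(lA' i ir).
  pose ps i := \sum_(0 <= j < i.+1) A' j T.
  have psr : ps r.-1 = 0 by rewrite /ps prednK // big_mkord A's.
  have psS i : ps i.+1 = ps i + A' i.+1 T by rewrite /ps big_nat_recr.
  have ps0 : ps 0%N = A' 0%N T by rewrite /ps big_nat1.
  (* A primitive on the cycle of indices is determined up to a constant, normalized here to vanish
     at the first negative index. *)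
  pose cst := if has (fun i => ~~ pos i) (iota 0 r)
    then ps (find (fun i => ~~ pos i) (iota 0 r)) else 0.
  pose t i := ps i - cst.
  have tA i : (i < r)%N -> A' i T = t i - t (prv i).
    move=> ir; rewrite /t opprB addrA subrK /prv; case: i ir => [|i] ir /=.
      by rewrite psr subr0.
    by rewrite psS addrC addKr.
  (* All partial sums at negative indices agree. *)
  have psneg g i : (g < i < r)%N -> ~~ pos g -> ~~ pos i -> ps g = ps i.
    move=> /andP[gi ir] ng ni; have gr := ltn_trans gi ir.
    have hg : ev (w g) (loc M T) < 0 by rewrite ltNge.
    have hi : ev (w i) (loc M T) < 0 by rewrite ltNge.
    have e : ps i = ps g + \sum_(g.+1 <= j < i.+1) A' j T.
      by rewrite /ps (big_cat_nat (n := g.+1)) //= ltnS ltnW.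
    have gir : (g < i < r)%N by rewrite gi ir.
    case: (neg_arc noncoll m2 bdet gir hg hi) => hz.
      rewrite e big_nat big1 ?addr0 // => j /andP[gj ji].
      case: (eqVneq j i) => [->|jni]; first exact: A'0.
      have gji : (g < j < i)%N by rewrite gj ltn_neqAle jni.
      by apply: A'0; [lia|rewrite /pos -ltNge hz].
    have : ps r.-1 = \sum_(0 <= j < r) A' j T by rewrite /ps prednK.
    rewrite psr (big_cat_nat (n := g.+1)) //=.
    rewrite [X in _ + X](big_cat_nat (n := i.+1)) //=; last by rewrite ltnS ltnW.
    rewrite [X in _ = X + _]big_nat big1 ?add0r; last first.
      move=> j /andP[_ jg]; case: (eqVneq j g) => [->|jn]; first exact: A'0.
      by apply: A'0; [lia|rewrite /pos -ltNge hz //; lia].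
    rewrite [X in _ = _ + X]big_nat [X in _ = _ + X]big1 ?addr0; last first.
      by move=> j /andP[ij jr]; apply: A'0; [lia|rewrite /pos -ltNge hz //; lia].
    by move=> z; rewrite e -z addr0.
  have tneg i : (i < r)%N -> ~~ pos i -> t i = 0.
    move=> ir ni; have hs : has (fun i => ~~ pos i) (iota 0 r).
      by apply/hasP; exists i; rewrite // mem_iota.
    rewrite /t /cst hs; set g := find _ _.
    have gr : (g < r)%N by have := hs; rewrite has_find size_iota.
    have ng : ~~ pos g by have := nth_find 0%N hs; rewrite nth_iota.
    case: (ltngtP g i) => [gi|ig|->]; last by rewrite subrr.
      by rewrite (psneg g i) ?subrr // gi.
    by rewrite (psneg i g) ?subrr // ig.
  exists t; split=> // i ir; split; first exact: tA.
  move=> ti; split; first by rewrite /U -[0 <= _]negbK; apply: contraTN isT => /(tneg i ir) e; rewrite e eqxx in ti.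
  rewrite /U -[0 <= _]/(pos (nxt m i)); apply: contraNT ti => ni.
  have nr : (nxt m i < r)%N by exact: nxt_lt.
  have := tA _ nr; rewrite A'0 // tneg // sub0r.
  have -> : prv (nxt m i) = i by rewrite /prv /nxt -/r; case: (i.+1 =P r) => [e|_] //=; rewrite -e.
  by move/esym/eqP; rewrite oppr_eq0.
pose tt i T := t T i.
have stt i : supported p.+2 (tt i) by move=> T /(proj1 (tP T)) h0; rewrite /tt h0.
(* The corrected first lifts agree for all i, so their common value lies in every half-space, that
   is, in the cone. *)
pose E i T := B i T - kosk (tt i) T.
have E_prv i T : (i < r)%N -> E i T = E (prv i) T.
  move=> ir; apply/eqP; rewrite -subr_eq0 /E opprB addrACA -addrA.
  have -> : kosk (tt i) T = kosk (A' i) T + kosk (tt (prv i)) T.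
    rewrite -koskD; apply: eq_kosk => T'.
    by have [_ /(_ i ir)[-> _]] := tP T'; rewrite /tt subrK.
  by rewrite cA'; apply/eqP; ring.
have E0 i T : (i < r)%N -> E i T = E 0%N T.
  elim: i => // i IH ir; rewrite E_prv // /prv /= IH //; exact: ltnW.
exists (E 0%N); split.
- move=> T Tp; rewrite /E (supported_kosk (stt _) Tp) subr0.
  exact: (supported_wedge _ sc Tp).
- move=> T ET; apply: (inC_dirs m2 bdet borth) => i ir.
  have lE : located P M (U i) (E i).
    apply: locatedB => [T' /(lB i ir)[] //|].
    apply: located_kosk; first by move=> x j; exact: Uup.
    by move=> T' ti; have [_ /(_ i ir)[_ /(_ ti)[]]] := tP T'.
  by apply: lE; rewrite E0.
- by move=> T; rewrite koskB koskK subr0 Bc.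
Qed.
End Ishida.

End IshidaComplex.

(** * Lattice points near a segment and interior summands *)

Module HeightOne.
Import KoszulContraction PolynomialKoszul PlaneGordan PolygonCone NormalFan SupportArcs
  IshidaComplex.

Section LatticeTriangles.
Implicit Types a b c e z : int * int.

Definition detz e z : int := e.1 * z.2 - e.2 * z.1.

Lemma detz_eq0 e z : coprimez e.1 e.2 -> detz e z = 0 ->
  exists t : int, z = (t * e.1, t * e.2).
Proof.
case: e z => [e1 e2] [z1 z2]; rewrite /detz /= => /coprimezP[[u v] /= uv] d0.
exists (u * z1 + v * z2); congr (_, _).
  transitivity (z1 * (u * e1 + v * e2)); first by rewrite uv mulr1.
  have -> : (u * z1 + v * z2) * e1 = u * z1 * e1 + v * (e1 * z2 - e2 * z1) + v * e2 * z1 by ring.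
  by rewrite d0; ring.
transitivity (z2 * (u * e1 + v * e2)); first by rewrite uv mulr1.
have -> : (u * z1 + v * z2) * e2 = u * e1 * z2 - u * (e1 * z2 - e2 * z1) + v * z2 * e2 by ring.
by rewrite d0; ring.
Qed.

(* A lattice triangle over a primitive edge contains a lattice point at height 1:
   in a basis (e, f) round up the first coordinate on the segment at height 1. *)
Lemma height_one a e c : coprimez e.1 e.2 -> 0 < detz e (c - a) ->
  exists c' t, [/\ 0 <= t <= detz e (c - a) - 1, detz e (c' - a) = 1 &
    let H := detz e (c - a) in
    H * c'.1 = (H - 1 - t) * a.1 + t * (a.1 + e.1) + c.1 /\
    H * c'.2 = (H - 1 - t) * a.2 + t * (a.2 + e.2) + c.2].
Proof.
move=> /coprimezP[[u v] /= uv]; set H := detz _ _ => H0.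
pose f : int * int := (- v, u); pose x := detz (c - a) f.
pose t := (- x %% H)%Z; pose y := - (- x %/ H)%Z.
have xt : y * H = x + t.
  by have := divz_eq (- x) H; rewrite -/t /y; lia.
have ca1 : c.1 - a.1 = x * e.1 + H * f.1.
  transitivity ((c.1 - a.1) * (u * e.1 + v * e.2)); first by rewrite uv mulr1.
  by rewrite /x /H /detz /f /=; ring.
have ca2 : c.2 - a.2 = x * e.2 + H * f.2.
  transitivity ((c.2 - a.2) * (u * e.1 + v * e.2)); first by rewrite uv mulr1.
  by rewrite /x /H /detz /f /=; ring.
exists (a.1 + y * e.1 + f.1, a.2 + y * e.2 + f.2), t; split.
- have Hn0 : H != 0 by rewrite gt_eqF.
  have := modz_ge0 (- x) Hn0; have := ltz_pmod (- x) H0; rewrite -/t; lia.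
- rewrite /detz /f /= -uv; ring.
split=> /=.
  have -> : H * (a.1 + y * e.1 + f.1) = H * a.1 + (y * H) * e.1 + H * f.1 by ring.
  rewrite xt; have -> : c.1 = a.1 + (x * e.1 + H * f.1) by rewrite -ca1; ring.
  ring.
have -> : H * (a.2 + y * e.2 + f.2) = H * a.2 + (y * H) * e.2 + H * f.2 by ring.
rewrite xt; have -> : c.2 = a.2 + (x * e.2 + H * f.2) by rewrite -ca2; ring.
ring.
Qed.

End LatticeTriangles.

Lemma eq_triple (x y : int * int * int) :
  x.1.1 = y.1.1 -> x.1.2 = y.1.2 -> x.2 = y.2 -> x = y.
Proof. by case: x y => -[x1 x2] x3 [[y1 y2] y3] /= -> -> ->. Qed.

Section InteriorPoints.
Variables (R : realFieldType) (N : nat) (P : 'I_N -> int * int) (i0 : 'I_N).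
Local Notation emb := (@emb R).
Local Notation ev := (@ev R N P i0).
Local Notation inC := (@inC R N P i0).
Local Notation intC := (@intC R N P i0).
Local Notation PP := (@PP N P).
Implicit Types (a b c e z : int * int).

Hypothesis closedP : forall z, inC (z, 1) -> exists i, P i = z.
Hypothesis noncoll : forall l, l != 0 -> exists i j, dot l (emb (P i)) < dot l (emb (P j)).

Lemma ev_comb (l : R * R) (h p q r : int) z a b c :
  h = p + q + r -> h * z.1 = p * a.1 + q * b.1 + r * c.1 ->
  h * z.2 = p * a.2 + q * b.2 + r * c.2 ->
  h%:~R * ev l (z, 1) = p%:~R * ev l (a, 1) + q%:~R * ev l (b, 1) + r%:~R * ev l (c, 1).
Proof.
move=> e0 /(congr1 (intr : int -> R)) e1 /(congr1 (intr : int -> R)) e2.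
rewrite !intrD !intrM in e1; rewrite !intrD !intrM in e2.
rewrite /ev /dot /emb /=; set hm := hmin _ _ _.
transitivity (l.1 * (h%:~R * z.1%:~R) + l.2 * (h%:~R * z.2%:~R) - h%:~R * hm); first by ring.
by rewrite e1 e2 e0 !intrD; ring.
Qed.

Lemma comb_intC (h p q r : int) z a b c : 0 < h -> 0 <= p -> 0 <= q -> 0 < r ->
  h = p + q + r -> h * z.1 = p * a.1 + q * b.1 + r * c.1 ->
  h * z.2 = p * a.2 + q * b.2 + r * c.2 ->
  inC (a, 1) -> inC (b, 1) -> intC (c, 1) -> intC (z, 1).
Proof.
move=> h0 p0 q0 r0 e0 e1 e2 ia ib ic l l0.
rewrite -(pmulr_rgt0 (x := h%:~R)) ?ltr0z // (ev_comb l e0 e1 e2).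
rewrite ltr_wpDl ?mulr_gt0 ?ltr0z ?ic //.
by rewrite addr_ge0 // mulr_ge0 ?ler0z ?ia ?ib.
Qed.

Lemma comb_inC (h p q r : int) z a b c : 0 < h -> 0 <= p -> 0 <= q -> 0 <= r ->
  h = p + q + r -> h * z.1 = p * a.1 + q * b.1 + r * c.1 ->
  h * z.2 = p * a.2 + q * b.2 + r * c.2 ->
  inC (a, 1) -> inC (b, 1) -> inC (c, 1) -> inC (z, 1).
Proof.
move=> h0 p0 q0 r0 e0 e1 e2 ia ib ic l.
rewrite -(pmulr_rge0 (x := h%:~R)) ?ltr0z // (ev_comb l e0 e1 e2).
by rewrite !addr_ge0 ?mulr_ge0 ?ler0z ?ia ?ib ?ic.
Qed.

Lemma height_one_intC a e c : coprimez e.1 e.2 -> 0 < detz e (c - a) ->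
  inC (a, 1) -> inC (a + e, 1) -> intC (c, 1) ->
  exists2 c', intC (c', 1) & detz e (c' - a) = 1.
Proof.
move=> ce H0 ca cb cc; have [c' [t [/andP[t0 tH] d1 [e1 e2]]]] := height_one ce H0.
exists c' => //.
move: (detz _ _) H0 tH e1 e2 => H H0 tH e1 e2.
have p0 : 0 <= H - 1 - t by rewrite subr_ge0.
have e0 : H = H - 1 - t + t + 1 by ring.
apply: (@comb_intC H (H - 1 - t) t 1 c' a (a + e) c H0 p0 t0 ltr01 e0 _ _ ca cb cc).
  by rewrite mul1r e1.
by rewrite mul1r e2.
Qed.

Lemma height_one_inC a e c : coprimez e.1 e.2 -> 0 < detz e (c - a) ->
  inC (a, 1) -> inC (a + e, 1) -> inC (c, 1) ->
  exists2 c', inC (c', 1) & detz e (c' - a) = 1.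
Proof.
move=> ce H0 ca cb cc; have [c' [t [/andP[t0 tH] d1 [e1 e2]]]] := height_one ce H0.
exists c' => //.
move: (detz _ _) H0 tH e1 e2 => H H0 tH e1 e2.
have p0 : 0 <= H - 1 - t by rewrite subr_ge0.
have e0 : H = H - 1 - t + t + 1 by ring.
apply: (@comb_inC H (H - 1 - t) t 1 c' a (a + e) c H0 p0 t0 ler01 e0 _ _ ca cb cc).
  by rewrite mul1r e1.
by rewrite mul1r e2.
Qed.

Lemma detz_dot e z : (detz e z)%:~R = dot (- e.2%:~R, e.1%:~R) (emb z) :> R.
Proof. by rewrite /detz /dot /= intrB !intrM; ring. Qed.

(** An interior u' at height 1 and a point w at height -1 over the segment satisfy u' + w = a + b +
    t (b - a). For nonzero t, one of a and b would be a convex combination with positive weight at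
    u', hence interior; so t = 0 and w is the summand to remove. *)
Lemma interior_side a b u : inC (a, 1) -> inC (b, 1) ->
  intC ((a, 1) + (b, 1)) -> ~ intC (a, 1) -> ~ intC (b, 1) ->
  coprimez (b - a).1 (b - a).2 -> intC (u, 1) -> 0 < detz (b - a) (u - a) ->
  exists i, intC ((a, 1) + (b, 1) - PP i).
Proof.
move=> ia ib iab na nb cp iu Du; set e := b - a.
have bE : a + e = b by rewrite /e addrC subrK.
have [u' iu' Du'] := height_one_intC cp Du ia (eq_ind_r (fun x => inC (x, 1)) ib bE) iu.
have [Q Dq] : exists Q, detz e (P Q - a) < 0.
  pose l : R * R := (- e.2%:~R, e.1%:~R).
  have l0 : l != 0.
    apply/eqP => -[/eqP]; rewrite oppr_eq0 intr_eq0 => /eqP h2 /eqP.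
    rewrite intr_eq0 => /eqP h1.
    suff : coprimez 0 0 by [].
    by have <- : coprimez e.1 e.2 = coprimez 0 0 by congr coprimez.
  have [Q hQ] := hminP P i0 l; exists Q.
  have hb : dot l (emb b) = dot l (emb a).
    by rewrite -bE embD dotDr -[RHS]addr0; congr (_ + _); rewrite /dot /l /=; ring.
  rewrite -(ltrz0 R) detz_dot embD embN dotDr dotNr.
  have := iab l l0; rewrite /PolygonCone.ev [emb _](embD R a b) dotDr hb hQ.
  rewrite -[(_ + _).2%:~R]/(2%:R : R) -/l; move: (dot _ _) (dot _ _) => A B h; lra.
have cpN : coprimez (- e).1 (- e).2 by rewrite /coprimez /gcdz /= !abszN.
have DN z : detz (- e) (z - b) = - detz e (z - a).
  by rewrite -bE /detz /=; ring.
have Qpos : 0 < detz (- e) (P Q - b) by rewrite DN oppr_gt0.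
have aE : b - e = a by rewrite -bE addrK.
have [w iw] := height_one_inC cpN Qpos ib (eq_ind_r (fun x => inC (x, 1)) ia aE) (@inC_PP R N P i0 Q).
rewrite DN => /eqP; rewrite eqr_oppLR => /eqP Dw.
have [|t /(congr1 (fun z => z + (a + b)))] := detz_eq0 (z := u' + w - (a + b)) cp.
  transitivity (detz e (u' - a) + detz e (w - a)); last by rewrite Du' Dw subrr.
  by rewrite -bE /detz /=; ring.
rewrite subrK => ht.
have h1 : u'.1 + w.1 = a.1 + b.1 + t * (b.1 - a.1).
  by have := congr1 fst ht; rewrite /= addrC => ->; rewrite addrC.
have h2 : u'.2 + w.2 = a.2 + b.2 + t * (b.2 - a.2).
  by have := congr1 snd ht; rewrite /= addrC => ->; rewrite addrC.
case: (ltrgtP t 0) => [tn|tp|t0].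
- case: na; apply: (comb_intC (h := 1 - t) (p := 1) (a := w) (q := - t - 1) (b := b)
    (r := 1) (c := u')) => //; try lia.
- case: nb; apply: (comb_intC (h := 1 + t) (p := 1) (a := w) (q := t - 1) (b := a)
    (r := 1) (c := u')) => //; try lia.
- have [j Pj] := closedP iw; exists j => //.
  suff -> : (a, 1) + (b, 1) - PP j = (u', 1) by [].
  rewrite t0 !mul0r !addr0 in h1 h2.
  have e1 : a.1 + b.1 - w.1 = u'.1 by rewrite -h1 addrK.
  have e2 : a.2 + b.2 - w.2 = u'.2 by rewrite -h2 addrK.
  by apply: eq_triple; rewrite /PP Pj.
Qed.

(** Normality gives x = a + b. If neither summand is interior, another splitting comes from a
    lattice point strictly between them or, when the segment is primitive, from [interior_side] on
    the side of u. *)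
Lemma interior_decomp x (u : int * int) : x.2 = 2 -> intC x -> intC (u, 1) ->
  exists i, intC (x - PP i).
Proof.
move=> x2 ix iu.
have [i ii] : exists i, inC (x - PP i).
  by apply: (normal closedP); [rewrite x2|exact: intC_inC].
pose b := (x - PP i).1; pose a := P i.
have xE : x = (a, 1) + (b, 1).
  by apply: eq_triple; rewrite /= ?x2 // addrC subrK.
have bE : x - PP i = (b, 1) by rewrite xE addrAC subrr add0r.
rewrite bE in ii.
have ia : inC (a, 1) by exact: inC_PP.
have [jb Pb] := closedP ii.
have [iia|na] := pselect (intC (a, 1)).
  by exists jb; rewrite xE /PP Pb addrK.
have [iib|nb] := pselect (intC (b, 1)); first by exists i; rewrite bE.
have ix' l : l != 0 -> 0 < ev l (a, 1) + ev l (b, 1) by move=> l0; rewrite -evD -xE ix.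
pose g := gcdz (b - a).1 (b - a).2.
have gn0 : g != 0.
  rewrite gcdz_eq0; apply/negP => /andP[/eqP h1 /eqP h2].
  apply: na => l l0; have := ix' l l0.
  have -> : b = a.
    by case: (a) (b) h1 h2 => a1 a2 [b1 b2] /= /subr0_eq -> /subr0_eq ->.
  lra.
have g0 : 0 < g by rewrite lt_def gn0.
pose e : int * int := (((b - a).1 %/ g)%Z, ((b - a).2 %/ g)%Z).
have ge1 : b.1 - a.1 = g * e.1 by rewrite mulrC divzK // dvdz_gcdl.
have ge2 : b.2 - a.2 = g * e.2 by rewrite mulrC divzK // dvdz_gcdr.
(* A point strictly inside the segment is interior: every nonzero functional is nonnegative at both
   ends and positive at one of them. *)
case: (ltrP 1 g) => [g1|g1].
  have aa : intC (a + e, 1).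
    move=> l l0; have := ev_comb l (h := g) (p := g - 1) (q := 1) (r := 0)
      (z := a + e) (a := a) (b := b) (c := a).
    have ge : g = g - 1 + 1 + 0 by ring.
    move=> /(_ ge) h.
    rewrite -(pmulr_rgt0 (x := g%:~R)) ?ltr0z // h; first last.
    - by rewrite /= mulrDr -ge2; ring.
    - by rewrite /= mulrDr -ge1; ring.
    have := ix' l l0; have := ia l; have := ii l.
    move: (ev l (a, 1)) (ev l (b, 1)) => A B hB hA hAB.
    rewrite mul0r addr0 mul1r intrB.
    have : (2%:~R : R) <= g%:~R by rewrite ler_int; lia.
    rewrite -[2%:~R]/(2%:R : R) -[1%:~R]/(1 : R) => h2.
    have h3 : 0 <= (g%:~R - 2%:R) * A by rewrite mulr_ge0 // subr_ge0.
    lra.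
  have bb : inC (b - e, 1).
    apply: (comb_inC (h := g) (p := 1) (q := g - 1) (r := 0) (a := a) (b := b) (c := a)) => //.
    - lia.
    - lia.
    - by rewrite /= mulrBr -ge1; ring.
    - by rewrite /= mulrBr -ge2; ring.
  have [j Pj] := closedP bb; exists j; rewrite xE /PP Pj.
  suff -> : (a, 1) + (b, 1) - (b - e, 1) = (a + e, 1) :> (int * int * int)%type by [].
  by apply: eq_triple => /=; ring.
have g1' : g = 1 by lia.
have cp : coprimez (b - a).1 (b - a).2 by rewrite /coprimez -/g g1'.
case: (ltrgtP (detz (b - a) (u - a)) 0) => [Dn|Dp|D0].
- have cp' : coprimez (a - b).1 (a - b).2 by rewrite -opprB /coprimez /gcdz /= !abszN.
  have Dp : 0 < detz (a - b) (u - b).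
    by move: Dn; rewrite -oppr_gt0; congr (0 < _); rewrite /detz /=; ring.
  have [|j hj] := interior_side ii ia _ nb na cp' iu Dp.
    by rewrite addrC -xE.
  by exists j; rewrite xE [X in X - _]addrC.
- have [|j hj] := interior_side ia ii _ na nb cp iu Dp; first by rewrite -xE.
  by exists j; rewrite xE.
have [t ht] := detz_eq0 cp D0.
have h1 : u.1 = a.1 + t * (b.1 - a.1) by have := congr1 fst ht; rewrite /= => <-; ring.
have h2 : u.2 = a.2 + t * (b.2 - a.2) by have := congr1 snd ht; rewrite /= => <-; ring.
case: (ltrP 0 t) => t0.
  case: nb; apply: (comb_intC (h := t) (p := t - 1) (a := a) (q := 0) (b := b)
    (r := 1) (c := u)) => //; try lia.
  + by rewrite h1; ring.
  + by rewrite h2; ring.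
case: na; apply: (comb_intC (h := 1 - t) (p := - t) (a := b) (q := 0) (b := b)
    (r := 1) (c := u)) => //; try lia.
+ by rewrite h1; ring.
+ by rewrite h2; ring.
Qed.
End InteriorPoints.

End HeightOne.

(** * The lattice ideal and its multigraded Koszul homology *)

Module LatticeIdeals.
Import KoszulContraction HomogeneousParts PolynomialKoszul KoszulVanishing BettiVanishing
  PlaneGordan PolygonCone NormalFan SupportArcs IshidaComplex HeightOne.

Section LatticeIdeal.
Variables (k : fieldType) (N : nat) (P : 'I_N -> int * int).
Local Notation S := (mpoly N k).
Local Notation X i := (@mpolyX N k (mnm1 i)).
Local Notation PP := (@PP N P).
Local Notation loc := (@loc N P).
Implicit Types (f g : S) (m : multinom N) (x M : int * int * int).

Definition mlt m : int * int * int := \sum_i PP i *+ m i.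

Lemma mltD m1 m2 : mlt (mnm_add m1 m2) = mlt m1 + mlt m2.
Proof. by rewrite /mlt -big_split; apply: eq_bigr => i _; rewrite mnmDE mulrnDr. Qed.
Lemma mlt0 : mlt mnm0 = 0.
Proof. by rewrite /mlt big1 // => i _; rewrite mnm0E. Qed.
Lemma mlt1 i : mlt (mnm1 i) = PP i.
Proof.
rewrite /mlt (bigD1 i) //= mnm1E eqxx mulr1n big1 ?addr0 // => j ji.
by rewrite mnm1E eq_sym (negbTE ji).
Qed.
Lemma mlt2 m : (mlt m).2 = (mdeg m)%:Z.
Proof.
rewrite /mlt (raddf_sum (snd : {additive (int * int * int) -> int})) mdegE.
by rewrite -natz natr_sum; apply: eq_bigr => i _; rewrite raddfMn.
Qed.

(** The coefficient at M of the image of f in the semigroup ring. *)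
Definition csum M f : k := \sum_(m <- msupp f | mlt m == M) mcoeff m f.

Lemma csumE M f (r : seq (multinom N)) : uniq r -> {subset msupp f <= r} ->
  csum M f = \sum_(m <- r | mlt m == M) mcoeff m f.
Proof.
move=> ur sr; rewrite [RHS](bigID (fun m => m \in msupp f)) /= [Y in _ + Y]big1 ?addr0.
  transitivity (\sum_(m <- [seq m <- msupp f | mlt m == M]) mcoeff m f).
    by rewrite big_filter.
  rewrite -[RHS]big_filter; apply/esym; apply: perm_big; apply: uniq_perm; rewrite ?filter_uniq ?msupp_uniq // => m.
  rewrite !mem_filter; case: (boolP (m \in msupp f)) => [h|]; rewrite ?andbF ?andbT //.
  by rewrite sr ?andbT.
by move=> m /andP[_ /memN_msupp_eq0].
Qed.

Lemma csum_is_linear M : scalar (csum M).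
Proof.
move=> c f g; pose r := undup (msupp f ++ msupp g ++ msupp (c *: f + g)).
have ur : uniq r by exact: undup_uniq.
rewrite !(@csumE M _ r) //; try by move=> m; rewrite mem_undup !mem_cat => ->; rewrite ?orbT.
rewrite mulr_sumr -big_split; apply: eq_bigr => m _ /=.
by rewrite mcoeffD mcoeffZ.
Qed.
HB.instance Definition _ M := GRing.isLinear.Build k S k *%R (csum M) (csum_is_linear M).

Lemma csumX M m : csum M (mpolyX k m) = (mlt m == M)%:R.
Proof. by rewrite /csum msuppX big_mkcond big_seq1 mcoeffX eqxx; case: eqP. Qed.

Lemma csumMX M m f : csum M (mpolyX k m * f) = csum (M - mlt m) f.
Proof.
rewrite [in LHS](mpolyE f) [in RHS](mpolyE f) mulr_sumr [LHS]raddf_sum [RHS]raddf_sum /=.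
apply: eq_bigr => m' _; rewrite -scalerAr !linearZ /= -mpolyXD !csumX mltD.
by rewrite [in RHS]eq_sym subr_eq eq_sym addrC.
Qed.

Lemma csum_homz M (z : int) f : homz z f -> M.2 != z -> csum M f = 0.
Proof.
move=> hf Mz; rewrite /csum big_seq_cond big1 // => m /andP[/hf mz /eqP mM].
by rewrite -mM mlt2 mz eqxx in Mz.
Qed.

Lemma csum_neq0 M f : csum M f != 0 -> exists2 m, m \in msupp f & mlt m = M.
Proof.
apply: contra_neqP => h; rewrite /csum big_seq_cond big1 // => m /andP[mf /eqP mM].
by case: h; exists m.
Qed.

Definition lattice_ideal f : Prop := forall M, csum M f = 0.
Local Notation I := lattice_ideal.

Lemma lattice_ideal0 : I 0. Proof. by move=> M; rewrite raddf0. Qed.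
Lemma lattice_idealD f g : I f -> I g -> I (f + g).
Proof. by move=> hf hg M; rewrite raddfD /= hf hg addr0. Qed.
Lemma lattice_idealM f g : I g -> I (f * g).
Proof.
move=> hg M; rewrite (mpolyE f) mulr_suml raddf_sum big1 // => m _ /=.
by rewrite -scalerAl linearZ /= csumMX hg mulr0.
Qed.
Lemma lattice_ideal_hpart z f : I f -> I (hpart z f).
Proof.
move=> hf M; case: (eqVneq M.2 z) => [Mz|/csum_homz]; last by apply; exact: homz_hpart.
rewrite -(hf M); pose r := undup (msupp f ++ msupp (hpart z f)).
have ur : uniq r by exact: undup_uniq.
rewrite !(@csumE M _ r) //; try by move=> m; rewrite mem_undup !mem_cat => ->; rewrite ?orbT.
by apply: eq_bigr => m /eqP mM; rewrite mcoeff_hpart -mlt2 mM Mz eqxx.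
Qed.

Hypothesis Pinj : injective P.

Lemma mlt_inj_le1 m m' : (mdeg m <= 1)%N -> mlt m = mlt m' -> m = m'.
Proof.
move=> m1 e; have d : mdeg m = mdeg m'.
  by have := congr1 snd e; rewrite !mlt2 => -[].
case: (posnP (mdeg m)) => m0.
  have z (m2 : multinom N) : mdeg m2 = 0%N -> m2 = mnm0 by move/eqP; rewrite mdeg_eq0 => /eqP.
  by rewrite (z m m0) (z m') // -d.
have /eqP/mdeg1P[i /eqP ei] : mdeg m = 1%N by lia.
have /eqP/mdeg1P[j /eqP ej] : mdeg m' = 1%N by lia.
by move: e; rewrite ei ej !mlt1 => /(congr1 fst) /Pinj ->.
Qed.

Lemma lattice_ideal_degree (z : int) f : z <= 1 -> homz z f -> I f -> f = 0.
Proof.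
move=> z1 hf If; apply/mpolyP => m; rewrite mcoeff0.
case: (boolP (m \in msupp f)) => [mf|/memN_msupp_eq0 //].
rewrite -(If (mlt m)) /csum big_mkcond (bigD1_seq m) //= ?msupp_uniq ?eqxx //=.
rewrite big_seq_cond big1 ?addr0 // => m' /andP[m'f /eqP ne]; case: eqP => // e.
by case: ne; apply/esym/mlt_inj_le1; [have := hf m mf; lia|].
Qed.
End LatticeIdeal.

Section Bridge.
Variables (R : realFieldType) (N : nat) (P : 'I_N -> int * int) (i0 : 'I_N).
Variable (k : fieldType).
Local Notation S := (mpoly N k).
Local Notation X i := (@mpolyX N k (mnm1 i)).
Local Notation emb := (@emb R).
Local Notation ev := (@ev R N P i0).
Local Notation inC := (@inC R N P i0).
Local Notation intC := (@intC R N P i0).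
Local Notation PP := (@PP N P).
Local Notation loc := (@loc N P).
Local Notation mlt := (@mlt N P).
Local Notation csum := (@csum k N P).
Local Notation I := (@lattice_ideal k N P).

Hypothesis closedP : forall z, inC (z, 1) -> exists i, P i = z.
Hypothesis noncoll : forall l, l != 0 -> exists i j, dot l (emb (P i)) < dot l (emb (P j)).

Lemma inC_mlt m : inC (mlt m).
Proof.
move=> l; rewrite /mlt; elim/big_rec: _ => [|i x _ hx]; first by rewrite ev0.
by rewrite evD ev_Mn addr_ge0 // mulr_ge0 ?ler0n // ev_PP.
Qed.

Lemma inC_ge0 x : inC x -> 0 <= x.2.
Proof.
move=> hx; rewrite leNgt; apply/negP => x0.
have l0 : ((1, 0) : R * R) != 0 by apply/eqP => -[/eqP]; rewrite oner_eq0.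
have [i [j hij]] := noncoll l0.
have := hx (1, 0); have := hx (- (1, 0)); rewrite /PolygonCone.ev dotNl.
have := hmin_le P i0 ((1, 0) : R * R) i; have := hmin_le P i0 (- (1, 0) : R * R) j.
rewrite dotNl; move: (hmin _ _ _) (hmin _ _ _) (dot _ (emb x.1)) hij => A B D hij h1 h2 h3 h4.
have x1 : (x.2%:~R : R) < 0 by rewrite ltrz0.
have : x.2%:~R * (A + B) > 0 by rewrite nmulr_rgt0 //; lra.
rewrite mulrDr; lra.
Qed.

Lemma inC_deg0 z : inC (z, 0) -> z = 0.
Proof.
move=> hz; have h l : 0 <= dot l (emb z) by have := hz l; rewrite /PolygonCone.ev /= mul0r subr0.
have h0 l : dot l (emb z) = 0.
  by apply/eqP; rewrite eq_le h andbT -oppr_ge0 -dotNl h.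
have := h0 (1, 0); have := h0 (0, 1); rewrite /dot /= !mul0r !mul1r add0r addr0.
by move=> /eqP + /eqP; rewrite !intr_eq0; case: z {hz h h0} => z1 z2 /= /eqP -> /eqP ->.
Qed.

Lemma inC_monomial x : inC x -> exists m, mlt m = x.
Proof.
move=> hx; have := inC_ge0 hx; case ex : x.2 => [d|//] _; elim: d x ex hx => [|d IH] x ex hx.
  exists mnm0; rewrite mlt0; case: x ex hx => z e /= -> /inC_deg0 -> //.
have [i hi] : exists i, inC (x - PP i) by apply: (normal closedP) => //; rewrite ex.
have [|m mE] := IH (x - PP i) _ hi; first by rewrite /= ex; lia.
by exists (mnm_add m (mnm1 i)); rewrite mltD mlt1 mE subrK.
Qed.

(** The Koszul complex of S/I splits by multidegree. The chain f has components in finitely many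
    multidegrees; each bounds by hypothesis, and the bounding chains return to S through the choice
    of one monomial for each point of the cone. *)
Lemma Ivan_of_Avan p q : (forall M, M.2 = q -> Avan R P i0 k p M) -> Ivan I p q.
Proof.
move=> hA f sf hf kf.
have /choice[mon monP] x : exists m, inC x -> mlt m = x.
  have [/inC_monomial[m mx]|nx] := pselect (inC x); first by exists m.
  by exists mnm0.
pose c M T := csum (loc M T) (f T).
have sc M : supported p (c M) by move=> T Tp; rewrite /c sf // raddf0.
have lc M : located P M inC (c M).
  by move=> T /csum_neq0[m _ <-]; exact: inC_mlt.
have kosS_csum (h : {set 'I_N} -> S) M T :
    csum (loc M T) (kosS h T) = kosk (fun T => csum (loc M T) (h T)) T.
  rewrite /kosS /kosk /kos raddf_sum; apply: eq_bigr => i iT /=.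
  rewrite raddfMz /= /mulX csumMX mlt1; congr (csum _ _ *~ _).
  by rewrite (locU P M iT) addrK.
have kc M T : kosk (c M) T = 0 by rewrite -kosS_csum kf.
have /choice[b bP] M : exists b, M.2 = q -> [/\ supported p.+1 b, located P M inC b
    & forall T, kosk b T = c M T].
  case: (eqVneq M.2 q) => [Mq|/eqP nq]; last by exists (fun=> 0).
  by have [b hb] := hA M Mq (c M) (sc M) (lc M) (kc M); exists b.
(* A finite list containing every multidegree in which f has a nonzero component. *)
pose Ms := undup [seq mlt m + \sum_(i in (T : {set 'I_N})) PP i
  | T <- index_enum {set 'I_N}, m <- msupp (f T)].
have Ms2 M : M \in Ms -> M.2 = q.
  rewrite mem_undup => /allpairsPdep[T [m [_ mf ->]]] /=.
  case: (eqVneq #|T| p) => [Tp|/sf f0]; last by rewrite f0 msupp0 in mf.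
  rewrite mlt2 (hf T m mf) (raddf_sum (snd : {additive (int * int * int) -> int})) /=.
  by rewrite sumr_const natz Tp subrK.
have cMs M T : M \notin Ms -> c M T = 0.
  move=> MMs; apply: contraNeq MMs => /csum_neq0[m mf mM].
  rewrite mem_undup; apply/allpairsPdep; exists T, m; split=> //.
    by rewrite mem_index_enum.
  by rewrite mM /loc subrK.
exists (fun T => \sum_(M <- Ms) b M T *: mpolyX k (mon (loc M T))); split.
- move=> T Tp; rewrite big_seq big1 // => M /Ms2/bP[sb _ _].
  by rewrite sb // scale0r.
- move=> T; rewrite big_seq; apply: homz_sum => M MMs.
  have [sb lb _] := bP M (Ms2 M MMs).
  case: (eqVneq (b M T) 0) => [->|bT]; first by rewrite scale0r; exact: homz0.
  apply: homzZ; have := @homz_X k _ (mon (loc M T)); rewrite -(mlt2 P) monP; last exact: lb.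
  rewrite loc2 (Ms2 M MMs); case: (eqVneq #|T| p.+1) => [-> //|/sb e].
  by rewrite e eqxx in bT.
move=> T x; pose M := x + \sum_(i in T) PP i.
have xM : x = loc M T by rewrite /loc addrK.
rewrite raddfB /= xM kosS_csum; apply/eqP; rewrite subr_eq0; apply/eqP.
have bE T' : csum (loc M T') (\sum_(M <- Ms) b M T' *: mpolyX k (mon (loc M T')))
    = if M \in Ms then b M T' else 0.
  rewrite raddf_sum /=.
  have h M' : M' \in Ms -> csum (loc M T') (b M' T' *: mpolyX k (mon (loc M' T')))
      = if M' == M then b M T' else 0.
    move=> M'Ms; have [_ lb _] := bP M' (Ms2 M' M'Ms).
    rewrite linearZ /= csumX; case: (eqVneq M' M) => [<-|ne].
      case: (eqVneq (b M' T') 0) => [->|bT]; first by rewrite mul0r.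
      by rewrite monP ?eqxx ?mulr1 //; exact: lb.
    case: (eqVneq (b M' T') 0) => [->|bT]; first by rewrite mul0r.
    rewrite monP; last exact: lb.
    by rewrite (inj_eq (addIr _)) (negbTE ne) mulr0.
  rewrite big_seq (eq_bigr _ h) -big_seq; case: ifP => MMs.
    by rewrite (bigD1_seq M) ?undup_uniq //= eqxx big1 ?addr0 // => M' /negbTE ->.
  rewrite big_seq big1 // => M' M'Ms; case: eqP => // e.
  by rewrite -e M'Ms in MMs.
rewrite (eq_kosk _ bE) -/(c M T); case: (boolP (M \in Ms)) => MMs; last first.
  rewrite cMs //; apply/esym; rewrite /kosk /kos big1 // => i _.
  by rewrite raddf0 mul0rz.
by have [_ _ ->] := bP M (Ms2 M MMs).
Qed.

Lemma Lvan_empty p M :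
  (forall T : {set 'I_N}, #|T| = p -> ~ intC (- loc M T)) -> Lvan R P i0 k p M.
Proof.
move=> hE h sh _; exists (fun=> 0) => // T iT.
rewrite sh; first by rewrite /kosk /kos big1 // => i _; rewrite raddf0 mul0rz.
by apply/eqP => /hE; apply.
Qed.

(** For sets of p + 3 points the height of [- loc M T] is p + 3 - q, and interior points have
    positive height. *)
Lemma Ivan_top p (q : int) : p%:Z + 3 <= q -> Ivan I p q.
Proof.
move=> pq; apply: Ivan_of_Avan => M M2; apply: ishida => //.
apply: Lvan_empty => T Tp /(intC_pos noncoll); rewrite /= -[- _]/(- (loc M T).2) loc2; lia.
Qed.

Lemma Ivan_size p (q : int) : (N < p.+3)%N -> Ivan I p q.
Proof.
move=> pN; apply: Ivan_of_Avan => M M2; apply: ishida => //.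
by apply: Lvan_empty => T Tp _; have := subset_leq_card (subsetT T); rewrite cardsT card_ord Tp; lia.
Qed.

Lemma Ivan_no_interior p (q : int) : (forall i, ~ intC (PP i)) -> q = p%:Z + 2 -> Ivan I p q.
Proof.
move=> ni pq; apply: Ivan_of_Avan => M M2; apply: ishida => //.
apply: Lvan_empty => T Tp hT; have xE : - loc M T = ((- loc M T).1, 1).
  rewrite [LHS]surjective_pairing; congr (_, _).
  rewrite -[RHS]/1 -[LHS]/(- (loc M T).2) loc2; lia.
have [i Pi] : exists i, P i = (- loc M T).1 by apply/closedP/intC_inC; rewrite -xE.
by apply: (ni i); rewrite /PolygonCone.PP Pi -xE.
Qed.

(** Only the set T of all points matters, at height 2. By [interior_decomp] some T minus i again
    lies over an interior point, and the cycle condition there has the single term [h T]. *)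
Lemma Ivan_interior p (q : int) u : intC (PP u) -> N = p.+3 -> q = p%:Z + 1 -> Ivan I p q.
Proof.
move=> iu Np pq; apply: Ivan_of_Avan => M M2; apply: ishida => //.
move=> h sh kh; exists (fun=> 0) => // T iT.
have -> : kosk (fun=> 0) T = 0 :> k by rewrite /kosk /kos big1 // => i _; rewrite raddf0 mul0rz.
case: (eqVneq #|T| p.+3) => [Tp|/sh -> //].
have x2 : (- loc M T).2 = 2 by rewrite -[LHS]/(- (loc M T).2) loc2; lia.
have [i ii] := interior_decomp closedP x2 iT iu.
have Tfull : T = [set: 'I_N].
  by apply/eqP; rewrite eqEcard subsetT cardsT card_ord Tp /=; lia.
have iT' : i \in T by rewrite Tfull inE.
have := kh (T :\ i); rewrite locD // opprD => /(_ ii).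
have ni j : (j \notin T :\ i) = (j == i).
  by rewrite Tfull !inE andbT negbK.
rewrite /kosk /kos (bigD1 i) /= ?ni // big1 => [|j /andP[]]; last first.
  by rewrite ni => ->.
rewrite addr0 setD1K //= => e.
by rewrite -[h T]mulr1z -(ksgn_sqr i (T :\ i)) mulrzA e mul0rz.
Qed.
End Bridge.

End LatticeIdeals.

(** * Backward differences and sequences of quadratic growth *)

Module FiniteDifferences.
Import KoszulContraction PolynomialKoszul PlaneGordan PolygonCone NormalFan SupportArcs
  IshidaComplex HeightOne LatticeIdeals.

Section Differences.
Implicit Types (u v : int -> int) (z : int).

Definition Bd u z : int := u z - u (z - 1).

Lemma iter_BdS n u z : iter n.+1 Bd u z = iter n Bd u z - iter n Bd u (z - 1).
Proof. by []. Qed.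

Lemma iter_Bd_sets (I : finType) (A : {set I}) u z :
  \sum_(T : {set I} | T \subset A) (-1) ^+ #|T| * u (z - #|T|%:Z) = iter #|A| Bd u z.
Proof.
move Ea : #|A| => n; elim: n A u Ea => [|n IH] A u Ea.
  rewrite (big_pred1 set0) => [|T].
    by rewrite cards0 subr0 mul1r.
  have /eqP -> : A == set0 by rewrite -cards_eq0 Ea.
  by rewrite subset0.
have [v vA] : exists w : I, w \in A by apply/set0Pn; rewrite -cards_eq0 Ea.
rewrite iterSr -(IH (A :\ v)); last by have := cardsD1 v A; rewrite vA Ea => -[].
rewrite (bigID (fun T : {set I} => v \in T)) /= addrC.
have e1 : \sum_(T : {set I} | (T \subset A) && (v \notin T)) (-1) ^+ #|T| * u (z - #|T|%:Z)
    = \sum_(T : {set I} | T \subset A :\ v) (-1) ^+ #|T| * u (z - #|T|%:Z).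
  by apply: eq_bigl => T; rewrite subsetD1.
rewrite {}e1.
rewrite [Y in _ + Y](reindex_onto (fun T => v |: T) (fun T => T :\ v)) /=; last first.
  by move=> T /andP[_ vT]; rewrite setD1K.
rewrite [Y in _ + Y](eq_bigl (fun T : {set I} => T \subset A :\ v)); last first.
  move=> T; rewrite setU11 andbT subUset sub1set vA /= subsetD1.
  case: (boolP (v \in T)) => vT; last by rewrite setU1K ?eqxx.
  rewrite andbF; case: eqP => [e|_]; rewrite ?andbF //.
  by move: vT; rewrite -e setD11.
rewrite -big_split; apply: eq_bigr => T; rewrite subsetD1 => /andP[_ vT] /=.
rewrite cardsU1 vT add1n exprS /Bd mulrBr; congr (_ + _).
by rewrite mulN1r mulNr; congr (- (_ * u _)); lia.
Qed.

Lemma iter_Bd_setT n u z :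
  \sum_(T : {set 'I_n}) (-1) ^+ #|T| * u (z - #|T|%:Z) = iter n Bd u z.
Proof.
rewrite -[n in RHS]card_ord -cardsT -iter_Bd_sets.
by apply: eq_bigl => T; rewrite subsetT.
Qed.

Lemma iter_BdD n u v z : iter n Bd (fun z => u z + v z) z = iter n Bd u z + iter n Bd v z.
Proof.
elim: n z => [z|n IH z].
  by [].
rewrite !iter_BdS.
rewrite !IH.
by rewrite opprD addrACA.
Qed.
Lemma iter_BdZ n c u z : iter n Bd (fun z => c * u z) z = c * iter n Bd u z.
Proof.
elim: n z => [z|n IH z]; first by [].
by rewrite !iter_BdS !IH mulrBr.
Qed.
Lemma eq_Bd n u v z : u =1 v -> iter n Bd u z = iter n Bd v z.
Proof. by move=> /funext ->. Qed.
Lemma iter_Bd_shift n u c z : iter n Bd (fun z => u (z - c)) z = iter n Bd u (z - c).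
Proof.
elim: n z => [z|n IH z]; first by [].
by rewrite !iter_BdS !IH [z - 1 - c]addrAC.
Qed.

Lemma iter_Bd_quadratic n (a b c z : int) : (2 < n)%N ->
  iter n Bd (fun z => a + b * z + c * z * z) z = 0.
Proof.
case: n => [|[|[|n]]] // _; rewrite -[n.+3]addn3 iterD.
rewrite (@eq_Bd n _ (fun _ => 0)); last by move=> x; rewrite /= /Bd; ring.
elim: n z => [z|n IH z]; first by [].
by rewrite !iter_BdS !IH.
Qed.

Lemma Bd_bound n u (C : int) : 0 <= C ->
  (forall z, 0 <= z -> `|u z| <= C * (z + 1) ^+ 2) ->
  exists2 C' : int, 0 <= C' & forall z, n%:Z <= z -> `|iter n Bd u z| <= C' * (z + 1) ^+ 2.
Proof.
move=> C0 hu; elim: n => [|n [C' C'0 IH]]; first by exists C.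
exists (C' * 2); first by lia.
move=> z nz; rewrite iter_BdS; apply: (le_trans (ler_normB _ _)).
rewrite -mulrA mulrDl mul1r mulrDr lerD //; first by apply: IH; lia.
apply: (@le_trans _ _ (C' * (z - 1 + 1) ^+ 2)); first by apply: IH; lia.
by rewrite ler_wpM2l // ler_sqr ?nnegrE; lia.
Qed.

Lemma sqr_bounds z : 0 <= z ->
  [/\ 1 <= (z + 1) ^+ 2, z <= (z + 1) ^+ 2 & z * (z - 1) <= (z + 1) ^+ 2].
Proof. by move=> z0; rewrite expr2; split; nia. Qed.

(* A sequence with constant third differences kappa is kappa d^3 / 6 up to a quadratic. *)
Lemma third_diff (v : nat -> int) (C kappa : int) : 0 <= C ->
  (forall d : nat, v d.+3 - 3 * v d.+2 + 3 * v d.+1 - v d = kappa) ->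
  (forall d : nat, `|v d| <= C * (d%:Z + 1) ^+ 2) -> kappa = 0.
Proof.
move=> C0 hv bv.
pose c1 := v 1%N - v 0%N; pose c2 := v 2%N - 2 * v 1%N + v 0%N.
have ev d : 6 * v d = 6 * v 0%N + 6 * c1 * d%:Z + 3 * c2 * (d%:Z * (d%:Z - 1))
    + kappa * (d%:Z * (d%:Z - 1) * (d%:Z - 2)).
  suff [] : (fun d => 6 * v d = 6 * v 0%N + 6 * c1 * d%:Z + 3 * c2 * (d%:Z * (d%:Z - 1))
    + kappa * (d%:Z * (d%:Z - 1) * (d%:Z - 2))) d /\
   (fun d => 6 * v d = 6 * v 0%N + 6 * c1 * d%:Z + 3 * c2 * (d%:Z * (d%:Z - 1))
    + kappa * (d%:Z * (d%:Z - 1) * (d%:Z - 2))) d.+1 /\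
   (fun d => 6 * v d = 6 * v 0%N + 6 * c1 * d%:Z + 3 * c2 * (d%:Z * (d%:Z - 1))
    + kappa * (d%:Z * (d%:Z - 1) * (d%:Z - 2))) d.+2 by [].
  elim: d => [|d [h0 [h1 h2]]] /=.
    by rewrite /c1 /c2; split; [|split]; ring.
  split=> //; split=> //.
  have -> : v d.+3 = 3 * v d.+2 - 3 * v d.+1 + v d + kappa by rewrite -(hv d); ring.
  have -> : 6 * (3 * v d.+2 - 3 * v d.+1 + v d + kappa)
    = 3 * (6 * v d.+2) - 3 * (6 * v d.+1) + 6 * v d + 6 * kappa by ring.
  rewrite h0 h1 h2 -(addn3 d) -(addn2 d) -(addn1 d) !PoszD; ring.
move: c1 c2 ev => c1 c2 ev; clear hv; apply/eqP/negPn/negP => k0.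
pose A : int := 6 * C + 6 * `|v 0%N| + 6 * `|c1| + 3 * `|c2|.
have A0 : 0 <= A by rewrite /A; lia.
(* At d = t + 3 the cubic term is at least (t + 1)^3 in absolute value, while (d + 1)^2 is at most
   16 (t + 1)^2; with t = 16 A the bound A (d + 1)^2 falls short. *)
pose t : int := 16 * A; have t0 : 0 <= t by rewrite /t; lia.
pose d := absz (t + 3); have dE : d%:Z = t + 3 by rewrite /d; lia.
have h1 : `|kappa * (d%:Z * (d%:Z - 1) * (d%:Z - 2))| <= A * (d%:Z + 1) ^+ 2.
  have -> : kappa * (d%:Z * (d%:Z - 1) * (d%:Z - 2)) =
    6 * v d - 6 * v 0%N - 6 * (c1 * d%:Z) - 3 * (c2 * (d%:Z * (d%:Z - 1)))
    by rewrite ev; ring.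
  have d1 : 0 <= d%:Z * (d%:Z - 1) by rewrite dE; nia.
  have [q1 q2 q3] := sqr_bounds (isT : 0 <= d%:Z).
  move: ((d%:Z + 1) ^+ 2) q1 q2 q3 (bv d) => Q q1 q2 q3 bd.
  have hv0 : `|v 0%N| <= `|v 0%N| * Q by rewrite ler_peMr.
  have hc1 : `|c1 * d%:Z| <= `|c1| * Q by rewrite normrM ler_wpM2l.
  have hc2 : `|c2 * (d%:Z * (d%:Z - 1))| <= `|c2| * Q.
    by rewrite normrM ler_wpM2l // ger0_norm.
  have -> : A * Q = 6 * (C * Q) + 6 * (`|v 0%N| * Q) + 6 * (`|c1| * Q) + 3 * (`|c2| * Q).
    by rewrite /A; ring.
  move: bd hv0 hc1 hc2.
  move: (C * Q) (`|v 0%N| * Q) (`|c1| * Q) (`|c2| * Q) (c1 * d%:Z) (c2 * _) (v d) (v 0%N).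
  by clear; move=> ????????; lia.
have h2 : (t + 1) ^+ 3 <= `|kappa * (d%:Z * (d%:Z - 1) * (d%:Z - 2))|.
  rewrite normrM dE; have -> : (t + 3) * (t + 3 - 1) * (t + 3 - 2) = (t + 3) * (t + 2) * (t + 1) by ring.
  have p0 : 0 <= (t + 3) * (t + 2) * (t + 1) by rewrite !mulr_ge0 //; clear -t0; lia.
  rewrite (ger0_norm p0); apply: (@le_trans _ _ ((t + 3) * (t + 2) * (t + 1))).
    rewrite !exprS expr0 mulr1 mulrA ler_wpM2r //; first by lia.
    by apply: ler_pM; lia.
  by rewrite ler_peMl //; lia.
have h3 : (d%:Z + 1) ^+ 2 <= 16 * (t + 1) ^+ 2.
  have -> : 16 * (t + 1) ^+ 2 = (4 * (t + 1)) ^+ 2 by ring.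
  by rewrite dE ler_sqr ?nnegrE; clear -t0; lia.
have h4 : (t + 1) ^+ 3 <= t * (t + 1) ^+ 2.
  apply: (le_trans h2); apply: (le_trans h1).
  have -> : t * (t + 1) ^+ 2 = A * (16 * (t + 1) ^+ 2) by rewrite /t; ring.
  by rewrite ler_wpM2l.
have : (t + 1) ^+ 2 <= 0 by rewrite exprS mulrDl mul1r in h4; lia.
by rewrite expr2; nia.
Qed.

(** Orders are lowered one at a time: when the difference of order m + 4 vanishes, the one of order
    m + 3 is constant, and the quadratic growth of the m-th difference forces that constant to be
    0. *)
Lemma Bd_quadratic_growth m u (C : int) : 0 <= C ->
  (forall z, 0 <= z -> `|u z| <= C * (z + 1) ^+ 2) ->
  (forall z, m.+3%:Z <= z -> iter m.+3 Bd u z = 0) ->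
  forall z, 3 <= z -> iter 3 Bd u z = 0.
Proof.
move=> C0 bu; elim: m => // m IH hm; apply: IH.
have [C' C'0 bw] := Bd_bound m C0 bu.
pose kappa := iter m.+3 Bd u m.+3%:Z.
have kap (d : nat) : iter m.+3 Bd u (m.+3%:Z + d%:Z) = kappa.
  elim: d => [|d <-]; first by rewrite addr0.
  have := hm (m.+3%:Z + d.+1%:Z); rewrite iter_BdS => /(_ _)/subr0_eq -> //; last by lia.
  by congr (iter _ _ _ _); lia.
suff k0 : kappa = 0 by move=> z mz;
    have := kap (absz (z - m.+3%:Z)); rewrite k0 => <-; congr (iter _ _ _ _); lia.
pose v (d : nat) := iter m Bd u (m%:Z + d%:Z).
apply: (@third_diff v (C' * (m%:Z + 1) ^+ 2)) => [|d|d].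
- by rewrite mulr_ge0 // sqr_ge0.
- rewrite -(kap d) !iter_BdS /v.
  have <- : m%:Z + d.+3%:Z = m.+3%:Z + d%:Z by lia.
  have -> : m%:Z + d.+2%:Z = m%:Z + d.+3%:Z - 1 by lia.
  have -> : m%:Z + d.+1%:Z = m%:Z + d.+3%:Z - 1 - 1 by lia.
  have -> : m%:Z + d%:Z = m%:Z + d.+3%:Z - 1 - 1 - 1 by lia.
  ring.
apply: (le_trans (bw _ _)); first by lia.
rewrite -mulrA ler_wpM2l // -exprMn; rewrite ler_sqr ?nnegrE; nia.
Qed.

End Differences.

End FiniteDifferences.

(** * Euler characteristic of the Ishida complex *)

Module AlternatingCone.
Import KoszulContraction PolynomialKoszul PlaneGordan PolygonCone NormalFan SupportArcs
  IshidaComplex HeightOne LatticeIdeals FiniteDifferences.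

Section EulerCharacteristic.
Variables (R : realFieldType) (N : nat) (P : 'I_N -> int * int) (i0 : 'I_N).
Local Notation emb := (@emb R).
Local Notation ev := (@ev R N P i0).
Local Notation inC := (@inC R N P i0).
Local Notation intC := (@intC R N P i0).
Local Notation PP := (@PP N P).
Local Notation loc := (@loc N P).
Implicit Types (x M : int * int * int) (T : {set 'I_N}).

Hypothesis noncoll : forall l, l != 0 -> exists i j, dot l (emb (P i)) < dot l (emb (P j)).

(** Toggling v in T is a sign-reversing involution. *)
Lemma alternating_toggle (f : int * int * int -> int) v M :
  (forall x, f (x + PP v) = f x) -> \sum_(T : {set 'I_N}) (-1) ^+ #|T| * f (loc M T) = 0.
Proof.
move=> fv; rewrite (bigID (fun T : {set 'I_N} => v \in T)) /=.
rewrite (reindex_onto (fun T => v |: T) (fun T => T :\ v)) /=; last first.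
  by move=> T vT; rewrite setD1K.
rewrite [Y in Y + _](eq_bigl (fun T : {set 'I_N} => v \notin T)); last first.
  move=> T; rewrite setU11 /=; case: (boolP (v \in T)) => vT; last by rewrite setU1K ?eqxx.
  by case: eqP => // e; move: vT; rewrite -e setD11.
rewrite -big_split big1 //= => T vT.
rewrite cardsU1 vT add1n exprS (locU P M vT) fv; ring.
Qed.

Definition ind (A : int * int * int -> Prop) x : int := `[< A x >]%:R.

(** The numerical shadow of [ishida]: the indicator of the cone is 1, minus that of the opposite of
    the interior, minus those of the half-spaces, plus those of their consecutive intersections. All
    but the two cones are killed by toggling a vertex. *)
Lemma alternating_cone M :
  \sum_(T : {set 'I_N}) (-1) ^+ #|T| * ind inC (loc M T) =
  - \sum_(T : {set 'I_N}) (-1) ^+ #|T| * ind (fun x => intC (- x)) (loc M T).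
Proof.
have [b [m [m2 bdet borth]]] := fan_data R P.
pose w := dirs b m; pose r := (m + m)%N.
have r0 : (0 < r)%N by rewrite /r; lia.
pose pos x (i : nat) : bool := 0 <= ev (w i) x.
pose U (i : nat) x : int := (pos x i)%:R.
pose V (i : nat) x : int := (pos x i && pos x (nxt m i))%:R.
have inCE x : `[< inC x >] = [forall i : 'I_r, pos x i].
  apply/asboolP/forallP => [h i|h]; first exact: h.
  by apply: (inC_dirs m2 bdet borth) => i ir; exact: (h (Ordinal ir)).
have intCE x : `[< intC (- x) >] = [forall i : 'I_r, ~~ pos x i].
  apply/asboolP/forallP => [h i|h].
    by have := h (w i) (dirs_neq0 m2 bdet (ltn_ord i)); rewrite evN oppr_gt0 -ltNge.
  apply: (intC_dirs m2 bdet borth) => i ir.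
  by have := h (Ordinal ir); rewrite /pos -ltNge /= evN oppr_gt0.
(* The positive indices form a cyclic interval, so a proper one has one end. *)
have ends x : \sum_(i < r) (pos x i && ~~ pos x (nxt m i))%:R =
    1 - ind inC x - ind (fun x => intC (- x)) x :> int.
  rewrite /ind inCE intCE.
  case: (boolP [forall i : 'I_r, pos x i]) => [/forallP hp|].
    rewrite big1 => [|i _].
      case: forallP => [/(_ (Ordinal r0))|]; last by [].
      by rewrite (hp (Ordinal r0)).
    by have := hp (Ordinal (nxt_lt m2 (ltn_ord i))); rewrite /= => ->; rewrite andbF.
  rewrite negb_forall => /existsP[g ng].
  case: (boolP [forall i : 'I_r, ~~ pos x i]) => [/forallP hn|].
    by rewrite big1 // => i _; rewrite (negbTE (hn i)).
  rewrite negb_forall => /existsP[p]; rewrite negbK => pp.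
  have [i0' /andP[pi npi]] : exists i : 'I_r, pos x i && ~~ pos x (nxt m i).
    apply/existsP; apply: contraLR ng; rewrite negb_exists => /forallP h; rewrite negbK.
    have step (i : nat) : (i < r)%N -> pos x i -> pos x (nxt m i).
      by move=> ir pi; have := h (Ordinal ir); rewrite /= pi negbK.
    have up (i j : nat) : (i + j < r)%N -> pos x i -> pos x (i + j)%N.
      elim: j => [|j IH] ij pi; first by rewrite addn0.
      have := step (i + j)%N; rewrite /nxt -/r ifF; last by apply/eqP; lia.
      by rewrite addnS => -> //; [lia|apply: IH => //; lia].
    have p0 : pos x 0%N.
      have := step r.-1; rewrite /nxt -/r prednK // eqxx => -> //.
      have -> : r.-1 = (p + (r.-1 - p))%N by have := ltn_ord p; lia.
      by apply: up => //; have := ltn_ord p; lia.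
    by have := up 0%N g; rewrite add0n => ->.
  rewrite (bigD1 i0') //= pi npi big1 ?addr0 ?subr0 // => i ne.
  case: (boolP (pos x i)) => //= pi'; case: (boolP (pos x (nxt m i))) => //= npi'.
  (* Two ends would give two negative indices with nonnegative ones on both sides of them, against
     [neg_arc]. *)
  have nb : forall j j' : 'I_r, (j < j')%N -> pos x j -> ~~ pos x (nxt m j) ->
      pos x j' -> ~~ pos x (nxt m j') -> False.
    move=> j j' jj pj nj pj' nj'.
    have jr : (j.+1 < r)%N := leq_ltn_trans jj (ltn_ord j').
    have jn : nxt m j = j.+1 by rewrite /nxt -/r (ltn_eqF jr).
    rewrite jn in nj; have sj : (j.+1 < j')%N.
      rewrite ltn_neqAle jj andbT; apply: contraNneq nj => ->; exact: pj'.
    have hj : ev (w j.+1) x < 0 by rewrite ltNge.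
    case: (eqVneq j'.+1 r) => [jr'|jr'].
      have j0 : nxt m j' = 0%N by rewrite /nxt -/r jr' eqxx.
      rewrite j0 in nj'; have h0 : ev (w 0%N) x < 0 by rewrite ltNge.
      have hh : (0 < j.+1 < r)%N by [].
      case: (neg_arc noncoll m2 bdet hh h0 hj) => hz.
        case: (posnP j) => j00; first by move: pj; rewrite /pos j00 leNgt h0.
        by move: pj; rewrite /pos leNgt hz // j00 ltnSn.
      by move: pj'; rewrite /pos leNgt hz // sj orbT.
    have jn' : nxt m j' = j'.+1 by rewrite /nxt -/r (negbTE jr').
    rewrite jn' in nj'; have h' : ev (w j'.+1) x < 0 by rewrite ltNge.
    have hh : (j.+1 < j'.+1 < r)%N by rewrite ltnS jj ltn_neqAle jr' ltn_ord.
    case: (neg_arc noncoll m2 bdet hh hj h') => hz.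
      by move: pj'; rewrite /pos leNgt hz // sj ltnSn.
    by move: pj; rewrite /pos leNgt hz ?ltnSn.
  by case: (ltngtP i i0') => [h|h|/val_inj e];
    [case: (nb _ _ h)|case: (nb _ _ h)|rewrite e eqxx in ne].
have decomp x : ind inC x = 1 - ind (fun x => intC (- x)) x
    - \sum_(i < r) U i x + \sum_(i < r) V i x.
  have -> : \sum_(i < r) U i x = \sum_(i < r) V i x
      + \sum_(i < r) (pos x i && ~~ pos x (nxt m i))%:R.
    rewrite -big_split; apply: eq_bigr => i _; rewrite /U /V.
    by case: (pos x i); case: (pos x _).
  by rewrite ends; ring.
have U0 (i : nat) : (i < r)%N -> \sum_(T : {set 'I_N}) (-1) ^+ #|T| * U i (loc M T) = 0.
  move=> ir; have [v [v1 _]] := dirs_vertex i0 m2 bdet borth ir.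
  by apply: (alternating_toggle (v := v)) => x; rewrite /U /pos evD v1 addr0.
have V0 (i : nat) : (i < r)%N -> \sum_(T : {set 'I_N}) (-1) ^+ #|T| * V i (loc M T) = 0.
  move=> ir; have [v [v1 v2]] := dirs_vertex i0 m2 bdet borth ir.
  by apply: (alternating_toggle (v := v)) => x; rewrite /V /pos !evD v1 v2 !addr0.
have one0 : \sum_(T : {set 'I_N}) (-1) ^+ #|T| * 1 = 0 :> int.
  exact: (@alternating_toggle (fun=> 1) i0 M).
under eq_bigr do rewrite decomp mulrDr mulrBr mulrBr.
rewrite !big_split /= !sumrN one0 sub0r.
rewrite (_ : \sum_(T : {set 'I_N}) _ * \sum_(i < r) U i _ = 0) ?subr0; last first.
  under eq_bigr do rewrite mulr_sumr.
  by rewrite exchange_big big1 //= => i _; exact: U0.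
rewrite (_ : \sum_(T : {set 'I_N}) _ * \sum_(i < r) V i _ = 0) ?addr0 //.
under eq_bigr do rewrite mulr_sumr.
by rewrite exchange_big big1 //= => i _; exact: V0.
Qed.
End EulerCharacteristic.

End AlternatingCone.

(** * Lattice point counts, reciprocity and the Ehrhart polynomial *)

Module EhrhartCount.
Import KoszulContraction PolynomialKoszul PlaneGordan PolygonCone NormalFan SupportArcs
  IshidaComplex HeightOne LatticeIdeals FiniteDifferences AlternatingCone.

Section Extrapolation.
Variable h : int -> int.
Hypothesis h0 : forall z, 0 <= z -> h z = 0.

Lemma iter_Bd_ge0 m z : m%:Z <= z -> iter m Bd h z = 0.
Proof.
elim: m z => [|m IH] z hz; first exact: h0.
have z1 : m%:Z <= z - 1 by lia.
have z2 : m%:Z <= z by lia.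
by rewrite iter_BdS (IH _ z1) (IH _ z2) subrr.
Qed.

(** For a function supported on the negative integers, the m-th difference at m - 1 reaches down
    exactly to the argument -1. *)
Lemma iter_Bd_pred1 m : iter m Bd h (m%:Z - 1) = (-1) ^+ m * h (- 1).
Proof.
elim: m => [|m IH]; first by rewrite mul1r sub0r.
have e : m.+1%:Z - 1 = m%:Z by lia.
by rewrite iter_BdS e IH (iter_Bd_ge0 (lexx _)) sub0r exprS mulN1r mulNr.
Qed.

Lemma iter_Bd_pred2 m : iter m Bd h (m%:Z - 2) = (-1) ^+ m * (h (- 2) - m%:Z * h (- 1)).
Proof.
elim: m => [|m IH]; first by rewrite mul1r sub0r mul0r subr0.
have e1 : m.+1%:Z - 2 = m%:Z - 1 by lia.
have e2 : m%:Z - 1 - 1 = m%:Z - 2 by lia.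
have e3 : m.+1%:Z = m%:Z + 1 by lia.
by rewrite iter_BdS e1 e2 iter_Bd_pred1 IH exprS e3; ring.
Qed.
End Extrapolation.

Section Counting.
Variables (R : realFieldType) (N : nat) (P : 'I_N -> int * int) (i0 : 'I_N).
Local Notation emb := (@emb R).
Local Notation ev := (@ev R N P i0).
Local Notation inC := (@inC R N P i0).
Local Notation intC := (@intC R N P i0).
Local Notation PP := (@PP N P).
Local Notation loc := (@loc N P).
Implicit Types (x M : int * int * int) (T : {set 'I_N}) (d : int).

Hypothesis closedP : forall z, inC (z, 1) -> exists i, P i = z.
Hypothesis noncoll : forall l, l != 0 -> exists i j, dot l (emb (P i)) < dot l (emb (P j)).
Hypothesis Pinj : injective P.

Definition box (n : nat) : seq (int * int) :=
  [seq (i%:Z - n%:Z, j%:Z - n%:Z) | i <- iota 0 n.*2.+1, j <- iota 0 n.*2.+1].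

Lemma mem_box n z : (z \in box n) = (`|z.1| <= n%:Z) && (`|z.2| <= n%:Z).
Proof.
apply/allpairsP/idP => [[[i j] []]|/andP[h1 h2]].
  by rewrite !mem_iota => hi hj -> /=; move: hi hj => /=; lia.
case: z h1 h2 => z1 z2 h1 h2; rewrite /= in h1 h2.
exists (absz (z1 + n%:Z), absz (z2 + n%:Z)); split.
- rewrite mem_iota [(_, _).1]/=; lia.
- rewrite mem_iota [(_, _).2]/=; lia.
by rewrite [(_, _).1]/= [(_, _).2]/=; congr (_, _); lia.
Qed.

Lemma box_uniq n : uniq (box n).
Proof.
apply: allpairs_uniq; rewrite ?iota_uniq // => -[i j] [i' j'] _ _ /= [e1 e2].
by congr (_, _); lia.
Qed.

Lemma size_box n : size (box n) = (n.*2.+1 * n.*2.+1)%N.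
Proof. by rewrite size_allpairs size_iota. Qed.

Lemma cone_bounded : exists K : nat, forall z d, inC (z, d) -> z \in box (K * absz d).
Proof.
have [K hK] : exists K : nat, forall i, `|(P i).1| <= K%:Z /\ `|(P i).2| <= K%:Z.
  exists (\sum_i (absz (P i).1 + absz (P i).2))%N => i.
  by rewrite (bigD1 i) //=; lia.
exists K => z d hz; have d0 : 0 <= d by exact: (inC_ge0 noncoll hz).
have low l : (forall i, - K%:Z%:~R <= dot l (emb (P i))) -> - (K%:Z * d)%:~R <= dot l (emb z).
  move=> hl; have := hz l; rewrite /PolygonCone.ev /= subr_ge0; apply: le_trans.
  rewrite intrM -mulNr mulrC ler_wpM2l ?ler0z //.
  by have [i ->] := hminP P i0 l.
have K1 i : - K%:Z%:~R <= (P i).1%:~R :> R by have [h _] := hK i; rewrite -mulrNz ler_int; lia.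
have K2 i : (P i).1%:~R <= K%:Z%:~R :> R by have [h _] := hK i; rewrite ler_int; lia.
have K3 i : - K%:Z%:~R <= (P i).2%:~R :> R by have [_ h] := hK i; rewrite -mulrNz ler_int; lia.
have K4 i : (P i).2%:~R <= K%:Z%:~R :> R by have [_ h] := hK i; rewrite ler_int; lia.
have e1 u : dot (1, 0) (emb u) = u.1%:~R by rewrite /dot /=; ring.
have e2 u : dot (0, 1) (emb u) = u.2%:~R by rewrite /dot /=; ring.
have h1 : - (K%:Z * d)%:~R <= dot (- (0, 1)) (emb z).
  by apply: low => i; rewrite dotNl e2 lerN2.
have h2 : - (K%:Z * d)%:~R <= dot (0, 1) (emb z) by apply: low => i; rewrite e2.
have h3 : - (K%:Z * d)%:~R <= dot (- (1, 0)) (emb z).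
  by apply: low => i; rewrite dotNl e1 lerN2.
have h4 : - (K%:Z * d)%:~R <= dot (1, 0) (emb z) by apply: low => i; rewrite e1.
move: h1 h2 h3 h4; rewrite !dotNl !e1 !e2 -!mulrNz !ler_int => h1 h2 h3 h4.
rewrite lerN2 in h1; rewrite lerN2 in h3.
by rewrite mem_box PoszM gez0_abs // !ler_norml h1 h2 h3 h4.
Qed.

Variable K : nat.
Hypothesis KP : forall z d, inC (z, d) -> z \in box (K * absz d).

(* The numbers of lattice points of the d-th dilate, and of its interior
   indexed by negative d. *)
Definition cnt (A : int * int * int -> Prop) d : int :=
  (size [seq z <- box (K * absz d) | `[< A (z, d) >]])%:Z.

Definition ecount d := cnt inC d.
Definition icount d := cnt (fun x => intC (- x)) d.

Lemma cnt_box A B d : (forall z, A (z, d) -> z \in box (K * absz d)) ->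
  (K * absz d <= B)%N -> cnt A d = (size [seq z <- box B | `[< A (z, d) >]])%:Z.
Proof.
move=> AK KB; congr Posz; apply: perm_size; apply: uniq_perm.
- by rewrite filter_uniq // box_uniq.
- by rewrite filter_uniq // box_uniq.
move=> z; rewrite !mem_filter; case: asboolP => //= Az.
rewrite AK //; apply/esym; have := AK z Az; rewrite !mem_box; lia.
Qed.

Lemma intN_box z d : intC (- (z, d)) -> z \in box (K * absz d).
Proof.
move=> /intC_inC h; have := KP (z := - z) (d := - d) h.
by rewrite !mem_box /= !normrN abszN.
Qed.

(** A finite list of the multidegrees of height q that can contribute when the region counted is
    bounded by the boxes. *)
Definition levels (q : int) : seq (int * int * int) :=
  undup [seq ((z : int * int) + (\sum_(i in (T : {set 'I_N})) PP i).1, q) |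
    T <- index_enum {set 'I_N}, z <- box (K * (absz q + N))].

Lemma iter_Bd_level A q : (forall z d, A (z, d) -> z \in box (K * absz d)) ->
  iter N Bd (cnt A) q =
    \sum_(M <- levels q) \sum_(T : {set 'I_N}) (-1) ^+ #|T| * ind A (loc M T).
Proof.
move=> AK; rewrite exchange_big -iter_Bd_setT; apply: eq_bigr => T _ /=.
rewrite -mulr_sumr; congr (_ * _).
have TN : (#|T| <= N)%N by have := subset_leq_card (subsetT T); rewrite cardsT card_ord.
have qT : (absz (q - #|T|%:Z)%R <= absz q + N)%N by move: #|T| TN => t; lia.
have KB : (K * absz (q - #|T|%:Z)%R <= K * (absz q + N))%N by rewrite leq_mul2l qT orbT.
rewrite (cnt_box (fun z => AK z _) KB).
transitivity ((size [seq M <- levels q | `[< A (loc M T) >]])%:Z); last first.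
  rewrite size_filter -sum1_count -natz natr_sum [LHS]big_mkcond.
  by apply: eq_bigr => M _; rewrite /ind; case: asboolP.
rewrite -(size_map (fun M => (loc M T).1) [seq M <- levels q | _]); congr Posz.
have q2 M : M \in levels q -> M.2 = q by rewrite mem_undup => /allpairsPdep[? [? [_ _ ->]]].
have locE M : M \in levels q -> loc M T = ((loc M T).1, q - #|T|%:Z).
  by move=> /q2 <-; rewrite -(loc2 P M T); case: (loc M T).
apply: perm_size; apply: uniq_perm.
- by rewrite filter_uniq // box_uniq.
- rewrite map_inj_in_uniq ?filter_uniq ?undup_uniq // => M M'.
  rewrite !mem_filter => /andP[_ hM] /andP[_ hM'] e.
  have : loc M T = loc M' T by rewrite locE // [RHS]locE // e.
  by rewrite /loc => /addIr.
move=> z; rewrite mem_filter; apply/andP/mapP => [[/asboolP Az zB]|[M]].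
  exists (z + (\sum_(i in T) PP i).1, q).
    rewrite mem_filter mem_undup; apply/andP; split; last first.
      by apply/allpairsPdep; exists T, z; rewrite mem_index_enum.
    apply/asboolP; move: Az; congr A; apply: eq_triple; rewrite ?loc2 //=.
      by rewrite addrK.
    by rewrite addrK.
  by rewrite /loc /= addrK.
rewrite mem_filter => /andP[/asboolP AM Ml] ->.
rewrite locE // in AM; split; first exact/asboolP.
have := AK _ _ AM; rewrite !mem_box => /andP[h1 h2].
by move: KB h1 h2; clear; move: (K * absz (q - _))%N (K * (_ + N))%N => u v; lia.
Qed.

(** Ehrhart reciprocity for N-th differences, available before either count is known to be
    polynomial. *)
Lemma ecount_icount q : iter N Bd ecount q = - iter N Bd icount q.
Proof.
rewrite !iter_Bd_level; first last.
- exact: KP.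
- exact: intN_box.
rewrite -sumrN; apply: eq_bigr => M _; exact: alternating_cone.
Qed.

Lemma cnt0 A d : (forall z, ~ A (z, d)) -> cnt A d = 0.
Proof.
move=> nA; rewrite /cnt (eq_filter (a2 := pred0)) ?filter_pred0 // => z.
by apply/asboolP; exact: nA.
Qed.

Lemma cnt_seq A d s : (forall z, A (z, d) -> z \in box (K * absz d)) ->
  uniq s -> (forall z, z \in s <-> A (z, d)) -> cnt A d = (size s)%:Z.
Proof.
move=> AK us sA; congr Posz; apply: perm_size; apply: uniq_perm => //.
  by rewrite filter_uniq // box_uniq.
move=> z; rewrite mem_filter; apply/andP/idP => [[/asboolP/sA //]|/sA Az].
by split; [exact/asboolP|exact: AK].
Qed.

Lemma ecount_neg d : d < 0 -> ecount d = 0.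
Proof. by move=> d0; apply: cnt0 => z /(inC_ge0 noncoll) /=; lia. Qed.

Lemma icount_ge0 d : 0 <= d -> icount d = 0.
Proof. by move=> d0; apply: cnt0 => z /(intC_pos noncoll) /=; lia. Qed.

Lemma ecount0 : ecount 0 = 1.
Proof.
rewrite /ecount (@cnt_seq _ _ [:: 0]) // => [z|z]; first exact: KP.
rewrite inE; split=> [/eqP ->|/inC_deg0 -> //]; exact: (@inC0 R N P i0).
Qed.

Lemma ecount1 : ecount 1 = N%:Z.
Proof.
rewrite /ecount (@cnt_seq _ _ [seq P i | i <- enum 'I_N]) // => [|z||z].
- by rewrite size_map -cardE card_ord.
- exact: KP.
- by rewrite map_inj_uniq ?enum_uniq.
split=> [/mapP[i _ ->]|/closedP[i <-]]; first exact: inC_PP.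
by rewrite map_f ?mem_enum.
Qed.

Definition interior : {set 'I_N} := [set i | `[< intC (PP i) >]].
Local Notation N1 := (#|interior|).

Lemma icountN1 : icount (- 1) = N1%:Z.
Proof.
rewrite /icount (@cnt_seq _ _ [seq - P i | i <- enum interior]) // => [|z||z].
- by rewrite size_map -cardE.
- exact: intN_box.
- by rewrite map_inj_uniq ?enum_uniq // => i j /oppr_inj/Pinj.
split=> [/mapP[i]|hz].
  rewrite mem_enum inE => /asboolP hi ->.
  by move: hi; congr intC; apply: eq_triple; rewrite /= opprK.
have hz' : intC (- z, 1) by move: hz; congr intC; apply: eq_triple.
have [i Pi] := closedP (intC_inC hz').
apply/mapP; exists i; last by rewrite Pi opprK.
by rewrite mem_enum inE; apply/asboolP; rewrite /PolygonCone.PP Pi.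
Qed.

Hypothesis N3 : (2 < N)%N.

Lemma ecount_growth d : 0 <= d -> `|ecount d| <= ((2 * K%:Z + 1) ^+ 2) * (d + 1) ^+ 2.
Proof.
move=> d0; rewrite -exprMn ger0_norm //; apply: (@le_trans _ _ (size (box (K * absz d)))%:Z).
  by rewrite /ecount /cnt lez_nat size_filter count_size.
rewrite size_box PoszM expr2 -addn1 -muln2 PoszD !PoszM gez0_abs //.
have K0 : 0 <= K%:Z by []. move: (K%:Z) K0 => k k0; nia.
Qed.

Lemma ecount_top d : N%:Z <= d -> iter N Bd ecount d = 0.
Proof. by move=> dN; rewrite ecount_icount (iter_Bd_ge0 icount_ge0 dN) oppr0. Qed.

Lemma ecount_third d : 3 <= d -> iter 3 Bd ecount d = 0.
Proof.
have [m Nm] : exists m, N = m.+3 by exists (N - 3)%N; lia.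
apply: (@Bd_quadratic_growth m ecount ((2 * K%:Z + 1) ^+ 2)).
- exact: sqr_ge0.
- exact: ecount_growth.
- by move=> z; rewrite -Nm; exact: ecount_top.
Qed.

(** Twice the Ehrhart polynomial, which keeps the coefficients integral. *)
Definition ehrhart d : int := 2 + (N%:Z - N1%:Z) * d + (N%:Z + N1%:Z - 2) * d * d.

(** Newton interpolation of twice the count at 0, 1, 2, extended to all integers. *)
Let f0 d : int := 2 * ecount 0 + 2 * (ecount 1 - ecount 0) * d
  + (ecount 2 - 2 * ecount 1 + ecount 0) * (d * (d - 1)).

Let ecount_f0 d : 0 <= d -> 2 * ecount d = f0 d.
Proof.
have step (n : nat) : ecount n.+3%:Z = 3 * ecount n.+2%:Z - 3 * ecount n.+1%:Z + ecount n%:Z.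
  have := @ecount_third n.+3%:Z isT; rewrite !iter_BdS /=.
  have -> : n.+3%:Z - 1 = n.+2 by lia.
  have -> : n.+2%:Z - 1 = n.+1 by lia.
  have -> : n.+1%:Z - 1 = n by lia.
  move: (ecount _) (ecount _) (ecount _) (ecount _) => a b c e; lia.
case: d => // n _.
suff [] : 2 * ecount n%:Z = f0 n /\ 2 * ecount n.+1%:Z = f0 n.+1 /\ 2 * ecount n.+2%:Z = f0 n.+2 by [].
elim: n => [|n [h0 [h1 h2]]]; first by rewrite /f0; split; [ring|split; ring].
split=> //; split=> //; rewrite step.
have -> : 2 * (3 * ecount n.+2 - 3 * ecount n.+1 + ecount n) =
  3 * (2 * ecount n.+2) - 3 * (2 * ecount n.+1) + 2 * ecount n by ring.
rewrite h0 h1 h2 /f0 -(addn3 n) -(addn2 n) -(addn1 n) !PoszD; ring.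
Qed.

(** The defect of the interpolation is supported on the negative integers and has twice the N-th
    differences of the count, quadratics being killed as N > 2. Reciprocity thus gives its value at
    -1, and with it the count at 2. *)
Let h d := 2 * ecount d + (- 1) * f0 d.
Let h0 d : 0 <= d -> h d = 0.
Proof. by move=> d0; rewrite /h ecount_f0 // mulN1r subrr. Qed.

Let iter_h z : iter N Bd h z = 2 * iter N Bd ecount z.
Proof.
rewrite /h (iter_BdD N (fun d => 2 * ecount d) (fun d => -1 * f0 d)) !iter_BdZ.
rewrite (@eq_Bd N f0 (fun z => 2 * ecount 0
  + (2 * (ecount 1 - ecount 0) - (ecount 2 - 2 * ecount 1 + ecount 0)) * z
  + (ecount 2 - 2 * ecount 1 + ecount 0) * z * z)); last by move=> x; rewrite /f0; ring.
by rewrite iter_Bd_quadratic // mulr0 addr0.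
Qed.

Let signN : (-1) ^+ N != 0 :> int. Proof. by rewrite signr_eq0. Qed.

Let h_N1 : h (- 1) = - (2 * N1%:Z).
Proof.
have := iter_h (N%:Z - 1); rewrite ecount_icount (iter_Bd_pred1 h0) (iter_Bd_pred1 icount_ge0).
rewrite icountN1 => e; apply: (mulfI signN); rewrite e; ring.
Qed.

Let ecount2 : ecount 2 = 3 * N%:Z + N1%:Z - 3.
Proof.
have := h_N1; rewrite /h ecount_neg // /f0 ecount0 ecount1; lia.
Qed.

Lemma ecount_ehrhart d : 0 <= d -> 2 * ecount d = ehrhart d.
Proof.
by move/ecount_f0 ->; rewrite /f0 /ehrhart ecount0 ecount1 ecount2; ring.
Qed.

Lemma iter_Bd_ecount_pred1 : iter N Bd ecount (N%:Z - 1) = - ((-1) ^+ N * N1%:Z).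
Proof. by rewrite ecount_icount (iter_Bd_pred1 icount_ge0) icountN1. Qed.

Lemma iter_Bd_ecount_pred2 :
  iter N Bd ecount (N%:Z - 2) = - ((-1) ^+ N * ((N%:Z - 3) * (1 - N1%:Z))).
Proof.
have := iter_h (N%:Z - 2); rewrite (iter_Bd_pred2 h0) h_N1.
have -> : h (- 2) = - (2 * (N%:Z + 3 * N1%:Z - 3)).
  by rewrite /h ecount_neg // /f0 ecount0 ecount1 ecount2; ring.
move=> e; apply: (@mulfI _ (2 : int)) => //; rewrite -e; ring.
Qed.
End Counting.

End EhrhartCount.

(** * Betti numbers of the lattice ideal outside the cubics *)

Module LatticeIdealBetti.
Import KoszulContraction HomogeneousParts PolynomialKoszul KoszulVanishing BettiVanishing
  HilbertBetti PlaneGordan PolygonCone NormalFan SupportArcs IshidaComplex HeightOne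
  LatticeIdeals FiniteDifferences AlternatingCone EhrhartCount.

(* The Hilbert function of a polynomial ring in m + 1 variables. *)
Definition hilb (m : nat) (z : int) : int := if z is Posz d then 'C(d + m, d)%:Z else 0.

Lemma iter_Bd_hilb m z : iter m.+1 Bd (hilb m) z = (z == 0)%:Z.
Proof.
elim: m z => [|m IH] z.
  rewrite iter_BdS; case: z => [[|d]|d]; first by [].
    have -> : d.+1%:Z - 1 = d by lia.
    by rewrite /= !addn0 !binn.
  by have -> : Negz d - 1 = Negz d.+1 by lia.
rewrite iterSr (_ : Bd (hilb m.+1) = hilb m) ?IH //; apply/funext => -[[|d]|d].
- by rewrite /Bd /= !bin0.
- rewrite /Bd (_ : d.+1%:Z - 1 = d); last by lia.
  rewrite /= addnS binS (addSnnS d m); lia.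
by rewrite /Bd (_ : Negz d - 1 = Negz d.+1); last by lia.
Qed.

Lemma eq_Bd_le n u v z : (forall y, y <= z -> u y = v y) -> iter n Bd u z = iter n Bd v z.
Proof.
elim: n z => [|n IH] z h; first exact: h.
by rewrite !iter_BdS !IH // => y yz; apply: h; lia.
Qed.

Lemma iter_Bd_sum n (I : Type) (s : seq I) (F : I -> int -> int) z :
  iter n Bd (fun z => \sum_(i <- s) F i z) z = \sum_(i <- s) iter n Bd (F i) z.
Proof.
elim: n z => [|n IH] z; first by [].
by rewrite !iter_BdS !IH -sumrB; apply: eq_bigr => i _; rewrite iter_BdS.
Qed.

Section LatticeBetti.
Variables (R : realFieldType) (N : nat) (P : 'I_N -> int * int) (i0 : 'I_N).
Variables (k : fieldType) (C : free_complex k N).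
Local Notation emb := (@emb R).
Local Notation inC := (@inC R N P i0).
Local Notation intC := (@intC R N P i0).
Local Notation PP := (@PP N P).
Local Notation mlt := (@mlt N P).
Local Notation csum := (@csum k N P).
Local Notation S := (mpoly N k).
Local Notation I := (@lattice_ideal k N P).
Local Notation interior := (@interior R N P i0).
Local Notation N1 := (#|interior|).

Hypothesis closedP : forall z, inC (z, 1) -> exists i, P i = z.
Hypothesis noncoll : forall l, l != 0 -> exists i j, dot l (emb (P i)) < dot l (emb (P j)).
Hypothesis Pinj : injective P.
Hypothesis N3 : (2 < N)%N.
Hypothesis chark : [pchar k] =i pred0.
Hypothesis resC : minimal_graded_free_resolution I C.

Local Notation I0 := (lattice_ideal0 k P).
Local Notation ID := (@lattice_idealD k N P).
Local Notation IM := (@lattice_idealM k N P).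
Local Notation Ihom := (@lattice_ideal_hpart k N P).
Local Notation Idegree := (lattice_ideal_degree Pinj).

Lemma betti_low p q : (q <= p.+1)%N -> betti C p.+1 q = 0%N.
Proof. exact: (betti_lt I0 IM Ihom Idegree resC). Qed.

Lemma betti_Ivan p (q : nat) : Ivan I p.+1 q%:Z -> betti C p.+1 q = 0%N.
Proof. exact: (betti_eq0 chark I0 IM Ihom Idegree resC). Qed.

Lemma betti_high p q : (p.+4 <= q)%N -> betti C p.+1 q = 0%N.
Proof. by move=> pq; apply: betti_Ivan; apply: (@Ivan_top R N P i0 k closedP noncoll); lia. Qed.

Lemma betti_length p q : (N < p.+4)%N -> betti C p.+1 q = 0%N.
Proof. by move=> pN; apply: betti_Ivan; exact: (@Ivan_size R N P i0 k closedP noncoll). Qed.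

Lemma betti_top_linear p : interior != set0 -> N = p.+4 -> betti C p.+1 p.+2 = 0%N.
Proof.
move=> /set0Pn[u]; rewrite inE => /asboolP iu Np.
apply: betti_Ivan; apply: (@Ivan_interior R N P i0 k closedP noncoll _ _ u) => //; lia.
Qed.

Lemma betti_quadratic_no_interior p : interior = set0 -> betti C p.+1 p.+3 = 0%N.
Proof.
move=> i0'; apply: betti_Ivan.
apply: (@Ivan_no_interior R N P i0 k closedP noncoll); last by lia.
by move=> i hi; have : i \in interior by [rewrite inE; apply/asboolP]; rewrite i0' inE.
Qed.

Section Degree.
Variables (K q : nat).
Hypothesis KP : forall z d, inC (z, d) -> z \in box (K * absz d).
Definition level_points : seq (int * int) := [seq z <- box (K * q) | `[< inC (z, q%:Z) >]].
(** Coordinates on the degree q part of the semigroup ring, which identify it with that of S/I. *)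
Definition level_coord (f : S) : 'rV[k]_(size level_points) :=
  \row_j csum (nth 0 level_points j, q%:Z) f.

Lemma level_coord_is_linear : linear level_coord.
Proof. by move=> c f g; apply/rowP => j; rewrite !mxE linearP. Qed.
HB.instance Definition _ :=
  GRing.isLinear.Build k S 'rV[k]_(size level_points) _ level_coord level_coord_is_linear.

Lemma mem_level_points z : inC (z, q%:Z) -> z \in level_points.
Proof. by move=> hz; rewrite mem_filter (KP hz) andbT; apply/asboolP. Qed.

Lemma level_coord_ker f : homz q%:Z f -> level_coord f = 0 <-> I f.
Proof.
move=> hf; split=> [/rowP h M|If]; last by apply/rowP => j; rewrite !mxE If.
case: (eqVneq M.2 q%:Z) => [Mq|]; last exact: csum_homz.
have [hM|nM] := pselect (inC M).
  have hz : M.1 \in level_points by apply: mem_level_points; rewrite -Mq; case: M hM {Mq h}.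
  have := hz; rewrite -index_mem => hi; have := h (Ordinal hi).
  by rewrite !mxE nth_index // -Mq; case: M {hM Mq h hz hi}.
apply/eqP/negPn/negP => /csum_neq0[m _ mM]; apply: nM; rewrite -mM; exact: inC_mlt.
Qed.

Lemma level_coord_surj u : exists2 f, homz q%:Z f & level_coord f = u.
Proof.
have hp (j : 'I_(size level_points)) : inC (nth 0 level_points j, q%:Z).
  by have := mem_nth 0 (ltn_ord j); rewrite mem_filter => /andP[/asboolP].
have /choice[mon monP] j : exists m, mlt m = (nth 0 level_points (j : 'I_(size level_points)), q%:Z).
  exact: (inC_monomial closedP noncoll (hp j)).
exists (\sum_j u 0 j *: mpolyX k (mon j)).
  apply: homz_sum => j _; apply: homzZ.
  by have := @homz_X k _ (mon j); rewrite -(mlt2 P) monP.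
apply/rowP => j; rewrite mxE raddf_sum (bigD1 j) //= linearZ /= csumX monP eqxx mulr1.
rewrite big1 ?addr0 // => i ij; rewrite linearZ /= csumX monP.
case: eqP => [[/eqP]|_]; last by rewrite mulr0.
by rewrite nth_uniq ?filter_uniq ?box_uniq // (inj_eq val_inj) (negbTE ij).
Qed.

Lemma hilbert_level n : N = n.+1 -> ecount R P i0 K q%:Z =
  \sum_(e < q.+1) (\sum_(p < q.+1) (-1) ^+ p * (betti C p e)%:Z) * ('C(q - e + n, q - e))%:Z.
Proof.
move=> Nn.
exact: (hilbert_betti I0 ID IM Ihom Idegree resC level_coord_ker level_coord_surj Nn).
Qed.
End Degree.

Definition euler_betti (e : nat) : int := \sum_(p < e.+1) (-1) ^+ p * (betti C p e)%:Z.

Lemma ecount_betti K (q : nat) n : (forall z d, inC (z, d) -> z \in box (K * absz d)) ->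
  N = n.+1 -> ecount R P i0 K q%:Z =
  \sum_(e < q.+1) euler_betti e * ('C(q - e + n, q - e))%:Z.
Proof.
move=> KP Nn; rewrite (hilbert_level q KP Nn); apply: eq_bigr => e _; congr (_ * _).
have eq : (e.+1 <= q.+1)%N by rewrite ltnS -ltnS.
rewrite /euler_betti (big_ord_widen _ (fun p => (-1) ^+ p * (betti C p e)%:Z) eq).
rewrite [RHS]big_mkcond; apply: eq_bigr => p _; case: ifP => // /negbT; rewrite -leqNgt.
by case: (nat_of_ord p) => // p' ep; rewrite betti_low ?mulr0 //; lia.
Qed.

(** A difference at q involves only degrees at most q, so the Hilbert function may be replaced by
    the finite sum V of shifted Hilbert functions of S, each having a Kronecker delta as its N-th
    difference. *)
Lemma iter_Bd_betti K (q : nat) : (forall z d, inC (z, d) -> z \in box (K * absz d)) ->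
  iter N Bd (ecount R P i0 K) q%:Z = euler_betti q.
Proof.
move=> KP; have [n Nn] : exists n, N = n.+1 by exists N.-1; lia.
pose V z := \sum_(e <- iota 0 q.+1) euler_betti e * hilb n (z - e%:Z).
have -> : iter N Bd (ecount R P i0 K) q%:Z = iter N Bd V q%:Z.
  apply: eq_Bd_le => -[d|d] dq; last first.
    rewrite ecount_neg // /V big_seq big1 // => e _.
    by rewrite (_ : Negz d - e%:Z = Negz (d + e)); [rewrite mulr0|lia].
  rewrite (ecount_betti d KP Nn) /V (big_ord_widen q.+1 (fun e => euler_betti e *
    ('C(d - e + n, d - e))%:Z)); last by lia.
  rewrite -[iota 0 q.+1]/(index_iota 0 q.+1) big_mkord [LHS]big_mkcond.
  apply: eq_bigr => e _; case: ifP => ed.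
    by rewrite (_ : d%:Z - e%:Z = (d - e)%N) //; lia.
  by rewrite (_ : d%:Z - e%:Z = Negz (e - d).-1) ?mulr0 //; lia.
rewrite /V iter_Bd_sum.
have h (e : nat) : iter N Bd (fun z => euler_betti e * hilb n (z - e%:Z)) q%:Z =
    euler_betti e * (q == e)%:Z.
  rewrite iter_BdZ (iter_Bd_shift N (hilb n)) Nn iter_Bd_hilb subr_eq0; by [].
under eq_bigr do rewrite h.
rewrite (bigD1_seq q) ?iota_uniq ?mem_iota //= eqxx mulr1 big1 ?addr0 // => e.
by rewrite eq_sym => /negbTE ->; rewrite mulr0.
Qed.

Lemma euler_betti1 : euler_betti 1 = 0.
Proof.
rewrite /euler_betti !big_ord_recr big_ord0 /=.
by rewrite (betti0 I0 Ihom Idegree resC) betti_low //.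
Qed.
Lemma euler_betti0 : euler_betti 0 = 1.
Proof. by rewrite /euler_betti !big_ord_recr big_ord0 /= (betti0 I0 Ihom Idegree resC). Qed.
Lemma euler_betti2 : euler_betti 2 = - (betti C 1 2)%:Z.
Proof.
rewrite /euler_betti !big_ord_recr big_ord0 /= (betti0 I0 Ihom Idegree resC) (@betti_low 1) //=.
ring.
Qed.
Lemma euler_betti3 : euler_betti 3 = (betti C 2 3)%:Z - (betti C 1 3)%:Z.
Proof.
rewrite /euler_betti !big_ord_recr big_ord0 /= (betti0 I0 Ihom Idegree resC) (@betti_low 2) //=.
ring.
Qed.

Lemma betti12 : (betti C 1 2)%:Z = 'C(N.+1, 2)%:Z - (3 * N%:Z + N1%:Z - 3).
Proof.
have [n Nn] : exists n, N = n.+1 by exists N.-1; lia.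
have [K KP] := cone_bounded i0 noncoll.
have e : ecount R P i0 K 2 = 3 * N%:Z + N1%:Z - 3.
  have := ecount_ehrhart closedP noncoll Pinj KP N3 (isT : 0 <= (2 : int)).
  by rewrite /ehrhart; lia.
have := ecount_betti 2 KP Nn; rewrite e !big_ord_recr big_ord0 /=.
rewrite euler_betti0 euler_betti1 euler_betti2 !subn0 subnn bin0.
have -> : (2 + n = N.+1)%N by rewrite Nn.
move: (betti C 1 2) => b; lia.
Qed.

Lemma betti23 : (betti C 2 3)%:Z = 6 * N%:Z + 3 * N1%:Z - 8 - 'C(N.+2, 3)%:Z
  + N%:Z * (betti C 1 2)%:Z + (betti C 1 3)%:Z.
Proof.
have [n Nn] : exists n, N = n.+1 by exists N.-1; lia.
have [K KP] := cone_bounded i0 noncoll.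
have e : ecount R P i0 K 3 = 6 * N%:Z + 3 * N1%:Z - 8.
  have := ecount_ehrhart closedP noncoll Pinj KP N3 (isT : 0 <= (3 : int)).
  by rewrite /ehrhart; lia.
have := ecount_betti 3 KP Nn; rewrite e !big_ord_recr big_ord0 /=.
rewrite euler_betti0 euler_betti1 euler_betti2 euler_betti3 !subn0 subnn bin0.
have -> : (3 + n = N.+2)%N by rewrite Nn.
have -> : (3 - 2 + n = N)%N by rewrite Nn.
rewrite [(3 - 2)%N]/= bin1 => h.
move: h; move: (betti C 1 2) (betti C 2 3) (betti C 1 3) => b b' b'' h; lia.
Qed.

Lemma betti_skip n : betti C n n.+3 = 0%N.
Proof.
by case: n => [|n]; [rewrite (betti0 I0 Ihom Idegree resC)|exact: betti_high].
Qed.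

(** In degree N - 1 only beta_(N-3,N-1) survives: the resolution has length at most N - 3, and
    shorter steps would leave the two strands. *)
Lemma euler_betti_pred1 n : N = n.+4 -> (betti C n.+1 n.+3)%:Z = N1%:Z.
Proof.
move=> Nn; have [K KP] := cone_bounded i0 noncoll.
have := iter_Bd_ecount_pred1 closedP noncoll Pinj KP.
rewrite (_ : N%:Z - 1 = n.+3); last by lia.
rewrite iter_Bd_betti // /euler_betti !big_ord_recr /= big1 => [|p _]; last first.
  case: p => -[|p] /= pn; first by rewrite (betti0 I0 Ihom Idegree resC).
  by rewrite betti_high ?mulr0 //; lia.
rewrite (@betti_length n.+1) ?(@betti_length n.+2); try by lia.
have sN : (-1) ^+ N = (-1) ^+ n.+4 :> int by congr (_ ^+ _).
rewrite betti_skip add0r !mulr0 !addr0 add0r sN => e.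
apply: (@mulfI _ ((-1) ^+ n.+1 : int)); first by rewrite signr_eq0.
by rewrite e !exprS; ring.
Qed.

Lemma no_interior3 : N = 3%N -> N1 = 0%N.
Proof.
move=> Nn; have [K KP] := cone_bounded i0 noncoll.
have := iter_Bd_ecount_pred1 closedP noncoll Pinj KP.
rewrite (_ : N%:Z - 1 = 2%N); last by lia.
have sN : (-1) ^+ N = -1 :> int by rewrite (_ : N = 3%N).
rewrite iter_Bd_betti // euler_betti2 betti_length ?Nn // sN; lia.
Qed.

(** In degree N - 2 two terms survive, the end of the linear strand and the one that is c_2. *)
Lemma euler_betti_pred2 n : N = n.+4.+1 ->
  (betti C n.+2 n.+3)%:Z - (betti C n.+1 n.+3)%:Z = n.+2%:Z * (1 - N1%:Z).
Proof.
move=> Nn; have [K KP] := cone_bounded i0 noncoll.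
have := iter_Bd_ecount_pred2 closedP noncoll Pinj KP N3.
rewrite (_ : N%:Z - 2 = n.+3); last by lia.
rewrite iter_Bd_betti // /euler_betti !big_ord_recr /= big1 => [|p _]; last first.
  case: p => -[|p] /= pn; first by rewrite (betti0 I0 Ihom Idegree resC).
  by rewrite betti_high ?mulr0 //; lia.
rewrite (@betti_low n.+2) // (_ : N%:Z - 3 = n.+2%:Z); last by lia.
have sN : (-1) ^+ N = (-1) ^+ n.+4.+1 :> int by congr (_ ^+ _).
rewrite betti_skip add0r !mulr0 !addr0 add0r sN => e.
apply: (@mulfI _ ((-1) ^+ n : int)); first by rewrite signr_eq0.
transitivity (- ((-1) ^+ n.+4.+1 * (n.+2%:Z * (1 - N1%:Z)))); last by rewrite !exprS; ring.
by rewrite -e !exprS; ring.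
Qed.

End LatticeBetti.

End LatticeIdealBetti.

(** * The toric ideal as a lattice ideal *)

Module ToricIdeals.
Import mathcomp.reals.reals.
Import KoszulContraction HomogeneousParts PolynomialKoszul KoszulVanishing BettiVanishing
  PlaneGordan PolygonCone NormalFan SupportArcs IshidaComplex HeightOne LatticeIdeals.

Section ToricLattice.
Variables (k : fieldType) (N : nat) (P : 'I_N -> int * int).
Local Notation S := (mpoly N k).
Local Notation mlt := (@mlt N P).
Local Notation csum := (@csum k N P).
Implicit Types (f : S) (m : multinom N) (M : int * int * int).

Definition tmap (a b : k) (i : 'I_N) : k := a ^ (P i).1 * b ^ (P i).2.

Definition tchar (a b : k) M : k := a ^ M.1.1 * b ^ M.1.2.

Lemma tcharD a b M M' : a != 0 -> b != 0 -> tchar a b (M + M') = tchar a b M * tchar a b M'.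
Proof. by move=> a0 b0; rewrite /tchar /= !expfzDr //; ring. Qed.

Lemma tcharMn a b M n : a != 0 -> b != 0 -> tchar a b (M *+ n) = tchar a b M ^+ n.
Proof.
move=> a0 b0; elim: n => [|n IH]; first by rewrite mulr0n /tchar /= !expr0z mulr1.
by rewrite mulrS tcharD // IH exprS.
Qed.

Lemma meval_monomial a b m : a != 0 -> b != 0 ->
  meval (tmap a b) (mpolyX k m) = tchar a b (mlt m).
Proof.
move=> a0 b0; rewrite mevalX /LatticeIdeals.mlt.
elim/big_ind2: _ => [|x M y M' -> ->|i _].
- by rewrite /tchar /= !expr0z mulr1.
- by rewrite tcharD.
by rewrite tcharMn.
Qed.

Definition mlts f : seq (int * int * int) := undup (map mlt (msupp f)).

Lemma meval_csum a b f : a != 0 -> b != 0 ->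
  meval (tmap a b) f = \sum_(M <- mlts f) csum M f * tchar a b M.
Proof.
move=> a0 b0; rewrite [in LHS](mpolyE f) raddf_sum /=.
transitivity (\sum_(m <- msupp f) \sum_(M <- mlts f)
    (if mlt m == M then mcoeff m f * tchar a b M else 0)).
  rewrite [LHS]big_seq [RHS]big_seq; apply: eq_bigr => m mf.
  have mM : mlt m \in mlts f by rewrite mem_undup map_f.
  rewrite mevalZ meval_monomial // (bigD1_seq (mlt m)) ?undup_uniq //= eqxx.
  by rewrite big1 ?addr0 // => M /negbTE; rewrite eq_sym => ->.
rewrite exchange_big; apply: eq_bigr => M _ /=.
by rewrite /LatticeIdeals.csum mulr_suml -big_mkcond.
Qed.

Hypothesis chark : [pchar k] =i pred0.

Lemma natk_inj (n n' : nat) : (n%:R : k) = n'%:R -> n = n'.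
Proof.
wlog le : n n' / (n <= n')%N.
  by move=> h; case: (leqP n n') => [/h //|/ltnW/h h' /esym/h' ->].
move=> e; have : ((n' - n)%:R : k) = 0 by rewrite natrB // e subrr.
by move/eqP; rewrite ((pcharf0P k).1 chark) subn_eq0 => le'; apply/eqP; rewrite eqn_leq le.
Qed.

(** W exceeds twice every coordinate, so M.1.1 + W M.1.2 determines both coordinates; c makes these
    exponents nonnegative. *)
Lemma distinct_exponents (s : seq (int * int * int)) (d : int) : uniq s ->
  (forall M, M \in s -> M.2 = d) -> exists W : nat, exists e : int * int * int -> nat,
  {in s &, injective e} /\ exists c : nat, forall M, M \in s ->
    (e M)%:Z = M.1.1 + W%:Z * M.1.2 + c%:Z.
Proof.
move=> us sd; pose B := (\sum_(M <- s) (absz M.1.1 + absz M.1.2))%N.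
have hB M : M \in s -> `|M.1.1| <= B%:Z /\ `|M.1.2| <= B%:Z.
  by move=> Ms; rewrite /B (bigD1_seq M) //=; split; lia.
pose W := (2 * B + 1)%N; pose c := (B + W * B)%N.
pose e M := absz (M.1.1 + W%:Z * M.1.2 + c%:Z).
have eE M : M \in s -> (e M)%:Z = M.1.1 + W%:Z * M.1.2 + c%:Z.
  move=> /hB[h1 h2]; rewrite /e gez0_abs // /c PoszD PoszM.
  have : - (W%:Z * B%:Z) <= W%:Z * M.1.2 by rewrite -mulrN ler_wpM2l //; lia.
  by lia.
exists W, e; split; last by exists c.
move=> M M' Ms M's ee; have := eE M Ms; rewrite ee eE // => h.
have [h1 h2] := hB M Ms; have [h1' h2'] := hB M' M's.
have e2 : M.1.2 = M'.1.2.
  apply/eqP/negPn/negP => ne.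
  have : W%:Z <= W%:Z * `|M.1.2 - M'.1.2| by rewrite ler_peMr //; lia.
  have -> : W%:Z * `|M.1.2 - M'.1.2| = `|W%:Z * (M.1.2 - M'.1.2)| by rewrite normrM.
  have -> : W%:Z * (M.1.2 - M'.1.2) = M'.1.1 - M.1.1.
    move/addIr: h => h; apply/eqP.
    by rewrite mulrBr subr_eq addrAC h [M.1.1 + _]addrC addrK.
  have -> : W%:Z = 2 * B%:Z + 1 by rewrite /W PoszD PoszM.
  by move: h1 h1'; move: (B%:Z) (M.1.1) (M'.1.1) => u v w; clear; lia.
apply: eq_triple => //; last by rewrite !sd.
by move/addIr: h; rewrite e2 => /addIr/esym.
Qed.

(** On the curve (t, t^W) distinct multidegrees get distinct powers of t. Up to a factor t^c, f
    becomes a polynomial in t with coefficients [csum], and in characteristic 0 it has the distinct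
    roots 1, 2, 3 and so on. *)
Lemma vanishing_csum d f : homz d f ->
  (forall a b, a != 0 -> b != 0 -> meval (tmap a b) f = 0) -> lattice_ideal P f.
Proof.
move=> hf h M.
case: (boolP (M \in mlts f)) => [MM|nM]; last first.
  apply: contraNeq nM => /csum_neq0[m mf mM]; rewrite mem_undup -mM; exact: map_f.
have sd : forall M, M \in mlts f -> M.2 = d.
  by move=> M'; rewrite mem_undup => /mapP[m mf ->]; rewrite mlt2 hf.
have [W [e [einj [c ec]]]] := distinct_exponents (undup_uniq _) sd.
pose p : {poly k} := \sum_(M <- mlts f) csum M f *: 'X^(e M).
have proot (t : k) : t != 0 -> p.[t] = 0.
  move=> t0; have tW : t ^+ W != 0 by rewrite expf_neq0.
  have := h t (t ^+ W) t0 tW; rewrite meval_csum // => hh.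
  rewrite -[RHS](mul0r (t ^+ c)) -hh /p horner_sum mulr_suml.
  rewrite [LHS]big_seq [RHS]big_seq; apply: eq_bigr => M' /ec eM'.
  rewrite hornerZ hornerXn -mulrA; congr (_ * _).
  by rewrite [LHS]exprnP eM' !expfzDr // /tchar [t ^+ W]exprnP exprz_exp.
have p0 : p = 0.
  apply: (@roots_geq_poly_eq0 _ p [seq (n.+1)%:R | n <- iota 0 (size p)]).
  - by apply/allP => _ /mapP[n _ ->]; rewrite /root proot // ((pcharf0P k).1 chark).
  - by rewrite map_inj_uniq ?iota_uniq // => n n' /natk_inj[].
  by rewrite size_map size_iota.
have := congr1 (fun q : {poly k} => q`_(e M)) p0; rewrite coef0 /p coef_sum.
rewrite (bigD1_seq M) ?undup_uniq //= coefZ coefXn eqxx mulr1 big_seq_cond big1 ?addr0 //.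
move=> M' /andP[M'M ne]; rewrite coefZ coefXn; case: eqP => [/einj ee|_]; last by rewrite mulr0.
by rewrite -ee ?eqxx in ne.
Qed.

End ToricLattice.

(** A form vanishes on the closure exactly when it vanishes on the image of the torus; [i0] supplies
    the nonzero coordinate that makes the image points projective. *)
Lemma toric_ideal_lattice (R : realType) (k : fieldType) (D : R * R -> Prop)
    (i0 : 'I_(num_points D)) (f : mpoly (num_points D) k) : [pchar k] =i pred0 ->
  toric_ideal k D f <-> lattice_ideal (@lattice_point R D) f.
Proof.
move=> chark; pose P := @lattice_point R D.
have tm a b : torus_map D a b = tmap P a b by [].
have hp d : hpart (Posz d) f = pihomog (@mdeg _) d f by [].
split=> [hf|hf d v [_ hv]].
  have hd (d : nat) : lattice_ideal P (hpart (Posz d) f).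
    apply: (@vanishing_csum _ _ P chark (Posz d) _ (@homz_hpart _ _ (Posz d) f)) => a b a0 b0.
    apply: hf; split.
      by exists i0; rewrite mulf_neq0 // expfz_neq0.
    by move=> d' F _; apply; exists a, b.
  move=> M; case Md : M.2 => [d|d].
    rewrite -(hd d M); pose r := undup (msupp f ++ msupp (hpart (Posz d) f)).
    have ur : uniq r by exact: undup_uniq.
    rewrite !(@csumE k _ P M _ r) //; try by move=> m; rewrite mem_undup !mem_cat => ->; rewrite ?orbT.
    by apply: eq_bigr => m /eqP mM; rewrite mcoeff_hpart -(mlt2 P) mM Md eqxx.
  apply/eqP/negPn/negP => /csum_neq0[m _ mM].
  by have := mlt2 P m; rewrite mM Md.
apply: hv; first exact: pihomogP.
move=> w [a [b [a0 b0 ->]]]; rewrite tm -hp meval_csum // big1 // => M _.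
by rewrite (@lattice_ideal_hpart k _ P _ _ hf M) mul0r.
Qed.

End ToricIdeals.

(** * Cocycles on 4-subsets and Koelman's criterion *)

Module KoelmanGraphs.
Import KoszulContraction HomogeneousParts PolynomialKoszul KoszulVanishing BettiVanishing
  PlaneGordan PolygonCone NormalFan SupportArcs IshidaComplex HeightOne LatticeIdeals
  EhrhartCount ToricIdeals.

Lemma fredholm (k : fieldType) (J : finType) (A : J -> J -> k) (h : J -> k) :
  (exists c : J -> k, forall t, \sum_s c s * A s t = h t) \/
  (exists z : J -> k, (forall s, \sum_t A s t * z t = 0) /\ \sum_t h t * z t != 0).
Proof.
pose Am := \matrix_(i < #|J|, j < #|J|) A (enum_val i) (enum_val j).
pose hm := \row_(j < #|J|) h (enum_val j).
have ev_sum (F : J -> k) : \sum_t F t = \sum_(i < #|J|) F (enum_val i).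
  by rewrite (reindex (@enum_val J J)) //; apply: onW_bij; exact: enum_val_bij.
case: (boolP (hm *m cokermx Am == 0)) => [hA|].
  left; have /submxP[c hc] : (hm <= Am)%MS by rewrite submxE.
  exists (fun s => c 0 (enum_rank s)) => t.
  have := congr1 (fun v : 'rV_#|J| => v 0 (enum_rank t)) hc.
  rewrite !mxE enum_rankK => ->; rewrite ev_sum; apply: eq_bigr => i _.
  by rewrite !mxE enum_valK enum_rankK.
move=> hA; right.
have [j hj] : exists j, (hm *m cokermx Am) 0 j != 0.
  apply/existsP; apply: contraNT hA; rewrite negb_exists => /forallP h0.
  by apply/eqP/rowP => j; rewrite [RHS]mxE; apply/eqP; have := h0 j; rewrite negbK.
exists (fun t => cokermx Am (enum_rank t) j); split=> [s|].
  have := congr1 (fun v : 'M_#|J| => v (enum_rank s) j) (mulmx_coker Am).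
  rewrite !mxE => e; rewrite -[RHS]e ev_sum; apply: eq_bigr => i _.
  by rewrite !mxE enum_valK enum_rankK.
move: hj; rewrite mxE; apply: contraNN => /eqP e; apply/eqP; rewrite -[RHS]e ev_sum.
by apply: eq_bigr => i _; rewrite !mxE enum_valK.
Qed.

Section Green.
Variables (k : fieldType) (N : nat) (lam : 'I_N -> int).
Hypothesis lam_inj : injective lam.
Implicit Types (X T : {set 'I_N}).

Let wt T : int := \sum_(i in T) lam i.

(* The weight of a maximal element omitted by some T can be moved up: each
   point omitted by the support of a cocycle yields one more weight. *)
Lemma cocycle_weights q n X (z : {set 'I_N} -> k) : #|X| = n ->
  (forall T, z T != 0 -> T \subset X /\ #|T| = q) ->
  (forall T, T \subset X -> \sum_(i in T) z (T :\ i) *~ ksgn i T = 0) ->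
  (exists T, z T != 0) ->
  exists s : seq int, [/\ uniq s, (n < size s + q)%N &
    forall x, x \in s -> exists2 T, z T != 0 & x = wt T].
Proof.
elim: n X z => [|n IH] X z Xn sz cz [T1 zT1].
  have [TX <-] := sz T1 zT1; exists [:: wt T1]; split=> // x.
  by rewrite inE => /eqP ->; exists T1.
pose U := [set i in X | [exists T, (z T != 0) && (i \notin T)]].
case: (eqVneq U set0) => [U0|/set0Pn[i1 i1U]].
  have XT : X \subset T1.
    apply/subsetP => i iX; apply: contraT => iT.
    have : i \in U by rewrite inE iX; apply/existsP; exists T1; rewrite zT1.
    by rewrite U0 inE.
  have [TX Tq] := sz T1 zT1; exists [:: wt T1]; split=> // [|x].
    by rewrite -Xn -Tq /= add1n ltnS subset_leq_card.
  by rewrite inE => /eqP ->; exists T1.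
(* The induction is applied to the sets of the support that omit p; the additional weight will
   exceed all of theirs. *)
pose p := [arg max_(i > i1 in U) lam i]%O.
have [pU pmax] : p \in U /\ forall i, i \in U -> lam i <= lam p by rewrite /p; case: arg_maxP.
have /setIdP[pX /existsP[T2 /andP[zT2 pT2]]] := pU.
pose z' T := if p \in T then 0 else z T.
have z'E T : z' T != 0 -> (p \notin T) /\ z T != 0.
  by rewrite /z'; case: ifP => // _; rewrite eqxx.
have z'T2 : z' T2 != 0 by rewrite /z' (negbTE pT2).
have [||||s [us ns sP]] := IH (X :\ p) z'.
- by have := cardsD1 p X; rewrite pX Xn => -[].
- by move=> T /z'E[pT /sz[TX Tq]]; rewrite subsetD1 TX pT.
- move=> T; rewrite subsetD1 => /andP[TX pT]; rewrite -[RHS](cz T TX).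
  apply: eq_bigr => i iT; rewrite /z' ifF //; apply/negbTE.
  by apply: contra pT; rewrite in_setD1 => /andP[].
- by exists T2.
pose T0 := [arg max_(T > T2 | z' T != 0) wt T]%O.
have [z'T0 T0max] : z' T0 != 0 /\ forall T, z' T != 0 -> wt T <= wt T0.
  by rewrite /T0; case: arg_maxP.
have [pT0 zT0] := z'E _ z'T0; have [T0X T0q] := sz _ zT0.
(* The cocycle condition at T0 with p added yields another set of the support, containing p and
   omitting some i. As i is omitted, it is lighter than p, so the weight goes up. *)
have [i /andP[iT0 zi]] : exists i, (i \in T0) && (z ((p |: T0) :\ i) != 0).
  apply/existsP; apply: contraT; rewrite negb_exists => /forallP h.
  have := cz (p |: T0); rewrite subUset sub1set pX T0X => /(_ isT).
  rewrite big_setU1 //= setU1K // big1 ?addr0 => [|i iT0]; last first.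
    by have := h i; rewrite iT0 /= negbK => /eqP ->; rewrite mul0rz.
  move=> e; rewrite -[z T0]mulr1z -(ksgn_sqr p (p |: T0)) mulrzA e mul0rz eqxx in zT0.
  by [].
have ip : i != p by apply: contraNneq pT0 => <-.
have iU : i \in U.
  rewrite inE (subsetP T0X) //; apply/existsP; exists ((p |: T0) :\ i).
  by rewrite zi setD11.
have lip : lam i < lam p by rewrite lt_neqAle (inj_eq lam_inj) ip pmax.
have wE : wt ((p |: T0) :\ i) = wt T0 + (lam p - lam i).
  have : wt (p |: T0) = lam i + wt ((p |: T0) :\ i).
    by rewrite /wt (big_setD1 i) //= !inE iT0 orbT.
  rewrite {1}/wt big_setU1 //= -/(wt T0) => e.
  by apply: (addrI (lam i)); rewrite -e; ring.
exists (wt ((p |: T0) :\ i) :: s); split.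
- rewrite /= us andbT; apply/negP => /sP[T z'T e].
  by have := T0max T z'T; rewrite -e wE gerDl subr_le0 leNgt lip.
- by rewrite /= addSn ltnS.
move=> x; rewrite inE => /orP[/eqP ->|/sP[T /z'E[_ zT] ->]]; last by exists T.
by exists ((p |: T0) :\ i).
Qed.
End Green.

Section Koelman.
Variables (R : realFieldType) (N : nat) (P : 'I_N -> int * int) (i0 : 'I_N).
Variable (k : fieldType).
Local Notation emb := (@emb R).
Local Notation inC := (@inC R N P i0).
Local Notation intC := (@intC R N P i0).
Local Notation PP := (@PP N P).
Local Notation loc := (@loc N P).
Local Notation I := (@lattice_ideal k N P).
Local Notation interior := (@interior R N P i0).
Local Notation N1 := (#|interior|).
Local Notation X i := (@mpolyX N k (mnm1 i)).

Hypothesis closedP : forall z, inC (z, 1) -> exists i, P i = z.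
Hypothesis noncoll : forall l, l != 0 -> exists i j, dot l (emb (P i)) < dot l (emb (P j)).
Hypothesis Pinj : injective P.

(** If h does not bound, Fredholm's alternative gives a nonzero cocycle on the 4-subsets T over
    interior points of height 4 - 3 = 1. By [cocycle_weights] it has at least N - 3 weights, each a
    fixed shift of the weight of an interior point, so N - 3 <= N1. *)
Lemma Lvan_koelman M : M.2 = 3 -> (N1 + 3 < N)%N -> Lvan R P i0 k 4 M.
Proof.
move=> M3 NB h sh _.
pose good (T : {set 'I_N}) : bool := `[< intC (- loc M T) >].
have good4 T : good T -> h T != 0 -> #|T| = 4%N.
  by move=> _ hT; apply/eqP; apply: contraNT hT => /sh ->.
(* The matrix of [kosk] from 5-subsets to the 4-subsets over interior points. *)
pose A (S T : {set 'I_N}) : k := if (#|S| == 5) && good T && (T \subset S) && (#|T| == 4)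
  then \sum_(i in S | S :\ i == T) (1 *~ ksgn i T) else 0.
have [[c hc]|[z [hz1 hz2]]] := fredholm A (fun T => if good T then h T else 0).
  exists (fun S : {set 'I_N} => if #|S| == 5 then c S else 0) => [S /negbTE -> //|T iT].
  have gT : good T by apply/asboolP.
  have := hc T; rewrite gT => <-.
  case: (eqVneq #|T| 4%N) => T4; last first.
    rewrite big1 => [|S _]; last by rewrite /A (negbTE T4) andbF mulr0.
    rewrite /kosk /kos big1 // => i iT' /=.
    by rewrite cardsU1 iT' add1n eqSS (negbTE T4) mul0rz.
  rewrite /kosk /kos; under eq_bigr => i iT' do rewrite /= cardsU1 iT' T4 eqxx.
  have cA (S : {set 'I_N}) : c S * A S T = \sum_(i | (i \notin T) && (i |: T == S)) c S *~ ksgn i T.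
    rewrite /A gT T4 eqxx andbT.
    case: (boolP ((#|S| == 5) && (T \subset S))) => [/andP[S5 TS]|nS].
      rewrite S5 TS /= mulr_sumr; apply: eq_big => [i|i _]; last by rewrite mulrzr.
      apply/andP/andP => [[iS /eqP <-]|[iT' /eqP <-]].
        by rewrite setD11 setD1K.
      by rewrite setU11 setU1K.
    have -> : (#|S| == 5) && true && (T \subset S) = false by rewrite andbT (negbTE nS).
    rewrite mulr0 big1 // => i /andP[iT' /eqP e]; case/negP: nS.
    by rewrite -e cardsU1 iT' T4 subsetUr.
  under [RHS]eq_bigr do rewrite cA.
  rewrite (exchange_big_dep (fun i => i \notin T)) /= => [|S i _ /andP[] //].
  apply: eq_bigr => i iT'; rewrite (big_pred1 (i |: T)) // => S.
  by rewrite eq_sym iT'.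
pose z' (T : {set 'I_N}) := if good T && (#|T| == 4) then z T else 0.
have z'E (T : {set 'I_N}) : z' T != 0 -> good T /\ #|T| = 4%N.
  by rewrite /z'; case: andP => [[? /eqP]|]; rewrite ?eqxx.
(* The exponents along a monomial curve also provide a linear form that is injective on the
   points. *)
have [W [e [einj [cc ec]]]] := distinct_exponents (d := 1) (s := [seq PP i | i <- enum 'I_N])
  (etrans (map_inj_uniq (fun i j (e : PP i = PP j) => Pinj (congr1 fst e)) _) (enum_uniq _)) ltac:(by move=> M' /mapP[i _ ->]).
pose lamx (x : int * int * int) : int := x.1.1 + W%:Z * x.1.2.
have lamxD x y : lamx (x + y) = lamx x + lamx y by rewrite /lamx /=; ring.
pose lam i := lamx (PP i).
have lam_inj : injective lam.
  move=> i j h'; have [Pi Pj] : PP i \in [seq PP i | i <- enum 'I_N] /\ PP j \in [seq PP i | i <- enum 'I_N].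
    by split; apply: map_f; rewrite mem_enum.
  apply: Pinj; apply: (congr1 fst (x := PP i) (y := PP j)); apply: einj => //.
  suff [] : (e (PP i))%:Z = (e (PP j))%:Z by [].
  by rewrite !ec // -/(lamx (PP i)) -/(lamx (PP j)) -/(lam i) -/(lam j) h'.
have wtE (T : {set 'I_N}) : \sum_(i in T) lam i = lamx (\sum_(i in T) PP i).
  apply/esym; elim/big_rec2: _ => [|i y x _ <-]; last by rewrite lamxD.
  by rewrite /lamx /= mulr0 addr0.
have [||||s [us ns sP]] := @cocycle_weights k N lam lam_inj 4 N [set: 'I_N] z'.
- by rewrite cardsT card_ord.
- by move=> T /z'E[_]; rewrite subsetT.
- move=> S _; case: (eqVneq #|S| 5%N) => S5; last first.
    rewrite big1 // => i iS; rewrite /z' ifF ?mul0rz //; apply/negbTE.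
    rewrite negb_and orbC; apply/orP; left; apply: contra S5 => /eqP e4.
    by rewrite (cardsD1 i S) iS e4.
  rewrite -[RHS](hz1 S).
  have AE (T : {set 'I_N}) : A S T * z T = \sum_(i | (i \in S) && (S :\ i == T)) z' T *~ ksgn i S.
    rewrite /A S5 eqxx /=; case: (boolP (good T && (T \subset S) && (#|T| == 4))) => [|nT].
      move=> /andP[/andP[gT TS] T4]; rewrite mulr_suml; apply: eq_bigr => i /andP[iS /eqP e'].
      by rewrite /z' gT T4 -e' ksgnD1 mulrzl.
    rewrite mul0r big1 // => i /andP[iS /eqP e']; rewrite /z' ifF ?mul0rz //.
    apply: contraNF nT => /andP[gT T4]; rewrite gT T4 andbT /= -e'; exact: subsetDl.
  under [RHS]eq_bigr do rewrite AE.
  rewrite (exchange_big_dep (fun i => i \in S)) /= => [|T i _ /andP[] //].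
  apply: eq_bigr => i iS; rewrite (big_pred1 (S :\ i)) // => T.
  by rewrite eq_sym iS.
- apply/existsP; apply: contraNT hz2; rewrite negb_exists => /forallP z0.
  rewrite big1 // => T _; case: ifP => gT; last by rewrite mul0r.
  case: (eqVneq (h T) 0) => [->|hT]; first by rewrite mul0r.
  by have := z0 T; rewrite /z' gT (good4 T gT hT) eqxx /= negbK => /eqP ->; rewrite mulr0.
have : (size s <= size [seq (lamx M + lam u)%R | u <- enum interior])%N.
  apply: uniq_leq_size => // x /sP[T /z'E[/asboolP gT T4] ->].
  have TE : - loc M T = ((- loc M T).1, 1).
    rewrite [LHS]surjective_pairing; congr (_, _).
    by rewrite -[LHS]/(- (loc M T).2) loc2 M3 T4.
  have [u Pu] : exists u, P u = (- loc M T).1 by apply/closedP/intC_inC; rewrite -TE.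
  have Pu' : PP u = - loc M T by rewrite /PolygonCone.PP Pu -TE.
  apply/mapP; exists u.
    by rewrite mem_enum inE; apply/asboolP; rewrite Pu'.
  by rewrite wtE /lam Pu' -lamxD /IshidaComplex.loc opprB addrCA subrr addr0.
rewrite size_map -cardE => sN; exfalso; move: ns NB sN; clear; move: (size s) #|_| => a b; lia.
Qed.

Lemma Ivan_koelman : (N <= 3)%N || (N1 + 3 < N)%N -> Ivan I 1 3.
Proof.
move=> h; apply: (Ivan_of_Avan closedP noncoll) => M M3; apply: ishida => //.
case/orP: h => h; last exact: Lvan_koelman.
apply: Lvan_empty => T T4 _.
by have := subset_leq_card (subsetT T); rewrite cardsT card_ord T4; lia.
Qed.

(** By Euler's identity f is the Koszul boundary of its partial derivatives divided by 3. Since f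
    lies in I, this 1-chain is a cycle modulo I; a correction by a boundary moves its entries into I
    without changing f. *)
Lemma cubics_lin_syz : [pchar k] =i pred0 -> Ivan I 1 3 ->
  forall f, I f -> homz 3 f -> lin_syz I f.
Proof.
move=> chark hI f If hf.
have k3 : (3%:~R : k) != 0 by exact: (intk_neq0 chark).
pose F (T : {set 'I_N}) : mpoly N k :=
  \sum_(i | T == [set i]) (3%:~R : k)^-1 *: mderiv i f.
have FE i : F [set i] = (3%:~R : k)^-1 *: mderiv i f.
  rewrite /F (big_pred1 i) // => j; apply/eqP/eqP => [|-> //].
  by move/set1_inj.
have sF : supported 1 F.
  by move=> T T1; rewrite /F big1 // => i /eqP e; rewrite e cards1 in T1.
have kos0 (G : {set 'I_N} -> mpoly N k) : kosS G set0 = \sum_i X i * G [set i].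
  rewrite /kosS /kos; apply: eq_big => [i|i _]; first by rewrite inE.
  have -> : ksgn i set0 = 1.
    rewrite /ksgn; have -> : kpos i set0 = 0%N.
      by apply/eqP; rewrite cards_eq0; apply/eqP/setP => j; rewrite !inE.
    by [].
  by rewrite mulr1z setU0.
have kF : kosS F set0 = f.
  rewrite kos0; under eq_bigr do rewrite FE -scalerAr.
  by rewrite -scaler_sumr (euler hf) -scaler_int scalerA mulVf // scale1r.
have [||g [sg hg kg]] := hI F sF.
- by move=> T; apply: homz_sum => i _; apply: homzZ; exact: homz_mderiv hf.
- move=> T; case: (eqVneq T set0) => [->|T0]; first by rewrite kF.
  rewrite /kosS /kos big1 => [|i iT]; first exact: (lattice_ideal0 k P).
  rewrite sF ?raddf0 ?mul0rz // cardsU1 iT add1n eqSS cards_eq0; exact: T0.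
exists (fun i => F [set i] - kosS g [set i]).
  move=> i; split; first exact: kg.
  rewrite FE; apply: homzB; first by apply: homzZ; exact: homz_mderiv hf.
  have := @kosS_homz _ _ _ g [set i] hg; by [].
have -> : \sum_i X i * (F [set i] - kosS g [set i]) =
    kosS F set0 - kosS (kosS g) set0.
  rewrite !kos0 -sumrB; apply: eq_bigr => i _; by rewrite mulrBr.
rewrite kF (_ : kosS (kosS g) set0 = 0) ?subr0 //.
by apply: kosK => i j u; rewrite /= /mulX mulrCA.
Qed.
End Koelman.

End KoelmanGraphs.

(** * Cubic generators from isolated monomials *)

Module CubicGenerators.
Import KoszulContraction HomogeneousParts PolynomialKoszul KoszulVanishing BettiVanishing
  PlaneGordan PolygonCone NormalFan SupportArcs IshidaComplex HeightOne LatticeIdeals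
  EhrhartCount ToricIdeals KoelmanGraphs.

Section Cubics.
Variables (k : fieldType) (N : nat) (P : 'I_N -> int * int).
Local Notation S := (mpoly N k).
Local Notation PP := (@PP N P).
Local Notation mlt := (@mlt N P).
Local Notation csum := (@csum k N P).
Local Notation I := (@lattice_ideal k N P).
Local Notation X i := (@mpolyX N k (mnm1 i)).
Local Notation U i := (@mnm1 N i).

Definition tri (a b c : 'I_N) : multinom N := mnm_add (U a) (mnm_add (U b) (U c)).
Definition tsum (a b c : 'I_N) : int * int * int := PP a + (PP b + PP c).

Lemma mlt_tri a b c : mlt (tri a b c) = tsum a b c.
Proof. by rewrite /tri !mltD !mlt1. Qed.

Lemma mdeg_tri a b c : mdeg (tri a b c) = 3%N.
Proof. by rewrite /tri !mdegD !mdeg1. Qed.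

Lemma mdegS_split (m : multinom N) d : mdeg m = d.+1 ->
  exists i m', m = mnm_add (U i) m' /\ mdeg m' = d.
Proof.
move=> md; have [i mi] : exists i, (0 < m i)%N.
  apply/existsP; apply: contraT; rewrite negb_exists => /forallP h.
  move: md; rewrite mdegE big1 // => i _; apply/eqP; have := h i; by rewrite -leqNgt leqn0.
exists i, (mnm_sub m (U i)); split.
  apply/mnmP => j; rewrite mnmDE mnmBE mnm1E.
  by case: eqP => [<-|_]; rewrite ?subn0 // add1n subn1 prednK.
move: md; rewrite -{1}(_ : mnm_add (U i) (mnm_sub m (U i)) = m).
  by rewrite mdegD mdeg1 => -[].
apply/mnmP => j; rewrite mnmDE mnmBE mnm1E.
by case: eqP => [<-|_]; rewrite ?subn0 // add1n subn1 prednK.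
Qed.

Lemma mdeg3_tri (m : multinom N) : mdeg m = 3%N -> exists a b c, m = tri a b c.
Proof.
move=> /mdegS_split[a [m1 [-> /mdegS_split[b [m2 [-> /mdegS_split[c [m3 [-> m0]]]]]]]]].
exists a, b, c; congr mnm_add; congr mnm_add; move/eqP: m0; rewrite mdeg_eq0 => /eqP ->.
by apply/mnmP => j; rewrite mnmDE mnm0E addn0.
Qed.

Lemma binomial_ideal (x y : multinom N) : mlt x = mlt y -> I (mpolyX k x - mpolyX k y).
Proof. by move=> e M; rewrite raddfB /= !csumX e subrr. Qed.

Lemma homz_binomial (x y : multinom N) d : mdeg x = d -> mdeg y = d ->
  homz d%:Z (mpolyX k x - mpolyX k y).
Proof. by move=> xd yd; apply: homzB; [rewrite -xd|rewrite -yd]; exact: homz_X. Qed.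

Local Notation lin_syz := (lin_syz I).

Lemma lin_syz_shared a b c b' c' : PP b + PP c = PP b' + PP c' ->
  lin_syz (mpolyX k (tri a b c) - mpolyX k (tri a b' c')).
Proof.
move=> e; pose g : S := mpolyX k (mnm_add (U b) (U c)) - mpolyX k (mnm_add (U b') (U c')).
exists (fun i => if i == a then g else 0).
  move=> i; case: eqP => _; last by split; [exact: lattice_ideal0|exact: homz0].
  split; first by apply: binomial_ideal; rewrite !mltD !mlt1.
  by apply: (@homz_binomial _ _ 2); rewrite mdegD !mdeg1.
rewrite (bigD1 a) //= eqxx big1 ?addr0 => [|i /negbTE ->]; last by rewrite mulr0.
by rewrite mulrBr -!mpolyXD.
Qed.

Definition unique_pair (a b : 'I_N) : Prop := forall c d, PP c + PP d = PP a + PP b ->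
  mnm_add (U c) (U d) = mnm_add (U a) (U b).

Lemma csum_unique (m : multinom N) g : homz (mdeg m)%:Z g ->
  (forall m', mdeg m' = mdeg m -> mlt m' = mlt m -> m' = m) -> csum (mlt m) g = mcoeff m g.
Proof.
move=> hg um; rewrite /LatticeIdeals.csum; case: (boolP (m \in msupp g)) => mg.
  rewrite big_mkcond (bigD1_seq m) ?msupp_uniq //= eqxx big_seq_cond big1 ?addr0 //.
  move=> m' /andP[/hg[m'd] ne]; case: eqP => // e; by rewrite (um m') ?eqxx in ne.
rewrite (memN_msupp_eq0 mg) big_seq_cond big1 // => m' /andP[m'g /eqP e].
by move: (m'g) => /hg[m'd]; rewrite (um m') // (negbTE mg) in m'g.
Qed.

Lemma mcoeff_mulX i (g : S) m : mcoeff (mnm_add (U i) m) (X i * g) = mcoeff m g.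
Proof.
by rewrite mulrC mcoeffMX.
Qed.

Lemma mcoeff_mulX0 i (g : S) (m : multinom N) : m i = 0%N -> mcoeff m (X i * g) = 0.
Proof.
move=> mi; rewrite (mpolyE g) mulr_sumr raddf_sum big1 // => m' _ /=.
rewrite -scalerAr mcoeffZ -mpolyXD mcoeffX; case: eqP => [e|_]; last by rewrite mulr0.
by move: mi; rewrite -e mnmDE mnm1E eqxx.
Qed.

(** A quadric of I has coefficient 0 at a monomial that is alone in its fibre, so no product X_i g
    contributes to this cubic monomial. *)
Lemma lin_syz_mcoeff a b c f : unique_pair a b -> unique_pair a c -> unique_pair b c ->
  lin_syz f -> mcoeff (tri a b c) f = 0.
Proof.
move=> uab uac ubc [g hg ->]; rewrite raddf_sum big1 // => i _ /=.
have main x y z : tri a b c = tri x y z -> unique_pair y z -> mcoeff (tri a b c) (X x * g x) = 0.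
  move=> -> uyz; have [Ig hgx] := hg x; rewrite /tri mcoeff_mulX.
  rewrite -(csum_unique (m := mnm_add (U y) (U z))) => [|//|m' m'2 e]; first exact: Ig.
    by rewrite mdegD !mdeg1.
  move: m'2; rewrite mdegD !mdeg1 => /mdegS_split[c' [m1 [em /mdegS_split[d' [m2 [em1 m0]]]]]].
  have em2 : m' = mnm_add (U c') (U d').
    rewrite em em1; congr mnm_add; move/eqP: m0; rewrite mdeg_eq0 => /eqP ->.
    by apply/mnmP => j; rewrite mnmDE mnm0E addn0.
  by rewrite em2 (uyz c' d') //; move: e; rewrite em2 !mltD !mlt1.
case: (eqVneq i a) => [->|ia]; first exact: (main a b c).
case: (eqVneq i b) => [->|ib].
  by apply: (main b a c) => //; apply/mnmP => j; rewrite !mnmDE addnCA.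
case: (eqVneq i c) => [->|ic].
  apply: (main c a b) => //; apply/mnmP => j; rewrite !mnmDE; lia.
by apply: mcoeff_mulX0; rewrite !mnmDE !mnm1E ![_ == i]eq_sym (negbTE ia) (negbTE ib) (negbTE ic).
Qed.

Hypothesis Pinj : injective P.
Variable C : free_complex k N.
Hypothesis resC : minimal_graded_free_resolution I C.

(** The monomials [E j] cannot be reached by quadratic moves, each shares its fibre with an ordinary
    monomial [H j], and ordinary monomials of one fibre are connected. So the binomials [E j] -
    [H j] are a basis of the cubics modulo S_1 I_2. *)
Lemma betti13_exceptional r (ea eb ec pa pb pc : 'I_r -> 'I_N) :
  let E j := tri (ea j) (eb j) (ec j) in
  injective E ->
  (forall j, [/\ unique_pair (ea j) (eb j), unique_pair (ea j) (ec j) & unique_pair (eb j) (ec j)]) ->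
  (forall j, tsum (pa j) (pb j) (pc j) = tsum (ea j) (eb j) (ec j) /\
     forall j', tri (pa j) (pb j) (pc j) <> E j') ->
  (forall a b c a' b' c', (forall j, tri a b c <> E j) -> (forall j, tri a' b' c' <> E j) ->
     tsum a b c = tsum a' b' c' -> lin_syz (mpolyX k (tri a b c) - mpolyX k (tri a' b' c'))) ->
  betti C 1 3 = r.
Proof.
move=> E Einj hu hp hl; pose H j := tri (pa j) (pb j) (pc j).
have hE j f : lin_syz f -> mcoeff (E j) f = 0.
  by have [u1 u2 u3] := hu j; exact: lin_syz_mcoeff.
pose g j : S := mpolyX k (E j) - mpolyX k (H j).
have mlt_g j : mlt (E j) = mlt (H j) by rewrite !mlt_tri; have [-> _] := hp j.
have gI j : I (g j) /\ homz 3 (g j).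
  split; first exact: binomial_ideal.
  by apply: (@homz_binomial _ _ 3); rewrite mdeg_tri.
have gE (c : 'I_r -> k) j : mcoeff (E j) (\sum_i c i *: g i) = c j.
  rewrite raddf_sum (bigD1 j) //= mcoeffZ mcoeffB !mcoeffX eqxx.
  case: eqP => [e|_]; first by have [_ /(_ j)] := hp j; rewrite -/(H j) e.
  rewrite subr0 mulr1 big1 ?addr0 // => i ij; rewrite mcoeffZ mcoeffB !mcoeffX.
  rewrite (inj_eq Einj) (negbTE ij); case: eqP => [e|_]; last by rewrite subrr mulr0.
  by have [_ /(_ j)] := hp i; rewrite -/(H i) e.
apply: (betti13 (lattice_ideal0 k P) (@lattice_idealD k N P) (@lattice_idealM k N P)
  (@lattice_ideal_hpart k N P) (lattice_ideal_degree Pinj) resC gI).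
  by move=> c /hE h j; rewrite -(gE c j) h.
move=> f If hf; exists (fun j => mcoeff (E j) f).
set f' := f - _.
have f'E j : mcoeff (E j) f' = 0 by rewrite mcoeffB gE subrr.
have If' : I f'.
  have Is : I (\sum_i mcoeff (E i) f *: g i).
    elim/big_rec: _ => [|j x _ hx]; first exact: lattice_ideal0.
    apply: lattice_idealD => //; rewrite -mul_mpolyC; exact: lattice_idealM (gI j).1.
  by move=> M; rewrite /f' raddfB /= If Is subr0.
have hf' : homz 3 f'.
  by apply: homzB => //; apply: homz_sum => j _; apply: homzZ; exact: (gI j).2.
(* One monomial of f' in each fibre: the coefficients in a fibre sum to 0, so f' is a combination of
   differences with these representatives. *)
pose rho M := head mnm0 [seq m <- msupp f' | mlt m == M].
have rhoP m : m \in msupp f' -> rho (mlt m) \in msupp f' /\ mlt (rho (mlt m)) = mlt m.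
  move=> mf; have : m \in [seq m' <- msupp f' | mlt m' == mlt m] by rewrite mem_filter eqxx.
  have : {subset [seq m' <- msupp f' | mlt m' == mlt m] <= [pred m' | (m' \in msupp f') && (mlt m' == mlt m)]}.
    by move=> m'; rewrite mem_filter andbC.
  rewrite /rho; case: [seq _ <- _ | _] => // m' s hs _.
  by have := hs m' (mem_head _ _); rewrite inE => /andP[-> /eqP ->].
have -> : f' = \sum_(m <- msupp f') mcoeff m f' *: (mpolyX k m - mpolyX k (rho (mlt m))).
  under eq_bigr do rewrite scalerBr.
  rewrite sumrB -mpolyE [Y in _ - Y](_ : _ = 0) ?subr0 //.
  transitivity (\sum_(M <- mlts P f') csum M f' *: mpolyX k (rho M)); last first.
    by rewrite big1 // => M _; rewrite If' scale0r.
  transitivity (\sum_(m <- msupp f') \sum_(M <- mlts P f')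
      (if mlt m == M then mcoeff m f' *: mpolyX k (rho M) else 0)).
    rewrite [LHS]big_seq [RHS]big_seq; apply: eq_bigr => m mf.
    have mM : mlt m \in mlts P f' by rewrite mem_undup map_f.
    rewrite (bigD1_seq (mlt m)) ?undup_uniq //= eqxx.
    by rewrite big1 ?addr0 // => M /negbTE; rewrite eq_sym => ->.
  rewrite exchange_big; apply: eq_bigr => M _ /=.
  by rewrite /LatticeIdeals.csum scaler_suml -big_mkcond.
rewrite big_seq; elim/big_rec: _ => [|m x mf hx].
  exact: (lin_syz0 (lattice_ideal0 k P)).
apply: (lin_syzD (@lattice_idealD k N P)) => //; apply: (lin_syzZ (@lattice_idealM k N P)).
have [rf re] := rhoP m mf.
have nE m' : m' \in msupp f' -> forall j, m' <> E j.
  by move=> m'f j e; move: m'f; rewrite e mcoeff_msupp f'E eqxx.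
have [a [b [c em]]] := mdeg3_tri (congr1 absz (hf' m mf)).
have [a' [b' [c' er]]] := mdeg3_tri (congr1 absz (hf' _ rf)).
rewrite er em; apply: hl; first by rewrite -em; exact: nE.
  by rewrite -er; exact: nE.
by rewrite -!mlt_tri -em -er re.
Qed.

End Cubics.

Section SubConfiguration.
Variables (k : fieldType) (N N' : nat) (P : 'I_N -> int * int) (iota : 'I_N' -> 'I_N).
Local Notation P' := (P \o iota).
Local Notation PP := (@PP N P).
Local Notation X i := (@mpolyX N k (mnm1 i)).

Let phi : mpoly N' k -> mpoly N k := comp_mpoly [tuple X (iota i) | i < N'].

Let phiX (m : multinom N') : exists2 m' : multinom N,
  phi (mpolyX k m) = mpolyX k m' & mlt P m' = mlt P' m.
Proof.
rewrite /phi comp_mpolyX /mlt; elim/big_ind2: _ => [|x M y M' [m1 -> e1] [m2 -> e2]|i _].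
- by exists mnm0; [rewrite mpolyX0|exact: mlt0].
- by exists (mnm_add m1 m2); [rewrite mpolyXD|rewrite -/(mlt P _) mltD /mlt e1 e2].
rewrite tnth_mktuple; elim: (m i) => [|n [m1 e1 e2]].
  by exists mnm0; [rewrite expr0 mpolyX0|rewrite mulr0n; exact: mlt0].
exists (mnm_add (mnm1 (iota i)) m1); first by rewrite exprS e1 mpolyXD.
by rewrite -/(mlt P _) mltD mlt1 mulrS /mlt e2.
Qed.

Let phiE f : phi f = \sum_(m <- msupp f) mcoeff m f *: phi (mpolyX k m).
Proof.
rewrite [in LHS](mpolyE f) /phi raddf_sum /=.
by apply: eq_bigr => m _; rewrite comp_mpolyZ.
Qed.

Let phi_homz (d : nat) f : homz d%:Z f -> homz d%:Z (phi f).
Proof.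
move=> hf; rewrite phiE big_seq; apply: homz_sum => m mf; apply: homzZ.
have [m' -> e] := phiX m; have := @homz_X k _ m'.
by rewrite -(mlt2 P) e (mlt2 P') (hf m mf).
Qed.

Let phi_ideal f : lattice_ideal P' f -> lattice_ideal P (phi f).
Proof.
move=> hf M; rewrite -(hf M) [in RHS](mpolyE f) phiE [LHS]raddf_sum [RHS]raddf_sum /=.
apply: eq_bigr => m _; rewrite [LHS]linearZ [RHS]linearZ /=; congr (_ * _).
by have [m' e1 e] := phiX m; rewrite e1 !csumX e.
Qed.

Lemma lin_syz_sub (f : mpoly N' k) : lin_syz (lattice_ideal P') f -> lin_syz (lattice_ideal P) (phi f).
Proof.
move=> [g hg ->]; exists (fun j => \sum_(i | iota i == j) phi (g i)).
  move=> j; split.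
    move=> M; rewrite raddf_sum big1 // => i _ /=; apply: phi_ideal; exact: (hg i).1.
  by apply: homz_sum => i _; apply: (@phi_homz 2); exact: (hg i).2.
rewrite /phi raddf_sum /=.
transitivity (\sum_i X (iota i) * phi (g i)).
  by apply: eq_bigr => i _; rewrite rmorphM /= comp_mpolyXU -tnth_nth tnth_mktuple.
under [RHS]eq_bigr do rewrite mulr_sumr.
rewrite (exchange_big_dep xpredT) //=; apply: eq_bigr => i _.
by rewrite (big_pred1 (iota i)) // => j; rewrite eq_sym.
Qed.

Hypothesis quad' : forall f : mpoly N' k, lattice_ideal P' f -> homz 3 f -> lin_syz (lattice_ideal P') f.

(** If a subset of the points has all its cubics generated by quadrics, relations between its
    triples carry over along the inclusion of polynomial rings. *)
Lemma lin_syz_subtri a b c a' b' c' :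
  tsum P (iota a) (iota b) (iota c) = tsum P (iota a') (iota b') (iota c') ->
  lin_syz (lattice_ideal P) (mpolyX k (tri (iota a) (iota b) (iota c))
    - mpolyX k (tri (iota a') (iota b') (iota c'))).
Proof.
move=> e; have phi_tri x y z : phi (mpolyX k (tri x y z)) = mpolyX k (tri (iota x) (iota y) (iota z)).
  rewrite /tri !mpolyXD /phi !rmorphM /= !comp_mpolyXU -!tnth_nth !tnth_mktuple.
  by [].
rewrite -!phi_tri -raddfB; apply: lin_syz_sub; apply: quad'.
  by apply: binomial_ideal; rewrite !mlt_tri.
by apply: (@homz_binomial _ _ _ _ 3); rewrite mdeg_tri.
Qed.
End SubConfiguration.

End CubicGenerators.

(** * Cutting off a vertex, and polygons with three boundary points *)

Module BoundaryTriangles.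
Import KoszulContraction HomogeneousParts PolynomialKoszul KoszulVanishing BettiVanishing
  PlaneGordan PolygonCone NormalFan SupportArcs IshidaComplex HeightOne LatticeIdeals
  EhrhartCount ToricIdeals KoelmanGraphs CubicGenerators.

Definition dz (l z : int * int) : int := l.1 * z.1 + l.2 * z.2.

Section Functionals.
Variables (R : realFieldType) (N : nat) (P : 'I_N -> int * int) (i0 : 'I_N).
Local Notation emb := (@emb R).
Local Notation ev := (@ev R N P i0).
Local Notation intC := (@intC R N P i0).
Local Notation PP := (@PP N P).

Lemma dz_dot l z : (dz l z)%:~R = dot (emb l) (emb z).
Proof. by rewrite /dz /dot intrD !intrM. Qed.

Lemma emb_neq0 l : l != 0 -> emb l != 0.
Proof.
apply: contraNneq => -[/eqP h1 /eqP h2]; rewrite !intr_eq0 in h1 h2.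
by apply/eqP; case: l h1 h2 => l1 l2 /= /eqP -> /eqP ->.
Qed.

Lemma noncoll3 i j k : detz (P j - P i) (P k - P i) != 0 ->
  forall l : R * R, l != 0 -> exists i j, dot l (emb (P i)) < dot l (emb (P j)).
Proof.
move=> d0 l l0; apply: contrapT => h.
have eq_l a b : dot l (emb (P a)) = dot l (emb (P b)).
  apply/eqP; rewrite eq_le; apply/andP; split; rewrite leNgt; apply/negP => hlt; apply: h.
    by exists b, a.
  by exists a, b.
have e1 : dot l (emb (P j - P i)) = 0 by rewrite embD embN dotDr dotNr (eq_l j i) subrr.
have e2 : dot l (emb (P k - P i)) = 0 by rewrite embD embN dotDr dotNr (eq_l k i) subrr.
move: (P j - P i) (P k - P i) d0 e1 e2 => [x1 x2] [y1 y2]; rewrite /detz /dot /emb /= => d0 e1 e2.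
have d0' : (x1%:~R * y2%:~R - x2%:~R * y1%:~R : R) != 0.
  by rewrite -!intrM -intrB intr_eq0.
case/negP: l0; apply/eqP; case: l {h eq_l} e1 e2 => l1 l2 /= e1 e2; congr (_, _).
  apply: (mulfI d0'); rewrite mulr0.
  have -> : (x1%:~R * y2%:~R - x2%:~R * y1%:~R) * l1 =
    y2%:~R * (l1 * x1%:~R + l2 * x2%:~R) - x2%:~R * (l1 * y1%:~R + l2 * y2%:~R) :> R by ring.
  by rewrite e1 e2 !mulr0 subrr.
apply: (mulfI d0'); rewrite mulr0.
have -> : (x1%:~R * y2%:~R - x2%:~R * y1%:~R) * l2 =
  x1%:~R * (l1 * y1%:~R + l2 * y2%:~R) - y1%:~R * (l1 * x1%:~R + l2 * x2%:~R) :> R by ring.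
by rewrite e1 e2 !mulr0 subrr.
Qed.

Lemma min_not_interior l i : l != 0 -> (forall j, dz l (P i) <= dz l (P j)) -> ~ intC (PP i).
Proof.
move=> l0 h /(_ _ (emb_neq0 l0)); rewrite /PolygonCone.ev /= mul1r subr_gt0.
by have [j ->] := hminP P i0 (emb l); rewrite -!dz_dot ltr_int ltNge h.
Qed.
End Functionals.

Section Sub.
Variables (R : realFieldType) (N : nat) (P : 'I_N -> int * int) (i0 : 'I_N).
Variables (k : fieldType) (b c0 : 'I_N).
Hypothesis chark : [pchar k] =i pred0.
Local Notation emb := (@emb R).
Local Notation inC := (@inC R N P i0).
Local Notation intC := (@intC R N P i0).
Local Notation PP := (@PP N P).
Hypothesis closedP : forall z, inC (z, 1) -> exists i, P i = z.
Hypothesis Pinj : injective P.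

Definition sub_size : nat := #|[set~ b]|.
Definition sub_inj (i : 'I_sub_size) : 'I_N := enum_val i.
Hypothesis cb : c0 \in [set~ b].
Definition sub_base : 'I_sub_size := enum_rank_in cb c0.
Local Notation P' := (P \o sub_inj).

Lemma sub_inj_neq i : sub_inj i != b.
Proof. by have := enum_valP i; rewrite !inE. Qed.

Lemma sub_injP i : i != b -> exists i', sub_inj i' = i.
Proof.
move=> ib; have ib' : i \in [set~ b] by rewrite !inE.
by exists (enum_rank_in ib' i); rewrite /sub_inj enum_rankK_in.
Qed.

Lemma sub_Pinj : injective P'.
Proof. by move=> i j /Pinj /enum_val_inj. Qed.

(** As b is the unique minimum of l, it lies outside the hull of the other points, which are
    therefore again all lattice points of their hull. *)
Lemma sub_closed l : (forall i, i != b -> dz l (P b) < dz l (P i)) ->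
  forall z, @PolygonCone.inC R _ P' sub_base (z, 1) -> exists i, P' i = z.
Proof.
move=> sep z hz.
have [i Pi] : exists i, P i = z.
  apply: closedP => m; apply: le_trans (hz m) _; rewrite /PolygonCone.ev lerD2l lerN2 /= !mul1r.
  have [j ->] := hminP P' sub_base m; exact: hmin_le.
case: (eqVneq i b) => [ib|/sub_injP[i' ei]]; last by exists i'; rewrite /= ei.
have := hz (emb l); rewrite /PolygonCone.ev /= mul1r subr_ge0.
have [j ->] := hminP P' sub_base (emb l); rewrite -!dz_dot ler_int -Pi ib leNgt.
by rewrite sep // sub_inj_neq.
Qed.

(** Koelman's criterion for the polygon with the vertex b cut off; i, j, m witness that it is still
    two-dimensional. *)
Lemma sub_quad l i j m : (forall i, i != b -> dz l (P b) < dz l (P i)) ->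
  i != b -> j != b -> m != b -> detz (P j - P i) (P m - P i) != 0 ->
  (sub_size <= 3)%N || (#|@interior R _ P' sub_base| + 3 < sub_size)%N ->
  forall a1 a2 a3 b1 b2 b3, a1 != b -> a2 != b -> a3 != b -> b1 != b -> b2 != b -> b3 != b ->
  tsum P a1 a2 a3 = tsum P b1 b2 b3 ->
  lin_syz (@lattice_ideal k N P) (mpolyX k (tri a1 a2 a3) - mpolyX k (tri b1 b2 b3)).
Proof.
move=> sep ib jb mb d0 hK a1 a2 a3 b1 b2 b3.
move=> /sub_injP[a1' <-] /sub_injP[a2' <-] /sub_injP[a3' <-].
move=> /sub_injP[b1' <-] /sub_injP[b2' <-] /sub_injP[b3' <-].
apply: lin_syz_subtri => f If hf; apply: cubics_lin_syz => //.
have [i' ei] := sub_injP ib; have [j' ej] := sub_injP jb; have [m' em] := sub_injP mb.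
apply: (@Ivan_koelman R _ P' sub_base k (sub_closed sep) _ sub_Pinj hK).
by apply: (@noncoll3 R _ P' i' j' m'); rewrite /= ei ej em.
Qed.
End Sub.

(* The lattice points of a triangle whose vertices b are its only boundary
   points, with the barycentric coordinates H / delta. *)
Definition triangle (N : nat) (P : 'I_N -> int * int) (b : 'I_3 -> 'I_N)
    (H : 'I_3 -> int * int * int -> int) (delta : int) : Prop :=
  [/\ 0 < delta, forall j, exists l c, forall x, H j x = dz l x.1 + c * x.2,
    forall i j, H j (PP P (b i)) = if i == j then delta else 0,
    forall j i, (forall j', i != b j') -> 0 < H j (PP P i) < delta
  & forall x, delta * x.1.1 = \sum_j H j x * (P (b j)).1 /\
              delta * x.1.2 = \sum_j H j x * (P (b j)).2 /\ delta * x.2 = \sum_j H j x].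

Section TriangleExists.
Variables (R : realFieldType) (N : nat) (P : 'I_N -> int * int) (i0 : 'I_N).
Local Notation emb := (@emb R).
Local Notation ev := (@ev R N P i0).
Local Notation inC := (@inC R N P i0).
Local Notation intC := (@intC R N P i0).
Local Notation PP := (@PP N P).
Local Notation interior := (@interior R N P i0).
Hypothesis noncoll : forall l, l != 0 -> exists i j, dot l (emb (P i)) < dot l (emb (P j)).

(** Twice the signed area of the triangle p, q, x, homogenized in the height of x. *)
Definition edge (p q : 'I_N) (x : int * int * int) : int :=
  detz (P q - P p) (x.1 - (x.2 * (P p).1, x.2 * (P p).2)).

Definition vertex3 (b1 b2 b3 : 'I_N) (j : 'I_3) : 'I_N := nth b1 [:: b1; b2; b3] j.
Definition edge3 b1 b2 b3 (j : 'I_3) : int * int * int -> int :=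
  nth (edge b2 b3) [:: edge b2 b3; edge b3 b1; edge b1 b2] j.

Lemma edge_dz p q i : edge p q (PP i) = dz (- (P q - P p).2, (P q - P p).1) (P i)
  - dz (- (P q - P p).2, (P q - P p).1) (P p).
Proof. by rewrite /edge /detz /dz /=; ring. Qed.

(** An edge functional attains its extremes at no interior point, hence only among the three
    vertices, where its values are 0, 0 and d; so it lies strictly between 0 and d at interior
    points. *)
Lemma triangle_oriented b1 b2 b3 : (forall i, i \notin interior -> i \in [:: b1; b2; b3]) ->
  0 < detz (P b2 - P b1) (P b3 - P b1) ->
  triangle P (vertex3 b1 b2 b3) (edge3 b1 b2 b3) (detz (P b2 - P b1) (P b3 - P b1)).
Proof.
move=> hB d0; set d := detz _ _ in d0 *.
have edge_b p q r : [/\ p \in [:: b1; b2; b3], q \in [:: b1; b2; b3] & r \in [:: b1; b2; b3]] ->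
  [:: b1; b2; b3] =i [:: p; q; r] -> edge p q (PP r) = d ->
  forall i, i \in interior -> 0 < edge p q (PP i) < d.
  move=> _ eqb er i iI.
  pose l : int * int := (- (P q - P p).2, (P q - P p).1).
  have ep : edge p q (PP p) = 0 by rewrite /edge /detz /=; ring.
  have eq0 : edge p q (PP q) = 0 by rewrite /edge /detz /=; ring.
  have l0 : l != 0.
    apply/eqP => -[/eqP h1 h2]; rewrite oppr_eq0 in h1; move/eqP: h1 => h1.
    by move: d0; rewrite -er /edge /detz /= h1 h2 !mul0r subrr ltxx.
  have bnd j : j \notin interior -> 0 <= edge p q (PP j) <= d.
    move/hB; rewrite eqb !inE => /or3P[] /eqP ->; rewrite ?ep ?eq0 ?er ?lexx ?ltW //.
  have intP : intC (PP i) by move: iI; rewrite inE => /asboolP.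
  have lN0 : - l != 0 by rewrite oppr_eq0.
  have notint j (v : R * R) : v != 0 -> hmin P i0 v = dot v (emb (P j)) -> j \notin interior.
    move=> v0 hv; rewrite inE; apply/negP => /asboolP /(_ _ v0).
    by rewrite /PolygonCone.ev /= mul1r hv subrr ltxx.
  apply/andP; split.
    have := intP _ (emb_neq0 R l0); rewrite /PolygonCone.ev /= mul1r subr_gt0.
    have [j hj] := hminP P i0 (emb l); rewrite hj -!dz_dot ltr_int.
    have /bnd/andP[] := notint j _ (emb_neq0 R l0) hj.
    rewrite !edge_dz -/l; move: (dz l _) (dz l _) (dz l _) => x y z; lia.
  have := intP _ (emb_neq0 R lN0); rewrite /PolygonCone.ev /= mul1r subr_gt0.
  have [j hj] := hminP P i0 (emb (- l)); rewrite hj -!dz_dot ltr_int.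
  have /bnd/andP[_] := notint j _ (emb_neq0 R lN0) hj.
  have dzN z : dz (- l) z = - dz l z by rewrite /dz /=; ring.
  rewrite !edge_dz -/l !dzN; move: (dz l _) (dz l _) (dz l _) => x y z; lia.
split=> //.
- have edgeE p q : exists l c, forall x, edge p q x = dz l x.1 + c * x.2.
    exists (- (P q - P p).2, (P q - P p).1), (- dz (- (P q - P p).2, (P q - P p).1) (P p)) => x.
    by rewrite /edge /detz /dz /=; ring.
  by move=> [[|[|[|]]] //= hj]; exact: edgeE.
- move=> [[|[|[|]]] //= hi] [[|[|[|]]] //= hj]; rewrite /edge3 /vertex3 /edge /= /d /detz /=; ring.
- move=> j i ib.
  have iI : i \in interior.
    apply: contraT => /hB; rewrite !inE => /or3P[] /eqP e.
    + by have := ib (Ordinal (isT : 0 < 3)%N); rewrite e /vertex3 /= eqxx.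
    + by have := ib (Ordinal (isT : 1 < 3)%N); rewrite e /vertex3 /= eqxx.
    by have := ib (Ordinal (isT : 2 < 3)%N); rewrite e /vertex3 /= eqxx.
  case: j => -[|[|[|]]] //= hj; rewrite /edge3 /=.
  + apply: (@edge_b b2 b3 b1) => //; first by split; rewrite !inE eqxx ?orbT.
      by move=> x; rewrite !inE; do 3!case: (x == _).
    by rewrite /edge /d /detz /=; ring.
  + apply: (@edge_b b3 b1 b2) => //; first by split; rewrite !inE eqxx ?orbT.
      by move=> x; rewrite !inE; do 3!case: (x == _).
    by rewrite /edge /d /detz /=; ring.
  apply: (@edge_b b1 b2 b3) => //; first by split; rewrite !inE eqxx ?orbT.
  by rewrite /edge /d /detz /=; ring.
move=> x; rewrite !big_ord_recr !big_ord0 /= /edge3 /vertex3 /= /edge /d /detz /=.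
by split; [|split]; ring.
Qed.

(** Fewer than three boundary points are padded by repetition; the padded triples have determinant 0
    and are excluded together with the collinear ones. *)
Lemma triangle_exists : (#|~: interior| <= 3)%N ->
  exists b H delta, triangle P b H delta /\ forall i, (i \in interior) = [forall j, i != b j].
Proof.
move=> B3.
have [b1 [b2 [b3 hB]]] : exists b1 b2 b3, enum (~: interior) =i [:: b1; b2; b3].
  have nB : exists i, i \in ~: interior.
    have l0 : ((1, 0) : R * R) != 0 by apply/eqP => -[/eqP]; rewrite oner_eq0.
    have [i hi] := hminP P i0 ((1, 0) : R * R); exists i; rewrite !inE.
    by apply/negP => /asboolP /(_ _ l0); rewrite /PolygonCone.ev /= mul1r hi subrr ltxx.
  have [i iB] := nB; rewrite -mem_enum in iB.
  move: B3; rewrite cardE; case: (enum _) iB => [|x [|y [|z [|t s]]]] // _ _.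
  + by exists x, x, x => u; rewrite !inE; case: (u == x).
  + by exists x, x, y => u; rewrite !inE; case: (u == x).
  by exists x, y, z => u.
have hB' i : i \notin interior -> i \in [:: b1; b2; b3] by move=> h; rewrite -hB mem_enum in_setC.
have fin (x y z : 'I_N) : [:: b1; b2; b3] =i [:: x; y; z] -> 0 < detz (P y - P x) (P z - P x) ->
    exists b H delta, triangle P b H delta /\ forall i, (i \in interior) = [forall j, i != b j].
  move=> e d0; exists (vertex3 x y z), (edge3 x y z), (detz (P y - P x) (P z - P x)); split.
    by apply: triangle_oriented => // i /hB'; rewrite e.
  move=> i; apply/idP/forallP => [iI [[|[|[|]]] //= hj]|h].
  - rewrite /vertex3 /=; apply: contraTneq iI => ->.
    by have := hB x; rewrite e mem_enum in_setC !in_cons eqxx => ->.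
  - rewrite /vertex3 /=; apply: contraTneq iI => ->.
    by have := hB y; rewrite e mem_enum in_setC !in_cons eqxx orbT => ->.
  - rewrite /vertex3 /=; apply: contraTneq iI => ->.
    by have := hB z; rewrite e mem_enum in_setC !in_cons eqxx !orbT => ->.
  apply: contraT => /hB'; rewrite e !inE => /or3P[] /eqP ei.
  - by have := h (Ordinal (isT : 0 < 3)%N); rewrite ei /vertex3 /= eqxx.
  - by have := h (Ordinal (isT : 1 < 3)%N); rewrite ei /vertex3 /= eqxx.
  by have := h (Ordinal (isT : 2 < 3)%N); rewrite ei /vertex3 /= eqxx.
case: (ltrgtP (detz (P b2 - P b1) (P b3 - P b1)) 0) => d0; last 1 first.
- (* collinear boundary points would confine all points to a line *)
  have [l l0 [e2 e3]] : exists2 l : int * int, l != 0 & dz l (P b2) = dz l (P b1) /\ dz l (P b3) = dz l (P b1).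
    case: (eqVneq (P b2) (P b1)) => e21; last first.
      exists (- (P b2 - P b1).2, (P b2 - P b1).1).
        apply: contraNneq e21 => -[/eqP h1 h2]; rewrite oppr_eq0 in h1; move/eqP: h1 => h1.
        by apply/eqP; rewrite (surjective_pairing (P b2)) (surjective_pairing (P b1)) (subr0_eq h1) (subr0_eq h2).
      by move: d0; rewrite /detz /dz /= => d0; split; lia.
    case: (eqVneq (P b3) (P b1)) => e31; last first.
      exists (- (P b3 - P b1).2, (P b3 - P b1).1).
        apply: contraNneq e31 => -[/eqP h1 h2]; rewrite oppr_eq0 in h1; move/eqP: h1 => h1.
        by apply/eqP; rewrite (surjective_pairing (P b3)) (surjective_pairing (P b1)) (subr0_eq h1) (subr0_eq h2).
      by rewrite e21 /dz /=; split; lia.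
    by exists (1, 0); rewrite ?e21 ?e31.
  have hm (v : R * R) : v != 0 -> exists2 j, j \in [:: b1; b2; b3] & hmin P i0 v = dot v (emb (P j)).
    move=> v0; have [j hj] := hminP P i0 v; exists j => //; apply: hB'.
    by rewrite inE; apply/negP => /asboolP /(_ _ v0); rewrite /PolygonCone.ev /= mul1r hj subrr ltxx.
  have eb j : j \in [:: b1; b2; b3] -> dot (emb l) (emb (P j)) = dot (emb l) (emb (P b1)).
    by rewrite !inE -!dz_dot => /or3P[] /eqP ->; rewrite ?e2 ?e3.
  have l0' := emb_neq0 R l0; have lN0 : - emb l != 0 by rewrite oppr_eq0.
  have [i [j]] := noncoll l0'.
  have [j1 /eb e1 h1] := hm _ l0'; have [j2 /eb e2' h2] := hm _ lN0.
  have := hmin_le P i0 (emb l) i; have := hmin_le P i0 (- emb l) j.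
  rewrite h1 h2 !dotNl e1 e2' lerN2 => a1 a2 a3.
  by have := le_lt_trans a2 (lt_le_trans a3 a1); rewrite ltxx.
- apply: (fin b1 b3 b2) => [x|]; first by rewrite !inE; do 3!case: (x == _).
  by move: d0; rewrite /detz /=; lia.
- by apply: (fin b1 b2 b3).
Qed.
End TriangleExists.

End BoundaryTriangles.

(** * Barycentric coordinates and sums of three points *)

Module TriangleSums.
Import KoszulContraction HomogeneousParts PolynomialKoszul KoszulVanishing BettiVanishing
  PlaneGordan PolygonCone NormalFan SupportArcs IshidaComplex HeightOne LatticeIdeals
  EhrhartCount ToricIdeals KoelmanGraphs CubicGenerators BoundaryTriangles.

Lemma height_one_abs (a e c : int * int) : coprimez e.1 e.2 -> detz e (c - a) != 0 ->
  exists c' h p q, [/\ 0 <= p, 0 <= q, h = p + q + 1,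
    detz e (c' - a) != 0 /\ (detz e (c - a) = h * detz e (c' - a) /\ `|detz e (c' - a)| = 1) &
    h * c'.1 = p * a.1 + q * (a.1 + e.1) + 1 * c.1 /\
    h * c'.2 = p * a.2 + q * (a.2 + e.2) + 1 * c.2].
Proof.
move=> ce; rewrite neq_lt => /orP[dn|dp]; last first.
  have [c' [t [/andP[t0 tH] d1 [e1 e2]]]] := height_one ce dp.
  exists c', (detz e (c - a)), (detz e (c - a) - 1 - t), t.
  by rewrite d1 !mul1r e1 e2 mulr1; split=> //; lia.
have ceN : coprimez (- e).1 (- e).2 by rewrite /coprimez /gcdz /= !abszN.
pose a' : int * int := a + e.
have DN z : detz (- e) (z - a') = - detz e (z - a) by rewrite /a' /detz /=; ring.
have dp : 0 < detz (- e) (c - a') by rewrite DN oppr_gt0.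
have [c' [t [/andP[t0 tH] d1 [e1 e2]]]] := height_one ceN dp.
have d1' : detz e (c' - a) = -1 by rewrite -[LHS]opprK -DN d1.
rewrite DN in tH e1 e2.
exists c', (- detz e (c - a)), t, (- detz e (c - a) - 1 - t); rewrite d1' !mul1r e1 e2 /a' /=.
split=> //.
- by rewrite subr_ge0.
- by ring.
- by split=> //; split=> //; rewrite mulrN1 opprK.
by split; ring.
Qed.

Section TripleSums.
Variables (k : fieldType) (N : nat) (P : 'I_N -> int * int).
Local Notation PP := (@PP N P).
Local Notation I := (@lattice_ideal k N P).
Local Notation tri := (@tri N).
Local Notation tsum := (@tsum N P).

Lemma tri_perm a b c a' b' c' : perm_eq [:: a; b; c] [:: a'; b'; c'] -> tri a b c = tri a' b' c'.
Proof.
move=> /permP h; apply/mnmP => j; have := h (pred1 j).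
by rewrite /CubicGenerators.tri !mnmDE !mnm1E /= !addn0.
Qed.

Lemma tsum_tri a b c a' b' c' : tri a b c = tri a' b' c' -> tsum a b c = tsum a' b' c'.
Proof. by move=> e; rewrite -!mlt_tri e. Qed.

Lemma tri_mem v a b c : v \in [:: a; b; c] ->
  exists x y, [/\ tri a b c = tri v x y, x \in [:: a; b; c] & y \in [:: a; b; c]].
Proof.
rewrite !inE => /or3P[] /eqP ->.
- by exists b, c; split=> //; rewrite !inE eqxx ?orbT.
- exists a, c; split; [|by rewrite !inE eqxx ?orbT|by rewrite !inE eqxx ?orbT].
  by apply/mnmP => j; rewrite !mnmDE addnCA.
exists a, b; split; [|by rewrite !inE eqxx ?orbT|by rewrite !inE eqxx ?orbT].
by apply/mnmP => j; rewrite !mnmDE; lia.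
Qed.

Lemma tri_mem2 v w a b c : v != w -> v \in [:: a; b; c] -> w \in [:: a; b; c] ->
  exists2 z, tri a b c = tri v w z & z \in [:: a; b; c].
Proof.
move=> vw; rewrite !inE => /or3P[] /eqP ev /or3P[] /eqP ew; subst v w;
  try (by rewrite eqxx in vw).
- by exists c; rewrite ?inE ?eqxx ?orbT.
- by exists b; rewrite ?inE ?eqxx ?orbT //; apply/mnmP => j; rewrite !mnmDE; lia.
- by exists c; rewrite ?inE ?eqxx ?orbT //; apply/mnmP => j; rewrite !mnmDE; lia.
- by exists a; rewrite ?inE ?eqxx ?orbT //; apply/mnmP => j; rewrite !mnmDE; lia.
- by exists b; rewrite ?inE ?eqxx ?orbT //; apply/mnmP => j; rewrite !mnmDE; lia.
by exists a; rewrite ?inE ?eqxx ?orbT //; apply/mnmP => j; rewrite !mnmDE; lia.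
Qed.

Local Notation equiv x y := (lin_syz I (mpolyX k x - mpolyX k y)).

Lemma equiv_common v a b c a' b' c' : v \in [:: a; b; c] -> v \in [:: a'; b'; c'] ->
  tsum a b c = tsum a' b' c' -> equiv (tri a b c) (tri a' b' c').
Proof.
move=> /tri_mem[x [y [e _ _]]] /tri_mem[x' [y' [e' _ _]]].
rewrite (tsum_tri e) (tsum_tri e') e e' => /addrI; exact: lin_syz_shared.
Qed.
End TripleSums.

Lemma third (j j' : 'I_3) : j != j' ->
  exists m, [/\ m != j, m != j' & forall i, [|| i == j, i == j' | i == m]].
Proof.
move=> jj; have jj' : (j : nat) <> j' by move=> e; case/eqP: jj; exact: val_inj.
have m3 : (3 - j - j' < 3)%N by have := ltn_ord j; have := ltn_ord j'; lia.
exists (Ordinal m3); have := ltn_ord j; have := ltn_ord j' => h1 h2.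
by split=> [||i]; rewrite -?val_eqE /=; try have := ltn_ord i; rewrite -?val_eqE /=; lia.
Qed.

Section Triangles.
Variables (R : realFieldType) (N : nat) (P : 'I_N -> int * int) (i0 : 'I_N).
Local Notation emb := (@emb R).
Local Notation ev := (@ev R N P i0).
Local Notation inC := (@inC R N P i0).
Local Notation intC := (@intC R N P i0).
Local Notation PP := (@PP N P).
Local Notation interior := (@interior R N P i0).
Local Notation tsum := (@tsum N P).
Hypothesis closedP : forall z, inC (z, 1) -> exists i, P i = z.
Hypothesis noncoll : forall l, l != 0 -> exists i j, dot l (emb (P i)) < dot l (emb (P j)).
Hypothesis Pinj : injective P.

Variables (b : 'I_3 -> 'I_N) (H : 'I_3 -> int * int * int -> int) (delta : int).
Hypothesis T : triangle P b H delta.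

Lemma delta_gt0 : 0 < delta. Proof. by case: T. Qed.

Lemma HD j x y : H j (x + y) = H j x + H j y.
Proof. by case: T => _ /(_ j)[l [c hl]] _ _ _; rewrite !hl /dz /=; ring. Qed.

Lemma HN j x : H j (- x) = - H j x.
Proof. by case: T => _ /(_ j)[l [c hl]] _ _ _; rewrite !hl /dz /=; ring. Qed.

Lemma Hb i j : H j (PP (b i)) = if i == j then delta else 0. Proof. by case: T. Qed.

Lemma H_int j i : (forall j', i != b j') -> 0 < H j (PP i) < delta.
Proof. by case: T => _ _ _ h _; exact: h. Qed.

Lemma H_comb j (h p q r : int) z a1 a2 a3 : h = p + q + r ->
  h * z.1 = p * a1.1 + q * a2.1 + r * a3.1 -> h * z.2 = p * a1.2 + q * a2.2 + r * a3.2 ->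
  h * H j (z, 1) = p * H j (a1, 1) + q * H j (a2, 1) + r * H j (a3, 1).
Proof.
case: T => _ /(_ j)[l [c hl]] _ _ _ e0 e1 e2; rewrite !hl /dz /= !mulr1.
have -> : h * (l.1 * z.1 + l.2 * z.2 + c) = l.1 * (h * z.1) + l.2 * (h * z.2) + h * c by ring.
by rewrite e1 e2 e0; ring.
Qed.

Lemma H_le j i : 0 <= H j (PP i) <= delta.
Proof.
case: (boolP [forall j', i != b j']) => [/forallP /(H_int j)/andP[h1 h2]|].
  by rewrite !ltW.
rewrite negb_forall => /existsP[j']; rewrite negbK => /eqP ->; rewrite Hb.
by have d0 := ltW delta_gt0; case: eqP => _; rewrite lexx d0.
Qed.

Lemma H_max j i : H j (PP i) = delta -> i = b j.
Proof.
case: (boolP [forall j', i != b j']) => [/forallP /(H_int j)/andP[_ h2] e|].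
  by rewrite e ltxx in h2.
rewrite negb_forall => /existsP[j']; rewrite negbK => /eqP ->; rewrite Hb.
by case: eqP => [-> //|_ e]; have := delta_gt0; rewrite -e ltxx.
Qed.

Lemma H_zero j i : H j (PP i) = 0 -> exists2 j', j' != j & i = b j'.
Proof.
case: (boolP [forall j', i != b j']) => [/forallP /(H_int j)/andP[h2 _] e|].
  by rewrite e ltxx in h2.
rewrite negb_forall => /existsP[j']; rewrite negbK => /eqP ->; rewrite Hb.
case: eqP => [_ e|/eqP ne _]; last by exists j'.
by have := delta_gt0; rewrite e ltxx.
Qed.

Lemma b_inj : injective b.
Proof.
move=> i j e; apply/eqP; apply: contraT => ij; have := Hb i j.
by rewrite e Hb eqxx (negbTE ij) => d; have := delta_gt0; rewrite d ltxx.
Qed.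

Lemma bary_affine l c x : delta * (dz l x.1 + c * x.2) =
  \sum_j H j x * (dz l (P (b j)) + c).
Proof.
case: T => _ _ _ _ /(_ x)[e1 [e2 e3]].
transitivity (l.1 * (delta * x.1.1) + l.2 * (delta * x.1.2) + c * (delta * x.2)).
  by rewrite /dz; ring.
rewrite e1 e2 e3 !mulr_sumr -!big_split /=; apply: eq_bigr => j _; rewrite /dz; ring.
Qed.

Lemma bary_detz e a i : delta * detz e (P i - a) =
  \sum_j H j (PP i) * detz e (P (b j) - a).
Proof.
have h z : detz e (z - a) = dz (- e.2, e.1) z + detz e (- a).
  by rewrite /detz /dz /=; ring.
rewrite h; have := bary_affine (- e.2, e.1) (detz e (- a)) (PP i).
rewrite /= mulr1 => ->; by apply: eq_bigr => j _; rewrite h.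
Qed.

Lemma sumI3 (j1 j2 j3 : 'I_3) (F : 'I_3 -> int) : j1 != j2 -> j3 != j1 -> j3 != j2 ->
  \sum_j F j = F j1 + F j2 + F j3.
Proof.
move=> j12 j31 j32; rewrite (bigD1 j1) //= (bigD1 j2) 1?eq_sym //= (bigD1 j3) ?j31 //= big1.
  by rewrite addr0 addrA.
move=> i /andP[/andP[i1 i2] i3].
have [m [_ _ /(_ i)]] := third j12; rewrite (negbTE i1) (negbTE i2) /= => /eqP im.
have [m' [_ _ /(_ j3)]] := third j12; rewrite (negbTE j31) (negbTE j32) /= => /eqP jm.
have i1' : (i : nat) <> j1 by move=> e; case/eqP: i1; exact: val_inj.
have i2' : (i : nat) <> j2 by move=> e; case/eqP: i2; exact: val_inj.
have i3' : (i : nat) <> j3 by move=> e; case/eqP: i3; exact: val_inj.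
have a1' : (j1 : nat) <> j2 by move=> e; case/eqP: j12; exact: val_inj.
have a2' : (j3 : nat) <> j1 by move=> e; case/eqP: j31; exact: val_inj.
have a3' : (j3 : nat) <> j2 by move=> e; case/eqP: j32; exact: val_inj.
exfalso; move: (ltn_ord i) (ltn_ord j1) (ltn_ord j2) (ltn_ord j3) i1' i2' i3' a1' a2' a3'.
by clear; move: (i : nat) (j1 : nat) (j2 : nat) (j3 : nat) => x y z t; lia.
Qed.

Lemma H_inC x : (forall j, 0 <= H j x) -> inC x.
Proof.
move=> hx l; case: T => d0 _ _ _ /(_ x)[e1 [e2 e3]].
rewrite -(pmulr_rge0 (x := delta%:~R)) ?ltr0z //.
have -> : delta%:~R * ev l x = \sum_j (H j x)%:~R * ev l (PP (b j)).
  rewrite /PolygonCone.ev /dot /= ; set hm := hmin _ _ _.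
  transitivity (l.1 * (delta * x.1.1)%:~R + l.2 * (delta * x.1.2)%:~R - (delta * x.2)%:~R * hm).
    by rewrite !intrM; ring.
  rewrite e1 e2 e3 !(rmorph_sum (intr : {rmorphism int -> R})) !mulr_sumr mulr_suml -big_split -sumrB /=.
  by apply: eq_bigr => j _; rewrite !intrM; ring.
by apply: sumr_ge0 => j _; rewrite mulr_ge0 ?ler0z // ev_PP.
Qed.

(** The third barycentric coordinate vanishes at both summands, so they are vertices; the coordinate
    at j tells which. *)
Lemma unique_pair_b j j' : j != j' -> unique_pair P (b j) (b j').
Proof.
move=> jj c d e; have [m [mj mj' hm]] := third jj.
have em := congr1 (H m) e; rewrite !HD !Hb eq_sym (negbTE mj) eq_sym (negbTE mj') addr0 in em.
have [cm _] := andP (H_le m c); have [dm _] := andP (H_le m d).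
have [p pm cp] : exists2 p, p != m & c = b p by apply: H_zero; lia.
have [q qm dq] : exists2 q, q != m & d = b q by apply: H_zero; lia.
have ej := congr1 (H j) e; rewrite !HD cp dq !Hb eqxx [j' == j]eq_sym (negbTE jj) addr0 in ej.
have d0 := delta_gt0.
have := hm p; have := hm q; rewrite (negbTE pm) (negbTE qm) !orbF.
case: (eqVneq q j) ej => [qj|qj]; case: (eqVneq p j) => [pj|pj] //= ej.
- by move: ej d0; clear; lia.
- by move=> _ /eqP pj'; rewrite cp dq pj' qj; apply/mnmP => i; rewrite !mnmDE addnC.
- by move=> /eqP qj' _; rewrite cp dq pj qj'.
by move: ej d0; clear; lia.
Qed.

Section Collinear.
Variables (a e : int * int).
Hypotheses (ce : coprimez e.1 e.2) (aC : inC (a, 1)) (aeC : inC (a + e, 1)).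
Hypothesis D0 : forall i, i \in interior -> detz e (P i - a) = 0.
Hypothesis intE : forall i, (i \in interior) = [forall j, i != b j].

(** The triangle over the segment from a to a + e with apex b_j has a lattice point at height 1 or
    -1. It is off the line of interior points, so it is a vertex; its positive weight at b_j makes
    it b_j itself. *)
Lemma side_le1 j : detz e (P (b j) - a) != 0 -> `|detz e (P (b j) - a)| = 1.
Proof.
move=> dj; have [c' [h [p [q [p0 q0 hE [dc' [dcE dc1]] [e1 e2]]]]]] := height_one_abs ce dj.
have h0 : 0 < h by lia.
have c'C : inC (c', 1).
  by apply: (comb_inC (a := a) (b := a + e) (c := P (b j)) h0 p0 q0 ler01 hE e1 e2 aC aeC); exact: inC_PP.
have [i Pi] := closedP c'C; have [i1 Pi1] := closedP aC; have [i2 Pi2] := closedP aeC.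
have : i \notin interior by apply: contraNN dc' => /D0; rewrite Pi => ->.
rewrite intE negb_forall => /existsP[j']; rewrite negbK => /eqP ij'.
have : h * H j' (PP i) = p * H j' (PP i1) + q * H j' (PP i2) + H j' (PP (b j)).
  rewrite /PolygonCone.PP Pi Pi1 Pi2.
  by rewrite (@H_comb j' h p q 1 c' a (a + e) (P (b j)) hE e1 e2) mul1r.
rewrite {1}ij' Hb eqxx.
have /andP[_ a1] := H_le j' i1; have /andP[_ a2] := H_le j' i2; have /andP[_ a3] := H_le j' (b j).
have b1 := ler_wpM2l p0 a1; have b2 := ler_wpM2l q0 a2.
rewrite {1}hE !mulrDl mul1r => e3.
have eq3 : H j' (PP (b j)) = delta.
  by move: e3 b1 b2 a3; clear; move: (p * _) (q * _) (p * _) (q * _) => x y z t; lia.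
by rewrite (H_max eq3) -ij' Pi.
Qed.

Lemma not_all_zero : ~ forall j, detz e (P (b j) - a) = 0.
Proof.
move=> h0; have e0 : ((- e.2, e.1) : int * int) != 0.
  apply/eqP => -[/eqP h1 h2]; rewrite oppr_eq0 in h1; move/eqP: h1 => h1.
  by move: ce; rewrite h1 h2.
have [i [j]] := noncoll (emb_neq0 R e0); rewrite -!dz_dot ltr_int.
have z i' : detz e (P i' - a) = 0.
  apply: (mulfI (lt0r_neq0 delta_gt0)); rewrite mulr0 bary_detz big1 // => j' _.
  by rewrite h0 mulr0.
have := z i; have := z j; rewrite /detz /dz /=; lia.
Qed.

(** The heights of the vertices are 0, 1 or -1 and have weighted mean 0 at u with positive weights,
    so both signs occur. It remains to exclude a repeated sign. *)
Lemma collinear_signs u : u \in interior -> exists jp jv jw,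
  [/\ jp != jv, jp != jw & jv != jw] /\
  [/\ detz e (P (b jp) - a) = 0, detz e (P (b jv) - a) = 1 & detz e (P (b jw) - a) = - 1].
Proof.
move=> uI; pose D j := detz e (P (b j) - a).
have Hu j : 0 < H j (PP u) < delta.
  by apply: H_int => j'; move: uI; rewrite intE => /forallP/(_ j').
have sum0 : \sum_j H j (PP u) * D j = 0 by rewrite -bary_detz D0 // mulr0.
have cases j : [\/ D j = 0, D j = 1 | D j = -1].
  case: (eqVneq (D j) 0) => [|/side_le1 h]; first by constructor 1.
  by move: h; rewrite -/(D j); case: (lerP 0 (D j)) => h0 h; [constructor 2|constructor 3]; lia.
have pm : (exists j, D j = 1) /\ (exists j, D j = -1).
  split; apply: contrapT => nex; apply: not_all_zero => j; apply/eqP; apply: contraT => dj.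
    have le0 i : 0 <= - (H i (PP u) * D i).
      have /andP[h1 _] := Hu i; rewrite -mulrN mulr_ge0 ?(ltW h1) //.
      by case: (cases i) => d; rewrite d //; case: nex; exists i.
    have : \sum_i - (H i (PP u) * D i) = 0 by rewrite sumrN sum0 oppr0.
    move/eqP; rewrite psumr_eq0 // => /allP/(_ j (mem_index_enum _)) /=.
    by rewrite oppr_eq0 mulf_eq0 (negbTE dj) orbF gt_eqF //; case/andP: (Hu j).
  have le0 i : 0 <= H i (PP u) * D i.
    have /andP[h1 _] := Hu i; rewrite mulr_ge0 ?(ltW h1) //.
    by case: (cases i) => d; rewrite d //; case: nex; exists i.
  move/eqP: sum0; rewrite psumr_eq0 // => /allP/(_ j (mem_index_enum _)) /=.
  by rewrite mulf_eq0 (negbTE dj) orbF gt_eqF //; case/andP: (Hu j).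
have [[jv Dv] [jw Dw]] := pm.
have vw : jv != jw by apply: contra_eqN Dv => /eqP ->; rewrite Dw.
have [m [mv mw hm]] := third vw.
case: (eqVneq (D m) 0) => [Dm|Dm0]; first by exists m, jv, jw.
(* Otherwise reflecting the lone vertex b j' at u gives a lattice point inside
   the opposite edge. *)
have refl j j' : j != j' -> m != j -> m != j' -> D m = D j -> D j' = - D j -> D j != 0 -> False.
  move=> jj mj mj' e1 e2 dj.
  have s1 := sumI3 (fun i => H i (PP u) * D i) jj mj mj'; rewrite sum0 e1 e2 in s1.
  have s2 : \sum_i H i (PP u) = delta.
    by case: T => _ _ _ _ /(_ (PP u))[_ [_]]; rewrite /= mulr1 => <-.
  rewrite (sumI3 _ jj mj mj') in s2.
  (* Hence u has coordinate delta / 2 at j', and its reflection has coordinate 0 there. *)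
  have s3 : H j (PP u) - H j' (PP u) + H m (PP u) = 0.
    by apply: (mulIf dj); rewrite mul0r [RHS]s1; ring.
  pose x := PP u + PP u - PP (b j').
  have Hx i : H i x = H i (PP u) + H i (PP u) - (if j' == i then delta else 0).
    by rewrite /x !HD HN Hb.
  have xC : inC x.
    apply: H_inC => i; rewrite Hx; have /andP[hu _] := Hu i; case: eqP => [<-|_]; last by lia.
    by lia.
  have xE : x = (x.1, 1) by apply: eq_triple.
  have [y Py] : exists y, P y = x.1 by apply: closedP; rewrite -xE.
  have Py' : PP y = x by rewrite xE /PolygonCone.PP Py.
  have [q qj yq] : exists2 q, q != j' & y = b q.
    by apply: H_zero; rewrite Py' Hx eqxx; lia.
  have hq i : i != j' -> i != q -> False.
    move=> ij' iq; have := Hx i; rewrite -Py' yq Hb eq_sym (negbTE iq) eq_sym (negbTE ij').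
    have /andP[+ _] := Hu i; clear; move: (H i (PP u)) => y; lia.
  case: (eqVneq q j) => [qj'|qj']; last by apply: (hq j) => //; rewrite eq_sym.
  by apply: (hq m) => //; rewrite qj'.
exfalso; case: (cases m) => Dm; first by rewrite Dm in Dm0.
  by apply: (refl jv jw) => //; rewrite ?Dm ?Dv ?Dw.
apply: (refl jw jv) => //; rewrite ?Dm ?Dv ?Dw // eq_sym //.
Qed.
End Collinear.

Lemma primitive_step a z : z != a -> inC (a, 1) -> inC (z, 1) ->
  exists e g, [/\ coprimez e.1 e.2, 0 < g, inC (a + e, 1) &
    z.1 - a.1 = g * e.1 /\ z.2 - a.2 = g * e.2].
Proof.
move=> za aC zC; pose g := gcdz (z.1 - a.1) (z.2 - a.2).
have gn0 : g != 0.
  rewrite gcdz_eq0; apply: contra za => /andP[/eqP h1 /eqP h2].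
  by rewrite (surjective_pairing z) (surjective_pairing a) (subr0_eq h1) (subr0_eq h2).
have g0 : 0 < g by rewrite lt_def gn0.
pose e : int * int := (((z.1 - a.1) %/ g)%Z, ((z.2 - a.2) %/ g)%Z).
have e1 : z.1 - a.1 = g * e.1 by rewrite mulrC divzK // dvdz_gcdl.
have e2 : z.2 - a.2 = g * e.2 by rewrite mulrC divzK // dvdz_gcdr.
exists e, g; split=> //.
  rewrite /coprimez; apply/eqP; apply: (mulfI gn0); rewrite mulr1.
  by rewrite -{1}(gez0_abs (ltW g0)) -[RHS]/(gcdz (z.1 - a.1) (z.2 - a.2)) e1 e2 /gcdz /= !abszM -muln_gcdr PoszM.
have gm1 : 0 <= g - 1 by rewrite subr_ge0 -gtz0_ge1.
have gE : g = g - 1 + 1 + 0 by ring.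
apply: (comb_inC (a := a) (b := z) (c := a) g0 gm1 ler01 (lexx 0) gE _ _ aC zC aC).
  by rewrite /= mulrDr -e1; ring.
by rewrite /= mulrDr -e2; ring.
Qed.

End Triangles.

End TriangleSums.

(** * Cubics when the interior points are collinear *)

Module CollinearCubics.
Import KoszulContraction HomogeneousParts PolynomialKoszul KoszulVanishing BettiVanishing
  PlaneGordan PolygonCone NormalFan SupportArcs IshidaComplex HeightOne LatticeIdeals
  EhrhartCount ToricIdeals KoelmanGraphs CubicGenerators BoundaryTriangles TriangleSums.

Section CollinearInterior.
Variables (R : realFieldType) (N : nat) (P : 'I_N -> int * int) (i0 : 'I_N).
Variables (k : fieldType) (C : free_complex k N).
Local Notation emb := (@emb R).
Local Notation inC := (@inC R N P i0).
Local Notation intC := (@intC R N P i0).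
Local Notation PP := (@PP N P).
Local Notation interior := (@interior R N P i0).
Local Notation tsum := (@tsum N P).
Local Notation I := (@lattice_ideal k N P).
Local Notation equiv x y := (lin_syz I (mpolyX k x - mpolyX k y)).
Hypothesis closedP : forall z, inC (z, 1) -> exists i, P i = z.
Hypothesis noncoll : forall l, l != 0 -> exists i j, dot l (emb (P i)) < dot l (emb (P j)).
Hypothesis Pinj : injective P.
Hypothesis chark : [pchar k] =i pred0.
Hypothesis resC : minimal_graded_free_resolution I C.

Definition quad_away (w : 'I_N) : Prop :=
  forall a1 a2 a3 b1 b2 b3, a1 != w -> a2 != w -> a3 != w -> b1 != w -> b2 != w -> b3 != w ->
  tsum a1 a2 a3 = tsum b1 b2 b3 -> equiv (tri a1 a2 a3) (tri b1 b2 b3).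

(** Without w all points have height 0 or 1, so the remaining polygon has no interior points and
    Koelman's criterion applies. *)
Lemma quad_end p v w u e t : v != w -> p != w -> u != w -> t != 0 ->
  detz e (P v - P p) = 1 -> detz e (P w - P p) = -1 ->
  (forall i, i != v -> i != w -> detz e (P i - P p) = 0) ->
  P u - P p = (t * e.1, t * e.2) -> quad_away w.
Proof.
move=> vw pw uw t0 Dv Dw D0 Pu.
have cb : p \in [set~ w] by rewrite !inE.
pose l : int * int := (- e.2, e.1).
have dzD z : dz l z = detz e (z - P p) + dz l (P p) by rewrite /dz /detz /=; ring.
have dz_le i j : (dz l (P i) <= dz l (P j)) = (detz e (P i - P p) <= detz e (P j - P p)).
  by rewrite (dzD (P i)) (dzD (P j)) lerD2r.
have dzN z : dz (- l) z = - dz l z by rewrite /dz /=; ring.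
have Dge i : i != w -> 0 <= detz e (P i - P p).
  by move=> iw; case: (eqVneq i v) => [->|iv]; [rewrite Dv|rewrite D0].
have Dle i : detz e (P i - P p) <= 1.
  case: (eqVneq i v) => [->|iv]; first by rewrite Dv.
  by case: (eqVneq i w) => [->|iw]; [rewrite Dw|rewrite D0].
have l0 : l != 0.
  by apply/eqP => -[/eqP h1 h2]; rewrite oppr_eq0 in h1; move: Dv; rewrite /detz (eqP h1) h2 !mul0r.
have nI : #|@EhrhartCount.interior R _ (P \o @sub_inj N w) (sub_base cb)| = 0%N.
  apply/eqP; rewrite cards_eq0; apply/eqP/setP => i; rewrite !inE; apply/negbTE/negP => /asboolP.
  have iw := sub_inj_neq i.
  case: (eqVneq (sub_inj i) v) => iv.
    apply: (@min_not_interior R _ (P \o @sub_inj N w) (sub_base cb) (- l)); first by rewrite oppr_eq0.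
    by move=> j; rewrite !dzN lerN2 dz_le iv Dv Dle.
  apply: (@min_not_interior R _ (P \o @sub_inj N w) (sub_base cb) l) => //.
  by move=> j; rewrite dz_le (D0 _ iv iw) Dge // sub_inj_neq.
apply: (@sub_quad R N P i0 k w p chark closedP Pinj cb l p u v) => //.
- by move=> i iw; rewrite ltNge dz_le Dw -ltNge (lt_le_trans _ (Dge i iw)).
- rewrite Pu; have -> : detz (t * e.1, t * e.2) (P v - P p) = t * detz e (P v - P p).
    by rewrite /detz /=; ring.
  by rewrite Dv mulr1.
by rewrite nI; case: leqP => // h; rewrite add0n h.
Qed.

Variables (b : 'I_3 -> 'I_N) (H : 'I_3 -> int * int * int -> int) (delta : int).
Hypothesis T : triangle P b H delta.
Hypothesis intE : forall i, (i \in interior) = [forall j, i != b j].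

(** Along e the line carries the points p, p + e, ..., p + n e, and v + w = 2 p + (2 n + 1) e. The
    exceptional monomials are v w x for x on the line other than its far end [un], with partner [un]
    twice and x + e. *)
Lemma betti13_line jp jv jw e u t : jp != jv -> jp != jw -> jv != jw -> coprimez e.1 e.2 ->
  detz e (P (b jv) - P (b jp)) = 1 -> detz e (P (b jw) - P (b jp)) = -1 ->
  (forall i, i \in interior -> detz e (P i - P (b jp)) = 0) ->
  u \in interior -> P u - P (b jp) = (t * e.1, t * e.2) -> 0 < t ->
  betti C 1 3 = (N - 3)%N.
Proof.
move=> jpv jpw jvw ce; set p := b jp; set v := b jv; set w := b jw.
move=> Dv Dw Dint uI Pu t0.
have [m [mv mw hm]] := third jvw.
have jpm : jp = m by have := hm jp; rewrite (negbTE jpv) (negbTE jpw) /= => /eqP.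
have binj := b_inj T.
have pv : p != v by rewrite (inj_eq binj).
have pw : p != w by rewrite (inj_eq binj).
have vw : v != w by rewrite (inj_eq binj).
pose D i := detz e (P i - P p).
have Dp : D p = 0 by rewrite /D subrr /detz /= !mulr0 subrr.
have bnd i : i != p -> i != v -> i != w -> i \in interior.
  move=> ip iv iw; rewrite intE; apply/forallP => j; have := hm j.
  by case/or3P => /eqP ->; rewrite // -jpm.
have D0 i : i != v -> i != w -> D i = 0.
  by move=> iv iw; case: (eqVneq i p) => [-> //|ip]; apply/Dint/bnd.
have /choice[tau tauP] i : exists s : int, i != v -> i != w -> P i - P p = (s * e.1, s * e.2).
  case: (boolP ((i != v) && (i != w))) => [/andP[iv iw]|h].
    by have [s hs] := detz_eq0 ce (D0 i iv iw); exists s.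
  by exists 0 => iv iw; rewrite iv iw in h.
have e0 (s s' : int) : ((s * e.1, s * e.2) : int * int) = (s' * e.1, s' * e.2) -> s = s'.
  move=> [h1 h2]; have /coprimezP[[x y] /= xy] := ce.
  have -> : s = x * (s * e.1) + y * (s * e.2) by rewrite -[LHS]mulr1 -xy; ring.
  by rewrite h1 h2 -[RHS]mulr1 -xy; ring.
have P1 i : i != v -> i != w -> (P i).1 = (P p).1 + tau i * e.1.
  by move=> iv iw; have := congr1 fst (tauP i iv iw); rewrite /= => <-; ring.
have P2 i : i != v -> i != w -> (P i).2 = (P p).2 + tau i * e.2.
  by move=> iv iw; have := congr1 snd (tauP i iv iw); rewrite /= => <-; ring.
have tau_inj i i' : i != v -> i != w -> i' != v -> i' != w -> tau i = tau i' -> i = i'.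
  move=> iv iw i'v i'w h; apply: Pinj; rewrite (surjective_pairing (P i)) (surjective_pairing (P i')).
  by rewrite (P1 i) // (P1 i') // (P2 i) // (P2 i') // h.
have notb i j : i \in interior -> i != b j by rewrite intE => /forallP.
have uv : u != v by exact: notb.
have uw : u != w by exact: notb.
have tau_u : tau u = t by apply: e0; rewrite -tauP.
pose A : {set 'I_N} := ~: [set v; w].
have inA i : (i \in A) = (i != v) && (i != w) by rewrite !inE negb_or.
have uA : u \in A by rewrite inA uv uw.
pose un := [arg max_(i > u in A) tau i]%O.
have [unA unmax] : un \in A /\ forall i, i \in A -> tau i <= tau un by rewrite /un; case: arg_maxP.
have [unv unw] := andP (etrans (esym (inA un)) unA).
pose n := tau un; have n0 : 0 < n by apply: lt_le_trans (unmax u uA); rewrite tau_u.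
have unp : un != p.
  apply: contraTneq n0 => unp; rewrite /n unp (_ : tau p = 0) ?ltxx //.
  by apply: e0; rewrite -tauP // subrr !mul0r.
have unI : un \in interior by exact: bnd.
(* v + w = 2 p + s e *)
have [s hs] : exists s, P v + P w - (P p + P p) = (s * e.1, s * e.2).
  apply: detz_eq0 => //; transitivity (D v + D w); first by rewrite /D /detz /=; ring.
  by rewrite /D Dv Dw subrr.
have s1 : (P v).1 + (P w).1 = (P p).1 + (P p).1 + s * e.1.
  by have := congr1 fst hs; rewrite /= => <-; ring.
have s2 : (P v).2 + (P w).2 = (P p).2 + (P p).2 + s * e.2.
  by have := congr1 snd hs; rewrite /= => <-; ring.
(* The coordinates of v and w grow equally along e and reach delta after s steps; the far end is
   interior, so its coordinate at p is still positive after n steps. *)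
have sgt : 2 * n < s.
  pose eta j := H j (e, 0).
  have Hun j : H j (PP un) = H j (PP p) + n * eta j.
    case: T => _ /(_ j)[l [c hl]] _ _ _; rewrite /eta !hl /dz /= !mulr1 mulr0 addr0.
    by rewrite (P1 un) // (P2 un) // -/n; ring.
  have Hvw j : H j (PP v) + H j (PP w) = H j (PP p) + H j (PP p) + s * eta j.
    case: T => _ /(_ j)[l [c hl]] _ _ _; rewrite /eta !hl /dz /= !mulr1 mulr0 addr0.
    transitivity (l.1 * ((P v).1 + (P w).1) + l.2 * ((P v).2 + (P w).2) + (c + c)); first by ring.
    by rewrite s1 s2; ring.
  have ev := Hvw jv; have ew := Hvw jw; have up := Hun jp; have uv' := Hun jv; have uw' := Hun jw.
  rewrite !(Hb T) eqxx (negbTE jpv) [jw == jv]eq_sym (negbTE jvw) in ev.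
  rewrite !(Hb T) eqxx (negbTE jpw) (negbTE jvw) in ew.
  rewrite (Hb T) (negbTE jpv) in uv'; rewrite (Hb T) (negbTE jpw) in uw'.
  have sumH : \sum_j H j (PP un) = delta.
    by case: T => _ _ _ _ /(_ (PP un))[_ [_]]; rewrite /= mulr1 => <-.
  rewrite (sumI3 _ jvw jpv jpw) in sumH.
  have hp : 0 < H jp (PP un) by case/andP: (H_int T jp (notb un ^~ unI)).
  have hv : 0 < H jv (PP un) by case/andP: (H_int T jv (notb un ^~ unI)).
  have d0 := delta_gt0 T.
  rewrite uv' add0r in hv sumH; rewrite uw' add0r in sumH.
  rewrite addr0 !add0r in ev; rewrite !add0r in ew.
  have eta0 : 0 < eta jv by rewrite pmulr_rgt0 in hv.
  have s0 : s != 0 by apply: contraTneq d0 => s0; rewrite ev s0 mul0r ltxx.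
  have ee : eta jw = eta jv by apply: (mulfI s0); rewrite -ew -ev.
  rewrite -(ltr_pM2r eta0) -ev -sumH ee -mulrA mulrDl mul1r; move: hp; clear.
  by move: (n * _) (H _ _) => x y; lia.
(* For larger s the triangle would contain p + (n + 1) e, beyond the far end. *)
have sle : s <= 2 * n + 1.
  rewrite leNgt; apply/negP => sn.
  pose y : int * int := ((P p).1 + (n + 1) * e.1, (P p).2 + (n + 1) * e.2).
  have yC : inC (y, 1).
    have h0 : 0 < s by move: sn n0; clear; lia.
    have h1 : 0 <= s - 2 * (n + 1) by move: sn; clear; lia.
    have h2 : 0 <= n + 1 by move: n0; clear; lia.
    have h3 : s = s - 2 * (n + 1) + (n + 1) + (n + 1) by ring.
    apply: (comb_inC (a := P p) (b := P v) (c := P w) h0 h1 h2 h2 h3); try exact: inC_PP.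
      transitivity ((s - 2 * (n + 1)) * (P p).1 + (n + 1) * ((P v).1 + (P w).1)); last by ring.
      by rewrite s1 /y /=; ring.
    transitivity ((s - 2 * (n + 1)) * (P p).2 + (n + 1) * ((P v).2 + (P w).2)); last by ring.
    by rewrite s2 /y /=; ring.
  have [i Pi] := closedP yC.
  have Di : D i = 0 by rewrite /D Pi /y /detz /=; ring.
  have iv : i != v by apply: contra_eqN Di => /eqP ->; rewrite /D Dv.
  have iw : i != w by apply: contra_eqN Di => /eqP ->; rewrite /D Dw.
  have ti : tau i = n + 1.
    by apply: e0; rewrite -tauP // Pi /y; congr (_, _) => /=; ring.
  by have := unmax i; rewrite inA iv iw ti -/n => /(_ isT); clear; lia.
have sE : s = 2 * n + 1 by move: sgt sle; clear; lia.
pose E0 := A :\ un; pose r := #|E0|.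
have rE : r = (N - 3)%N.
  have cA : #|A| = (N - 2)%N by rewrite cardsCs setCK cards2 vw card_ord.
  have := cardsD1 un A; rewrite unA cA -/E0 -/r add1n; clear; lia.
rewrite -rE.
have inE0 i : (i \in E0) = [&& i != un, i != v & i != w] by rewrite in_setD1 inA.
have /choice[nx nxP] (j : 'I_r) : exists i, [/\ i != v, i != w & tau i = tau (enum_val j) + 1].
  have := enum_valP j; rewrite inE0; set x := enum_val j => /and3P[xun xv xw].
  have xn : tau x < n.
    rewrite lt_neqAle unmax ?inA ?xv ?xw // andbT; apply: contraNneq xun => ex.
    exact/eqP/tau_inj.
  pose y : int * int := ((P p).1 + (tau x + 1) * e.1, (P p).2 + (tau x + 1) * e.2).
  have yC : inC (y, 1).
    have h0 : 0 < n - tau x by rewrite subr_gt0.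
    have h1 : 0 <= n - tau x - 1 by move: xn; clear; move: (tau x) => z; lia.
    have h3 : n - tau x = n - tau x - 1 + 0 + 1 by ring.
    apply: (comb_inC (a := P x) (b := P x) (c := P un) h0 h1 (lexx 0) ler01 h3); try exact: inC_PP.
      by rewrite /y /= (P1 x) // (P1 un) // -/n; ring.
    by rewrite /y /= (P2 x) // (P2 un) // -/n; ring.
  have [i Pi] := closedP yC.
  have Di : D i = 0 by rewrite /D Pi /y /detz /=; ring.
  have iv : i != v by apply: contra_eqN Di => /eqP ->; rewrite /D Dv.
  have iw : i != w by apply: contra_eqN Di => /eqP ->; rewrite /D Dw.
  exists i; split=> //.
  by apply: e0; rewrite -tauP // Pi /y; congr (_, _) => /=; ring.
pose DD (x : int * int * int) := detz e (x.1 - (x.2 * (P p).1, x.2 * (P p).2)).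
have DDD x y : DD (x + y) = DD x + DD y by rewrite /DD /detz /=; ring.
have DDP i : DD (PP i) = D i.
  by rewrite /DD /D /detz /=; ring.
have Dcase i : [\/ i = v, i = w | (i != v) && (i != w)].
  case: (eqVneq i v) => [->|iv]; first by constructor 1.
  by case: (eqVneq i w) => [->|iw]; [constructor 2|constructor 3].
have tsumD a1 a2 a3 : DD (tsum a1 a2 a3) = D a1 + (D a2 + D a3).
  by rewrite /CubicGenerators.tsum !DDD !DDP.
(* the coordinate along e of the sum of points of height 0 *)
pose F (x : int * int * int) (z : int) := x.1 = (x.2 * (P p).1 + z * e.1, x.2 * (P p).2 + z * e.2).
have FD x y z z' : F x z -> F y z' -> F (x + y) (z + z').
  by rewrite /F => h h'; rewrite /= h h'; congr (_, _) => /=; ring.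
have FP i : i != v -> i != w -> F (PP i) (tau i).
  by move=> iv iw; rewrite /F /= !mul1r -(P1 i) // -(P2 i) //; case: (P i).
have Fvw : F (PP v + PP w) s.
  by rewrite /F; transitivity ((P v).1 + (P w).1, (P v).2 + (P w).2) => //; rewrite s1 s2; congr (_, _) => /=; ring.
have Finj x z z' : F x z -> F x z' -> z = z'.
  by rewrite /F => -> [/addrI h1 /addrI h2]; apply: e0; rewrite h1 h2.
have tn0 : t != 0 by rewrite gt_eqF.
have qw : quad_away w := @quad_end p v w u e t vw pw uw tn0 Dv Dw D0 Pu.
have DN z : detz (- e) z = - detz e z by rewrite /detz /=; ring.
have qv : quad_away v.
  have wv : w != v by rewrite eq_sym.
  have tN0 : - t != 0 by rewrite oppr_eq0.
  apply: (@quad_end p w v u (- e) (- t) wv pv uv tN0).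
  - by rewrite DN Dw opprK.
  - by rewrite DN Dv.
  - by move=> i iw iv; rewrite DN -[detz e _]/(D i) D0 // oppr0.
  by rewrite Pu /= !mulrNN.
(* Heights put the third point z on the line, and as the triple is not exceptional, z is the far
   end. Then the sum lies at 3 n + 1 along e, out of reach for three points of the line. *)
have main a1 a2 a3 b1 b2 b3 : (forall j : 'I_r, tri a1 a2 a3 <> tri v w (enum_val j)) ->
    v \in [:: a1; a2; a3] -> w \in [:: a1; a2; a3] ->
    v \notin [:: b1; b2; b3] -> w \notin [:: b1; b2; b3] ->
    tsum a1 a2 a3 = tsum b1 b2 b3 -> False.
  move=> hE va wa; rewrite !inE !negb_or ![v == _]eq_sym ![w == _]eq_sym.
  move=> /and3P[b1v b2v b3v] /and3P[b1w b2w b3w] es.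
  have [z ez za] := tri_mem2 vw va wa; rewrite (tsum_tri P ez) in es.
  have := congr1 DD es; rewrite !tsumD {1}/D {1}/D Dv Dw (D0 b1) // (D0 b2) // (D0 b3) // addrA subrr add0r !addr0.
  case: (Dcase z) => [->|->|/andP[zv zw] _]; [by rewrite /D Dv|by rewrite /D Dw|].
  case: (eqVneq z un) => [zun|zun]; last first.
    have zE : z \in E0 by rewrite inE0 zun zv zw.
    by apply: (hE (enum_rank_in zE z)); rewrite enum_rankK_in.
  have f1 : F (tsum v w z) (s + tau z).
    rewrite /CubicGenerators.tsum addrA; exact (FD _ _ _ _ Fvw (FP _ zv zw)).
  have f2 : F (tsum v w z) (tau b1 + (tau b2 + tau b3)).
    by rewrite es; exact (FD _ _ _ _ (FP _ b1v b1w) (FD _ _ _ _ (FP _ b2v b2w) (FP _ b3v b3w))).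
  have := Finj _ _ _ f1 f2; rewrite zun -/n sE.
  have := unmax b1; have := unmax b2; have := unmax b3.
  rewrite !inA b1v b1w b2v b2w b3v b3w -/n => /(_ isT) + /(_ isT) + /(_ isT).
  by clear; move: (tau b1) (tau b2) (tau b3) => x y z'; lia.
(* The total height is at least 1 for the triple with v and at most -1 for the triple with w. *)
have main2 a1 a2 a3 b1 b2 b3 : v \in [:: a1; a2; a3] -> w \notin [:: a1; a2; a3] ->
    v \notin [:: b1; b2; b3] -> w \in [:: b1; b2; b3] ->
    tsum a1 a2 a3 = tsum b1 b2 b3 -> False.
  move=> va wa vb wb es.
  have Dge i : i != w -> 0 <= D i.
    move=> iw'; case: (Dcase i) => [->|e'|/andP[iv _]]; [by rewrite /D Dv|by rewrite e' eqxx in iw'|by rewrite D0].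
  have Dle i : i != v -> D i <= 0.
    move=> iv'; case: (Dcase i) => [e'|->|/andP[_ iw]]; [by rewrite e' eqxx in iv'|by rewrite /D Dw|by rewrite D0].
  have [x [y [e1 xa ya]]] := tri_mem va; have [x' [y' [e2 xb yb]]] := tri_mem wb.
  have := congr1 DD es; rewrite (tsum_tri P e1) (tsum_tri P e2) !tsumD {1}/D Dv [D w]/D Dw.
  have := Dge x (memPn wa _ xa); have := Dge y (memPn wa _ ya).
  have := Dle x' (memPn vb _ xb); have := Dle y' (memPn vb _ yb).
  by clear; move: (D x) (D y) (D x') (D y') => c1 c2 c3 c4; lia.
have DvE : D v = 1 by [].
have DwE : D w = -1 by [].
have upair_u x : x != v -> x != w -> unique_pair P v x /\ unique_pair P w x.
  move=> xv xw; split=> c d es; have := congr1 DD es; rewrite !DDD !DDP (D0 x) // addr0.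
    rewrite DvE; case: (Dcase c) es => [->|->|/andP[cv cw]] es.
    - by move=> _; have /(congr1 fst)/Pinj -> := addrI _ es.
    - by rewrite DwE; case: (Dcase d) => [->|->|/andP[dv dw]]; rewrite ?DvE ?DwE ?D0.
    rewrite (D0 c) // add0r; case: (Dcase d) es => [->|->|/andP[dv dw]] es.
    - move=> _; rewrite addrC in es; have /(congr1 fst)/Pinj -> := addrI _ es.
      by apply/mnmP => j; rewrite !mnmDE addnC.
    - by rewrite DwE.
    by rewrite D0.
  rewrite DwE; case: (Dcase c) es => [->|->|/andP[cv cw]] es.
  - by rewrite DvE; case: (Dcase d) => [->|->|/andP[dv dw]]; rewrite ?DvE ?DwE ?D0.
  - by move=> _; have /(congr1 fst)/Pinj -> := addrI _ es.
  rewrite (D0 c) // add0r; case: (Dcase d) es => [->|->|/andP[dv dw]] es.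
  - by rewrite DvE.
  - move=> _; rewrite addrC in es; have /(congr1 fst)/Pinj -> := addrI _ es.
    by apply/mnmP => j; rewrite !mnmDE addnC.
  by rewrite D0.
(* Two points of the line reach at most 2 n along e, while v + w is at 2 n + 1. *)
have upair_vw : unique_pair P v w.
  move=> c d es; have := congr1 DD es; rewrite !DDD !DDP DvE DwE subrr.
  case: (Dcase c) es => [->|->|/andP[cv cw]] es.
  - by move=> _; have /(congr1 fst)/Pinj -> := addrI _ es.
  - move=> _; rewrite [PP v + _]addrC in es; have /(congr1 fst)/Pinj -> := addrI _ es.
    by apply/mnmP => j; rewrite !mnmDE addnC.
  rewrite (D0 c) // add0r; case: (Dcase d) => [->|->|/andP[dv dw] _]; [by rewrite DvE|by rewrite DwE|].
  have f1 := FD _ _ _ _ (FP c cv cw) (FP d dv dw); rewrite es in f1.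
  have := Finj _ _ _ f1 Fvw; rewrite sE.
  have := unmax c; have := unmax d; rewrite !inA cv cw dv dw -/n => /(_ isT) + /(_ isT).
  by clear; move: (tau c) (tau d) => x y; lia.
have Ej (j : 'I_r) : [&& enum_val j != un, enum_val j != v & enum_val j != w].
  by have := enum_valP j; rewrite inE0.
apply: (@betti13_exceptional k N P Pinj C resC r (fun=> v) (fun=> w) (fun j => enum_val j)
  (fun=> un) (fun=> un) nx) => /=.
- move=> j j' /mnmP h; apply: enum_val_inj; have := h (enum_val j).
  rewrite !mnmDE !mnm1E eqxx; have /and3P[_ /negbTE jv' /negbTE jw'] := Ej j.
  rewrite [v == _]eq_sym [w == _]eq_sym jv' jw' !add0n.
  by case: eqP => [-> //|].
- move=> j; have /and3P[_ jv' jw'] := Ej j; have [h1 h2] := upair_u _ jv' jw'.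
  by split.
- move=> j; have [nv nw nt] := nxP j; have /and3P[_ jv' jw'] := Ej j; split.
    have f1 : F (tsum un un (nx j)) (n + (n + tau (nx j))).
      exact (FD _ _ _ _ (FP _ unv unw) (FD _ _ _ _ (FP _ unv unw) (FP _ nv nw))).
    have f2 : F (tsum v w (enum_val j)) (s + tau (enum_val j)).
      rewrite /CubicGenerators.tsum addrA; exact (FD _ _ _ _ Fvw (FP _ jv' jw')).
    have es : n + (n + tau (nx j)) = s + tau (enum_val j) by rewrite nt sE; ring.
    rewrite es in f1; move: f1 f2; rewrite /F => f1 f2.
    by apply: eq_triple => //; [rewrite f1 f2|rewrite f1 f2].
  move=> j' /mnmP/(_ v); rewrite !mnmDE !mnm1E eqxx.
  by rewrite (negbTE unv) (negbTE nv).
move=> a1 a2 a3 b1 b2 b3 ha hb es.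
case: (boolP (v \in [:: a1; a2; a3])) => va; case: (boolP (v \in [:: b1; b2; b3])) => vb.
- exact: equiv_common va vb es.
- case: (boolP (w \in [:: a1; a2; a3])) => wa; case: (boolP (w \in [:: b1; b2; b3])) => wb.
  + exact: equiv_common wa wb es.
  + by case: (main a1 a2 a3 b1 b2 b3).
  + by case: (main2 a1 a2 a3 b1 b2 b3).
  move: wa wb; rewrite !inE !negb_or ![w == _]eq_sym => /and3P[? ? ?] /and3P[? ? ?]; exact: qw.
- case: (boolP (w \in [:: a1; a2; a3])) => wa; case: (boolP (w \in [:: b1; b2; b3])) => wb.
  + exact: equiv_common wa wb es.
  + by case: (main2 b1 b2 b3 a1 a2 a3).
  + by case: (main b1 b2 b3 a1 a2 a3).
  move: wa wb; rewrite !inE !negb_or ![w == _]eq_sym => /and3P[? ? ?] /and3P[? ? ?]; exact: qw.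
move: va vb; rewrite !inE !negb_or ![v == _]eq_sym => /and3P[? ? ?] /and3P[? ? ?]; exact: qv.
Qed.

(** The direction e comes from two interior points or, if there is a single one, from it and a
    vertex; its sign is chosen so that interior points lie on the positive side of the vertex on the
    line. *)
Lemma betti13_collinear (l : int * int) c u : l != 0 -> u \in interior ->
  (forall i, i \in interior -> dz l (P i) = c) -> betti C 1 3 = (N - 3)%N.
Proof.
move=> l0 uI lc.
have pos_comb (q : 'I_N) g e z : 0 < g -> z.1 - (P q).1 = g * e.1 -> z.2 - (P q).2 = g * e.2 ->
    detz e (z - P q) = 0.
  by move=> _ h1 h2; rewrite /detz /= h1 h2; ring.
have [a [e [ce aC aeC D0]]] : exists a e, [/\ coprimez e.1 e.2, inC (a, 1), inC (a + e, 1) &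
    forall i, i \in interior -> detz e (P i - a) = 0].
  case: (boolP [exists u', (u' \in interior) && (u' != u)]) => [/existsP[u' /andP[u'I u'u]]|nu].
    have Pu : P u' != P u by apply: contra u'u => /eqP/Pinj ->.
    have [e [g [ce g0 aeC [e1 e2]]]] := primitive_step Pu (@inC_PP R N P i0 u) (@inC_PP R N P i0 u').
    exists (P u), e; split=> //; first exact: inC_PP.
    move=> i iI.
    have le : l.1 * e.1 + l.2 * e.2 = 0.
      apply: (mulfI (lt0r_neq0 g0)); rewrite mulr0 mulrDr !mulrA ![g * _]mulrC -!mulrA -e1 -e2.
      transitivity (dz l (P u') - dz l (P u)); first by rewrite /dz; ring.
      by rewrite !lc // subrr.
    have lx : l.1 * ((P i).1 - (P u).1) + l.2 * ((P i).2 - (P u).2) = 0.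
      transitivity (dz l (P i) - dz l (P u)); first by rewrite /dz; ring.
      by rewrite !lc // subrr.
    have [l1|l2] : l.1 != 0 \/ l.2 != 0.
      case: (eqVneq l.1 0) => h1; last by left.
      by right; apply: contra l0 => /eqP h2; rewrite (surjective_pairing l) h1 h2.
      apply: (mulfI l1); rewrite mulr0 /detz /=.
      transitivity ((l.1 * e.1 + l.2 * e.2) * ((P i).2 - (P u).2) -
        e.2 * (l.1 * ((P i).1 - (P u).1) + l.2 * ((P i).2 - (P u).2))); first by ring.
      by rewrite le lx mul0r mulr0 subrr.
    apply: (mulfI l2); rewrite mulr0 /detz /=.
    transitivity (e.1 * (l.1 * ((P i).1 - (P u).1) + l.2 * ((P i).2 - (P u).2)) -
      (l.1 * e.1 + l.2 * e.2) * ((P i).1 - (P u).1)); first by ring.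
    by rewrite le lx mul0r mulr0 subrr.
  have ub : u != b ord0 by move: uI; rewrite intE => /forallP.
  have Pu : P u != P (b ord0) by apply: contra ub => /eqP/Pinj ->.
  have [e [g [ce g0 aeC [e1 e2]]]] := primitive_step Pu (@inC_PP R N P i0 (b ord0)) (@inC_PP R N P i0 u).
  exists (P (b ord0)), e; split=> //; first exact: inC_PP.
  move=> i iI; have -> : i = u.
    by apply/eqP; apply: contraNT nu => iu; apply/existsP; exists i; rewrite iI.
  by apply: (pos_comb _ g).
have [jp [jv [jw [[jpv jpw jvw] [Dp Dv Dw]]]]] :=
  collinear_signs closedP noncoll T ce aC aeC D0 intE uI.
have Dpp z : detz e (z - P (b jp)) = detz e (z - a).
  have -> : detz e (z - a) = detz e (z - P (b jp)) + detz e (P (b jp) - a).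
    by rewrite /detz /=; ring.
  by rewrite Dp addr0.
have [t ht] := detz_eq0 ce (etrans (Dpp (P u)) (D0 u uI)).
have t0 : t != 0.
  apply: contraTneq uI => t0; rewrite intE negb_forall; apply/existsP; exists jp; rewrite negbK.
  apply/eqP/Pinj; move: ht; rewrite t0 !mul0r.
  by case: (P u) (P (b jp)) => x1 x2 [y1 y2] [/subr0_eq -> /subr0_eq ->].
have D0' i : i \in interior -> detz e (P i - P (b jp)) = 0 by move=> iI; rewrite Dpp D0.
case: (ltrgtP t 0) => ts; last by rewrite ts eqxx in t0.
  have DN z : detz (- e) z = - detz e z by rewrite /detz /=; ring.
  apply: (@betti13_line jp jw jv (- e) u (- t)) => //.
  - by rewrite eq_sym.
  - by rewrite /coprimez /gcdz /= !abszN.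
  - by rewrite DN Dpp Dw opprK.
  - by rewrite DN Dpp Dv.
  - by move=> i iI; rewrite DN D0' // oppr0.
  - by rewrite ht /= !mulrNN.
  by rewrite oppr_gt0.
by apply: (@betti13_line jp jv jw e u t) => //; rewrite Dpp.
Qed.
End CollinearInterior.

End CollinearCubics.

(** * Cubics when the interior points are not collinear *)

Module NoncollinearCubics.
Import KoszulContraction HomogeneousParts PolynomialKoszul KoszulVanishing BettiVanishing
  PlaneGordan PolygonCone NormalFan SupportArcs IshidaComplex HeightOne LatticeIdeals
  EhrhartCount ToricIdeals KoelmanGraphs CubicGenerators BoundaryTriangles TriangleSums
  CollinearCubics.

Section NoncollinearInterior.
Variables (R : realFieldType) (N : nat) (P : 'I_N -> int * int) (i0 : 'I_N).
Variables (k : fieldType) (C : free_complex k N).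
Local Notation emb := (@emb R).
Local Notation inC := (@inC R N P i0).
Local Notation intC := (@intC R N P i0).
Local Notation PP := (@PP N P).
Local Notation interior := (@interior R N P i0).
Local Notation tsum := (@tsum N P).
Local Notation I := (@lattice_ideal k N P).
Local Notation equiv x y := (lin_syz I (mpolyX k x - mpolyX k y)).
Hypothesis closedP : forall z, inC (z, 1) -> exists i, P i = z.
Hypothesis noncoll : forall l, l != 0 -> exists i j, dot l (emb (P i)) < dot l (emb (P j)).
Hypothesis Pinj : injective P.
Hypothesis chark : [pchar k] =i pred0.

Variables (b : 'I_3 -> 'I_N) (H : 'I_3 -> int * int * int -> int) (delta : int).
Hypothesis T : triangle P b H delta.
Hypothesis intE : forall i, (i \in interior) = [forall j, i != b j].
Hypothesis NC : forall l c, l != 0 -> exists2 i, i \in interior & dz l (P i) != c.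

Lemma vertices_off_line e a : e != 0 -> exists j, detz e (P (b j) - a) != 0.
Proof.
move=> en; apply: contrapT => h0.
have e0 : ((- e.2, e.1) : int * int) != 0.
  apply: contra en => /eqP[/eqP h1 h2]; rewrite oppr_eq0 in h1.
  by rewrite (surjective_pairing e) h2 (eqP h1).
have [i [j]] := noncoll (emb_neq0 R e0); rewrite -!dz_dot ltr_int.
have z i' : detz e (P i' - a) = 0.
  apply: (mulfI (lt0r_neq0 (delta_gt0 T))); rewrite mulr0 (bary_detz T) big1 // => j' _.
  by apply/eqP; rewrite mulf_eq0; apply/orP; right; apply: contraT => d; case: h0; exists j'.
by have := z i; have := z j; rewrite /detz /dz /=; lia.
Qed.

Lemma Hint_gt0 j u : u \in interior -> 0 < H j (PP u).
Proof. by rewrite intE => /forallP h; case/andP: (H_int T j h). Qed.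

(* If removing a vertex leaves only three boundary points, then the new one, u,
   sees the two other vertices at heights 1 and -1 over its line to the removed
   vertex, and this confines all interior points to that line. *)
Lemma quad_vertex j : @quad_away N P k (b j).
Proof.
have binj := b_inj T.
have [j1 jj1] : exists j1, j1 != j.
  by case: (eqVneq j ord0) => [->|h]; [exists ord_max|exists ord0; rewrite eq_sym].
have [j2 [j2j1 j2j hj]] := third jj1.
have [u0 u0I _] := NC 0 (isT : ((1, 0) : int * int) != 0).
have b1j : b j1 != b j by rewrite (inj_eq binj).
have b2j : b j2 != b j by rewrite (inj_eq binj).
have u0j j' : u0 != b j' by move: u0I; rewrite intE => /forallP.
have cb : b j1 \in [set~ b j] by rewrite !inE.
have d0 := delta_gt0 T.
have [l [cl hl]] : exists l c, forall x, H j x = dz l x.1 + c * x.2 by case: T.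
have dlE i : dz l (P i) = H j (PP i) - cl by rewrite hl /= mulr1 addrK.
have dzN z : dz (- l) z = - dz l z by rewrite /dz /=; ring.
have sep i : i != b j -> dz (- l) (P (b j)) < dz (- l) (P i).
  move=> ib; rewrite !dzN ltrN2 !dlE ltrD2r (Hb T) eqxx lt_neqAle.
  have /andP[_ ->] := H_le T j i; rewrite andbT.
  by apply: contra ib => /eqP/(H_max T) ->.
have det0 : detz (P (b j2) - P (b j1)) (P u0 - P (b j1)) != 0.
  have en : P (b j2) - P (b j1) != 0.
    by rewrite subr_eq0; apply: contra j2j1 => /eqP/Pinj/binj ->.
  have [j' dj'] := vertices_off_line (P (b j1)) en.
  have z1 : detz (P (b j2) - P (b j1)) (P (b j1) - P (b j1)) = 0.
    by rewrite subrr /detz /= !mulr0 subrr.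
  have z2 : detz (P (b j2) - P (b j1)) (P (b j2) - P (b j1)) = 0.
    by rewrite /detz mulrC subrr.
  have := bary_detz T (P (b j2) - P (b j1)) (P (b j1)) u0.
  rewrite (sumI3 _ jj1 j2j1 j2j) z1 z2 !mulr0 add0r addr0 => e.
  have jE : j' = j.
    have := hj j'; case: (eqVneq j' j1) => [j'1|_]; first by rewrite j'1 z1 eqxx in dj'.
    case: (eqVneq j' j2) => [j'2|_]; first by rewrite j'2 z2 eqxx in dj'.
    by rewrite /= orbF => /eqP.
  apply/eqP => h; move/eqP: e; rewrite h mulr0 eq_sym mulf_eq0 -jE (negbTE dj') orbF jE.
  by rewrite gt_eqF // Hint_gt0.
apply: (@sub_quad R N P i0 k (b j) (b j1) chark closedP Pinj cb (- l) (b j1) (b j2) u0 sep b1j b2j (u0j j) det0).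
apply/orP; case: (leqP (sub_size (b j)) 3) => M3; [by left|right].
(* Failure of Koelman's criterion means that the cut polygon has at most three boundary points, so
   it is itself a triangle of this kind. *)
rewrite ltnNge; apply/negP => Mle.
set P' := P \o @sub_inj N (b j).
have ncl' : forall l : R * R, l != 0 -> exists i j0, dot l (emb (P' i)) < dot l (emb (P' j0)).
  have [y1 e1] := sub_injP b1j; have [y2 e2] := sub_injP b2j; have [y3 e3] := sub_injP (u0j j).
  by apply: (@noncoll3 R _ P' y1 y2 y3); rewrite /P' /= e1 e2 e3.
have B3 : (#|~: @EhrhartCount.interior R _ P' (sub_base cb)| <= 3)%N.
  have := cardsC (@EhrhartCount.interior R _ P' (sub_base cb)); rewrite card_ord; move: Mle.
  by clear; move: #|_| #|_| => x y; lia.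
have [b' [H' [delta' [T' intE']]]] := triangle_exists ncl' B3.
have d0' := delta_gt0 T'.
have ln0 : l != 0.
  apply: contraTneq d0 => l0; rewrite -(subrr cl) -[delta](_ : H j (PP (b j)) = _); last by rewrite (Hb T) eqxx.
  have := Hb T j1 j; rewrite (negbTE jj1) !hl l0 /dz /= !mul0r !add0r mulr1 => ->.
  by rewrite subrr ltxx.
have bnd jc : jc != j -> exists p, sub_inj (b' p) = b jc.
  move=> jcj; have bcj : b jc != b j by rewrite (inj_eq binj).
  have [y ey] := sub_injP bcj.
  have : y \notin @EhrhartCount.interior R _ P' (sub_base cb).
    rewrite inE; apply/negP => /asboolP; apply: (@min_not_interior R _ P' (sub_base cb) l) => // y'.
    rewrite /P' /= ey !dlE lerD2r (Hb T) (negbTE jcj).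
    by case/andP: (H_le T j (sub_inj y')).
  by rewrite intE' negb_forall => /existsP[p]; rewrite negbK => /eqP yp; exists p; rewrite -yp.
have [p ep] := bnd j1 jj1; have [q eq] := bnd j2 j2j.
have pq : p != q by apply: contra j2j1 => /eqP pq; apply/eqP/binj; rewrite -eq -ep pq.
have [r [rp rq hr]] := third pq.
(* The third vertex of the cut triangle: the two others are vertices of the original one, so u was
   interior. *)
set u := sub_inj (b' r).
have uI : u \in interior.
  rewrite intE; apply/forallP => j'; have := hj j'.
  case/or3P => /eqP ->; last 1 first.
  - rewrite -eq; apply: contra rq => /eqP/enum_val_inj/(b_inj T') ->; exact: eqxx.
  - rewrite -ep; apply: contra rp => /eqP/enum_val_inj/(b_inj T') ->; exact: eqxx.
  exact: sub_inj_neq.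
have uj : P u != P (b j) by rewrite (inj_eq Pinj); exact: sub_inj_neq.
have [e [g [ce g0 aeC [g1 g2]]]] := primitive_step uj (@inC_PP R N P i0 (b j)) (@inC_PP R N P i0 u).
pose D i := detz e (P i - P (b j)).
have Du : D u = 0 by rewrite /D /detz /= g1 g2; ring.
have Dj : D (b j) = 0 by rewrite /D subrr /detz /= !mulr0 subrr.
have en : e != 0 by apply: contraTneq ce => ->.
have D12 : H j1 (PP u) * D (b j1) + H j2 (PP u) * D (b j2) = 0.
  have := bary_detz T e (P (b j)) u; rewrite (sumI3 _ jj1 j2j1 j2j) -!/(D _) Du Dj !mulr0 addr0.
  by move=> <-.
have D1n : D (b j1) != 0.
  apply/eqP => h; have h2 : D (b j2) = 0.
    move/eqP: D12; rewrite h mulr0 add0r mulf_eq0 => /orP[|/eqP //].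
    by rewrite gt_eqF // Hint_gt0.
  have [j' /eqP[]] := vertices_off_line (P (b j)) en; rewrite -/(D (b j')).
  by have := hj j'; case/or3P => /eqP ->.
have D2n : D (b j2) != 0.
  apply/eqP => h; move/eqP: D12; rewrite h mulr0 addr0 mulf_eq0 (negbTE D1n) orbF.
  by rewrite gt_eqF // Hint_gt0.
(* The lattice point z at height 1 or -1 in the triangle b_j, u, b_jc is on the side of the line
   through u and b_jc away from the cut polygon, yet belongs to that polygon. So it is on their
   common edge, and being off the line of u it is b_jc. *)
have side p' q' jc jo : p' != q' -> r != p' -> r != q' -> (forall i, [|| i == p', i == q' | i == r]) ->
    sub_inj (b' p') = b jc -> sub_inj (b' q') = b jo ->
    jc != j -> jo != j -> jc != jo -> D (b jc) != 0 -> `|D (b jc)| = 1.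
  move=> pq' rp' rq' hr' ec eo jcj joj jco Dc.
  pose h (z : int * int) := H' q' (z, 1).
  have hP y : h (P (sub_inj y)) = H' q' (@PolygonCone.PP _ P' y) by [].
  have h_ge0 i : i != b j -> 0 <= h (P i).
    by move=> /sub_injP[y <-]; rewrite hP; case/andP: (H_le T' q' y).
  have hu : h (P u) = 0 by rewrite /u hP (Hb T') (negbTE rq').
  have hc : h (P (b jc)) = 0 by rewrite -ec hP (Hb T') (negbTE pq').
  have ho : h (P (b jo)) = delta' by rewrite -eo hP (Hb T') eqxx.
  have [l' [c' hl']] : exists l c, forall x, H' q' x = dz l x.1 + c * x.2 by case: T'.
  have hj0 : h (P (b j)) < 0.
    have := bary_affine T l' c' (PP u); rewrite -hl' -[H' q' (PP u)]/(h (P u)) hu mulr0.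
    have hb i : dz l' (P (b i)) + c' = h (P (b i)) by rewrite /h hl' /= mulr1.
    have jco' : jo != jc by rewrite eq_sym.
    have jjc : j != jc by rewrite eq_sym.
    rewrite (sumI3 _ jjc joj jco') !hb hc ho mulr0 addr0 => e1.
    have a1 : 0 < H jo (PP u) * delta' by rewrite mulr_gt0 // Hint_gt0.
    rewrite -(pmulr_rlt0 (x := H j (PP u))) ?Hint_gt0 //.
    by move: e1 a1; clear; move: (_ * _) (_ * _) => x y; lia.
  have [y Py] := closedP aeC.
  have yj : y != b j.
    apply: contra en => /eqP yj; rewrite yj in Py.
    by rewrite -(subrr (P (b j))) {1}Py addrAC subrr add0r.
  have ge1 : 0 <= g - 1 by rewrite subr_ge0 -gtz0_ge1.
  have gE : g = g - 1 + 1 + 0 by ring.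
  have hae : g * h (P (b j) + e) = (g - 1) * h (P (b j)).
    have := @H_comb _ P' b' H' delta' T' q' g (g - 1) 1 0 (P (b j) + e) (P (b j)) (P u) (P u) gE.
    rewrite -!/(h _) hu mulr0 !addr0 => -> //=.
      by rewrite mulrDr -g1; ring.
    by rewrite mulrDr -g2; ring.
  (* Otherwise b_j + e would be a remaining lattice point at which h is negative. *)
  have gg : g = 1.
    apply/eqP; apply: contraT => gn1; have g1' : 0 < g - 1 by rewrite lt_neqAle ge1 andbT eq_sym subr_eq0.
    have a1 : g * h (P (b j) + e) < 0 by rewrite hae nmulr_llt0.
    by move: (h_ge0 y yj); rewrite Py -(pmulr_rge0 _ g0) leNgt a1.
  have aeE : P (b j) + e = P u.
    rewrite (surjective_pairing (P u)) [LHS]surjective_pairing /=.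
    by rewrite gg !mul1r in g1 g2; rewrite -g1 -g2; congr (_, _); ring.
  have [z [h0 [p0 [q0 [p0' q0' hE [dz' [_ dz1]] [e1 e2]]]]]] := height_one_abs ce Dc.
  have h00 : 0 < h0 by rewrite hE; move: p0' q0'; clear; move: p0 q0 => x y' a1 a2; lia.
  have zC : inC (z, 1).
    by apply: (comb_inC (a := P (b j)) (b := P (b j) + e) (c := P (b jc)) h00 p0' q0' ler01 hE e1 e2); rewrite // ; exact: inC_PP.
  have [i Pi] := closedP zC.
  have ij : i != b j by apply: contra dz' => /eqP ij; rewrite -Pi ij -/(D _) Dj.
  have hz : h0 * h z = p0 * h (P (b j)).
    have := @H_comb _ P' b' H' delta' T' q' h0 p0 q0 1 z (P (b j)) (P (b j) + e) (P (b jc)) hE e1 e2.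
    by rewrite -!/(h _) aeE hu hc !mulr0 !addr0.
  have hz0 : h z = 0.
    apply/eqP; rewrite eq_le; apply/andP; split; last by rewrite -Pi h_ge0.
    rewrite -(pmulr_rle0 _ h00) hz mulr_ge0_le0 //; exact: ltW.
  have [i' ei] := sub_injP ij; rewrite -Pi -ei hP in hz0.
  have [s sq is'] := H_zero T' hz0.
  have := hr' s; rewrite (negbTE sq) /= => /orP[/eqP sp|/eqP sr].
    by rewrite -dz1 -Pi -ei is' sp ec.
  by move: dz'; rewrite -Pi -ei is' sr -/u -/(D u) Du eqxx.
have D1 : `|D (b j1)| = 1.
  by apply: (side p q j1 j2) => //; rewrite eq_sym.
have D2 : `|D (b j2)| = 1.
  apply: (side q p j2 j1) => //; first by rewrite eq_sym.
  by move=> i; have := hr i; case/or3P => ->; rewrite ?orbT.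
have Dopp : D (b j2) = - D (b j1).
  move: D12 D1 D2; have := Hint_gt0 j1 uI; have := Hint_gt0 j2 uI.
  clear; move: (H _ _) (H _ _) (D _) (D _) => x y d1 d2 hx hy e1 a1 a2.
  have [h|h] : d1 = 1 \/ d1 = -1 by lia.
    by have [h'|h'] : d2 = 1 \/ d2 = -1 by [lia]; subst d1 d2; lia.
  by have [h'|h'] : d2 = 1 \/ d2 = -1 by [lia]; subst d1 d2; lia.
pose pe : int * int := (- e.2, e.1).
have pe0 : pe != 0.
  apply: contra en => /eqP[/eqP h1 h2]; rewrite oppr_eq0 in h1.
  by rewrite (surjective_pairing e) h2 (eqP h1).
have [w wI dw] := NC (dz pe (P (b j))) pe0.
have Dw : D w != 0.
  apply: contra dw => /eqP h; rewrite -subr_eq0; apply/eqP; rewrite -h /D /detz /dz /=; ring.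
have wb j' : w != b j' by move: wI; rewrite intE => /forallP.
have [w' ew] := sub_injP (wb j).
have w'b s : w' != b' s.
  apply: contra Dw => /eqP ws; have := hr s.
  case/or3P => /eqP es; rewrite -ew ws es.
  - by have := wb j1; rewrite -ew ws es ep eqxx.
  - by have := wb j2; rewrite -ew ws es eq eqxx.
  by rewrite -/u Du.
(* In the cut triangle w has coordinates strictly between 0 and delta' at two vertices of heights 1
   and -1, and the third vertex u has height 0; so its own height is strictly between -1 and 1. *)
have := bary_detz T' e (P (b j)) w'; rewrite (sumI3 _ pq rp rq).
rewrite /P' /= ew ep eq -/u -!/(D _) Du Dopp mulr0 addr0 => e1.
have /andP[p1 p2] := H_int T' p w'b; have /andP[q1 q2] := H_int T' q w'b.
case/negP: Dw; apply/eqP.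
move: e1 p1 p2 q1 q2 D1 d0'; clear.
move: (H' p _) (H' q _) (D w) (D (b j1)) delta' => x y z d s e1 x0 x1 y0 y1 d1 s0.
have sz : - s < s * z < s.
  have [d'|d'] : d = 1 \/ d = -1 by lia.
    by subst d; lia.
  by subst d; lia.
have /andP[z1 z2] : (- 1 < z < 1).
  by rewrite -(ltr_pM2l s0) mulrN1 -[z < 1](ltr_pM2l s0) mulr1.
by lia.
Qed.

Hypothesis resC : minimal_graded_free_resolution I C.

(** The product of the vertices is isolated by [unique_pair_b]. Two other triples of equal sum share
    a point, or omit a common vertex so that [quad_vertex] applies, or divide the three vertices
    between them, which barycentric coordinates exclude. *)
Lemma betti13_noncollinear : betti C 1 3 = 1%N.
Proof.
have binj := b_inj T; have d0 := delta_gt0 T.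
pose j0 : 'I_3 := ord0; pose j1 : 'I_3 := Ordinal (isT : 1 < 3)%N; pose j2 : 'I_3 := Ordinal (isT : 2 < 3)%N.
have hj (i : 'I_3) : [|| i == j0, i == j1 | i == j2] by case: i => -[|[|[|]]].
have [u uI _] := NC 0 (isT : ((1, 0) : int * int) != 0).
have ub j : u != b j by move: uI; rewrite intE => /forallP.
have [d [e sde]] : exists d e, tsum (b j0) (b j1) (b j2) = tsum u d e.
  (* All coordinates of the sum of the vertices equal delta, so it stays in the cone after an
     interior point is subtracted; normality splits the rest. *)
  pose x := tsum (b j0) (b j1) (b j2) - PP u.
  have Hs j : H j (tsum (b j0) (b j1) (b j2)) = delta.
    rewrite /CubicGenerators.tsum !(HD T) !(Hb T).
    by case: j => -[|[|[|]]] //= hh; rewrite ?add0r ?addr0.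
  have xC : inC x.
    apply: (@H_inC R N P i0 b H delta T x) => j; rewrite /x (HD T) (HN T) Hs subr_ge0.
    by case/andP: (H_le T j u).
  have [d hd] : exists d, inC (x - PP d) by apply: (normal closedP).
  have [e he] : exists e, inC (x - PP d - PP e) by apply: (normal closedP).
  exists d, e.
  have : x - PP d - PP e = 0.
    have -> : x - PP d - PP e = ((x - PP d - PP e).1, 0) by apply: eq_triple.
    rewrite (inC_deg0 (R := R) (P := P) (i0 := i0) (z := (x - PP d - PP e).1)) //.
  move/eqP; rewrite subr_eq0 subr_eq => /eqP xE.
  have -> : tsum (b j0) (b j1) (b j2) = PP u + x by rewrite /x addrC subrK.
  by rewrite xE /CubicGenerators.tsum [PP e + _]addrC.
have inE3 (v a1 a2 a3 : 'I_N) : v \notin [:: a1; a2; a3] -> [/\ a1 != v, a2 != v & a3 != v].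
  by rewrite !inE !negb_or ![v == _]eq_sym => /and3P.
(* Two vertices on one side and the third on the other force it to be shared. *)
have heights j j' m a1 a2 a3 b1 b2 b3 : j != j' -> m != j -> m != j' ->
    b j \in [:: a1; a2; a3] -> b j' \in [:: a1; a2; a3] -> b m \in [:: b1; b2; b3] ->
    tsum a1 a2 a3 = tsum b1 b2 b3 -> b m \in [:: a1; a2; a3].
  move=> jj mj mj' aj aj' bm es.
  have bjj : b j != b j' by rewrite (inj_eq binj).
  have [c ec ca] := tri_mem2 bjj aj aj'; have [x [y [ex _ _]]] := tri_mem bm.
  have := congr1 (H m) es; rewrite (tsum_tri P ec) (tsum_tri P ex) /CubicGenerators.tsum !(HD T) !(Hb T) eqxx.
  rewrite [j == m]eq_sym (negbTE mj) [j' == m]eq_sym (negbTE mj') !add0r => e1.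
  have /andP[_ c1] := H_le T m c; have /andP[x1 _] := H_le T m x; have /andP[y1 _] := H_le T m y.
  have cm : H m (PP c) = delta.
    by move: e1 c1 x1 y1; clear; move: (H _ _) (H _ _) (H _ _) => x' y' z' *; lia.
  by rewrite -(H_max T cm).
apply: (@betti13_exceptional k N P Pinj C resC 1 (fun=> b j0) (fun=> b j1) (fun=> b j2)
  (fun=> u) (fun=> d) (fun=> e)) => /=.
- by move=> i i' _; rewrite !ord1.
- by move=> _; split; apply: (unique_pair_b T).
- move=> _; split=> [//|_ /mnmP/(_ u)]; rewrite !mnmDE !mnm1E eqxx.
  by rewrite ![_ == u]eq_sym (negbTE (ub j0)) (negbTE (ub j1)) (negbTE (ub j2)).
move=> a1 a2 a3 b1 b2 b3 ha hb es.
have full c1 c2 c3 : tri c1 c2 c3 <> tri (b j0) (b j1) (b j2) ->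
    ~~ [&& b j0 \in [:: c1; c2; c3], b j1 \in [:: c1; c2; c3] & b j2 \in [:: c1; c2; c3]].
  move=> h; apply/negP => /and3P[h0 h1 h2]; apply: h.
  have us : uniq [:: b j0; b j1; b j2] by rewrite /= !inE !(inj_eq binj).
  have ss : {subset [:: b j0; b j1; b j2] <= [:: c1; c2; c3]}.
    by move=> z; rewrite !inE => /or3P[] /eqP ->; move: h0 h1 h2; rewrite !inE.
  have [sz si] := uniq_min_size us ss (leqnn _).
  by apply/esym/tri_perm/uniq_perm => //; rewrite -(eq_uniq sz si).
have fa := full _ _ _ (ha ord0); have fb := full _ _ _ (hb ord0).
have [[v va vb]|nc] := pselect (exists2 v, v \in [:: a1; a2; a3] & v \in [:: b1; b2; b3]).
  exact: equiv_common va vb es.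
have [[j ja jb]|nm] := pselect (exists2 j, b j \notin [:: a1; a2; a3] & b j \notin [:: b1; b2; b3]).
  have [? ? ?] := inE3 _ _ _ _ ja; have [? ? ?] := inE3 _ _ _ _ jb; exact: (@quad_vertex j).
exfalso.
have cov j : (b j \in [:: a1; a2; a3]) = (b j \notin [:: b1; b2; b3]).
  apply/idP/idP => [h|h]; first by apply/negP => h'; apply: nc; exists (b j).
  by apply: contraT => h'; case: nm; exists j.
have cov' j : b j \notin [:: a1; a2; a3] -> b j \in [:: b1; b2; b3] by rewrite cov negbK.
have es' := esym es.
have two j j' m : j != j' -> m != j -> m != j' -> b j \in [:: a1; a2; a3] -> b j' \in [:: a1; a2; a3] ->
    b m \notin [:: a1; a2; a3] -> False.
  move=> jj mj mj' h1 h2 h3; have h4 := cov' _ h3.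
  by rewrite (heights j j' m _ _ _ _ _ _ jj mj mj' h1 h2 h4 es) in h3.
have two' j j' m : j != j' -> m != j -> m != j' -> b j \notin [:: a1; a2; a3] ->
    b j' \notin [:: a1; a2; a3] -> b m \in [:: a1; a2; a3] -> False.
  move=> jj mj mj' /cov' h1 /cov' h2 h3.
  have := heights j j' m _ _ _ _ _ _ jj mj mj' h1 h2 h3 es'.
  by move: h3; rewrite cov => /negbTE ->.
case h0: (b j0 \in [:: a1; a2; a3]); case h1: (b j1 \in [:: a1; a2; a3]); case h2: (b j2 \in [:: a1; a2; a3]).
- by rewrite h0 h1 h2 in fa.
- by apply: (two j0 j1 j2); rewrite ?h0 ?h1 ?h2.
- by apply: (two j0 j2 j1); rewrite ?h0 ?h1 ?h2.
- by apply: (two' j1 j2 j0); rewrite ?h0 ?h1 ?h2.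
- by apply: (two j1 j2 j0); rewrite ?h0 ?h1 ?h2.
- by apply: (two' j0 j2 j1); rewrite ?h0 ?h1 ?h2.
- by apply: (two' j0 j1 j2); rewrite ?h0 ?h1 ?h2.
by move: fb; rewrite !cov' ?h0 ?h1 ?h2.
Qed.
End NoncollinearInterior.

End NoncollinearCubics.

(** * The strands in terms of N and the number of interior points *)

Module StrandFormulas.
Import KoszulContraction HomogeneousParts PolynomialKoszul KoszulVanishing BettiVanishing
  PlaneGordan PolygonCone NormalFan SupportArcs IshidaComplex HeightOne LatticeIdeals
  FiniteDifferences AlternatingCone EhrhartCount LatticeIdealBetti KoelmanGraphs
  BoundaryTriangles CollinearCubics NoncollinearCubics.

Section Strands.
Variables (R : realFieldType) (N : nat) (P : 'I_N -> int * int) (i0 : 'I_N).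
Variables (k : fieldType) (C : free_complex k N).
Hypothesis closedP : forall z, inC R P i0 (z, 1) -> exists i, P i = z.
Hypothesis noncoll : forall l : R * R, l != 0 ->
  exists i j, dot l (emb R (P i)) < dot l (emb R (P j)).
Hypothesis Pinj : injective P.
Hypothesis N3 : (2 < N)%N.
Hypothesis chark : has_char0 k.
Hypothesis resC : minimal_graded_free_resolution (lattice_ideal P) C.
Local Notation inner := (EhrhartCount.interior R P i0).
Local Notation n1 := #|inner|.
Local Notation b := (linear_strand C).
Local Notation c := (quadratic_strand C).

Lemma quadratic_strandE l n : (0 < l)%N -> N = (l + n.+3)%N -> c l = betti C n.+1 n.+3.
Proof.
move=> l0 e; rewrite /quadratic_strand ifT; last by lia.
by congr betti; lia.
Qed.

Lemma linear_strandE l : (0 < l)%N -> (l + 3 <= N)%N -> b l = betti C l l.+1.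
Proof. by move=> l0 e; rewrite /linear_strand ifT //; lia. Qed.

Lemma quadratic_strand0 l : (N < l + 3)%N \/ l = 0%N -> c l = 0%N.
Proof. by move=> h; rewrite /quadratic_strand ifF //; lia. Qed.

Lemma linear_strand0 l : (N < l + 3)%N \/ l = 0%N -> b l = 0%N.
Proof. by move=> h; rewrite /linear_strand ifF //; lia. Qed.

Lemma betti12N : (betti C 1 2)%:Z = 'C(N.+1, 2)%:Z - (3 * N%:Z + n1%:Z - 3).
Proof. exact: (betti12 closedP noncoll Pinj N3 resC). Qed.

Lemma interior3 : N = 3%N -> n1 = 0%N.
Proof. exact: (no_interior3 closedP noncoll Pinj N3 chark resC). Qed.

(** The bound is the nonnegativity of beta_(1,2) = 1 - N1. *)
Lemma interior4 : N = 4%N -> (n1 <= 1)%N.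
Proof.
move=> e; have := betti12N.
have -> : 'C(N.+1, 2) = 10%N by rewrite e.
lia.
Qed.

Lemma quadratic_strand1 : c 1 = n1.
Proof.
have [e|ne] := eqVneq N 3%N; first by rewrite quadratic_strand0 ?interior3 //; lia.
have e : N = (N - 4).+4 by lia.
rewrite (@quadratic_strandE 1 (N - 4)) //.
by have [] := euler_betti_pred1 closedP noncoll Pinj N3 chark resC e.
Qed.

Lemma interior_set0 : n1 = 0%N -> inner = set0.
Proof. by move/eqP; rewrite cards_eq0 => /eqP. Qed.

Lemma betti_top0 p : (0 < n1)%N -> N = p.+4 -> betti C p.+1 p.+2 = 0%N.
Proof.
by rewrite card_gt0; exact: (betti_top_linear closedP noncoll Pinj N3 chark resC).
Qed.

Lemma betti_quadratic0 p : n1 = 0%N -> betti C p.+1 p.+3 = 0%N.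
Proof.
by move/interior_set0; exact: (betti_quadratic_no_interior closedP noncoll Pinj N3 chark resC).
Qed.

(** For N = 4 the index 2 is outside the strand, in agreement with N1 = 1; otherwise the end of the
    linear strand vanishes in the relation of degree N - 2. *)
Lemma quadratic_strand2_interior : (0 < n1)%N -> c 2 = ((N - 3) * (n1 - 1))%N.
Proof.
move=> n0; have [e|ne] := eqVneq N 3%N; first by have := interior3 e; lia.
have [e|ne4] := eqVneq N 4%N.
  by rewrite quadratic_strand0; [have := interior4 e; lia | lia].
have e : N = (N - 5).+4.+1 by lia.
have e4 : N = (N - 5).+1.+4 by lia.
rewrite (@quadratic_strandE 2 (N - 5)) //.
have := euler_betti_pred2 closedP noncoll Pinj N3 chark resC e.
rewrite (betti_top0 n0 e4); move: n0 ne ne4; clear -N3.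
move: (betti _ _ _) n1 => x y; move: N N3 => n; nia.
Qed.

Lemma quadratic_strand2_no_interior : n1 = 0%N -> c 2 = 0%N.
Proof.
move=> n0; have [h|h] := ltnP N 5; first by rewrite quadratic_strand0 //; lia.
by rewrite (@quadratic_strandE 2 (N - 5)) ?betti_quadratic0 //; lia.
Qed.

Lemma linear_strand_top_interior : (0 < n1)%N -> b (N - 3) = 0%N.
Proof.
move=> n0; have [e|ne] := eqVneq N 3%N; first by have := interior3 e; lia.
rewrite linear_strandE; try lia.
have -> : (N - 3 = (N - 4).+1)%N by lia.
by apply: betti_top0 => //; lia.
Qed.

Lemma linear_strand_top_no_interior : n1 = 0%N -> b (N - 3) = (N - 3)%N.
Proof.
move=> n0; have [e|ne] := eqVneq N 3%N; first by rewrite linear_strand0; lia.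
rewrite linear_strandE; try lia.
have [e|ne4] := eqVneq N 4%N.
  have -> : (N - 3 = 1)%N by lia.
  have := betti12N; have -> : 'C(N.+1, 2) = 10%N by rewrite e.
  by rewrite n0; lia.
have e : N = (N - 5).+4.+1 by lia.
have := euler_betti_pred2 closedP noncoll Pinj N3 chark resC e.
have -> : (N - 3 = (N - 5).+2)%N by lia.
rewrite (betti_quadratic0 _ n0) n0; lia.
Qed.

Lemma quadratic_strand_top : c (N - 3) = if N == 3 then 0%N else betti C 1 3.
Proof.
case: eqP => e; first by rewrite quadratic_strand0; lia.
by rewrite (@quadratic_strandE _ 0); lia.
Qed.

Lemma quadratic_strand_top_big : (n1 + 3 < N)%N -> c (N - 3) = 0%N.
Proof.
move=> h; rewrite quadratic_strand_top; case: eqP => // _.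
have hb : (N <= 3)%N || (n1 + 3 < N)%N by rewrite h orbT.
have J := @betti_Ivan N P k C Pinj chark resC 0 3.
exact: (J (@Ivan_koelman R N P i0 k closedP noncoll Pinj hb)).
Qed.

Lemma quadratic_strand_top_noncollinear : #|~: inner| = 3%N ->
  (forall (l : int * int) (a : int), l != 0 -> exists2 i, i \in inner & dz l (P i) != a) ->
  c (N - 3) = 1%N.
Proof.
move=> B3 NC; have B : (#|~: inner| <= 3)%N by rewrite B3.
have [v [H [d [T intE]]]] := triangle_exists noncoll B.
rewrite quadratic_strand_top; case: eqP => [e|_]; last first.
  exact: (betti13_noncollinear closedP noncoll Pinj chark T intE NC resC).
have [i iI _] := NC (1, 0) 0 isT.
by move: iI; rewrite (interior_set0 (interior3 e)) inE.
Qed.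

Lemma quadratic_strand_top_collinear : #|~: inner| = 3%N ->
  (forall u, u \in inner -> exists (l : int * int) (a : int),
     l != 0 /\ forall i, i \in inner -> dz l (P i) = a) ->
  c (N - 3) = (N - 3)%N.
Proof.
move=> B3 col; have B : (#|~: inner| <= 3)%N by rewrite B3.
have [v [H [d [T intE]]]] := triangle_exists noncoll B.
rewrite quadratic_strand_top; case: eqP => [e|ne]; first by lia.
have : (0 < n1)%N.
  by have := cardsC inner; rewrite card_ord B3; lia.
rewrite card_gt0 => /set0Pn[u uI]; have [l [a [l0 la]]] := col u uI.
exact: (betti13_collinear closedP noncoll Pinj chark resC T intE l0 uI la).
Qed.

Lemma linear_strand1 : (b 1)%:Z = 'C(N - 1, 2)%:Z - (N%:Z + n1%:Z - 2).
Proof.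
have [e|ne] := eqVneq N 3%N.
  by rewrite linear_strand0 ?interior3 // ?e //; left.
rewrite linear_strandE //; last by lia.
rewrite betti12N; have -> : (N.+1 = (N - 1).+2)%N by lia.
by rewrite !binS !bin1 !bin0; lia.
Qed.

(** For N > 4 this is the Euler relation in degree 3. For N = 3 and N = 4 the index 2 is outside the
    strand, and the right-hand side is 0; for N = 4 its last term is c_1 = N1. *)
Lemma linear_strand2 : (b 2)%:Z =
  2 * 'C(N - 1, 3)%:Z - (N - 3)%N%:Z * (N%:Z + n1%:Z - 2) + (c (N - 3))%:Z.
Proof.
have [e|ne] := eqVneq N 3%N.
  rewrite linear_strand0; last by left; lia.
  rewrite quadratic_strand0; last by right; lia.
  have -> : 'C(N - 1, 3) = 0%N by rewrite e.
  have -> : (N - 3 = 0)%N by lia.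
  by rewrite mul0r.
have [e|ne4] := eqVneq N 4%N.
  have -> : (N - 3 = 1)%N by lia.
  rewrite linear_strand0; last by left; lia.
  have -> : 'C(N - 1, 3) = 1%N by rewrite e.
  by rewrite quadratic_strand1 [X in X%:Z + _]e; lia.
rewrite linear_strandE //; last by lia.
rewrite quadratic_strand_top (negbTE ne).
rewrite (betti23 closedP noncoll Pinj N3 resC) betti12N.
suff bin (x y : int) : 6 * N%:Z + 3 * y - 8 - 'C(N.+2, 3)%:Z
    + N%:Z * ('C(N.+1, 2)%:Z - (3 * N%:Z + y - 3)) + x
    = 2 * 'C(N - 1, 3)%:Z - (N - 3)%N%:Z * (N%:Z + y - 2) + x by exact: bin.
have [M e] : exists M, N = M.+3 by exists (N - 3)%N; lia.
rewrite e !subSS !subn0 ; have := mul_bin_left M.+2 2; rewrite !subSS subn0.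
rewrite !binS !bin1 !bin0 => h.
have h' : (3 * 'C(M.+2, 3)%:Z = M%:Z * 'C(M.+2, 2)%:Z) by rewrite -!PoszM; congr Posz; move: h; rewrite !binS !bin1 !bin0; lia.
move: h'; rewrite !binS !bin1 !bin0; move: 'C(M, 2) 'C(M, 3) => u v; clear; nia.
Qed.

End Strands.

End StrandFormulas.

From mathcomp Require Import finmap all_classical all_reals all_analysis.

Import Order.TTheory GRing.Theory Num.Theory.
Import numFieldNormedType.Exports.

Local Open Scope classical_set_scope.
Local Open Scope ring_scope.

(** * Convex hulls and dimension in the plane *)

Module PlaneConvexity.
Import PlaneGordan PolygonCone NormalFan SupportArcs HeightOne EhrhartCount.

Section ConvexHulls.
Variable R : realType.
Implicit Types (l x y : R * R) (A : set (R * R)).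

Lemma convex_setP A : @convex_set R (R * R)%type A <->
  forall x y (t : R), 0 <= t -> t <= 1 -> A x -> A y ->
    A (t * x.1 + (1 - t) * y.1, t * x.2 + (1 - t) * y.2).
Proof.
split=> [cA x y t t0 t1 Ax Ay|cA x y t].
  have h : Itv.spec (@Itv.num_sem R) (Itv.Real `[0%Z, 1%Z]) t.
    by rewrite /= /Itv.num_sem /= in_itv /= num_real t0 t1.
  have := cA x y (Itv.Def h); rewrite !inE => /(_ Ax Ay).
  exact.
rewrite !inE => Ax Ay; exact: (cA x y t%:num (ge0 t) (le1 t) Ax Ay).
Qed.

Lemma conv_hull_sub A B : @convex_set R (R * R)%type B -> A `<=` B -> conv_hull A `<=` B.
Proof. by move=> cB AB; apply: smallest_sub. Qed.

Lemma sub_conv_hull A : A `<=` conv_hull A.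
Proof. by apply: sub_smallest. Qed.

Lemma convex_conv_hull A : @convex_set R (R * R)%type (conv_hull A).
Proof.
apply/convex_setP => x y t t0 t1 Ax Ay B [/= cB AB].
by move/convex_setP: (cB); apply => //; [apply: Ax | apply: Ay].
Qed.

Lemma dot_conv l x y (t : R) :
  dot l (t * x.1 + (1 - t) * y.1, t * x.2 + (1 - t) * y.2) =
  t * dot l x + (1 - t) * dot l y.
Proof. by rewrite /dot /=; ring. Qed.

Lemma conv_ge (a b c t : R) : 0 <= t -> t <= 1 -> c <= a -> c <= b ->
  c <= t * a + (1 - t) * b.
Proof. by move=> *; nra. Qed.

Lemma conv_gt (a b c t : R) : 0 <= t -> t <= 1 -> c < a -> c < b ->
  c < t * a + (1 - t) * b.
Proof.
move=> t0 t1 ca cb; have [->|tn] := eqVneq t 0; first by rewrite mul0r add0r subr0 mul1r.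
have tp : 0 < t by rewrite lt_def tn.
by nra.
Qed.

(* Gordan's alternative for the vectors w - x. *)
Lemma conv_hullP (W : seq (R * R)) x :
  conv_hull [set` W] x <-> forall l, exists2 w, w \in W & dot l w <= dot l x.
Proof.
split=> [Wx l|h].
  move: Wx; apply: (@conv_hull_sub [set` W] [set x | exists2 w, w \in W & dot l w <= dot l x]).
    apply/convex_setP => {}x y t t0 t1 [u uW hu] [v vW hv] /=.
    have [xy|yx] := leP (dot l u) (dot l v).
      by exists u => //; rewrite dot_conv; apply: conv_ge => //; exact: le_trans hv.
    by exists v => //; rewrite dot_conv; apply: conv_ge => //; apply: le_trans hu; exact: ltW.
  by move=> w /= wW; exists w.
case: (gordan [seq w - x | w <- W]) => [[l hl]|].
  have [w wW wx] := h l; have := hl _ (map_f (fun w => w - x) wW).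
  by rewrite dotDr dotNr subr_gt0 ltNge wx.
move=> [w1 [w2 [w3 [a [b [c [[/mapP[u1 u1W ->] /mapP[u2 u2W ->] /mapP[u3 u3W ->]]]]]]]]].
case=> a0 b0 c0 s0 e1 e2; have /convex_setP cH := @convex_conv_hull [set` W].
have [H1 H2 H3] : [/\ conv_hull [set` W] u1, conv_hull [set` W] u2 & conv_hull [set` W] u3].
  by split; apply: sub_conv_hull.
have [q0|qn] := eqVneq (b + c) 0.
  have bz : b = 0 by lra.
  have cz : c = 0 by lra.
  suff -> : x = u1 by [].
  have ap : a != 0 by rewrite bz cz in s0; apply/eqP; lra.
  move: e1 e2; rewrite bz cz !mul0r !addr0 => /eqP + /eqP.
  rewrite !mulf_eq0 (negbTE ap) /= !subr_eq0 => /eqP f1 /eqP f2.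
  by rewrite (surjective_pairing x) -f1 -f2 -surjective_pairing.
have qp : 0 < b + c by rewrite lt_def qn addr_ge0.
pose y := ((b / (b + c)) * u2.1 + (1 - b / (b + c)) * u3.1,
           (b / (b + c)) * u2.2 + (1 - b / (b + c)) * u3.2).
have Hy : conv_hull [set` W] y.
  have q0 : 0 <= b / (b + c) by rewrite divr_ge0 // ltW.
  have q1 : b / (b + c) <= 1 by rewrite ler_pdivrMr // mul1r lerDl.
  exact: (cH _ _ _ q0 q1 H2 H3).
pose s := a + b + c.
have -> : x = (a / s * u1.1 + (1 - a / s) * y.1, a / s * u1.2 + (1 - a / s) * y.2).
  have sn : s != 0 by rewrite gt_eqF.
  move: e1 e2 => /= e1 e2; rewrite (surjective_pairing x); congr pair; rewrite /y /=.
    have -> : x.1 = (a * u1.1 + b * u2.1 + c * u3.1) / s.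
      by apply: (mulIf sn); rewrite divfK // /s; lra.
    by rewrite /s; field; rewrite qn -/s sn.
  have -> : x.2 = (a * u1.2 + b * u2.2 + c * u3.2) / s.
    by apply: (mulIf sn); rewrite divfK // /s; lra.
  by rewrite /s; field; rewrite qn -/s sn.
have q0 : 0 <= a / s by rewrite divr_ge0 // ltW.
have q1 : a / s <= 1 by rewrite ler_pdivrMr // mul1r /s -addrA lerDl ltW.
exact: (cH _ _ _ q0 q1 H1 Hy).
Qed.

End ConvexHulls.

Section Dimension.
Variable R : realType.
Implicit Types (l x y : R * R) (A : set (R * R)).

Lemma sub_aff_hull A : A `<=` aff_hull A.
Proof. by apply: sub_smallest. Qed.

Lemma aff_hull_set0 : aff_hull (@set0 (R * R)) = set0.
Proof. by rewrite eqEsubset; split=> // x; apply => /=; split. Qed.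

Lemma has_dim_neq0 A d : has_dim A d -> A <> set0.
Proof.
move=> [x [U [e _]]] A0; move: e; rewrite A0 aff_hull_set0 => e.
have : @set0 (R * R) x by rewrite e /=; exists 0; rewrite ?addr0 //= mem0v.
by [].
Qed.

Lemma dim_plane : \dim {:(R * R)%type} = 2.
Proof. by rewrite dimvf. Qed.

(** A line containing A would contain its affine hull, which is the whole plane. *)
Lemma has_dim2_line A l (c : R) : has_dim A 2 -> l != 0 ->
  exists2 x, A x & dot l x != c.
Proof.
move=> [x0 [U [e dU]]] l0; apply: contrapT => H; case/eqP: l0.
have sub : aff_hull A `<=` [set x | dot l x = c].
  apply: smallest_sub => [x y t /= hx hy|x Ax /=].
    transitivity ((1 - t) * dot l x + t * dot l y); last first.
      by rewrite hx hy; ring.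
    have -> : (1 - t) *: x + t *: y = ((1 - t) * x.1 + t * y.1, (1 - t) * x.2 + t * y.2) by [].
    by rewrite /dot /=; ring.
  by apply/eqP; apply: contra_notT H => xc; exists x.
have UT : U = {:(R * R)%type}%VS.
  by apply/eqP; rewrite eqEdim subvf dU dim_plane.
have h u : dot l (x0 + u) = c.
  by apply: sub; rewrite e /=; exists u => //=; rewrite UT memvf.
have : dot l l = 0.
  have d0 : dot l 0 = 0 by rewrite /dot /= !mulr0 addr0.
  have := h l; have := h 0; rewrite !dotDr d0 addr0 => -> e1.
  by apply: (addrI c); rewrite e1 addr0.
rewrite /dot => hl.
have l1 : l.1 = 0 by nra.
have l2 : l.2 = 0 by nra.
by rewrite (surjective_pairing l) l1 l2.
Qed.

Lemma dim_le1_det A x y z : dim_le1 A -> A x -> A y -> A z -> det2 (y - x) (z - x) = 0.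
Proof.
move=> [->|[d d1 [x0 [U [e dU]]]]] // Ax Ay Az.
have mem w : A w -> exists2 u, u \in U & w = x0 + u.
  by move=> Aw; have := sub_aff_hull Aw; rewrite e => -[u uU <-]; exists u.
have [u uU ->] := mem _ Ax; have [v vU ->] := mem _ Ay; have [w wU ->] := mem _ Az.
have -> : x0 + v - (x0 + u) = v - u by rewrite opprD addrACA subrr add0r.
have -> : x0 + w - (x0 + u) = w - u by rewrite opprD addrACA subrr add0r.
have vu : v - u \in U by rewrite memvB.
have wu : w - u \in U by rewrite memvB.
have [->|nz] := eqVneq (v - u) 0; first by rewrite /det2 /=; ring.
have UE : U = <[v - u]>%VS.
  apply/eqP; rewrite eq_sym eqEdim -memvE vu /= dim_vline nz dU; lia.
by move: wu; rewrite UE => /vlineP[k ->]; have -> : k *: (v - u) = (k * (v - u).1, k * (v - u).2) by []; rewrite /det2 /=; ring.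
Qed.

End Dimension.

End PlaneConvexity.

(** * Lattice points of a lattice polygon *)

Module PolygonPoints.
Import PlaneGordan PolygonCone NormalFan SupportArcs HeightOne EhrhartCount
  PlaneConvexity.

Section LatticePolygons.
Variables (R : realType) (D : set (R * R)).
Hypotheses (latD : lattice_polygon D) (dimD : has_dim D 2).
Local Notation N := (num_points D).
Local Notation P := (@lattice_point R D).
Local Notation emb := (emb R).
Implicit Types (l x y : R * R) (z : int * int) (E : set (R * R)).

Lemma polygon_hull : exists s : seq (int * int),
  (forall z, z \in s -> D (emb z)) /\
  forall x, D x <-> forall l, exists2 z, z \in s & dot l (emb z) <= dot l x.
Proof.
have [s ->] := latD; exists s.
have -> : @lattice_embed R @` [set` s] = [set` [seq emb z | z <- s]].
  rewrite eqEsubset; split=> [_ [z /= zs <-]|_ /mapP[z zs ->]] /=; first exact: map_f.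
  by exists z.
split=> [z zs|x]; first by apply: sub_conv_hull; exact: (map_f emb).
rewrite conv_hullP; split=> h l; have := h l.
  by move=> [_ /mapP[z zs ->] lz]; exists z.
by move=> [z zs lz]; exists (emb z); rewrite ?map_f.
Qed.

(** The four signed coordinate functionals enclose D in a box. *)
Lemma finite_lattice E : E `<=` D -> finite_set (@lattice_embed R @^-1` E).
Proof.
move=> ED; have [s [_ hs]] := polygon_hull.
pose K := (\sum_(z <- s) (absz z.1 + absz z.2))%N.
have hK z : z \in s -> (absz z.1 + absz z.2 <= K)%N.
  by move=> zs; rewrite /K (big_rem z) //= leq_addr.
apply: (@sub_finite_set _ _ [set` box K]); last exact: finite_seq.
move=> z /ED/hs h; rewrite /= mem_box.
have dE (u v : int * int) : dot (emb u) (emb v) = (u.1 * v.1 + u.2 * v.2)%:~R.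
  by rewrite /dot /= intrD !intrM.
have h1 (u : int * int) : exists2 w, w \in s & u.1 * w.1 + u.2 * w.2 <= u.1 * z.1 + u.2 * z.2.
  have [w ws] : exists2 w, w \in s & dot (emb u) (emb w) <= dot (emb u) (emb z) := h (emb u).
  by rewrite !dE ler_int; exists w.
have [a /hK] := h1 (1, 0); have [b /hK] := h1 (-1, 0).
have [c /hK] := h1 (0, 1); have [d /hK] := h1 (0, -1).
move=> /=; clear; lia.
Qed.

Lemma mem_lattice_points E z : E `<=` D -> z \in lattice_points E <-> E (emb z).
Proof.
move=> ED; rewrite /lattice_points in_fset_set; last exact: finite_lattice.
by rewrite inE.
Qed.

Lemma lattice_pointP z : D (emb z) <-> exists i, P i = z.
Proof.
rewrite -(mem_lattice_points z (@subset_refl _ D)); split=> [|[i <-]]; last first.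
  by rewrite /lattice_point mem_nth.
move=> /(nthP (0, 0))[j jN e]; by exists (Ordinal (jN : (j < N)%N)).
Qed.

Lemma lattice_point_inj : injective P.
Proof.
move=> i j /eqP; rewrite /lattice_point nth_uniq ?fset_uniq //.
by move=> /eqP e; apply: val_inj.
Qed.

Lemma num_points_card E : E `<=` D ->
  num_points E = #|[set i : 'I_N | `[<E (emb (P i))>]]%SET|.
Proof.
move=> ED; rewrite cardE -(size_map P); apply: perm_size; apply: uniq_perm.
- exact: fset_uniq.
- by rewrite (map_inj_uniq lattice_point_inj) enum_uniq.
move=> z; apply/idP/mapP => [zE|[i]].
  have Ez := (mem_lattice_points z ED).1 zE.
  have [i iz] := (lattice_pointP z).1 (ED _ Ez); exists i => //.
  by rewrite mem_enum inE iz; apply/asboolP.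
by rewrite mem_enum inE => /asboolP h ->; apply/(mem_lattice_points _ ED).
Qed.

Lemma exists_lattice_point : exists i : 'I_N, True.
Proof.
have [s [sD hs]] := polygon_hull.
have /eqP/set0P[x /hs h] := has_dim_neq0 dimD.
have [z /sD/lattice_pointP[i _] _] := h 0.
by exists i.
Qed.

Variable i0 : 'I_N.
Local Notation hmin := (hmin P i0).

(** The generators of the hull are among the lattice points of D, so both have the same support
    function. *)
Lemma polygonP x : D x <-> forall l, hmin l <= dot l x.
Proof.
have [s [sD hs]] := polygon_hull; rewrite hs; split=> h l.
  have [z /sD/lattice_pointP[i <-]] := h l; apply: le_trans; exact: hmin_le.
have [i hi] := hminP P i0 l; have Di : D (emb (P i)) by apply/lattice_pointP; exists i.
by have [z zs lz] := (hs _).1 Di l; exists z => //; rewrite (le_trans lz) // -hi.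
Qed.

Lemma lattice_points_closed z : inC R P i0 (z, 1) -> exists i, P i = z.
Proof.
move=> h; apply/lattice_pointP/polygonP => l.
by have := h l; rewrite /PolygonCone.ev /= mul1r subr_ge0.
Qed.

Lemma lattice_points_noncollinear l : l != 0 ->
  exists i j, dot l (emb (P i)) < dot l (emb (P j)).
Proof.
move=> l0; have [x Dx xc] := has_dim2_line (hmin l) dimD l0.
have h1 := (polygonP x).1 Dx l; have h2 := (polygonP x).1 Dx (- l).
have [i hi] := hminP P i0 l; have [j hj] := hminP P i0 (- l); exists i, j.
move: h2; rewrite hj !dotNl lerN2; apply: lt_le_trans.
by rewrite -hi lt_neqAle eq_sym xc h1.
Qed.

Lemma num_points_gt2 : (2 < N)%N.
Proof.
rewrite ltnNge; apply/negP => N2.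
have i1 : (0 < N)%N by case: (i0) => m; case: (N).
pose a := P (Ordinal i1).
have [b hb] : exists b : int * int, forall i, P i = a \/ P i = b.
  have [N1|N1] := leqP N 1.
    exists a => i; left; congr P; apply: val_inj => /=; have := ltn_ord i; lia.
  exists (P (Ordinal N1)) => -[m mN].
  have [e|m0] := eqVneq m 0%N; first by left; congr P; apply: val_inj.
  by right; congr P; apply: val_inj => /=; lia.
have line l : l != 0 -> dot l (emb a) = dot l (emb b) -> False.
  move=> l0 e; have [i [j]] := lattice_points_noncollinear l0.
  by case: (hb i) => ->; case: (hb j) => ->; rewrite ?e ltxx.
have [e|ne] := eqVneq (emb b - emb a) 0.
  apply: (line (1, 0)); first by rewrite xpair_eqE oner_eq0.
  by congr dot; apply/esym/eqP; rewrite -subr_eq0 e.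
pose v := emb b - emb a; apply: (line (- v.2, v.1)).
  apply: contraNneq ne => e; have e1 : v.1 = 0 := congr1 snd e.
  have /eqP e2 : - v.2 = 0 := congr1 fst e; rewrite oppr_eq0 in e2.
  by rewrite -/v [v]surjective_pairing e1 (eqP e2).
by rewrite /dot /v /=; ring.
Qed.

End LatticePolygons.

End PolygonPoints.

(** * Topological interior and boundary of the polygon *)

Module PolygonInterior.
Import PlaneGordan PolygonCone NormalFan SupportArcs HeightOne LatticeIdeals EhrhartCount
  BoundaryTriangles PlaneConvexity PolygonPoints.

Section InteriorBoundary.
Variables (R : realType) (D : set (R * R)).
Hypotheses (latD : lattice_polygon D) (dimD : has_dim D 2).
Local Notation N := (num_points D).
Local Notation P := (@lattice_point R D).
Local Notation emb := (PolygonCone.emb R).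
Variable i0 : 'I_N.
Local Notation hmin := (PolygonCone.hmin P i0).
Local Notation dirs := (NormalFan.dirs).
Local Notation inner := (EhrhartCount.interior R P i0).
Implicit Types (l x y : R * R) (z : int * int) (E : set (R * R)).

Lemma dot_near l x (c : R) : c < dot l x -> nbhs x [set y | c < dot l y].
Proof.
move=> h; pose s := 1 + `|l.1| + `|l.2|.
have s0 : 0 < s by rewrite /s -addrA ltr_pwDl // addr_ge0.
apply/nbhs_ballP; exists ((dot l x - c) / s) => /=.
  by rewrite divr_gt0 // subr_gt0.
move=> y [/= h1 h2]; move: h1 h2; rewrite /ball /= => h1 h2.
have e0 : (dot l x - c) / s * s = dot l x - c by rewrite divfK // gt_eqF.
have k1 : l.1 * (x.1 - y.1) <= `|l.1| * `|x.1 - y.1| by rewrite -normrM ler_norm.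
have k2 : l.2 * (x.2 - y.2) <= `|l.2| * `|x.2 - y.2| by rewrite -normrM ler_norm.
have k3 : `|l.1| * `|x.1 - y.1| <= `|l.1| * ((dot l x - c) / s) by rewrite ler_wpM2l // ltW.
have k4 : `|l.2| * `|x.2 - y.2| <= `|l.2| * ((dot l x - c) / s) by rewrite ler_wpM2l // ltW.
have e : 0 < (dot l x - c) / s by rewrite divr_gt0 // subr_gt0.
have ed : dot l x - dot l y = l.1 * (x.1 - y.1) + l.2 * (x.2 - y.2) by rewrite /dot; ring.
have es : (dot l x - c) / s * s = (dot l x - c) / s + `|l.1| * ((dot l x - c) / s)
    + `|l.2| * ((dot l x - c) / s) by rewrite /s; ring.
move: e0 e k1 k2 k3 k4 ed es; move: ((dot l x - c) / s) => t.
move: (l.1 * _) (l.2 * _) (`|l.1| * `|_|) (`|l.2| * `|_|) (`|l.1| * t) (`|l.2| * t) => p1 p2 p3 p4 p5 p6.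
by move: (t * s) (dot l x) (dot l y) => q dx dy; clear; lra.
Qed.

Section Fan.
Variables (b : nat -> R * R) (m : nat).
Hypotheses (m2 : (1 < m)%N) (bdet : forall i j, (i < j < m)%N -> 0 < det2 (b i) (b j)).
Hypothesis edges : forall i j : 'I_N,
  exists2 l, (l < m)%N & dot (b l) (emb (P i) - emb (P j)) = 0.

(** Finitely many half-planes cut out D, so interior and measurability reduce to finite
    intersections. *)
Lemma polygon_dirs x :
  (forall i, (i < m + m)%N -> hmin (dirs b m i) <= dot (dirs b m i) x) -> D x.
Proof.
move=> h; apply/(polygonP latD i0) => l.
have [i ir [a [c [a0 c0 ->]]]] := dirs_cover m2 bdet l.
have [v [v1 v2]] := dirs_vertex i0 m2 bdet edges ir.
apply: (le_trans (hmin_le P i0 _ v)).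
move: v1 v2; rewrite /PolygonCone.ev /= !mul1r => /subr0_eq v1 /subr0_eq v2.
have dl y : dot ((a * (dirs b m i).1, a * (dirs b m i).2) +
    (c * (dirs b m (nxt m i)).1, c * (dirs b m (nxt m i)).2)) y =
    a * dot (dirs b m i) y + c * dot (dirs b m (nxt m i)) y by rewrite /dot /=; ring.
rewrite !dl v1 v2.
by rewrite lerD // ler_wpM2l // h // nxt_lt.
Qed.

End Fan.

(** An interior point can be moved a little against l, which makes the inequality strict;
    conversely, finitely many strict inequalities persist near x. *)
Lemma polygon_interiorP x : D° x <-> forall l, l != 0 -> hmin l < dot l x.
Proof.
split=> [/nbhs_ballP[e /= e0 eD] l l0|h].
  pose s := 1 + `|l.1| + `|l.2|.
  have s0 : 0 < s by rewrite /s -addrA ltr_pwDl // addr_ge0.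
  have s1 : `|l.1| < s by rewrite /s -addrA [ltRHS]addrCA ltrDl ltr_pwDl.
  have s2 : `|l.2| < s by rewrite /s ltrDr ltr_pwDl.
  have es0 : 0 < e / s by rewrite divr_gt0.
  have : D (x.1 - e / s * l.1, x.2 - e / s * l.2).
    have key a u : `|a| < s -> `|u - (u - e / s * a)| < e.
      rewrite opprB addrC subrK normrM (gtr0_norm es0) => h.
      by rewrite -[ltRHS](@divfK _ s) ?gt_eqF // ltr_pM2l.
    by apply: eD; split; apply: key.
  move=> /(polygonP latD i0)/(_ l) h; apply: (le_lt_trans h).
  have -> : dot l (x.1 - e / s * l.1, x.2 - e / s * l.2)
    = dot l x - e / s * (l.1 * l.1 + l.2 * l.2) by rewrite /dot /=; ring.
  rewrite gtrBl mulr_gt0 // lt_def addr_ge0 -?expr2 ?sqr_ge0 // andbT.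
  apply: contraNneq l0; move=> /eqP; rewrite paddr_eq0 ?sqr_ge0 // !sqrf_eq0.
  by case/andP=> /eqP l1 /eqP l2; rewrite (surjective_pairing l) l1 l2.
have [b [m [m2 bdet edges]]] := fan_data R P.
pose A (i : 'I_(m + m)) := [set y | hmin (dirs b m i) <= dot (dirs b m i) y].
have : nbhs x [set y | forall i, A i y].
  suff hA i : nbhs x (A i).
    exact: (@filter_forall _ _ A (nbhs x) _ hA).
  rewrite /A.
  have [->|/h w0] := eqVneq (dirs b m i) 0.
    by apply: filterE => y /=; rewrite hmin0 dot0l.
  by apply: filterS (dot_near w0) => y /=; exact: ltW.
apply: filterS => y hy; apply: (polygon_dirs m2 bdet edges) => i im.
exact: (hy (Ordinal im)).
Qed.

Lemma polygon_closed : closed D.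
Proof.
move=> x cx; apply/(polygonP latD i0) => l; rewrite leNgt; apply/negP => h.
have : - hmin l < dot (- l) x by rewrite dotNl ltrN2.
move=> /dot_near/cx[y [/(polygonP latD i0)/(_ l) h1 /=]].
by rewrite dotNl ltrN2 ltNge h1.
Qed.

Lemma lattice_point_in i : D (emb (P i)).
Proof. by apply/(lattice_pointP latD); exists i. Qed.

Lemma lattice_point_interior i : D° (emb (P i)) <-> i \in inner.
Proof.
rewrite polygon_interiorP inE; split=> [h|/asboolP h l l0].
  by apply/asboolP => l l0; rewrite /PolygonCone.ev /= mul1r subr_gt0 h.
by have := h l l0; rewrite /PolygonCone.ev /= mul1r subr_gt0.
Qed.

Lemma num_points_boundary : num_points (boundary D) = #|~: inner|%SET.
Proof.
rewrite (num_points_card latD) //; last by rewrite /boundary -(closure_id D).1 //; exact: polygon_closed.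
apply: eq_card => i; rewrite inE [RHS]inE.
apply/asboolP/negP => [[_ h]|h].
  by move=> hi; apply: h; apply/lattice_point_interior.
split; first by apply: subset_closure; exact: lattice_point_in.
by move=> /lattice_point_interior hi; apply: h; exact: hi.
Qed.

Lemma interior_polygon_sub : interior_polygon D `<=` D°.
Proof.
apply: conv_hull_sub => [|x []] //; apply/convex_setP => x y t t0 t1.
rewrite !polygon_interiorP => hx hy l l0; rewrite dot_conv.
by apply: conv_gt; rewrite ?hx ?hy.
Qed.

Lemma interior_polygon_lattice z : interior_polygon D (emb z) <-> D° (emb z).
Proof.
split; first exact: interior_polygon_sub.
by move=> h; apply: sub_conv_hull; split=> //; exists z.
Qed.

Lemma num_points_interior : num_points (interior_polygon D) = #|inner|.
Proof.
rewrite (num_points_card latD) //; last first.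
  by apply: subset_trans interior_polygon_sub _; exact: interior_subset.
apply: eq_card => i; rewrite inE; apply/asboolP/idP.
  by move=> /interior_polygon_lattice/lattice_point_interior.
by move=> /lattice_point_interior/interior_polygon_lattice.
Qed.

Lemma interior_polygon_eq0 : interior_polygon D = set0 <-> inner = finset.set0.
Proof.
split=> h.
  apply/setP => i; rewrite [RHS]inE; apply/negP => /lattice_point_interior.
  by move=> /interior_polygon_lattice; rewrite h.
have e : D° `&` range (@lattice_embed R) = set0.
  rewrite -subset0 => x [hx [z _ zx]]; move: hx; rewrite -zx => hz.
  have [i iz] := (lattice_pointP latD z).1 (interior_subset hz).
  have : i \in inner by apply/lattice_point_interior; rewrite iz.
  by rewrite h inE.
by rewrite /interior_polygon e -subset0; apply: conv_hull_sub => // x y t; rewrite inE.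
Qed.

Lemma interior_noncollinear : has_dim (interior_polygon D) 2 ->
  forall (l : int * int) (c : int), l != 0 -> exists2 i, i \in inner & dz l (P i) != c.
Proof.
move=> d2 l c l0; apply: contrapT => H.
have [x Dx] := has_dim2_line c%:~R d2 (emb_neq0 R l0).
suff -> : dot (emb l) x = c%:~R by rewrite eqxx.
move: x Dx; apply: (@conv_hull_sub R _ [set x | dot (emb l) x = c%:~R]).
  by apply/convex_setP => x y t _ _ /= hx hy; rewrite dot_conv hx hy; ring.
move=> x [hx [z _ zx]] /=; move: hx; rewrite -zx => hz.
have [i iz] := (lattice_pointP latD z).1 (interior_subset hz).
have iI : i \in inner by apply/lattice_point_interior; rewrite iz.
rewrite -[lattice_embed R z]/(emb z) -iz -dz_dot; congr (_%:~R).
by apply/eqP; apply: contra_notT H => ne; exists i.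
Qed.

Lemma interior_collinear u : dim_le1 (interior_polygon D) -> u \in inner ->
  exists (l : int * int) (c : int), l != 0 /\ forall i, i \in inner -> dz l (P i) = c.
Proof.
move=> d1 uI; have mem i : i \in inner -> interior_polygon D (emb (P i)).
  by move=> /lattice_point_interior/interior_polygon_lattice.
have [/existsP[v /andP[vI vu]]|/existsPn h] := boolP [exists v, (v \in inner) && (P v != P u)].
  exists (- ((P v).2 - (P u).2), (P v).1 - (P u).1).
  exists (dz (- ((P v).2 - (P u).2), (P v).1 - (P u).1) (P u)); split.
    apply: contraNneq vu => -[/eqP e2 /eqP e1].
    move: e2 e1; rewrite oppr_eq0 !subr_eq0 => /eqP e2 /eqP e1.
    by rewrite (surjective_pairing (P v)) e1 e2 -surjective_pairing.
  move=> i iI; have := dim_le1_det d1 (mem _ uI) (mem _ vI) (mem _ iI).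
  rewrite /det2 /= -!intrB -!intrM -intrB => /eqP; rewrite intr_eq0 => /eqP.
  rewrite /dz /=; move: (P u) (P v) (P i) => [u1 u2] [v1 v2] [w1 w2] /= e; clear -e; lia.
exists (1, 0), (dz (1, 0) (P u)); split=> // i iI.
by have := h i; rewrite iI /= negbK => /eqP ->.
Qed.

End InteriorBoundary.

End PolygonInterior.

(** * Area by counting small squares *)

Module PolygonVolume.
Import PlaneGordan PolygonCone NormalFan SupportArcs HeightOne LatticeIdeals EhrhartCount
  PlaneConvexity PolygonPoints PolygonInterior.

Section Cells.
Variable R : realType.
Local Notation mu := (@lebesgue_measure R \x @lebesgue_measure R)%E.
Local Notation plane := (measurableTypeR R * measurableTypeR R)%type.
Implicit Types (z : int * int) (s : seq (int * int)) (h : R).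

(** Half-open squares, so that distinct ones are disjoint. *)
Definition cell h z : set plane :=
  `[z.1%:~R * h, (z.1 + 1)%:~R * h[%classic `*` `[z.2%:~R * h, (z.2 + 1)%:~R * h[%classic.

Definition cells h s : set plane := \big[setU/set0]_(i < size s) cell h (nth (0, 0) s i).

Lemma measurable_cell h z : measurable (cell h z).
Proof. by apply: measurableX; exact: measurable_itv. Qed.

Lemma cell_inj h z z' x : 0 < h -> cell h z x -> cell h z' x -> z = z'.
Proof.
move=> h0 [/= + +] [/= + +]; rewrite !in_itv /= => /andP[a1 a2] /andP[b1 b2] /andP[c1 c2] /andP[d1 d2].
have H (u v : int) (y : R) : u%:~R * h <= y -> y < (v + 1)%:~R * h -> u <= v.
  by move=> uy yv; have := le_lt_trans uy yv; rewrite ltr_pM2r // ltr_int ltzD1.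
have e1 : z.1 = z'.1 by apply/eqP; rewrite eq_le (H _ _ _ a1 c2) (H _ _ _ c1 a2).
have e2 : z.2 = z'.2 by apply/eqP; rewrite eq_le (H _ _ _ b1 d2) (H _ _ _ d1 b2).
by rewrite (surjective_pairing z) e1 e2 -surjective_pairing.
Qed.

Lemma measure_cell h z : 0 < h -> mu (cell h z) = (h * h)%:E.
Proof.
move=> h0; rewrite /cell product_measure1E; [|exact: measurable_itv|exact: measurable_itv].
have H (u : int) : lebesgue_measure (`[u%:~R * h, (u + 1)%:~R * h[%classic : set R) = h%:E.
  rewrite lebesgue_measure_itv /= lte_fin ltr_pM2r // ltr_int ltzD1 lexx.
  by rewrite -EFinB -mulrBl -intrB addrAC subrr add0r mul1r.
by rewrite EFinM; congr (_ * _)%E; exact: H.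
Qed.

Lemma mem_cells h s x : cells h s x <-> exists2 z, z \in s & cell h z x.
Proof.
rewrite /cells -(bigcup_mkord (size s) (fun i => cell h (nth (0, 0) s i))).
split=> [[i /= si zx]|[z /(nthP (0, 0))[i si <-] zx]]; last by exists i.
by exists (nth (0, 0) s i) => //; rewrite mem_nth.
Qed.

Lemma measurable_cells h s : measurable (cells h s).
Proof. by apply: bigsetU_measurable => i _; exact: measurable_cell. Qed.

Lemma measure_cells h s : 0 < h -> uniq s -> mu (cells h s) = ((size s)%:R * (h * h))%:E.
Proof.
move=> h0 us; rewrite /cells measure_bigsetU_ord; last first.
- move=> i j _ _ [x [xi xj]]; apply: val_inj.
  by have := nth_uniq (0, 0) (ltn_ord i) (ltn_ord j) us;
    rewrite (cell_inj h0 xi xj) eqxx => /esym/eqP.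
- by move=> i; exact: measurable_cell.
rewrite (eq_bigr (fun=> (h * h)%:E)); last by move=> i _; exact: measure_cell.
by rewrite sumEFin sumr_const card_ord mulr_natl.
Qed.

End Cells.

Section Limit.
Variable R : realType.

Lemma le0_of_bounded_multiples (x K : R) : (forall n, (0 < n)%N -> x * n%:R <= K) -> x <= 0.
Proof.
move=> H; rewrite leNgt; apply/negP => x0.
have K0 : 0 <= K by apply: le_trans (H 1 isT); rewrite mulr1 ltW.
have h1 : K / x < (Num.bound (K / x))%:R by apply: archi_boundP; rewrite divr_ge0 // ltW.
have := H (Num.bound (K / x)).+1 isT; rewrite leNgt => /negP; apply.
rewrite mulrC -ltr_pdivrMr //; apply: (lt_trans h1); by rewrite ltr_nat.
Qed.

(** After division by n the two inequalities bound all multiples n (u - A) and n (A - u) by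
    constants. *)
Lemma quadratic_leading (A B c u : R) : 0 <= A -> 0 <= B -> 0 <= c ->
  (forall n, (0 < n)%N -> A * n%:R ^+ 2 <= u * (n%:R + c) ^+ 2) ->
  (forall n, (0 < n)%N -> u * n%:R ^+ 2 <= 2 + B * (n%:R + c) + A * (n%:R + c) ^+ 2) ->
  u = A.
Proof.
move=> A0 B0 c0 H1 H2.
have u0 : 0 <= u.
  have := H1 1 isT; rewrite expr1n mulr1 => h; have := le_trans A0 h.
  by rewrite pmulr_lge0 // exprn_gt0 // ltr_pwDl.
have uc : 0 <= u * c by rewrite mulr_ge0.
have Ac : 0 <= A * c by rewrite mulr_ge0.
have Bc : 0 <= B * c by rewrite mulr_ge0.
have ucc : 0 <= u * c * c by rewrite mulr_ge0.
have Acc : 0 <= A * c * c by rewrite mulr_ge0.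
apply/eqP; rewrite eq_le -subr_le0 -[X in _ && X]subr_le0; apply/andP; split.
  apply: (@le0_of_bounded_multiples _ (2 + B + B * c + 2 * (A * c) + A * c * c)) => n n0.
  have np : 0 < n%:R :> R by rewrite ltr0n.
  have n1 : 1 <= n%:R :> R by rewrite ler1n.
  have := H2 n n0; move: np n1; move: (n%:R) => t t0 t1 h.
  rewrite -(ler_pM2r t0); move: h; rewrite !expr2.
  have p1 : 2 * 1 <= 2 * t by rewrite ler_wpM2l.
  have p2 : B * c * 1 <= B * c * t by rewrite ler_wpM2l.
  have p3 : A * c * c * 1 <= A * c * c * t by rewrite ler_wpM2l.
  by move=> h; lra.
apply: (@le0_of_bounded_multiples _ (2 * (u * c) + u * c * c)) => n n0.
have np : 0 < n%:R :> R by rewrite ltr0n.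
have n1 : 1 <= n%:R :> R by rewrite ler1n.
have := H1 n n0; move: np n1; move: (n%:R) => t t0 t1 h.
rewrite -(ler_pM2r t0); move: h; rewrite !expr2.
have p3 : u * c * c * 1 <= u * c * c * t by rewrite ler_wpM2l.
by move=> h; lra.
Qed.

End Limit.

Section Sandwich.
Variable R : realFieldType.

Lemma sandwich_up (a h e s x : R) : h <= a -> a - e <= s -> s <= x -> 0 <= e - h + x.
Proof. lra. Qed.

Lemma sandwich_low (a e f d c h s : R) : 0 <= e - d * h ->
  - s <= (d + c) * a - (e + f) -> s <= f - c * h -> (d + c) * h <= (d + c) * a.
Proof. by move=> *; rewrite [leLHS]mulrDl; lra. Qed.

End Sandwich.

Section Volume.
Variables (R : realType) (D : set (R * R)).
Hypotheses (latD : lattice_polygon D) (dimD : has_dim D 2).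
Local Notation N := (num_points D).
Local Notation P := (@lattice_point R D).
Local Notation emb := (PolygonCone.emb R).
Variable i0 : 'I_N.
Local Notation hmin := (PolygonCone.hmin P i0).
Local Notation ev := (PolygonCone.ev P i0).
Local Notation inC := (PolygonCone.inC R P i0).
Local Notation dirs := (NormalFan.dirs).
Local Notation inner := (EhrhartCount.interior R P i0).
Local Notation mu := (@lebesgue_measure R \x @lebesgue_measure R)%E.
Local Notation plane := (measurableTypeR R * measurableTypeR R)%type.
Implicit Types (l x y : R * R) (z : int * int).

Lemma measurable_halfplane l (c : R) : measurable ([set x | c <= dot l x] : set plane).
Proof.
have mf : measurable_fun setT (fun x : plane => l.1 * x.1 + l.2 * x.2).
  by apply: measurable_realfun.measurable_funD; apply: measurable_realfun.measurable_funM.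
have := mf measurableT `[c, +oo[%classic (measurable_itv _); rewrite setTI.
congr (measurable _); apply/seteqP; split=> x /=; by rewrite in_itv /= andbT.
Qed.

Lemma cell_dot l z x (d : R) : 0 < d -> cell d^-1 z x ->
  `|d * dot l x - dot l (emb z)| <= `|l.1| + `|l.2|.
Proof.
move=> d0 [/= + +]; rewrite !in_itv /= => /andP[a1 a2] /andP[b1 b2].
have H (u : int) (y : R) : u%:~R / d <= y -> y < (u + 1)%:~R / d -> `|d * y - u%:~R| <= 1.
  rewrite ler_pdivrMr // ltr_pdivlMr // intrD [y * d]mulrC => h1 h2.
  by rewrite ger0_norm ?subr_ge0 // lerBlDl ltW.
have -> : d * dot l x - dot l (emb z) = l.1 * (d * x.1 - z.1%:~R) + l.2 * (d * x.2 - z.2%:~R).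
  by rewrite /dot /=; ring.
apply: (le_trans (ler_normD _ _)); rewrite !normrM.
by apply: lerD; rewrite -[leRHS]mulr1 ler_wpM2l // H.
Qed.

Section Fan.
Variables (b : nat -> R * R) (m : nat).
Hypotheses (m2 : (1 < m)%N) (bdet : forall i j, (i < j < m)%N -> 0 < det2 (b i) (b j)).
Hypothesis edges : forall i j : 'I_N,
  exists2 l, (l < m)%N & dot (b l) (emb (P i) - emb (P j)) = 0.

Lemma measurable_polygon : measurable (D : set plane).
Proof.
suff -> : (D : set plane) = \bigcap_(i in `I_(m + m)) [set x | hmin (dirs b m i) <= dot (dirs b m i) x].
  by apply: fin_bigcap_measurable => // i _; exact: measurable_halfplane.
apply/seteqP; split=> x.
  by move=> Dx i _ /=; exact: (polygonP latD i0 x).1.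
by move=> h; apply: (polygon_dirs latD (i0 := i0) m2 bdet edges) => i im; exact: h.
Qed.

(** Translation by X absorbs the variation of each functional over a unit square. The sum of all
    points is interior to the cone, and a large multiple of it serves the finitely many
    directions. *)
Lemma cone_inradius : exists X : int * int * int, 0 <= X.2 /\
  forall i, (i < m + m)%N -> `|(dirs b m i).1| + `|(dirs b m i).2| <= ev (dirs b m i) X.
Proof.
pose Y := \sum_j PP P j; pose q (i : 'I_(m + m)) := dirs b m i.
have evY l : ev l Y = \sum_j ev l (PP P j) by exact: (big_morph _ (evD P i0 l) (ev0 P i0 l)).
have Y0 : inC Y by move=> l; rewrite evY sumr_ge0 // => j _; exact: ev_PP.
have Yp l : l != 0 -> 0 < ev l Y.
  move=> l0; have [i [j ij]] := lattice_points_noncollinear latD dimD i0 l0.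
  rewrite evY (bigD1 j) //= ltr_pwDl //; last by apply: sumr_ge0 => *; exact: ev_PP.
  by rewrite /PolygonCone.ev /= mul1r subr_gt0 (le_lt_trans (hmin_le P i0 l i)).
pose t i := Num.bound ((`|(q i).1| + `|(q i).2|) / ev (q i) Y).
exists (Y *+ \sum_i t i); split.
  have -> : (Y *+ \sum_i t i).2 = Y.2 *+ \sum_i t i by rewrite -raddfMn.
  apply: mulrn_wge0; rewrite /Y; elim/big_rec: _ => // i z _; rewrite /= => z0.
  by rewrite addr_ge0.
move=> i im; rewrite ev_Mn; pose j := Ordinal im.
have [e0|/Yp Yi] := eqVneq (dirs b m i) 0.
  by rewrite e0 /= normr0 addr0 mulr_ge0 // (Y0 0).
have n0 : 0 <= (`|(q j).1| + `|(q j).2|) / ev (q j) Y.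
  by apply: divr_ge0; [exact: addr_ge0 | exact: ltW].
have := archi_boundP n0; rewrite -/(t j) ltr_pdivrMr // => /ltW h.
apply: (le_trans h); rewrite ler_wpM2r ?(ltW Yi) // ler_nat.
by rewrite (bigD1 j) //= leq_addr.
Qed.

Variable K : nat.
Hypothesis KP : forall z d, inC (z, d) -> z \in box (K * absz d).
Local Notation ecount := (EhrhartCount.ecount R P i0 K).

Definition dilate_points (d : int) := [seq z <- box (K * absz d) | `[< inC (z, d) >]].

Lemma mem_dilate_points d z : z \in dilate_points d <-> inC (z, d).
Proof.
rewrite mem_filter; split=> [/andP[/asboolP]//|h].
by rewrite KP // andbT; apply/asboolP.
Qed.

Lemma dilate_points_uniq d : uniq (dilate_points d).
Proof. by rewrite filter_uniq // box_uniq. Qed.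

Variable X : int * int * int.
Hypothesis XP : forall i, (i < m + m)%N ->
  `|(dirs b m i).1| + `|(dirs b m i).2| <= ev (dirs b m i) X.

(** Each point of D is rounded down to the corner of its square of side 1/d; translated by X, the
    corner lies in the dilate of order d + X.2. *)
Lemma volume_le (d : int) : 0 < d ->
  (mu D <= ((ecount (d + X.2))%:~R * (d%:~R^-1 * d%:~R^-1))%:E)%E.
Proof.
move=> d0; have dp : 0 < d%:~R :> R by rewrite ltr0z.
pose s := [seq z - X.1 | z <- dilate_points (d + X.2)].
have us : uniq s by rewrite map_inj_uniq ?dilate_points_uniq //; exact: addIr.
have di : 0 < (d%:~R : R)^-1 by rewrite invr_gt0.
have -> : (ecount (d + X.2))%:~R = (size s)%:R :> R by rewrite size_map.
rewrite -measure_cells //; apply: le_measure; rewrite ?inE.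
- exact: measurable_polygon.
- exact: measurable_cells.
move=> x Dx; pose z := (Num.floor (d%:~R * x.1), Num.floor (d%:~R * x.2)).
have zx : cell d%:~R^-1 z x.
  split=> /=; rewrite in_itv /= ler_pdivrMr // ltr_pdivlMr // ![_ * d%:~R]mulrC;
    by rewrite floor_le floorD1_gt.
apply/mem_cells; exists z => //; apply/mapP; exists (z + X.1); last by rewrite addrK.
apply/mem_dilate_points; apply: (inC_dirs m2 bdet edges) => i im.
have -> : (z + X.1, d + X.2) = (z, d) + X by [].
rewrite evD; have := XP im; have := cell_dot (dirs b m i) dp zx.
have := (polygonP latD i0 x).1 Dx (dirs b m i); rewrite -(ler_pM2l dp) ler_norml.
rewrite [ev _ (z, d)]/PolygonCone.ev /= => h1 /andP[h2 h3] h4; exact: sandwich_up h1 h3 h4.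
Qed.

(** Translated by X, the points of the d-th dilate become corners of squares of side 1/(d + X.2)
    contained in D. *)
Lemma volume_ge (d : int) : 0 <= d -> 0 < d + X.2 ->
  (((ecount d)%:~R * ((d + X.2)%:~R^-1 * (d + X.2)%:~R^-1))%:E <= mu D)%E.
Proof.
move=> d0 dX; have dp : 0 < (d + X.2)%:~R :> R by rewrite ltr0z.
pose s := [seq z + X.1 | z <- dilate_points d].
have us : uniq s by rewrite map_inj_uniq ?dilate_points_uniq //; exact: addIr.
have di : 0 < ((d + X.2)%:~R : R)^-1 by rewrite invr_gt0.
have -> : (ecount d)%:~R = (size s)%:R :> R by rewrite size_map.
rewrite -measure_cells //; apply: le_measure; rewrite ?inE.
- exact: measurable_cells.
- exact: measurable_polygon.
move=> x /mem_cells[_ /mapP[z /mem_dilate_points hz ->] zx].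
apply: (polygon_dirs latD (i0 := i0) m2 bdet edges) => i im.
rewrite -(ler_pM2l dp).
have := XP im; have := cell_dot (dirs b m i) dp zx; have := hz (dirs b m i).
rewrite ler_norml embD dotDr /PolygonCone.ev /= intrD => h1 /andP[h2 h3] h4; exact: sandwich_low h1 h2 h4.
Qed.

End Fan.

Lemma volume_pick : 2 * vol D = N%:R + #|inner|%:R - 2.
Proof.
have closedP := lattice_points_closed latD (i0 := i0).
have noncoll := lattice_points_noncollinear latD dimD i0.
have [K KP] := cone_bounded i0 noncoll.
have N3 := num_points_gt2 latD dimD i0.
have [b [m [m2 bdet edges]]] := fan_data R P.
have [X [X0 XP]] := cone_inradius b m.
have E := ecount_ehrhart closedP noncoll (lattice_point_inj (D := D)) KP N3.
have le1 := volume_le m2 bdet edges KP XP; have ge1 := volume_ge m2 bdet edges KP XP.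
have mufin : mu D \is a fin_num.
  rewrite ge0_fin_numE //; apply: le_lt_trans (le1 1 isT) _; exact: ltry.
have eD : mu D = (vol D)%:E by rewrite /vol fineK.
have cN : (#|inner| <= N)%N by rewrite -[leqRHS]card_ord max_card.
pose A : R := N%:R + #|inner|%:R - 2; pose B : R := N%:R - #|inner|%:R.
have A0 : 0 <= A.
  by rewrite /A addrAC addr_ge0 // subr_ge0 ler_nat ltnW.
have B0 : 0 <= B by rewrite /B subr_ge0 ler_nat.
have Er (d : int) : 0 <= d ->
    2 * (EhrhartCount.ecount R P i0 K d)%:~R = 2 + B * d%:~R + A * d%:~R ^+ 2 :> R.
  move=> /E/(congr1 (fun t : int => t%:~R : R)).
  rewrite /ehrhart !(rmorphD, rmorphB, rmorphM) /= -!pmulrn => ->.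
  by rewrite /A /B; ring.
have c0 : 0 <= X.2%:~R :> R by rewrite ler0z.
apply: (quadratic_leading A0 B0 c0) => n n0.
  have np : 0 < n%:Z + X.2 by rewrite ltr_pwDl.
  have ep : 0 < (n%:Z + X.2)%:~R :> R by rewrite ltr0z.
  have := ge1 n%:Z isT np; rewrite eD lee_fin -invfM ler_pdivrMr ?mulr_gt0 // => h.
  have := Er n%:Z isT; have -> : (n%:R + X.2%:~R : R) = (n%:Z + X.2)%:~R by rewrite intrD.
  rewrite -mulrA expr2 => e2; apply: (@le_trans _ _ (2 * (EhrhartCount.ecount R P i0 K n%:Z)%:~R)).
    by rewrite e2 lerDr addr_ge0 // mulr_ge0.
  by rewrite ler_pM2l.
have np : 0 < n%:Z by [].
have ep : 0 < n%:R :> R by rewrite ltr0n.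
have := le1 n%:Z np; rewrite eD lee_fin -invfM ler_pdivlMr ?mulr_gt0 // => h.
have d0 : 0 <= n%:Z + X.2 by rewrite addr_ge0.
have := Er _ d0; rewrite intrD -mulrA [n%:R ^+ 2]expr2 => <-.
by rewrite ler_pM2l.
Qed.

End Volume.

End PolygonVolume.

Import PlaneGordan PolygonCone HeightOne LatticeIdeals EhrhartCount ToricIdeals
  PlaneConvexity PolygonPoints PolygonInterior PolygonVolume StrandFormulas.

Theorem corollary3p4 (R : realType) (k : fieldType) (Delta : set (R * R))
    (C : free_complex k (num_points Delta)) :
  [pchar k] =i pred0 ->
  lattice_polygon Delta ->
  has_dim Delta 2 ->
  minimal_graded_free_resolution (toric_ideal k Delta) C ->
  let Delta1 := interior_polygon Delta in
  let N := num_points Delta in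
  let N1 := num_points Delta1 in
  let b := linear_strand C in
  let c := quadratic_strand C in
  [/\ c 1%N = N1,
      (Delta1 <> set0 -> c 2%N = ((N - 3) * (N1 - 1))%N) /\
      (Delta1 = set0 -> c 2%N = 0%N)
    & [/\ (num_points (boundary Delta) > 3)%N -> c (N - 3)%N = 0%N,
          num_points (boundary Delta) = 3%N -> has_dim Delta1 2 ->
            c (N - 3)%N = 1%N
        & num_points (boundary Delta) = 3%N -> dim_le1 Delta1 ->
            c (N - 3)%N = (N - 3)%N]] /\
  [/\ (b 1%N)%:R = 'C(N - 1, 2)%:R - 2 * vol Delta :> R,
      (Delta1 <> set0 -> b (N - 3)%N = 0%N) /\
      (Delta1 = set0 -> b (N - 3)%N = (N - 3)%N)
    & (b 2%N)%:R = 2 * 'C(N - 1, 3)%:R - 2 * (N - 3)%:R * vol Delta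
                     + (c (N - 3)%N)%:R :> R].
Proof.
move=> chark latD dimD resC Delta1 N N1 b c.
have [i0 _] := exists_lattice_point latD dimD.
have tE : toric_ideal k Delta = lattice_ideal (@lattice_point R Delta).
  by apply/funext => f; apply/propext; exact: toric_ideal_lattice.
rewrite tE in resC.
have closedP := lattice_points_closed latD (i0 := i0).
have noncoll := lattice_points_noncollinear latD dimD i0.
have Pinj := @lattice_point_inj R Delta.
have N3 := num_points_gt2 latD dimD i0.
have vol2 := volume_pick latD dimD i0.
have N1E := num_points_interior latD i0.
have BE := num_points_boundary latD i0.
have cN := cardsC (EhrhartCount.interior R (@lattice_point R Delta) i0); rewrite card_ord in cN.
have n0 : Delta1 = set0 <-> N1 = 0%N.
  rewrite /Delta1 /N1 N1E (interior_polygon_eq0 latD i0); split=> [->|]; first by rewrite cards0.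
  exact: interior_set0.
have np : Delta1 <> set0 -> (0 < N1)%N by move=> h; rewrite lt0n; apply/eqP => /n0.
split; split.
- by rewrite /c (quadratic_strand1 closedP noncoll Pinj N3 chark resC) -N1E.
- split=> [/np|/n0]; rewrite /N1 N1E => h.
    exact: (quadratic_strand2_interior closedP noncoll Pinj N3 chark resC h).
  exact: (quadratic_strand2_no_interior closedP noncoll Pinj N3 chark resC h).
- rewrite BE; split=> h.
  (* N is N1 plus the number of boundary points, so more than three of these is the bound N1 + 3 <
     N. *)
  + apply: (quadratic_strand_top_big closedP noncoll Pinj N3 chark resC).
    by rewrite -[ltnRHS]cN ltn_add2l.
  + move=> d2; apply: (quadratic_strand_top_noncollinear closedP noncoll Pinj N3 chark resC h).
    exact: (interior_noncollinear latD i0 d2).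
  move=> d1; apply: (quadratic_strand_top_collinear closedP noncoll Pinj N3 chark resC h).
  by move=> u; exact: (interior_collinear latD d1).
- have := congr1 (fun t : int => t%:~R : R) (linear_strand1 closedP noncoll Pinj N3 chark resC).
  rewrite !(rmorphB, rmorphD, rmorphM) /= -!pmulrn => ->.
  by rewrite vol2.
- split=> [/np|/n0]; rewrite /N1 N1E => h.
    exact: (linear_strand_top_interior closedP noncoll Pinj N3 chark resC h).
  exact: (linear_strand_top_no_interior closedP noncoll Pinj N3 chark resC h).
have := congr1 (fun t : int => t%:~R : R) (linear_strand2 closedP noncoll Pinj N3 chark resC).
rewrite !(rmorphB, rmorphD, rmorphM) /= -!pmulrn => ->.
by rewrite [_ * vol _]mulrAC vol2 [_ * (N - 3)%:R]mulrC.
Qed.
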